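(* Let $G$ be a compact, simple, simply connected Lie group, $B$ the basic inner product on $\mathfrak g$, $\eta$ the canonical 3-form, and $\mathcal G$ the basic gerbe with connection on $G$ with curvature $\eta$. For $h\ge1$, the quasi-Hamiltonian $G$-space $(G^{2h},\omega,\Psi)$, with $\Psi(a_1,b_1,\dots,a_h,b_h)=\prod_{i=1}^h[a_i,b_i]$, has a unique pre-quantization (up to isomorphism).
   Context: $B$ is basic if $B(\xi,\xi)=2$ for all shortest nonzero $\xi$ in $\ker(\exp:\mathfrak t\to T)$. $\theta^L,\theta^R$ are the Maurer–Cartan forms; $\eta=\frac1{12}B(\theta^L,[\theta^L,\theta^L])$, whose class is the image of a generator of $H^3(G,\mathbb Z)\cong\mathbb Z$. $[a,b]=aba^{-1}b^{-1}$; $G$ acts on $G^{2h}$ by simultaneous conjugation. For $h=1$, the 2-form on $G^2$ (coordinates $(a,b)$) is $$\omega=-\tfrac12\big(B(a^*\theta^L,b^*\theta^R)+B(a^*\theta^R,b^*\theta^L)\big)-\tfrac12B((ab)^*\theta^L,(a^{-1}b^{-1})^*\theta^R),$$ and $d\omega=\Psi^*\eta$. For $h>1$, $(G^{2h},\omega,\Psi)$ is the $h$-fold fusion product of $G^2$, where the fusion product of $(M_1,\omega_1,\Psi_1)$ and $(M_2,\omega_2,\Psi_2)$ is $M_1\times M_2$ with diagonal action, moment map $\Psi_1\Psi_2$ and 2-form $\omega_1+\omega_2-\frac12B(\Psi_1^*\theta^L,\Psi_2^*\theta^R)$. Gerbes. With $(\delta L)_{ii'i''}=L_{i'i''}L_{ii''}^{-1}L_{ii'}$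 and $(\delta E)_{ii'}=E_{i'}E_i^{-1}$, and curvature the real form $dA$ where $\nabla\sigma=2\pi\sqrt{-1}A\sigma$: a gerbe with connection is an open cover with Hermitian line bundles with connection $(L_{ii'},\nabla_{ii'})$, $L_{ii'}\cong L_{i'i}^{-1}$, parallel unitary sections $\theta$ of $\delta L$ with $\delta\theta=1$, and 2-forms $\varpi_i$ with $\varpi_{i'}-\varpi_i=\operatorname{curv}(\nabla_{ii'})$; curvature $d\varpi_i$. A quasi-line bundle with connection: Hermitian line bundles with connection $(E_i,\nabla^E_i)$ and parallel unitary sections $\psi_{ii'}$ of $(\delta E^{-1})_{ii'}\otimes L_{ii'}$ with $\delta\psi=\theta$; error 2-form $\varpi_i-\operatorname{curv}(\nabla^E_i)$. Two of them are isomorphic if the line bundle with connection by which they differ has a parallel unitary section. A pre-quantization of $(M,\omega,\Psi)$ is a quasi-line bundle with connection for $\Psi^*\mathcal G$ with error 2-form $\omega$ (a relative gerbe with connection for $\Psi$ with curvature $(\omega,\eta)$). *)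

(* Defs.v *)
From HB Require Import structures.
From mathcomp Require Import all_boot all_order all_algebra.
From mathcomp Require Import complex.
From mathcomp Require Import all_classical all_reals all_analysis.
Set Implicit Arguments.
Unset Strict Implicit.
Unset Printing Implicit Defensive.
Import Order.TTheory GRing.Theory Num.Theory.
Import numFieldNormedType.Exports.
Local Open Scope classical_set_scope.
Local Open Scope ring_scope.

Section SmoothEuclidean.
Variables (R : realType) (m : nat) (W : normedModType R).

(* [Ck k U f], for [U] open: all iterated directional derivatives of [f] of
   order at most [k] exist and are continuous on [U]. *)
Fixpoint Ck (k : nat) (U : set 'rV[R]_m) (f : 'rV[R]_m -> W) : Prop :=
  (forall x, U x -> {for x, continuous f}) /\
  (if k is k'.+1 then
     forall v, (forall x, U x -> derivable f x v) /\
               Ck k' U (fun x => 'D_v f x)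
   else True).

Definition smooth_on (U : set 'rV[R]_m) (f : 'rV[R]_m -> W) : Prop :=
  forall k, Ck k U f.

End SmoothEuclidean.

(* A smooth atlas; the values of [chart_map a] outside [chart_dom a], and of
   [chart_inv a] outside the image of [chart_dom a], are irrelevant. *)
Record atlas (R : realType) (T : topologicalType) (n : nat) := Atlas {
  chart_index : Type;
  chart_dom : chart_index -> set T;
  chart_map : chart_index -> T -> 'rV[R]_n;
  chart_inv : chart_index -> 'rV[R]_n -> T;
  chart_dom_open : forall a, open (chart_dom a);
  chart_img_open : forall a, open (chart_map a @` chart_dom a);
  chart_mapK : forall a x, chart_dom a x -> chart_inv a (chart_map a x) = x;
  chart_map_continuous : forall a x, chart_dom a x ->
    {for x, continuous (chart_map a)};
  chart_inv_continuous : forall a y, (chart_map a @` chart_dom a) y ->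
    {for y, continuous (chart_inv a)};
  chart_cover : forall x, exists a, chart_dom a x;
  chart_smooth : forall a b,
    smooth_on (chart_map a @` (chart_dom a `&` chart_dom b))
              (chart_map b \o chart_inv a) }.

Arguments chart_index {R T n} A : rename.
Arguments chart_dom {R T n} A a : rename.
Arguments chart_map {R T n} A a : rename.
Arguments chart_inv {R T n} A a : rename.

Definition smooth_into (R : realType) (T : topologicalType) (n : nat)
    (A : atlas R T n) (m : nat) (U : set 'rV[R]_m) (p : 'rV[R]_m -> T) : Prop :=
  (forall x, U x -> {for x, continuous p}) /\
  (forall a, smooth_on (U `&` p @^-1` chart_dom A a) (chart_map A a \o p)).

#[short(type="topGroupType")]
HB.structure Definition TopGroup := {T of Group T & Topological T}.

(* Continuity of the operations follows from their smoothness. *)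
Record lieGroup (R : realType) := LieGroup {
  lie_sort :> topGroupType;
  lie_dim : nat;
  lie_atlas : atlas R lie_sort lie_dim;
  lie_hausdorff : hausdorff_space lie_sort;
  lie_second_countable : @second_countable lie_sort;
  lie_mul_smooth : forall m (U : set 'rV[R]_m) (p q : 'rV[R]_m -> lie_sort),
    open U -> smooth_into lie_atlas U p -> smooth_into lie_atlas U q ->
    smooth_into lie_atlas U (fun x => p x * q x)%g;
  lie_inv_smooth : forall m (U : set 'rV[R]_m) (p : 'rV[R]_m -> lie_sort),
    open U -> smooth_into lie_atlas U p ->
    smooth_into lie_atlas U (fun x => (p x)^-1)%g }.

(* The manifolds below are products of copies of a Lie group. What is recorded
   of a manifold is its topology and, for every open [U] in some R^m, which
   maps from [U] to it are smooth. *)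
Record smoothSpace (R : realType) := SmoothSpace {
  space_sort :> topologicalType;
  plot : forall m : nat, set 'rV[R]_m -> ('rV[R]_m -> space_sort) -> Prop }.
Arguments plot {R} M {m} U p : rename.

Definition lie_space (R : realType) (G : lieGroup R) : smoothSpace R :=
  @SmoothSpace R G (fun m U p => open U /\ smooth_into (lie_atlas G) U p).

Definition prod_space (R : realType) (M N : smoothSpace R) : smoothSpace R :=
  @SmoothSpace R (M * N)%type
    (fun m U p => plot M U (fst \o p) /\ plot N U (snd \o p)).

(* A [W]-valued [k]-form assigns to every smooth map [p] from an open set of
   R^m its pullback along [p], a [k]-form with values [alpha m p x v] at [x]
   on tangent vectors [v 0, ..., v (k-1)] of R^m. Taking [p] to be the inverses
   of the charts gives the local expressions; [smooth_form] makes the family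
   compatible with reparametrization. *)
Definition diff_form (R : realType) (W : Type) (M : smoothSpace R) (k : nat) : Type :=
  forall m : nat, ('rV[R]_m -> M) -> 'rV[R]_m -> ('I_k -> 'rV[R]_m) -> W.

Definition plot_in (R : realType) (M : smoothSpace R) (V : set M) (m : nat)
    (U : set 'rV[R]_m) (p : 'rV[R]_m -> M) : Prop :=
  plot M U p /\ U `<=` p @^-1` V.

Definition smooth_form (R : realType) (M : smoothSpace R) (k : nat)
    (V : set M) (alpha : diff_form R M k) : Prop :=
  [/\ forall m (U : set 'rV[R]_m) p x, plot_in V U p -> U x ->
        forall (i : 'I_k) (v : 'I_k -> 'rV[R]_m) (c : R) (u w : 'rV[R]_m),
        let put t := alpha m p x (fun j => if j == i then t else v j) in
        put (c *: u + w) = c * put u + put w,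
      forall m (U : set 'rV[R]_m) p x, plot_in V U p -> U x ->
        forall (i j : 'I_k) (v : 'I_k -> 'rV[R]_m),
        i != j -> v i = v j -> alpha m p x v = 0,
      forall m (U : set 'rV[R]_m) p, plot_in V U p ->
        forall v : 'I_k -> 'rV[R]_m, smooth_on U (fun x => alpha m p x v) &
      forall m l (U : set 'rV[R]_m) (U' : set 'rV[R]_l) p q
        (f : 'rV[R]_l -> 'rV[R]_m),
        plot_in V U p -> plot_in V U' q -> smooth_on U' f ->
        (forall y, U' y -> U (f y) /\ q y = p (f y)) ->
        forall y (v : 'I_k -> 'rV[R]_l), U' y ->
          alpha l q y v = alpha m p (f y) (fun i => 'D_(v i) f y)].

Definition form_eq (R : realType) (W : Type) (M : smoothSpace R) (k : nat)
    (V : set M) (alpha beta : diff_form W M k) : Prop :=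
  forall m (U : set 'rV[R]_m) p x (v : 'I_k -> 'rV[R]_m),
    plot_in V U p -> U x -> alpha m p x v = beta m p x v.

Section Forms.
Variables (R : realType) (M N : smoothSpace R).

Definition form_add (k : nat) (alpha beta : diff_form R M k) : diff_form R M k :=
  fun m p x v => alpha m p x v + beta m p x v.

Definition form_scale (k : nat) (c : R) (alpha : diff_form R M k) : diff_form R M k :=
  fun m p x v => c * alpha m p x v.

Definition form_sub (k : nat) (alpha beta : diff_form R M k) : diff_form R M k :=
  fun m p x v => alpha m p x v - beta m p x v.

Definition form_pull (W : Type) (k : nat) (f : M -> N) (alpha : diff_form W N k) :
    diff_form W M k :=
  fun m p => alpha m (f \o p).

Definition ext_d (W : normedModType R) (k : nat) (alpha : diff_form W M k) :
    diff_form W M k.+1 :=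
  fun m p x v => \sum_(i < k.+1)
    (-1) ^+ i *: 'D_(v i) (fun y => alpha m p y (fun j => v (lift i j))) x.

(* The wedge product of a 1-form with a [k]-form, for the pairing [op]. *)
Definition wedge_form (W1 W2 : Type) (W : lmodType R) (op : W1 -> W2 -> W) (k : nat)
    (alpha : diff_form W1 M 1) (beta : diff_form W2 M k) : diff_form W M k.+1 :=
  fun m p x v => \sum_(i < k.+1)
    (-1) ^+ i *: op (alpha m p x (fun=> v i))
                    (beta m p x (fun j => v (lift i j))).

End Forms.

Section LieTheory.
Variables (R : realType) (G : lieGroup R).

(* The Lie algebra is the tangent space at 1, read in a fixed chart around 1. *)
Definition lie_algebra : normedModType R := 'rV[R]_(lie_dim G).

Let A := lie_atlas G.
Definition chart_at_1 : chart_index A := projT1 (cid (chart_cover A 1%g)).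
Definition lie_chart : G -> lie_algebra := chart_map A chart_at_1.
Definition lie_chart_inv : lie_algebra -> G := chart_inv A chart_at_1.

Definition Ad (g : G) (X : lie_algebra) : lie_algebra :=
  'D_X (fun y => lie_chart (g * lie_chart_inv y * g^-1)%g) (lie_chart 1%g).

Definition lie_bracket (X Y : lie_algebra) : lie_algebra :=
  'D_X (fun y => Ad (lie_chart_inv y) Y) (lie_chart 1%g).

Definition thetaL : diff_form lie_algebra (lie_space G) 1 :=
  fun m p x v => 'D_(v ord0) (fun y => lie_chart ((p x)^-1 * p y)%g) x.

Definition thetaR : diff_form lie_algebra (lie_space G) 1 :=
  fun m p x v => 'D_(v ord0) (fun y => lie_chart (p y * (p x)^-1)%g) x.

Definition lie_simple : Prop :=
  (exists X Y, lie_bracket X Y <> 0) /\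
  (forall I : {vspace 'rV[R]_(lie_dim G)},
     (forall X Y : 'rV[R]_(lie_dim G), Y \in I -> lie_bracket X Y \in I) ->
     I = 0%VS \/ I = fullv).

(* The one-parameter subgroup s |-> exp (s xi). *)
Definition one_parameter (xi : lie_algebra) (gamma : 'rV[R]_1 -> G) : Prop :=
  [/\ smooth_into A setT gamma,
      forall s t, gamma (s + t) = (gamma s * gamma t)%g &
      'D_(const_mx 1) (lie_chart \o gamma) 0 = xi].

Definition torus (T : set G) : Prop :=
  [/\ T 1%g, forall x y, T x -> T y -> T (x * y)%g, forall x, T x -> T (x^-1)%g,
      forall x y, T x -> T y -> (x * y = y * x)%g & compact T /\ connected T].

Definition maximal_torus (T : set G) : Prop :=
  torus T /\ forall T' : set G, torus T' -> T `<=` T' -> T' = T.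

(* The kernel of exp : t -> T, with t the Lie algebra of T. *)
Definition integral_lattice (T : set G) (xi : lie_algebra) : Prop :=
  exists gamma, [/\ one_parameter xi gamma, forall s, T (gamma s) &
                    gamma (const_mx 1) = 1%g].

Definition invariant_inner_product (B : lie_algebra -> lie_algebra -> R) : Prop :=
  [/\ forall c X Y Z, B (c *: X + Y) Z = c * B X Z + B Y Z,
      forall X Y, B X Y = B Y X,
      forall X, X <> 0 -> 0 < B X X &
      forall g X Y, B (Ad g X) (Ad g Y) = B X Y].

Definition is_basic (T : set G) (B : lie_algebra -> lie_algebra -> R) : Prop :=
  forall xi, integral_lattice T xi -> xi <> 0 ->
    (forall zeta, integral_lattice T zeta -> zeta <> 0 -> B xi xi <= B zeta zeta) ->
    B xi xi = 2.

Definition cartan_form (B : lie_algebra -> lie_algebra -> R) : diff_form R (lie_space G) 3 :=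
  form_scale 12^-1
    (wedge_form (W := R) B thetaL (wedge_form lie_bracket thetaL thetaL)).

End LieTheory.

Definition simply_connected (R : realType) (T : topologicalType) : Prop :=
  (forall x y : T, exists c : R -> T,
     [/\ {within `[0, 1], continuous c}, c 0 = x & c 1 = y]) /\
  (forall c : R -> T, {within `[0, 1], continuous c} -> c 0 = c 1 ->
     exists H : R * R -> T,
     [/\ {within [set z : R * R | 0 <= z.1 <= 1 /\ 0 <= z.2 <= 1], continuous H},
         forall s, 0 <= s <= 1 -> H (s, 0) = c s /\ H (s, 1) = c 0 &
         forall t, 0 <= t <= 1 -> H (0, t) = c 0 /\ H (1, t) = c 0]).

Record qHamSpace (R : realType) (G : lieGroup R) := QHamSpace {
  qham_space :> smoothSpace R;
  qham_act : G -> qham_space -> qham_space;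
  qham_form : diff_form R qham_space 2;
  qham_moment : qham_space -> lie_space G }.

Arguments qham_act {R G} M g x : rename.
Arguments qham_form {R G} M : rename.
Arguments qham_moment {R G} M x : rename.

Section Fusion.
Variables (R : realType) (G : lieGroup R).
Variable (B : lie_algebra G -> lie_algebra G -> R).

Definition fusion (M1 M2 : qHamSpace G) : qHamSpace G :=
  let M := prod_space M1 M2 in
  let P1 : M -> lie_space G := qham_moment M1 \o fst in
  let P2 : M -> lie_space G := qham_moment M2 \o snd in
  @QHamSpace R G M
    (fun g x => (qham_act M1 g x.1, qham_act M2 g x.2))
    (form_sub
       (form_add (form_pull (M := M) fst (qham_form M1))
                 (form_pull (M := M) snd (qham_form M2)))
       (form_scale 2^-1
          (wedge_form (W := R) B (form_pull P1 (@thetaL R G))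
                            (form_pull P2 (@thetaR R G)))))
    (fun x => (P1 x * P2 x)%g).

(* G^2, with the moment map (a, b) |-> a b a^-1 b^-1. *)
Definition qham_double : qHamSpace G :=
  let M := prod_space (lie_space G) (lie_space G) in
  let a : M -> lie_space G := fst in
  let b : M -> lie_space G := snd in
  let ab : M -> lie_space G := fun x => (a x * b x)%g in
  let a'b' : M -> lie_space G := fun x => ((a x)^-1 * (b x)^-1)%g in
  let L f := form_pull f (@thetaL R G) in
  let Rt f := form_pull f (@thetaR R G) in
  @QHamSpace R G M
    (fun g x => (g * x.1 * g^-1, g * x.2 * g^-1)%g)
    (form_sub
       (form_scale (- 2^-1)
          (form_add (wedge_form (W := R) B (L a) (Rt b))
                    (wedge_form (W := R) B (Rt a) (L b))))
       (form_scale 2^-1 (wedge_form (W := R) B (L ab) (Rt a'b'))))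
    (fun x => (x.1 * x.2 * x.1^-1 * x.2^-1)%g).

(* [multi_double k] is G^(2 (k + 1)), the (k + 1)-fold fusion product of G^2;
   its points are (((a_1, b_1), (a_2, b_2)), ...). *)
Fixpoint multi_double (k : nat) : qHamSpace G :=
  if k is k'.+1 then fusion (multi_double k') qham_double else qham_double.

End Fusion.

(* A Hermitian line bundle with connection over an open subset of [M]. After
   choosing, without any continuity, a unit vector in every fibre, all fibres
   are the Hermitian line [R[i]]. The smooth structure is then given by local
   unitary frames [frame a], defined on the open sets [frame_dom a], and the
   connection by 1-forms [conn_form a] with
   nabla (frame a) = 2 pi i (conn_form a) (frame a). Tensor products and duals
   are fibrewise products and inverses. *)
Record lineBundle (R : realType) (M : smoothSpace R) := LineBundle {
  frame_index : Type;
  frame_dom : frame_index -> set M;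
  frame : frame_index -> M -> R[i];
  conn_form : frame_index -> diff_form R M 1 }.
Arguments frame_dom {R M} L a : rename.
Arguments frame {R M} L a : rename.
Arguments conn_form {R M} L a : rename.

Section LineBundles.
Variables (R : realType) (M : smoothSpace R).
Implicit Types (V : set M) (L : lineBundle M).

Definition smooth_fun V (g : M -> R[i]) : Prop :=
  forall m (U : set 'rV[R]_m) p, plot_in V U p ->
    smooth_on U (fun x => complex.Re (g (p x))) /\
    smooth_on U (fun x => complex.Im (g (p x))).

Definition unitary_on V (s : M -> R[i]) : Prop := forall x, V x -> `|s x| = 1.

Definition d_fun (g : M -> R[i]) : diff_form R[i] M 1 :=
  fun m p x v => ('D_(v ord0) (fun y => complex.Re (g (p y))) x +i*
                  'D_(v ord0) (fun y => complex.Im (g (p y))) x)%C.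

Definition two_pi_i_form (A : diff_form R M 1) (g : M -> R[i]) : diff_form R[i] M 1 :=
  fun m p x v => (0 +i* (2 * pi * A m p x v))%C * g (p x).

(* nabla (g * frame a) = covariant a g * frame a. *)
Definition covariant L (a : frame_index L) (g : M -> R[i]) : diff_form R[i] M 1 :=
  fun m p x v => d_fun g p x v + two_pi_i_form (conn_form L a) g p x v.

Definition is_line_bundle V L : Prop :=
  [/\ (forall a, open (frame_dom L a)) /\ V = \bigcup_a frame_dom L a,
      forall a, unitary_on (frame_dom L a) (frame L a),
      forall a, smooth_form (frame_dom L a) (conn_form L a) &
      forall a b, let g x := frame L b x / frame L a x in
        let V' := frame_dom L a `&` frame_dom L b in
        smooth_fun V' g /\
        form_eq V' (covariant a g) (two_pi_i_form (conn_form L b) g)].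

Definition parallel_unitary_section V L (s : M -> R[i]) : Prop :=
  unitary_on V s /\
  forall a, let g x := s x / frame L a x in
    let V' := V `&` frame_dom L a in
    smooth_fun V' g /\ form_eq V' (covariant a g) (fun _ _ _ _ => 0).

Definition lb_tensor L1 L2 : lineBundle M :=
  @LineBundle R M (frame_index L1 * frame_index L2)%type
    (fun a => frame_dom L1 a.1 `&` frame_dom L2 a.2)
    (fun a x => frame L1 a.1 x * frame L2 a.2 x)
    (fun a => form_add (conn_form L1 a.1) (conn_form L2 a.2)).

Definition lb_dual L : lineBundle M :=
  @LineBundle R M (frame_index L) (frame_dom L)
    (fun a x => (frame L a x)^-1)
    (fun a => form_scale (-1) (conn_form L a)).

(* The curvature is the real form dA, where nabla s = 2 pi i A s. *)
Definition has_curv L (F : diff_form R M 2) : Prop :=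
  forall a, form_eq (frame_dom L a) F (ext_d (W := R) (conn_form L a)).

End LineBundles.

Definition lb_pull (R : realType) (M N : smoothSpace R) (f : M -> N)
    (L : lineBundle N) : lineBundle M :=
  @LineBundle R M (frame_index L)
    (fun a => f @^-1` frame_dom L a)
    (fun a x => frame L a (f x))
    (fun a => form_pull f (conn_form L a)).

Record gerbe (R : realType) (M : smoothSpace R) := Gerbe {
  gerbe_index : Type;
  gerbe_dom : gerbe_index -> set M;
  gerbe_line : gerbe_index -> gerbe_index -> lineBundle M;
  gerbe_theta : gerbe_index -> gerbe_index -> gerbe_index -> M -> R[i];
  gerbe_form : gerbe_index -> diff_form R M 2 }.
Arguments gerbe_dom {R M} Gr i : rename.
Arguments gerbe_line {R M} Gr i j : rename.
Arguments gerbe_theta {R M} Gr i j k : rename.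
Arguments gerbe_form {R M} Gr i : rename.

Definition gerbe_pull (R : realType) (M N : smoothSpace R) (f : M -> N)
    (Gr : gerbe N) : gerbe M :=
  @Gerbe R M (gerbe_index Gr)
    (fun i => f @^-1` gerbe_dom Gr i)
    (fun i j => lb_pull f (gerbe_line Gr i j))
    (fun i j k x => gerbe_theta Gr i j k (f x))
    (fun i => form_pull f (gerbe_form Gr i)).

Section Gerbes.
Variables (R : realType) (M : smoothSpace R) (Gr : gerbe M).
Local Notation U := (gerbe_dom Gr).
Local Notation L := (gerbe_line Gr).
Local Notation theta := (gerbe_theta Gr).
Local Notation varpi := (gerbe_form Gr).

Definition is_gerbe : Prop :=
  [/\ (forall i, open (U i)) /\ \bigcup_i U i = setT,
      (forall i j, is_line_bundle (U i `&` U j) (L i j)) /\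
      (forall i j, exists s, parallel_unitary_section (U i `&` U j)
                               (lb_tensor (L i j) (L j i)) s),
      forall i j k, parallel_unitary_section (U i `&` U j `&` U k)
        (lb_tensor (lb_tensor (L j k) (lb_dual (L i k))) (L i j)) (theta i j k),
      forall i j k l x, (U i `&` U j `&` U k `&` U l) x ->
        theta j k l x / theta i k l x * theta i j l x / theta i j k x = 1 &
      (forall i, smooth_form (U i) (varpi i)) /\
      (forall i j, has_curv (L i j) (form_sub (varpi j) (varpi i)))].

Definition gerbe_curvature (F : diff_form R M 3) : Prop :=
  forall i, form_eq (U i) (ext_d (W := R) (varpi i)) F.

Record quasiLineBundle := QuasiLineBundle {
  quasi_line : gerbe_index Gr -> lineBundle M;
  quasi_psi : gerbe_index Gr -> gerbe_index Gr -> M -> R[i] }.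

Definition is_quasi_line_bundle (Q : quasiLineBundle) : Prop :=
  [/\ forall i, is_line_bundle (U i) (quasi_line Q i),
      forall i j, parallel_unitary_section (U i `&` U j)
        (lb_tensor (lb_tensor (lb_dual (quasi_line Q j)) (quasi_line Q i)) (L i j))
        (quasi_psi Q i j) &
      forall i j k x, (U i `&` U j `&` U k) x ->
        quasi_psi Q j k x / quasi_psi Q i k x * quasi_psi Q i j x = theta i j k x].

(* [F] is the error 2-form of [Q]: curv (E_i) = varpi_i - F for all i. *)
Definition error_form (Q : quasiLineBundle) (F : diff_form R M 2) : Prop :=
  forall i, has_curv (quasi_line Q i) (form_sub (varpi i) F).

(* The two differ by the line bundle obtained by gluing the E'_i E_i^-1 along
   psi' psi^-1; the [s i] are the restrictions of a parallel unitary section. *)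
Definition quasi_isomorphic (Q Q' : quasiLineBundle) : Prop :=
  exists s : gerbe_index Gr -> M -> R[i],
    (forall i, parallel_unitary_section (U i)
       (lb_tensor (quasi_line Q' i) (lb_dual (quasi_line Q i))) (s i)) /\
    (forall i j x, (U i `&` U j) x ->
       s j x / s i x * (quasi_psi Q' i j x / quasi_psi Q i j x) = 1).

End Gerbes.

Definition prequantization (R : realType) (G : lieGroup R) (M : qHamSpace G)
    (Gr : gerbe (lie_space G))
    (Q : quasiLineBundle (gerbe_pull (qham_moment M) Gr)) : Prop :=
  is_quasi_line_bundle Q /\ error_form Q (qham_form M).

(* Main.v *)
(* Over M = G^(2h) the obstruction to a pre-quantization is the gerbe with
   connection Psi^* Gr of curvature Psi^* eta = d omega, corrected by omega: a flat
   U(1)-gerbe. Write M = A x A', with A and A' the copies of G^h of the a's and of the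
   b's. On the slices A x {1} and {1} x A' the map Psi is constant and omega
   vanishes, so the flat gerbe is trivial there. Since G is simply connected, a
   trivialization over A x {1} can be transported along paths in A', and the
   comparison with the one over {1} x A' removes the ambiguity: the flat gerbe is
   trivial on M, which is a pre-quantization. In particular pi_2(G) = 0 is never
   needed. Two pre-quantizations differ by a flat line bundle on the simply
   connected M, which has a parallel section. *)

Require Import Defs.
From HB Require Import structures.
From mathcomp Require Import all_boot all_order all_algebra ring lra.
From mathcomp Require Import complex.
From mathcomp Require Import all_classical all_reals all_analysis.
Set Implicit Arguments.
Unset Strict Implicit.
Unset Printing Implicit Defensive.
Import Order.TTheory GRing.Theory Num.Theory.
Import numFieldNormedType.Exports.
Local Open Scope classical_set_scope.
Local Open Scope ring_scope.

(** * Identities in abelian groups *)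

(** The obstacle is to treat flat gerbes without sheaves or cohomology. Every line is trivialized
    pointwise, without continuity, so a section is a function into [circle], and [theta0] removes
    the cocycle [theta]. What remains of the geometry is a predicate telling which functions are
    flat near a point; two such functions differ by a local constant. Hence the topology runs over
    any abelian group, and analysis enters it only through the Poincare lemmas for 1-forms and
    2-forms (flat functions and local solutions exist) and through functions with zero derivative
    (uniqueness up to constants). Gluing over A' meets an obstruction on triple overlaps:
    trivializations over A x V and A x V' are compared by a flat section over A x (V cap V'), which
    is not unique. If each comparison is normalized to be 0 over {1} x A', the triple sums are
    locally constant along A and 0 at 1, hence they vanish. Flatness itself, d omega = Psi^* eta,
    comes from one formula for eta under multiplication of maps into G, [cartan_mul]: it is used
    three times for G^2 and once for each fusion. *)

Inductive zexpr := ZVar of nat | ZZero | ZAdd of zexpr & zexpr | ZOpp of zexpr.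

Fixpoint zeval (A : zmodType) (env : seq A) (e : zexpr) : A :=
  match e with
  | ZVar i => env`_i
  | ZZero => 0
  | ZAdd e1 e2 => zeval env e1 + zeval env e2
  | ZOpp e1 => - zeval env e1
  end.

Fixpoint zcoef (e : zexpr) (i : nat) : int :=
  match e with
  | ZVar j => (j == i)%:Z
  | ZZero => 0
  | ZAdd e1 e2 => zcoef e1 i + zcoef e2 i
  | ZOpp e1 => - zcoef e1 i
  end.

Lemma zevalE (A : zmodType) (env : seq A) e :
  zeval env e = \sum_(i < size env) env`_i *~ zcoef e i.
Proof.
elim: e => [j||e1 IH1 e2 IH2|e IH] /=.
- have [lt_j|le_j] := ltnP j (size env).
    rewrite (bigD1 (Ordinal lt_j)) //= eqxx mulr1z big1 ?addr0// => i.
    by rewrite -val_eqE /= eq_sym => /negPf ->.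
  rewrite nth_default// big1// => i _; rewrite gtn_eqF ?mulr0z//.
  exact: leq_trans (ltn_ord i) le_j.
- by rewrite big1// => i _; rewrite mulr0z.
- by rewrite IH1 IH2 -big_split; apply: eq_bigr => i _; rewrite /= mulrzDr.
- by rewrite IH -sumrN; apply: eq_bigr => i _; rewrite mulrNz.
Qed.

(** It suffices to compare the integer coefficients of the atoms, which is done by computation.
    [zmod] reifies a goal into this form and serves all cochain calculations below, where only a
    group structure is present. *)
Lemma zmod_reflect (A : zmodType) (env : seq A) e1 e2 :
  all (fun i => zcoef e1 i == zcoef e2 i) (iota 0 (size env)) ->
  zeval env e1 = zeval env e2.
Proof.
move=> /allP h; rewrite !zevalE; apply: eq_bigr => i _.
by have /eqP -> // : zcoef e1 i == zcoef e2 i by apply: h; rewrite mem_iota /=.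
Qed.

Ltac zmod_index x env :=
  lazymatch env with
  | x :: _ => constr:(0%N)
  | _ :: ?env' => let n := zmod_index x env' in constr:(S n)
  end.
Ltac zmod_mem x env :=
  lazymatch env with
  | nil => constr:(false) | x :: _ => constr:(true)
  | _ :: ?env' => zmod_mem x env'
  end.
Ltac zmod_vars t env :=
  lazymatch t with
  | GRing.add ?a ?b => let env' := zmod_vars a env in zmod_vars b env'
  | GRing.opp ?a => zmod_vars a env
  | GRing.zero => env
  | _ => let m := zmod_mem t env in
         lazymatch m with true => env | false => constr:(t :: env) end
  end.
Ltac zmod_quote t env :=
  lazymatch t with
  | GRing.add ?a ?b =>
      let a' := zmod_quote a env in let b' := zmod_quote b env in constr:(ZAdd a' b')
  | GRing.opp ?a => let a' := zmod_quote a env in constr:(ZOpp a')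
  | GRing.zero => constr:(ZZero)
  | _ => let n := zmod_index t env in constr:(ZVar n)
  end.
Ltac zmod :=
  lazymatch goal with
  | |- @eq ?T ?a ?b =>
      let env := zmod_vars a (@nil T) in
      let env := zmod_vars b env in
      let a' := zmod_quote a env in
      let b' := zmod_quote b env in
      exact: (@zmod_reflect _ env a' b' isT)
  end.

(** * Flat torsors and flat gerbes on topological spaces *)

(** Compactness of [a, b] without coverings. The supremum of the points reached from [a] is itself
    reached, by the local hypothesis there, and cannot lie before [b]. Each use chooses its
    relation: existence of a section or of a trivialization, a uniform radius, equality of
    values. *)
Lemma cousin (R : realType) (P : R -> R -> Prop) (a b : R) :
  a <= b ->
  (forall t, a <= t <= b -> exists2 e, 0 < e &
     forall s s', t - e < s -> s <= s' -> s' < t + e -> P s s') ->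
  (forall s m s', s <= m -> m <= s' -> P s m -> P m s' -> P s s') ->
  P a b.
Proof.
move=> leab loc add.
pose S := [set x | a <= x <= b /\ P a x].
have Sa : S a.
  split; first by rewrite lexx.
  have [|e e0 He] := loc a; first by rewrite lexx.
  by apply: He => //; [rewrite ltrBlDr ltrDl | rewrite ltrDl].
have hS : has_sup S by split; [exists a | exists b => x [/andP[]]].
have ub x : S x -> x <= sup S by apply: sup_upper_bound.
have ac : a <= sup S by exact: ub.
have cb : sup S <= b by apply: ge_sup => [|x [/andP[]]] //; exists a.
have [|e e0 He] := loc (sup S); first by rewrite ac.
have [x Sx ltx] := sup_adherent e0 hS.
(* Half of [e] keeps the right end strictly inside the neighbourhood of the supremum, and still
   passes the supremum unless [b] comes first. *)
pose c' := Num.min b (sup S + e / 2).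
have lee : e / 2 < e by rewrite ltr_pdivrMr// ltr_pMr// ltr1n.
have e20 : 0 < e / 2 by rewrite divr_gt0.
have cc' : sup S <= c' by rewrite le_min cb lerDl ltW.
have Pxc : P x c'.
  apply: He => //; first exact: le_trans (ub _ Sx) cc'.
  by rewrite gt_min ltrD2l lee orbT.
have Pac : P a c'.
  by apply: add (proj2 Sx) Pxc; [case: Sx => /andP[] | exact: le_trans (ub _ Sx) cc'].
have Sc' : S c' by split=> //; rewrite (le_trans ac cc') ge_min lexx.
have : c' <= sup S by exact: ub.
rewrite /c' ge_min => /orP[bc|]; last by rewrite gerDl leNgt e20.
move: Pac; rewrite /c'; suff -> : Num.min b (sup S + e / 2) = b by [].
by apply/min_idPl; rewrite (le_trans bc)// lerDl ltW.
Qed.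

Section Structures.
Variable A : zmodType.

(* A flat [A]-torsor on [D]: [good u x] says that [u] is a flat section near
   [x]. Sections need not be continuous functions: the fibres are trivialized
   pointwise, and only differences of flat sections are locally constant. *)
Record lineStr (X : topologicalType) (D : set X)
    (good : (X -> A) -> X -> Prop) : Prop := LineStr {
  ls_near : forall u x, D x -> good u x -> \forall y \near x, good u y;
  ls_ex : forall x, D x -> exists u, good u x;
  ls_sub : forall u v x, D x -> good u x -> good v x ->
    exists c, \forall y \near x, v y = u y + c;
  ls_shift : forall u v x c, good u x -> (\forall y \near x, v y = u y + c) -> good v x }.

Lemma ls_shiftW (X : topologicalType) (D : set X) good u v x c :
  lineStr D good -> good u x -> (forall y, v y = u y + c) -> good v x.
Proof. by move=> L gu vu; apply: (ls_shift L gu); exact: nearW. Qed.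

(** Flatness depends on germs only, so a section of the pulled-back torsor has to come from a flat
    section below just near [y]. *)
Definition pull_good (X Y : topologicalType) (phi : Y -> X)
    (good : (X -> A) -> X -> Prop) (w : Y -> A) (y : Y) : Prop :=
  exists2 u, good u (phi y) & \forall z \near y, w z = u (phi z).

Lemma lineStr_pull (X Y : topologicalType) (D : set X) (D' : set Y) phi good :
  (forall y, D' y -> D (phi y)) -> (forall y, D' y -> {for y, continuous phi}) ->
  lineStr D good -> lineStr D' (pull_good phi good).
Proof.
move=> DD cphi L; split.
- move=> w y /[dup] D'y /DD Dy [u gu wu].
  have /cphi := D'y => /(_ _ (ls_near L Dy gu)) /= n1.
  near=> z; exists u; first by near: z.
  by near: z; exact: nbhs_interior wu.
- move=> y /DD /(ls_ex L)[u gu]; exists (u \o phi), u => //; exact: nearW.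
- move=> w w' y D'y [u gu wu] [u' gu' wu'].
  have [c uc] := ls_sub L (DD _ D'y) gu gu'.
  exists c; have {}uc := cphi _ D'y _ uc.
  near=> z; rewrite (near wu' z)// (near wu z)//.
  by near: z.
- move=> w w' y c [u gu wu] ww'.
  exists (fun x => u x + c); first by apply: (ls_shift L gu); exact: nearW.
  by near=> z; rewrite (near ww' z)// (near wu z).
Unshelve. all: by end_near. Qed.

(* A flat [A]-gerbe on [D], with [P] a set of local trivializations: [C a b f x]
   says that, near [x], [a] and [b] are defined and [f] is a flat isomorphism
   between them, again with pointwise trivialized fibres. A [solution] is a
   global trivialization, glued from the [a x] by the cochain [g]. *)
Record flatGerbe (X : topologicalType) (D : set X) (P : Type)
    (C : P -> P -> (X -> A) -> X -> Prop) : Prop := FlatGerbe {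
  fg_near : forall a b f x, D x -> C a b f x -> \forall y \near x, C a b f y;
  fg_comp : forall a b c f g x, C a b f x -> C b c g x ->
    C a c (fun y => f y + g y) x;
  fg_inv : forall a b f x, C a b f x -> C b a (fun y => - f y) x;
  fg_cover : forall x, D x -> exists a, C a a (fun=> 0) x;
  fg_ex : forall a b x, D x -> C a a (fun=> 0) x -> C b b (fun=> 0) x ->
    exists f, C a b f x;
  fg_sub : forall a b f g x, D x -> C a b f x -> C a b g x ->
    exists c, \forall y \near x, g y = f y + c;
  fg_shift : forall a b f g x c, C a b f x ->
    (\forall y \near x, g y = f y + c) -> C a b g x }.

Lemma fg_eq X D P C (F : @flatGerbe X D P C) a b f g x :
  C a b f x -> f =1 g -> C a b g x.
Proof. by move=> Cf /funext <-. Qed.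

Lemma fg_near_eq X D P C (F : @flatGerbe X D P C) a b f g x :
  C a b f x -> (\forall y \near x, f y = g y) -> C a b g x.
Proof.
move=> Cf fg; apply: (fg_shift (c := 0) F Cf).
by apply: filterS fg => y ->; rewrite addr0.
Qed.

(** [C a a (fun=> 0) x] plays the role of [a] being defined near [x]; an isomorphism composed with
    its inverse provides it. *)
Lemma fg_src X D P C (F : @flatGerbe X D P C) a b f x :
  C a b f x -> C a a (fun=> 0) x.
Proof.
move=> Cf; apply: (fg_eq F (fg_comp F Cf (fg_inv F Cf))) => y; zmod.
Qed.

Definition pull_rel (X Y : topologicalType) (phi : Y -> X) (P : Type)
    (C : P -> P -> (X -> A) -> X -> Prop) (a b : P) (h : Y -> A) (y : Y) : Prop :=
  pull_good phi (C a b) h y.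

Lemma pull_goodS (X Y : topologicalType) (phi : Y -> X)
    (good : (X -> A) -> X -> Prop) u y :
  good u (phi y) -> pull_good phi good (u \o phi) y.
Proof. by exists u => //; exact: nearW. Qed.

Lemma flatGerbe_pull (X Y : topologicalType) (D : set X) (D' : set Y) phi P C :
  (forall y, D' y -> D (phi y)) -> (forall y, D' y -> {for y, continuous phi}) ->
  @flatGerbe X D P C -> flatGerbe D' (pull_rel phi C).
Proof.
move=> DD cphi F.
split.
- move=> a b w y /[dup] D'y /DD Dy [u gu wu].
  have /cphi := D'y => /(_ _ (fg_near F Dy gu)) /= n1.
  near=> z; exists u; first by near: z.
  by near: z; exact: nbhs_interior wu.
- move=> a b c f g y [u Cu fu] [v Cv gv].
  exists (fun x => u x + v x); first exact: (fg_comp F Cu).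
  by near=> z; rewrite (near fu z)// (near gv z).
- move=> a b f y [u Cu fu]; exists (fun x => - u x); first exact: (fg_inv F Cu).
  by near=> z; rewrite (near fu z).
- by move=> y /DD /(fg_cover F)[a Ca]; exists a, (fun=> 0) => //; exact: nearW.
- move=> a b y /DD Dy [u Cu _] [v Cv _].
  have [f Cf] := fg_ex F Dy (fg_src F Cu) (fg_src F Cv).
  by exists (f \o phi); exact: pull_goodS.
- move=> a b w w' y D'y [u gu wu] [u' gu' wu'].
  have [c uc] := fg_sub F (DD _ D'y) gu gu'.
  exists c; have {}uc := cphi _ D'y _ uc.
  near=> z; rewrite (near wu' z)// (near wu z)//.
  by near: z.
- move=> a b w w' y c [u gu wu] ww'.
  exists (fun x => u x + c); first by apply: (fg_shift F gu); exact: nearW.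
  by near=> z; rewrite (near ww' z)// (near wu z).
Unshelve. all: by end_near. Qed.

Definition solution (X : topologicalType) (D : set X) (P : Type)
    (C : P -> P -> (X -> A) -> X -> Prop) (a : X -> P) (g : X -> X -> A) : Prop :=
  forall x, D x -> \forall y \near x, C (a x) (a y) (fun z => g x z - g y z) y.

Lemma solution_def X D P C a g x : @solution X D P C a g -> D x ->
  C (a x) (a x) (fun=> 0) x.
Proof.
move=> S /S /nbhs_singleton; congr (C _ _ _ _); apply/funext => y; exact: subrr.
Qed.

Lemma solution_sub (X : topologicalType) (D D' : set X) P (C : P -> P -> (X -> A) -> X -> Prop) a g :
  D' `<=` D -> solution D C a g -> solution D' C a g.
Proof. by move=> DD S x /DD /S. Qed.

Lemma solution_pull (X Y : topologicalType) (D : set X) (D' : set Y) phi P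
    (C : P -> P -> (X -> A) -> X -> Prop) a g :
  (forall y, D' y -> D (phi y)) -> (forall y, D' y -> {for y, continuous phi}) ->
  solution D C a g ->
  solution D' (pull_rel phi C) (a \o phi) (fun y z => g (phi y) (phi z)).
Proof.
move=> DD cphi S y /[dup] /cphi cy /DD /S /cy Sy.
apply: filterS (Sy : \forall z \near y, _) => z /= Cz.
exact: (@pull_goodS _ _ phi (C _ _) (fun x => g (phi y) x - g (phi z) x)).
Qed.

(* Two solutions differ by a flat line bundle. *)
Definition sol_ratio (X : topologicalType) (P : Type)
    (C : P -> P -> (X -> A) -> X -> Prop) (a : X -> P) (g : X -> X -> A)
    (a' : X -> P) (g' : X -> X -> A) (u : X -> A) (x : X) : Prop :=
  C (a x) (a' x) (fun z => u z + g x z - g' x z) x.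

(** Near [x], an isomorphism from [a x] to [a' x] becomes one from [a y] to [a' y] by composition
    with the transitions of the two solutions; this gives openness. The other clauses are those of
    the gerbe for the pair [a x], [a' x]. *)
Lemma lineStr_ratio (X : topologicalType) (D : set X) P (C : P -> P -> (X -> A) -> X -> Prop) a g a' g' :
  flatGerbe D C -> solution D C a g -> solution D C a' g' ->
  lineStr D (sol_ratio C a g a' g').
Proof.
move=> F S S'; split.
- move=> u x Dx Cx; have n1 := fg_near F Dx Cx; have n2 := S x Dx.
  have n3 := S' x Dx; near=> y; rewrite /sol_ratio.
  have h1 : C (a x) (a' x) (fun z => u z + g x z - g' x z) y by near: y.
  have h2 : C (a x) (a y) (fun z => g x z - g y z) y by near: y.
  have h3 : C (a' x) (a' y) (fun z => g' x z - g' y z) y by near: y.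
  apply: (fg_eq F (fg_comp F (fg_inv F h2) (fg_comp F h1 h3))) => z; zmod.
- move=> x Dx; have [f Cf] := fg_ex F Dx (solution_def S Dx) (solution_def S' Dx).
  by exists (fun z => f z - g x z + g' x z); apply: (fg_eq F Cf) => z; zmod.
- move=> u v x Dx Cu Cv; have [c Hc] := fg_sub F Dx Cu Cv.
  exists c; apply: filterS Hc => y /(congr1 (fun t => t - g x y + g' x y)) Hy.
  transitivity (v y + g x y - g' x y - g x y + g' x y); first by zmod.
  by rewrite Hy; zmod.
- move=> u v x c Cu uv; apply: (fg_shift (c := c) F Cu).
  by apply: filterS uv => y ->; zmod.
Unshelve. all: by end_near. Qed.

End Structures.

Lemma nbhs_box (X Y : topologicalType) (x : X) (y : Y) (P : set (X * Y)) :
  nbhs (x, y) P -> exists U V, [/\ open U, U x, open V, V y & U `*` V `<=` P].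
Proof.
case=> -[U V] /= [nU nV] UV; exists U°, V°; split; try exact: open_interior.
- exact: nU.
- exact: nV.
- by move=> [a b] [/= /interior_subset Ua /interior_subset Vb]; exact: UV.
Qed.

Lemma nbhs_setX (X Y : topologicalType) (x : X) (y : Y) (U : set X) (V : set Y) :
  open U -> U x -> open V -> V y -> nbhs (x, y) (U `*` V).
Proof.
move=> oU Ux oV Vy; exists (U, V) => //=.
by split; exact: open_nbhs_nbhs.
Qed.

Lemma nbhs_itv (R : realType) (t : R) (U : set R) :
  nbhs t U -> exists2 e, 0 < e & forall s, t - e < s -> s < t + e -> U s.
Proof.
move=> /nbhs_ballP [e e0 eU]; exists e => // s ls sl; apply: eU.
by rewrite /ball /= distrC ltr_distl ls sl.
Qed.

Lemma near_lt_fst (R : realType) (Y : topologicalType) (t m : R) (y : Y) :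
  t < m -> \forall p \near (t, y), p.1 < m.
Proof.
move=> tm; exists ([set r | r < m], setT) => /=; last by move=> [a b] [].
by split; [exact: lt_nbhsl | exact: filterT].
Qed.

Lemma near_gt_fst (R : realType) (Y : topologicalType) (t m : R) (y : Y) :
  m < t -> \forall p \near (t, y), m < p.1.
Proof.
move=> tm; exists ([set r | m < r], setT) => /=; last by move=> [a b] [].
by split; [exact: lt_nbhsr | exact: filterT].
Qed.

Lemma lconst_seg (R : realType) (T : Type) (d : R -> T) (a b : R) : a <= b ->
  (forall r, a <= r <= b -> \forall r' \near r, d r' = d r) -> d a = d b.
Proof.
move=> ab loc; apply: (@cousin R (fun s t => d s = d t)) => //; last first.
  by move=> s m s' _ _ ->.
move=> t /loc /nbhs_itv [e e0 He]; exists e => // s s' h1 h2 h3.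
by rewrite !He//; lra.
Qed.

(** * Sections and solutions along segments; extension over intervals *)

Section Paths.
Variables (A : zmodType) (R : realType).

(** Flat sections over two adjacent segments differ by a constant near the common end, so they can
    be joined; compactness of the segment leaves finitely many shrinkings of the neighbourhood of
    [y0]. *)
Lemma line_seg (Y : topologicalType) (D : set (R * Y)) good (s t : R) (y0 : Y) :
  @lineStr A _ D good -> s <= t -> (forall r, s <= r <= t -> D (r, y0)) ->
  exists V u, [/\ open V, V y0 & forall r y, s <= r <= t -> V y -> good u (r, y)].
Proof.
move=> L st HD.
pose P a b := s <= a -> b <= t -> exists V u, [/\ open V, V y0 &
  forall r y, a <= r <= b -> V y -> good u (r, y)].
suff : P s t by apply.
apply: cousin => //.
  move=> r /HD Dr; have [u gu] := ls_ex L Dr.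
  have [U [V [oU Ur oV Vy UV]]] := nbhs_box (ls_near L Dr gu).
  have [e e0 He] := nbhs_itv (open_nbhs_nbhs (conj oU Ur)).
  exists e => // a b h1 h2 h3 _ _; exists V, u; split => // r' y /andP[h4 h5] Vy'.
  by apply: UV; split=> //=; apply: He; lra.
move=> a m b am mb Pam Pmb sa bt.
have [V [u [oV Vy0 Hu]]] := Pam sa (le_trans mb bt).
have [V' [u' [oV' Vy0' Hu']]] := Pmb (le_trans sa am) bt.
have Dm : D (m, y0) by apply: HD; rewrite (le_trans sa am) (le_trans mb bt).
have gum : good u (m, y0) by apply: Hu => //; rewrite am lexx.
have gum' : good u' (m, y0) by apply: Hu' => //; rewrite mb lexx.
have [c uc] := ls_sub L Dm gum gum'.
have [U [V2 [oU Um oV2 V2y UV]]] := nbhs_box uc.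
(* After subtraction of [c] both sections agree near (m, y0), so the case distinction is invisible
   to germs even at time [m]. *)
pose w p := if p.1 <= m then u p else u' p - c.
exists (V `&` V' `&` V2), w; split.
- exact/openI/oV2/openI.
- by split.
- move=> r y /andP[ar rb] [[Vy V'y] V2y'].
  have [rm|mr|rm] := ltgtP r m.
  + apply: (ls_shift (c := 0) L (Hu r y _ Vy)); first by rewrite ar ltW.
    have := near_lt_fst y rm; apply: filterS => p pm.
    by rewrite /w ltW// addr0.
  + apply: (ls_shift (c := - c) L (Hu' r y _ V'y)); first by rewrite rb ltW.
    have := near_gt_fst y mr; apply: filterS => p pm.
    by rewrite /w leNgt pm.
  + apply: (ls_shift (c := 0) L (Hu r y _ Vy)); first by rewrite ar rm lexx.
    have : nbhs (r, y) (U `*` V2).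
      by apply: nbhs_setX => //; rewrite rm.
    apply: filterS => p /UV /= Hp; rewrite /w Hp addrK addr0.
    by case: ifP.
Qed.

(** The argument of [line_seg] one degree higher: two solutions that meet at time [m] are matched by
    a section [u] of their ratio in place of a constant. *)
Lemma gerbe_seg (Y : topologicalType) (D : set (R * Y)) P C (s t : R) (y0 : Y) :
  @flatGerbe A _ D P C -> s <= t -> (forall r, s <= r <= t -> D (r, y0)) ->
  exists V a g, [/\ open V, V y0 &
    solution ([set r | s <= r <= t] `*` V) C a g].
Proof.
move=> F st HD.
pose Q b c := s <= b -> c <= t -> exists V a g, [/\ open V, V y0 &
    solution ([set r | b <= r <= c] `*` V) C a g].
suff : Q s t by apply.
apply: cousin => //.
  move=> r /HD Dr; have [a Ca] := fg_cover F Dr.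
  have [U [V [oU Ur oV Vy UV]]] := nbhs_box (fg_near F Dr Ca).
  have [e e0 He] := nbhs_itv (open_nbhs_nbhs (conj oU Ur)).
  exists e => // b c h1 h2 h3 _ _; exists V, (fun=> a), (fun _ _ => 0).
  split => // -[r' y] [/= /andP[h4 h5] Vy'].
  have : nbhs (r', y) (U `*` V) by apply: nbhs_setX => //; apply: He; lra.
  by apply: filterS => p /UV /= Cp; apply: (fg_eq F Cp) => z /=; zmod.
move=> b m c bm mc Qbm Qmc sb ct.
have [V [a [g [oV Vy0 Hu]]]] := Qbm sb (le_trans mc ct).
have [V' [a' [g' [oV' Vy0' Hu']]]] := Qmc (le_trans sb bm) ct.
(* Only germs at (m, y0) are compared, so gerbe and solutions are restricted to this single point,
   where their ratio is a torsor. *)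
have Dm : [set (m, y0)] `<=` D.
  by move=> _ ->; apply: HD; rewrite (le_trans sb bm) (le_trans mc ct).
have F0 : flatGerbe [set (m, y0)] C.
  by case: F => *; split; eauto.
have Sm : solution [set (m, y0)] C a g.
  by move=> _ ->; apply: Hu; split => //=; rewrite bm lexx.
have Sm' : solution [set (m, y0)] C a' g'.
  by move=> _ ->; apply: Hu'; split => //=; rewrite mc lexx.
have L := lineStr_ratio F0 Sm Sm'.
have [u gu] := ls_ex L (erefl (m, y0)).
have [U [V2 [oU Um oV2 V2y UV]]] := nbhs_box (ls_near L (erefl _) gu).
(* The local trivialization jumps at time [m]; adding [u] to the cochain on the left side only
   absorbs the jump. *)
pose al p := if p.1 <= m then a p else a' p.
pose ga p z := if p.1 <= m then u z + g p z else g' p z.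
exists (V `&` V' `&` V2), al, ga; split.
- exact/openI/oV2/openI.
- by split.
- move=> [r y] [/= /andP[ar rb] [[Vy V'y] V2y']].
  have [rm|mr|rm] := ltgtP r m.
  + have n1 := near_lt_fst y rm.
    have n2 : \forall p \near (r, y), C (a (r, y)) (a p) (fun z => g (r, y) z - g p z) p.
      by apply: Hu; split=> //=; rewrite ar ltW.
    near=> p; have pm : p.1 < m by near: p.
    have Cp : C (a (r, y)) (a p) (fun z => g (r, y) z - g p z) p by near: p.
    by rewrite /al /ga /= !ltW//; apply: (fg_eq F Cp) => z /=; zmod.
  + have n1 := near_gt_fst y mr.
    have n2 : \forall p \near (r, y), C (a' (r, y)) (a' p) (fun z => g' (r, y) z - g' p z) p.
      by apply: Hu'; split=> //=; rewrite rb ltW.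
    near=> p; have pm : m < p.1 by near: p.
    have Cp : C (a' (r, y)) (a' p) (fun z => g' (r, y) z - g' p z) p by near: p.
    by rewrite /al /ga /= leNgt mr /= leNgt pm /=.
  + have n1 : nbhs (r, y) (U `*` V2) by apply: nbhs_setX => //; rewrite rm.
    have n2 : \forall p \near (r, y), C (a (r, y)) (a p) (fun z => g (r, y) z - g p z) p.
      by apply: Hu; split=> //=; rewrite ar rm lexx.
    near=> p; have /UV Rp : (U `*` V2) p by near: p.
    have Cp : C (a (r, y)) (a p) (fun z => g (r, y) z - g p z) p by near: p.
    rewrite /al /ga /= rm lexx -rm; case: ifP => _.
      by apply: (fg_eq F Cp) => z /=; zmod.
    by apply: (fg_eq F (fg_comp F Cp Rp)) => z /=; zmod.
Unshelve. all: by end_near. Qed.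

(** Homotopy lifting for flat torsors, with parameters in [W] and prescribed values over [x0]. It is
    isolated because gluing uses it for two kinds of base, open intervals and simply connected
    spaces. *)
Definition line_extendable (X : topologicalType) (I : set X) (x0 : X) : Prop :=
  forall (Y : topologicalType) (W : set Y) good,
  open W -> @lineStr A _ (I `*` W) good ->
  forall w0, (forall y, W y -> pull_good (pair x0) good w0 y) ->
  exists w, (forall x y, I x -> W y -> good w (x, y)) /\
            (forall y, W y -> w (x0, y) = w0 y).

(** Connectedness of [I] in the form in which gluing uses it, for functions into the coefficient
    group. *)
Definition chained (X : topologicalType) (I : set X) (x0 : X) : Prop :=
  forall d : X -> A, (forall x, I x -> \forall x' \near x, d x' = d x) ->
  forall x, I x -> d x = d x0.

Lemma chained_itv (I : set R) :
  (forall s t r, I s -> I t -> s <= r <= t -> I r) -> I 0 -> chained I 0.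
Proof.
move=> conv I0 d loc x Ix; have [x0|/ltW x0] := leP x 0.
  by apply: lconst_seg => // r rx; apply: loc; apply: conv rx.
by apply/esym; apply: lconst_seg => // r rx; apply: loc; apply: conv rx.
Qed.

Lemma near_slice (X Y : topologicalType) (x : X) (y : Y) (Q : set (X * Y)) :
  nbhs (x, y) Q -> \forall x' \near x, Q (x', y).
Proof.
case=> -[U V] /= [nU nV] UV; apply: filterS nU => x' Ux'.
by apply: UV; split=> //=; exact: nbhs_singleton.
Qed.

Lemma near_slice2 (X Y : topologicalType) (x : X) (y : Y) (Q : set (X * Y)) :
  nbhs (x, y) Q -> \forall y' \near y, Q (x, y').
Proof.
case=> -[U V] /= [nU nV] UV; apply: filterS nV => y' Vy'.
by apply: UV; split=> //=; exact: nbhs_singleton.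
Qed.

Lemma ls_diff_slice (X Y : topologicalType) (D : set (X * Y)) good u v x y :
  @lineStr A _ D good -> D (x, y) -> good u (x, y) -> good v (x, y) ->
  \forall x' \near x, u (x', y) - v (x', y) = u (x, y) - v (x, y).
Proof.
move=> L Dx gu gv; have [c uc] := ls_sub L Dx gv gu.
rewrite (nbhs_singleton uc); apply: filterS (near_slice uc) => x' /= ->; zmod.
Qed.

(** Each point (t, y0) receives its own section along the segment between 0 and t, normalized by
    [w0] at time 0, and the extension reads at each point the value of that point's section.
    Neighbouring sections agree because their difference is locally constant along the segment and 0
    at time 0. *)
Lemma line_extendable_itv (I : set R) : open I ->
  (forall s t r, I s -> I t -> s <= r <= t -> I r) -> I 0 -> line_extendable I 0.
Proof.
move=> oI conv I0 Y W good oW L w0 Hw0.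
pose seg (t r : R) := (0 <= r <= t) || (t <= r <= 0).
have segI t r : I t -> seg t r -> I r.
  by move=> It /orP[] h; apply: conv h.
have ex1 (p : R * Y) : exists Vu : set Y * (R * Y -> A), I p.1 -> W p.2 ->
    [/\ open Vu.1, Vu.1 p.2, Vu.1 `<=` W,
     forall r y, seg p.1 r -> Vu.1 y -> good Vu.2 (r, y) &
     forall y, Vu.1 y -> Vu.2 (0, y) = w0 y].
  case: p => t y0 /=.
  have [[It Wy0]|nIW] := pselect (I t /\ W y0); last first.
    by exists (set0, fun=> 0) => It Wy; case: nIW.
  have [V [u [oV Vy0 Hu]]] : exists V u, [/\ open V, V y0 &
      forall r y, seg t r -> V y -> good u (r, y)].
    have [t0|/ltW t0] := leP 0 t.
      have := @line_seg _ _ _ 0 t y0 L t0; case=> [r rt|V [u [oV Vy Hu]]].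
        by split => //=; apply: segI It _; rewrite /seg rt.
      exists V, u; split => // r y /orP[] rt; first exact: Hu.
      by apply: Hu; lra.
    have := @line_seg _ _ _ t 0 y0 L t0; case=> [r rt|V [u [oV Vy Hu]]].
      by split => //=; apply: segI It _; rewrite /seg rt orbT.
    exists V, u; split => // r y /orP[] rt; last exact: Hu.
    by apply: Hu; lra.
  have [v gv wv] := Hw0 _ Wy0.
  have D0 : (I `*` W) (0, y0) by split.
  have gu0 : good u (0, y0) by apply: Hu => //; rewrite /seg lexx /= andbT le_total.
  have [c uc] := ls_sub L D0 gv gu0.
  have : nbhs y0 [set y | w0 y = v (0, y) /\ u (0, y) = v (0, y) + c].
    exact: filterI wv (near_slice2 uc).
  rewrite nbhsE => -[V2 [oV2 V2y] HV2].
  exists (V `&` V2 `&` W, fun p => u p - c) => _ _ /=; split.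
  - exact/openI/oW/openI.
  - by split.
  - by move=> y [].
  - move=> r y rt [[Vy V2y'] Wy].
    exact: ls_shiftW L (Hu r y rt Vy) (fun=> erefl).
  - by move=> y [[_ /HV2 /= [-> ->]] _]; rewrite addrK.
have [Vu HVu] := choice ex1.
exists (fun p => (Vu p).2 p); split => [t1 y1 It1 Wy1|y Wy]; last first.
  by have [_ h _ _ ->] := HVu (0, y) I0 Wy.
set u1 := (Vu (t1, y1)).2.
have [oV Vy1 VW Hu1 Hw1] := HVu (t1, y1) It1 Wy1.
rewrite -/u1 in Hu1 Hw1.
have seg1 t : seg t t by rewrite /seg !lexx !andbT le_total.
have D1 : (I `*` W) (t1, y1) by split.
have g1 : good u1 (t1, y1) by apply: Hu1.
apply: (ls_shift (c := 0) L g1).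
have [U [V2 [oU Ut oV2 V2y UV]]] := nbhs_box (ls_near L D1 g1).
have : nbhs t1 (I `&` U) by apply: open_nbhs_nbhs; split => //; exact: openI.
move=> /nbhs_itv [e e0 He].
have : nbhs (t1, y1) ([set r | t1 - e < r < t1 + e] `*` (V2 `&` (Vu (t1, y1)).1)).
  exists ([set r | t1 - e < r < t1 + e], (V2 `&` (Vu (t1, y1)).1)) => //=.
  split; last by apply: open_nbhs_nbhs; split => //; exact: openI.
  by apply/nbhs_ballP; exists e => // r; rewrite /ball /= distrC ltr_distl.
apply: filterS => -[t y] /= [/andP[h1 h2] [V2y' Vy]]; rewrite addr0.
have Iy : I t by apply: (proj1 (He _ _ _)).
have Wy := VW _ Vy.
have [_ Vy' _ Hu2 Hw2] := HVu (t, y) Iy Wy.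
(* [u1] is known to be flat along the segment of [t1] only; whatever the segment of [t] has beyond
   it lies within [e] of [t1], where flatness is open. *)
have gu1 r : seg t r -> good u1 (r, y).
  move=> tr; have [t1r|t1r] := boolP (seg t1 r); first exact: Hu1.
  apply: UV; split=> //=; apply: (proj2 (He _ _ _)).
    by move: t1r; rewrite negb_or !negb_and -!ltNge; move: tr; rewrite /seg; lra.
  by move: t1r; rewrite negb_or !negb_and -!ltNge; move: tr; rewrite /seg; lra.
pose d r := (Vu (t, y)).2 (r, y) - u1 (r, y).
suff : d t = d 0 by rewrite /d Hw2// Hw1// subrr => /eqP; rewrite subr_eq0 => /eqP.
have Hd r : seg t r -> \forall r' \near r, d r' = d r.
  move=> tr; apply: (ls_diff_slice L); last exact: gu1; last exact: Hu2.
  by split=> //=; apply: segI tr.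
have [t0|/ltW t0] := leP 0 t.
  by apply/esym; apply: lconst_seg => // r rt; apply: Hd; rewrite /seg rt.
by apply: lconst_seg => // r rt; apply: Hd; rewrite /seg rt orbT.
Qed.

End Paths.

Lemma continuous_pairl (X Y : topologicalType) (x : X) (y : Y) :
  {for y, continuous (pair x)}.
Proof. by move=> Q /near_slice2. Qed.

Lemma continuous_pairr (X Y : topologicalType) (x : X) (y : Y) :
  {for x, continuous (fun x' => (x', y))}.
Proof. by move=> Q /near_slice. Qed.

Lemma near_open (X : topologicalType) (x : X) (P : X -> Prop) :
  (\forall y \near x, P y) -> exists V, [/\ open V, V x & forall y, V y -> P y].
Proof.
move=> nP; exists P°; split=> //; first exact: open_interior.
exact: interior_subset.
Qed.

Lemma flatGerbe_sub (A : zmodType) (X : topologicalType) (D D' : set X) P C :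
  D' `<=` D -> @flatGerbe A X D P C -> flatGerbe D' C.
Proof. by move=> DD [] *; split; eauto. Qed.

(** * Gluing solutions over a product *)

Section Glue.
Variable A : zmodType.

(** Local solutions over I * V are first made to agree with the given one over {x0} * V. Their
    comparisons on overlaps can then start from 0 over [x0], and [line_extendable] extends them
    along [I]. Comparisons normalized in this way are additive on triple overlaps by [chained], so
    no cocycle condition has to be solved over [W]. *)
Lemma gerbe_glue (X Y : topologicalType) (I : set X) (x0 : X) (W : set Y) P C al ga :
  line_extendable A I x0 -> chained A I x0 -> open I -> I x0 -> open W ->
  @flatGerbe A (X * Y)%type (I `*` W) P C ->
  solution W (pull_rel (pair x0) C) al ga ->
  (forall y, W y -> exists V a g, [/\ open V, V y, V `<=` W &
     solution (I `*` V) C a g]) ->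
  exists a g, solution (I `*` W) C a g.
Proof.
move=> ext chn oI Ix0 oW F S0 loc.
have ex1 y1 : exists Vag : set Y * ((X * Y -> P) * (X * Y -> X * Y -> A)), W y1 ->
    [/\ open Vag.1, Vag.1 y1, Vag.1 `<=` W, solution (I `*` Vag.1) C Vag.2.1 Vag.2.2 &
     forall y, Vag.1 y -> pull_rel (pair x0) C (Vag.2.1 (x0, y)) (al y)
       (fun z => Vag.2.2 (x0, y) (x0, z) - ga y z) y].
  have [Wy1|nW] := pselect (W y1); last first.
    by exists (set0, (fun=> al y1, fun _ _ => 0)).
  have [V [a [g [oV Vy1 VW S]]]] := loc _ Wy1.
  have VD y : V y -> (I `*` W) (x0, y) by move=> /VW.
  have F0 : flatGerbe V (pull_rel (pair x0) C).
    by apply: flatGerbe_pull F => // y _; exact: continuous_pairl.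
  have S1 : solution V (pull_rel (pair x0) C) (fun y => a (x0, y))
      (fun y z => g (x0, y) (x0, z)).
    by apply: (solution_pull _ _ S) => // y _; exact: continuous_pairl.
  have L := lineStr_ratio F0 S1 (solution_sub VW S0).
  have [u gu] := ls_ex L Vy1.
  have [V2 [oV2 V2y HV2]] := near_open (ls_near L Vy1 gu).
  (* The correction [u] depends on the second coordinate alone and moves the local solution onto the
     given one over [x0]. *)
  exists (V `&` V2, (a, fun p z => g p z + u z.2)) => _ /=; split.
  - exact: openI.
  - by [].
  - by move=> y [/VW].
  - move=> p [Ip [Vp _]]; have := S p (conj Ip Vp); apply: filterS => q Cq.
    by apply: (fg_eq F Cq) => z; zmod.
  - move=> y [Vy /HV2]; rewrite /= /sol_ratio => /(fg_eq F0); apply => z; zmod.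
have [Vag HV] := choice ex1.
pose V y := (Vag y).1; pose a y := (Vag y).2.1; pose g y := (Vag y).2.2.
have ex2 (y12 : Y * Y) : exists w : X * Y -> A, W y12.1 -> W y12.2 ->
    (forall p, (I `*` (V y12.1 `&` V y12.2)) p ->
       sol_ratio C (a y12.1) (g y12.1) (a y12.2) (g y12.2) w p) /\
    (forall y, (V y12.1 `&` V y12.2) y -> w (x0, y) = 0).
  case: y12 => y1 y2 /=.
  have [[Wy1 Wy2]|nW] := pselect (W y1 /\ W y2); last first.
    by exists (fun=> 0) => W1 W2; case: nW.
  have [oV1 Vy1 VW1 S1 R1] := HV _ Wy1; have [oV2 Vy2 VW2 S2 R2] := HV _ Wy2.
  have F12 : flatGerbe (I `*` (V y1 `&` V y2)) C.
    by apply: flatGerbe_sub F => -[x y] [/= ? [/VW1]].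
  have S1' : solution (I `*` (V y1 `&` V y2)) C (a y1) (g y1).
    by apply: solution_sub S1 => -[x y] [? []].
  have S2' : solution (I `*` (V y1 `&` V y2)) C (a y2) (g y2).
    by apply: solution_sub S2 => -[x y] [? []].
  have L := lineStr_ratio F12 S1' S2'.
  have [||w [Hw Hw0]] := ext _ _ _ _ L (fun=> 0).
  - exact: openI.
  - move=> y [/R1 [f1 C1 E1] /R2 [f2 C2 E2]].
    exists (fun p => f1 p - f2 p - g y1 (x0, y) p + g y2 (x0, y) p).
      apply: (fg_eq F (fg_comp F C1 (fg_inv F C2))) => z; zmod.
    apply: filterS (filterI E1 E2) => z [/= <- <-]; rewrite /g; zmod.
  by exists w => _ _; split => [[x y] [Ix Vy]|]; [exact: Hw | exact: Hw0].
have [w Hw] := choice ex2.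
(* At [p] the local solution of index [p.2] is used, corrected at [q] by the comparison with that of
   index [q.2]. The transition then requires w (y, y2) = w (y, y') + w (y', y2). *)
exists (fun p => a p.2 p), (fun p q => g p.2 p q + w (p.2, q.2) q) => -[x y] [/= Ix Wy].
have [oV Vy VW S R] := HV _ Wy.
have n1 := S (x, y) (conj Ix Vy).
have L12 y' : W y' -> lineStr (I `*` (V y `&` V y'))
    (sol_ratio C (a y) (g y) (a y') (g y')).
  move=> Wy'; have [oV' Vy' VW' S' R'] := HV _ Wy'; apply: lineStr_ratio.
  - by apply: flatGerbe_sub F => -[? ?] [/= ? [/VW]].
  - by apply: solution_sub S => -[? ?] [/= ? []].
  - by apply: solution_sub S' => -[? ?] [/= ? []].
have nbV : nbhs (x, y) (I `*` V y) by apply: nbhs_setX.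
have near2 : \forall p \near (x, y), (I `*` V y) p /\
    C (a y (x, y)) (a y p) (fun z => g y (x, y) z - g y p z) p.
  exact: filterI nbV n1.
apply: filterS near2 => -[x' y'] [[/= Ix' Vy'] Cp].
have Wy' := VW _ Vy'; have [oV' Vy'' VW' S' R'] := HV _ Wy'.
have [/(_ (x', y')) Hr _] := Hw (y, y') Wy Wy'.
have {}Hr := Hr (conj Ix' (conj Vy' Vy'')).
apply: (fg_near_eq F (fg_comp F Cp Hr)).
have nbV' : nbhs (x', y') (I `*` (V y `&` V y')) by apply: nbhs_setX => //; exact: openI.
apply: filterS nbV' => -[x2 y2] [/= Ix2 [Vy2 Vy2']].
have Wy2 := VW _ Vy2; have [oV2 V2 VW2 S2 R2] := HV _ Wy2.
suff : w (y, y') (x2, y2) + w (y', y2) (x2, y2) = w (y, y2) (x2, y2).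
  by move=> <-; zmod.
(* The defect of additivity along [I], with [y2] fixed. It is the difference of two flat sections of
   one ratio, so it is locally constant, and it is 0 at [x0] by the normalization. *)
pose d t := w (y, y') (t, y2) + w (y', y2) (t, y2) - w (y, y2) (t, y2).
suff : d x2 = 0 by move=> /eqP; rewrite subr_eq0 => /eqP.
rewrite (chn d) //.
  rewrite /d; have [_ ->//] := Hw (y, y') Wy Wy'; have [_ ->//] := Hw (y', y2) Wy' Wy2.
  by have [_ ->//] := Hw (y, y2) Wy Wy2; zmod.
move=> t It.
have sub1 : [set (t, y2)] `<=` I `*` W by move=> _ ->.
pose F1 := flatGerbe_sub sub1 F.
have S1y : solution [set (t, y2)] C (a y) (g y) by apply: solution_sub S => _ ->.
have S2y : solution [set (t, y2)] C (a y2) (g y2) by apply: solution_sub S2 => _ ->.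
have L := lineStr_ratio F1 S1y S2y.
have g1 : sol_ratio C (a y) (g y) (a y2) (g y2) (w (y, y2)) (t, y2).
  by have [h _] := Hw (y, y2) Wy Wy2; apply: h.
have g2 : sol_ratio C (a y) (g y) (a y2) (g y2)
    (fun p => w (y, y') p + w (y', y2) p) (t, y2).
  have [h1 _] := Hw (y, y') Wy Wy'; have [h2 _] := Hw (y', y2) Wy' Wy2.
  have {}h1 := h1 (t, y2) (conj It (conj Vy2 Vy2')).
  have {}h2 := h2 (t, y2) (conj It (conj Vy2' V2)).
  by apply: (fg_eq F (fg_comp F h1 h2)) => z /=; zmod.
exact: (ls_diff_slice L (erefl _) g2 g1).
Qed.

(* Homotopy transport: the fibre coordinate is the time. *)
Lemma gerbe_transport (R : realType) (Y : topologicalType) (W : set Y) P C al ga :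
  open W -> @flatGerbe A (R * Y)%type (setT `*` W) P C ->
  solution W (@pull_rel A (R * Y)%type Y (pair (0 : R)) P C) al ga ->
  exists a g, solution W (@pull_rel A (R * Y)%type Y (pair (1 : R)) P C) a g.
Proof.
move=> oW F S0.
(* Gluing requires an open base, so the time interval [0, 1] is enlarged; -1 and 2 are also the ends
   of the compact segment given to [gerbe_seg]. *)
pose I := [set r : R | -1 < r < 2].
have oI : open I.
  have -> : I = `]-1, 2[%classic by apply/seteqP; split => r; rewrite /I /= in_itv.
  exact: interval_open.
have I0 : I 0 by rewrite /I /=; lra.
have conv s t r : I s -> I t -> s <= r <= t -> I r by rewrite /I /=; lra.
have sub : I `*` W `<=` setT `*` W by move=> [r y] [].
have [|a [g S]] := gerbe_glue (line_extendable_itv oI conv I0)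
   (chained_itv conv I0) oI I0 oW (flatGerbe_sub sub F) S0.
  move=> y Wy.
  have [||V [a [g [oV Vy S]]]] := @gerbe_seg A R Y (setT `*` W) P C (-1) 2 y F.
  - by lra.
  - by move=> r _.
  exists (V `&` W), a, g; split => //; first exact: openI.
  by apply: solution_sub S => -[r y'] [/= /andP[h1 h2] []]; split => //=; rewrite !ltW.
exists (fun y => a (1, y)), (fun y z => g (1, y) (1, z)).
apply: (solution_pull _ _ S) => y; last by move=> _; exact: continuous_pairl.
by move=> Wy; split => //=; rewrite /I /=; lra.
Qed.

End Glue.

Lemma nbhsS (X : topologicalType) (x : X) (P Q : set X) :
  nbhs x P -> P `<=` Q -> nbhs x Q.
Proof. by move=> nP PQ; exact: filterS nP. Qed.

Lemma nbhsW (X : topologicalType) (x : X) (P : set X) : (forall y, P y) -> nbhs x P.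
Proof. exact: nearW. Qed.

Lemma nbhs_and (X : topologicalType) (x : X) (P Q : set X) :
  nbhs x P -> nbhs x Q -> nbhs x (fun y => P y /\ Q y).
Proof. exact: filterI. Qed.

(** * Simply connected spaces and trivial holonomy *)

Section Clamp.
Variable R : realType.

Definition clamp (t : R) : R := Num.max 0 (Num.min 1 t).

Lemma clamp_id t : 0 <= t <= 1 -> clamp t = t.
Proof. by move=> /andP[t0 t1]; rewrite /clamp (min_idPr t1) (max_idPr t0). Qed.

Lemma clamp_le0 t : t <= 0 -> clamp t = 0.
Proof.
move=> t0; rewrite /clamp (_ : Num.min 1 t = t); last by apply/min_idPr; lra.
exact/max_idPl.
Qed.

Lemma clamp_ge1 t : 1 <= t -> clamp t = 1.
Proof. by move=> t1; rewrite /clamp (min_idPl t1); apply/max_idPr. Qed.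

Lemma clamp_itv t : 0 <= clamp t <= 1.
Proof. by rewrite /clamp le_max lexx /= ge_max ler01 ge_min lexx. Qed.

Lemma clampK t : clamp (clamp t) = clamp t.
Proof. exact/clamp_id/clamp_itv. Qed.

Lemma clamp0 : clamp 0 = 0. Proof. by rewrite clamp_le0. Qed.
Lemma clamp1 : clamp 1 = 1. Proof. by rewrite clamp_ge1. Qed.

Lemma clamp_continuous : continuous clamp.
Proof.
move=> t.
have h1 : {for t, continuous ((cst 1 : R -> R^o) \min (id : R -> R^o))}.
  by apply: continuous_min; [exact: cvg_cst | exact: cvg_id].
exact: (@continuous_max _ _ (cst 0) _ t (@cvg_cst _ _ _ _ _) h1).
Qed.

(** Continuity at one point needs agreement of the branches only at (m, z): for r distinct from m a
    single branch is active nearby, and for r = m both branches tend to the common value. *)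
Lemma continuous_paste (Z T : topologicalType) (f g : R * Z -> T) (m r : R) (z : Z) :
  {for (r, z), continuous f} -> {for (r, z), continuous g} -> f (m, z) = g (m, z) ->
  {for (r, z), continuous (fun p => if p.1 <= m then f p else g p)}.
Proof.
move=> cf cg fg Q /= nQ.
suff : nbhs (r, z) [set p | Q (if p.1 <= m then f p else g p)] by [].
have [rm|rm] := eqVneq r m.
  move: nQ; rewrite rm lexx => nQ; rewrite rm in cf cg *.
  have nQ' : nbhs (g (m, z)) Q by rewrite -fg.
  have h : nbhs (m, z) [set p | Q (f p) /\ Q (g p)].
    exact: (@nbhs_and (R * Z)%type) (cf _ nQ) (cg _ nQ').
  by apply: (@nbhsS (R * Z)%type _ _ _ h) => p [Qf Qg] /=; case: ifP.
move: rm nQ; rewrite neq_lt => /orP[rm|mr].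
- rewrite ltW// => nQ; have h : nbhs (r, z) [set p | Q (f p) /\ p.1 < m].
    exact: (@nbhs_and (R * Z)%type) (cf _ nQ) (near_lt_fst z rm).
  by apply: (@nbhsS (R * Z)%type _ _ _ h) => p [Qp /ltW pm]; rewrite /= pm.
- rewrite leNgt mr => nQ; have h : nbhs (r, z) [set p | Q (g p) /\ m < p.1].
    exact: (@nbhs_and (R * Z)%type) (cg _ nQ) (near_gt_fst z mr).
  by apply: (@nbhsS (R * Z)%type _ _ _ h) => p [Qp pm]; rewrite /= leNgt pm.
Qed.

End Clamp.

(* Paths and homotopies are defined on all real times, constant outside [0, 1];
   [sc_radial] contracts a neighbourhood of each point to this point. *)
Record simplyConnected (R : realType) (X : topologicalType) : Prop := SimplyConnected {
  sc_path : forall x y : X, exists c : R -> X,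
    [/\ continuous c, forall t, c t = c (clamp t), c 0 = x & c 1 = y];
  sc_loop : forall c : R -> X, continuous c -> (forall t, c t = c (clamp t)) ->
    c 0 = c 1 -> exists H : R * R -> X, [/\ continuous H,
      forall s, H (s, 0) = c s, forall s, H (s, 1) = c 0,
      forall t, H (0, t) = c 0 & forall t, H (1, t) = c 0];
  sc_radial : forall x : X, exists O, exists rho : R * X -> X, [/\ open O, O x,
    forall y, O y -> rho (0, y) = x /\ rho (1, y) = y,
    forall t y, rho (t, y) = rho (clamp t, y) &
    forall t y, O y -> {for (t, y), continuous rho}] }.

Section PullComp.
Variable A : zmodType.

Lemma pull_good_comp (X Y Z : topologicalType) (f : Y -> X) (g : Z -> Y)
    (good : (X -> A) -> X -> Prop) w z : {for z, continuous g} ->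
  pull_good f good w (g z) -> pull_good (f \o g) good (w \o g) z.
Proof. by move=> cg [u gu wu]; exists u => //; exact: cg _ wu. Qed.

Lemma pull_pull (X Y Z : topologicalType) (f : Y -> X) (g : Z -> Y)
    (good : (X -> A) -> X -> Prop) w z : {for z, continuous g} ->
  pull_good g (pull_good f good) w z <-> pull_good (f \o g) good w z.
Proof.
move=> cg; split=> [[v [u gu vu] wv]|[u gu wu]].
  exists u => //; apply: filterS (filterI wv (cg _ vu)) => z' /= [-> ->] //.
exists (u \o f) => //; exact: pull_goodS.
Qed.

Lemma pull_near_id (X : topologicalType) (D : set X) good (f : X -> X) (w : X -> A) x :
  lineStr D good -> (\forall y \near x, f y = y) -> pull_good f good w x -> good w x.
Proof.
move=> L fid [u gu wu]; rewrite (nbhs_singleton fid) in gu.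
apply: (ls_shift (c := 0) L gu).
by apply: filterS (filterI fid wu) => y [fy ->]; rewrite fy addr0.
Qed.

Lemma pull_goodP (X Y : topologicalType) (f g : Y -> X) good (w : Y -> A) :
  f =1 g -> pull_good f good w = pull_good g good w.
Proof. by move=> /funext ->. Qed.

End PullComp.

Section Extend.
Variables (A : zmodType) (R : realType).

Lemma section_cmp (T : topologicalType) (D : set T) good (sigma : R -> T) (v w : R -> A) :
  lineStr D good -> continuous sigma -> (forall t : R, 0 <= t <= 1 -> D (sigma t)) ->
  (forall t : R, 0 <= t <= 1 -> pull_good sigma good v t) ->
  (forall t : R, 0 <= t <= 1 -> pull_good sigma good w t) -> v 0 = w 0 -> v 1 = w 1.
Proof.
move=> L cs Ds gv gw vw.
have L' : lineStr [set t : R | 0 <= t <= 1] (pull_good sigma good).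
  by apply: lineStr_pull L => // t _; exact: cs.
have : v 0 - w 0 = v 1 - w 1.
  apply: (@lconst_seg R A (fun t => v t - w t)) => // t t01.
  have [c vc] := ls_sub L' (t01 : [set t : R | 0 <= t <= 1] t) (gw _ t01) (gv _ t01).
  rewrite (nbhs_singleton vc); apply: filterS vc => t' ->; zmod.
by rewrite vw subrr => /esym/eqP; rewrite subr_eq0 => /eqP.
Qed.

(** Parallel transport along the paths [phi (t, z)], uniformly in the parameter [z]:
    [line_extendable_itv] for the torsor pulled back by [phi], with all of [R] as interval. *)
Lemma line_transport (Z T : topologicalType) (D : set T) (V : set Z) good
    (phi : R * Z -> T) (v0 : Z -> A) : open V -> lineStr D good ->
  (forall t z, V z -> D (phi (t, z))) ->
  (forall t z, V z -> {for (t, z), continuous phi}) ->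
  (forall z, V z -> pull_good (fun z => phi (0, z)) good v0 z) ->
  exists w, (forall t z, V z -> pull_good phi good w (t, z)) /\
            (forall z, V z -> w (0, z) = v0 z).
Proof.
move=> oV L Dphi cphi g0.
have oI : open (setT : set R) by exact: openT.
have L' : lineStr (setT `*` V) (pull_good phi good).
  by apply: lineStr_pull L => -[t z] [_ Vz]; [exact: Dphi | exact: cphi].
have conv (s t r : R) : setT s -> setT t -> s <= r <= t -> (setT : set R) r by [].
have [|w [Hw Hw0]] := line_extendable_itv oI conv I oV L' (w0 := v0).
  by move=> z Vz; apply/pull_pull; [exact: continuous_pairl | exact: g0].
by exists w; split => // t z; exact: Hw.
Qed.

Variables (X : topologicalType) (SX : simplyConnected R X).

(** The constant section over the edge (0, t) is transported over the square of a contracting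
    homotopy. The homotopy is also constant on the edges (s, 1) and (1, t), so the value persists
    along them up to (1, 0), which is the end of [c]. *)
Lemma loop_section (Y : topologicalType) (D : set (X * Y)) good (c : R -> X) (y : Y)
    (v : R -> A) : lineStr D good -> (forall x, D (x, y)) ->
  continuous c -> (forall t, c t = c (clamp t)) -> c 0 = c 1 ->
  (forall t : R, 0 <= t <= 1 -> pull_good (fun t => (c t, y)) good v t) -> v 0 = v 1.
Proof.
move=> L Dy cc clc c01 gv.
have [H [cH H0 H1 Hl Hr]] := sc_loop SX cc clc c01.
pose phi (p : R * R) := (H p, y).
have cphi p : {for p, continuous phi}.
  by apply: (@continuous_comp _ _ _ H (fun x => (x, y))); [exact: cH | exact: continuous_pairr].
have g00 : good (fun p => v 0) (c 0, y) \/ True by right.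
have [u gu vu] : pull_good (fun t => (c t, y)) good v 0 by apply: gv; lra.
have [|||w [Hw Hw0]] := @line_transport R _ D setT good phi (fun=> v 0) openT L.
- by move=> t z _; exact: Dy.
- by move=> t z _; exact: cphi.
- move=> z _; exists u; first by rewrite /phi Hl.
  by apply: (@nbhsW R) => z'; rewrite /phi Hl (nbhs_singleton vu).
have w11 : w (0, 1) = w (1, 1).
  apply: (@lconst_seg R A (fun s => w (s, 1))) => // s _.
  have [f _ /near_slice wf] := Hw s 1 I; have wf1 := nbhs_singleton wf.
  by apply: filterS wf => s' ->; rewrite wf1 /phi !H1.
have w10 : w (1, 0) = w (1, 1).
  apply: (@lconst_seg R A (fun t => w (1, t))) => // t _.
  have [f _ /near_slice2 wf] := Hw 1 t I; have wf1 := nbhs_singleton wf.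
  by apply: filterS wf => s' ->; rewrite wf1 /phi !Hr.
suff -> : v 1 = w (1, 0) by rewrite w10 -w11 Hw0.
apply: (@section_cmp _ D good (fun t => (c t, y)) v (fun s => w (s, 0)) L) => //.
- by move=> t; apply: (@continuous_comp _ _ _ c (fun x => (x, y)));
    [exact: cc | exact: continuous_pairr].
- move=> t _; have := pull_good_comp (@continuous_pairr _ _ t 0) (Hw t 0 I).
  by rewrite (pull_goodP (g := fun t => (c t, y)))// => s /=; rewrite /phi H0.
- by rewrite Hw0.
Qed.

(** [c] followed by the reverse of [c'] is a loop. The section along it returns to its initial
    value, so its value at time 1/2 is reached by transport along [c] as well as along [c']. *)
Lemma path_indep (Y : topologicalType) (D : set (X * Y)) good (c c' : R -> X) (y : Y)
    (v v' : R -> A) : lineStr D good -> (forall x, D (x, y)) ->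
  continuous c -> (forall t, c t = c (clamp t)) ->
  continuous c' -> (forall t, c' t = c' (clamp t)) -> c 0 = c' 0 -> c 1 = c' 1 ->
  (forall t : R, 0 <= t <= 1 -> pull_good (fun t => (c t, y)) good v t) ->
  (forall t : R, 0 <= t <= 1 -> pull_good (fun t => (c' t, y)) good v' t) ->
  v 0 = v' 0 -> v 1 = v' 1.
Proof.
move=> L Dy cc clc cc' clc' c00 c11 gv gv' v00.
pose l t := if t <= 2^-1 then c (2 * t) else c' (2 - 2 * t).
have cl : continuous l.
  move=> t.
  (* The factor [bool] is a dummy that provides the shape [R * Z] of [continuous_paste]; further
     down it is the parameter space of [line_transport]. *)
  pose f (p : R * bool) := c (2 * p.1); pose g (p : R * bool) := c' (2 - 2 * p.1).
  have cf (p : R * bool) : {for p, continuous f}.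
    apply: (@continuous_comp _ _ _ (fun p : R * bool => 2 * p.1) c); last exact: cc.
    by apply: cvgM; [exact: cvg_cst | exact: cvg_fst].
  have cg (p : R * bool) : {for p, continuous g}.
    apply: (@continuous_comp _ _ _ (fun p : R * bool => 2 - 2 * p.1) c'); last exact: cc'.
    by apply: cvgB; [exact: cvg_cst|apply: cvgM; [exact: cvg_cst | exact: cvg_fst]].
  have fg : f (2^-1, true) = g (2^-1, true).
    by rewrite /f /g /= mulfV ?pnatr_eq0// c11; congr c'; lra.
  have := continuous_paste (cf (t, true)) (cg (t, true)) fg.
  move=> h; exact: (@continuous_comp _ _ _ (fun t => (t, true)) _ t (@continuous_pairr _ _ _ _) h).
have lc t : t <= 2^-1 -> l t = c (2 * t) by rewrite /l => ->.
have lc' t : 2^-1 <= t -> l t = c' (2 - 2 * t).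
  rewrite /l; case: ifPn => // t1 t2; have -> : t = 2^-1 by lra.
  by rewrite mulfV ?pnatr_eq0// c11; congr c'; lra.
have cll t : l t = l (clamp t).
  have [t0|t0] := leP t 0.
    rewrite clamp_le0// !lc; [|lra|lra]; rewrite clc [RHS]clc mulr0; congr c.
    by rewrite !clamp_le0//; lra.
  have [t1|t1] := leP 1 t.
    rewrite clamp_ge1// !lc'; [|lra|lra]; rewrite clc' [RHS]clc'; congr c'.
    by rewrite !clamp_le0//; lra.
  by rewrite clamp_id//; lra.
have l01 : l 0 = l 1.
  by rewrite lc ?lc'; [rewrite mulr0 c00; congr c'; lra|lra|lra].
have csig (s : R -> X) : continuous s -> continuous (fun t => (s t, y)).
  by move=> h t; apply: (@continuous_comp _ _ _ s (fun x => (x, y)));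
    [exact: h | exact: continuous_pairr].
pose phi (p : R * bool) := (l p.1, y).
have cphi (p : R * bool) : {for p, continuous phi}.
  by apply: (@continuous_comp _ _ _ fst (fun t => (l t, y))); [exact: cvg_fst | exact: csig].
have [u gu vu] : pull_good (fun t => (c t, y)) good v 0 by apply: gv; lra.
have l0 : l 0 = c 0 by rewrite lc ?mulr0//; lra.
have [|||w [Hw Hw0]] := @line_transport bool _ D setT good phi (fun=> v 0) openT L.
- by move=> t z _; exact: Dy.
- by move=> t z _; exact: cphi.
- move=> z _; exists u; first by rewrite /phi l0.
  by apply: nbhsW => z'; rewrite /phi l0 (nbhs_singleton vu).
pose u1 t := w (t, true).
have gu1 t : pull_good (fun t => (l t, y)) good u1 t.
  exact: pull_good_comp (@continuous_pairr _ _ t true) (Hw t true I).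
have u11 : u1 0 = u1 1 by apply: (loop_section L Dy cl cll l01) => t _; exact: gu1.
have u0 : u1 0 = v 0 by rewrite /u1 Hw0.
have cK (s : R -> X) : (forall t, s t = s (clamp t)) ->
   (fun t => (s t, y)) \o @clamp R =1 (fun t => (s t, y)) by move=> h t /=; rewrite -h.
have gvc (s : R -> X) (f : R -> A) : (forall t, s t = s (clamp t)) ->
    (forall t : R, 0 <= t <= 1 -> pull_good (fun t => (s t, y)) good f t) ->
    forall t, pull_good (fun t => (s t, y)) good (f \o @clamp R) t.
  move=> hs h t; have := pull_good_comp (@clamp_continuous R t) (h _ (clamp_itv t)).
  by rewrite (pull_goodP _ _ (cK s hs)).
have h1 : u1 2^-1 = v 1.
  (* The first half of the loop at unit speed is [c]; the second half, run backwards, will be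
     [c']. *)
  have := @section_cmp _ D good (fun t => (c t, y)) (fun t => u1 (clamp t / 2))
    (v \o @clamp R) L (csig c cc).
  rewrite /= clamp0 clamp1 mul0r mul1r; apply => //.
  - move=> t _; have ct : {for t, continuous (fun t : R => clamp t / 2)}.
      by apply: cvgM; [exact: clamp_continuous | exact: cvg_cst].
    have := pull_good_comp ct (gu1 (clamp t / 2)).
    rewrite (pull_goodP (g := fun t => (c t, y)))// => s /=.
    by have /andP[? ?] := clamp_itv s; rewrite lc; [rewrite [in RHS]clc; congr (c _, _); lra|lra].
  - by move=> t _; exact: gvc.
have h2 : u1 2^-1 = v' 1.
  have := @section_cmp _ D good (fun t => (c' t, y)) (fun t => u1 (1 - clamp t / 2))
    (v' \o @clamp R) L (csig c' cc').
  rewrite /= clamp0 clamp1 mul0r mul1r subr0 -u11 u0 v00.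
  have -> : 1 - 2^-1 = 2^-1 :> R by lra.
  apply => //.
  - move=> t _; have ct : {for t, continuous (fun t : R => 1 - clamp t / 2)}.
      by apply: cvgB; [exact: cvg_cst|apply: cvgM; [exact: clamp_continuous | exact: cvg_cst]].
    have := pull_good_comp ct (gu1 (1 - clamp t / 2)).
    rewrite (pull_goodP (g := fun t => (c' t, y)))// => s /=.
    by have /andP[? ?] := clamp_itv s; rewrite lc'; [rewrite [in RHS]clc'; congr (c' _, _); lra|lra].
  - by move=> t _; exact: gvc.
by rewrite -h1 h2.
Qed.

End Extend.

Lemma continuous_mkpair (Z X Y : topologicalType) (f : Z -> X) (g : Z -> Y) (z : Z) :
  {for z, continuous f} -> {for z, continuous g} ->
  {for z, continuous (fun z => (f z, g z))}.
Proof.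
move=> cf cg Q [[U V] /= [nU nV] UV].
by apply: (nbhsS (nbhs_and (cf _ nU) (cg _ nV))) => z' [Uz Vz]; apply: UV.
Qed.

Lemma lineStr_sub (A : zmodType) (X : topologicalType) (D D' : set X) good :
  D' `<=` D -> @lineStr A X D good -> lineStr D' good.
Proof.
move=> DD [h1 h2 h3 h4]; split => [u x /DD|x /DD|u v x /DD|//].
- exact: h1.
- exact: h2.
- exact: h3.
Qed.

(** * Flat torsors and flat gerbes over simply connected spaces *)

Section Extend2.
Variables (A : zmodType) (R : realType).

Section Detour.
Variables (X : topologicalType) (c : R -> X) (rho : R * X -> X) (x : X) (N : set X).
Hypotheses (cc : continuous c) (clc : forall t, c t = c (clamp t)) (c1 : c 1 = x).
Hypotheses (rhoE : forall y, N y -> rho (0, y) = x /\ rho (1, y) = y).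
Hypotheses (rhoc : forall t y, rho (t, y) = rho (clamp t, y)).
Hypotheses (crho : forall t y, N y -> {for (t, y), continuous rho}).

(** A path from [c 0] to [y] that varies continuously with [y]: [c] at double speed to the centre
    [x], then the radial path from [x] to [y]. *)
Definition detour (p : R * X) : X :=
  if p.1 <= 2^-1 then c (2 * p.1) else rho (2 * p.1 - 1, p.2).

Lemma detour_continuous t y : N y -> {for (t, y), continuous detour}.
Proof.
move=> Oy; apply: continuous_paste.
- apply: (@continuous_comp _ _ _ (fun p : R * X => 2 * p.1) c); last exact: cc.
  by apply: cvgM; [exact: cvg_cst | exact: cvg_fst].
- apply: (@continuous_comp _ _ _ (fun p : R * X => (2 * p.1 - 1, p.2)) rho); last exact: crho.
  apply: (@continuous_mkpair (R * X)%type).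
    by apply: cvgB; [apply: cvgM; [exact: cvg_cst | exact: cvg_fst]|exact: cvg_cst].
  exact: cvg_snd.
- by rewrite /= mulfV ?pnatr_eq0// subrr c1 (rhoE Oy).1.
Qed.

Lemma detour0 y : detour (0, y) = c 0.
Proof. by rewrite /detour /= mulr0 invr_ge0 ler0n. Qed.

Lemma detour1 y : N y -> detour (1, y) = y.
Proof.
move=> /rhoE[_ {2}<-]; rewrite /detour /= ifF; last by apply/negbTE; lra.
by congr (rho (_, _)); lra.
Qed.

Lemma detour_clamp t y : N y -> detour (t, y) = detour (clamp t, y).
Proof.
move=> Oy; have [t0|t0] := leP t 0.
  rewrite clamp_le0// detour0 /detour /= ifT; last by lra.
  by rewrite clc clamp_le0//; lra.
have [t1|t1] := leP 1 t; last by rewrite clamp_id//; lra.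
rewrite clamp_ge1// detour1// /detour /= ifF; last by apply/negbTE; lra.
by rewrite rhoc clamp_ge1 ?(rhoE Oy).2//; lra.
Qed.

End Detour.

(** The value at (a, y) is the transport of [w0] along a path chosen from [x0] to [a]. The choice is
    not continuous in [a]; near a given [a1] it is replaced by detours through [a1], which give the
    same value by [path_indep]. *)
Lemma line_extendable_sc (X : topologicalType) (x0 : X) :
  simplyConnected R X -> line_extendable A setT x0.
Proof.
move=> SX Y W good oW L w0 Hw0.
have [gam Hgam] := choice (sc_path SX x0).
have csig (s : R -> X) (y : Y) : continuous s -> continuous (fun t => (s t, y)).
  by move=> h t; apply: (@continuous_comp _ _ _ s (fun x => (x, y)));
    [exact: h | exact: continuous_pairr].
have DW x y : W y -> (setT `*` W) (x, y) by [].
have ex1 a : exists w : R * Y -> A,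
    (forall t y, W y -> pull_good (fun p : R * Y => (gam a p.1, p.2)) good w (t, y)) /\
    (forall y, W y -> w (0, y) = w0 y).
  have [cg clg g0 g1] := Hgam a.
  apply: (line_transport oW L) => //.
  - move=> t y Wy; apply: (@continuous_mkpair (R * Y)%type); last exact: cvg_snd.
    by apply: (@continuous_comp _ _ _ fst (gam a)); [exact: cvg_fst | exact: cg].
  - by move=> y Wy /=; rewrite g0; exact: Hw0.
have [wa Hwa] := choice ex1.
exists (fun p => wa p.1 (1, p.2)); split => [a1 y1 _ Wy1|y Wy]; last first.
  (* The path chosen for [x0] itself may fail to be constant, but it is a loop, so transport along
     it is trivial. *)
  have [cg clg g0 g1] := Hgam x0; have [Hw Hw00] := Hwa x0.
  rewrite /= -[RHS]Hw00//; apply/esym.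
  have Ly : lineStr (setT `*` [set y]) good.
    by apply: lineStr_sub L => -[x y'] [_ /= ->].
  have := @loop_section A R X SX Y _ good (gam x0) y (fun t => wa x0 (t, y)) Ly.
  apply => //.
  - by rewrite g0 g1.
  - by move=> t _; have := pull_good_comp (@continuous_pairr _ _ t y) (Hw t y Wy).
have [cg clg g0 g1] := Hgam a1.
have [N [rho [oO Oa rhoE rhoc crho]]] := sc_radial SX a1.
(* These paths vary continuously with their endpoint, so transport along all of them together is a
   flat section near (a1, y1). *)
pose det := detour (gam a1) rho.
pose phi (p : R * (X * Y)) := (det (p.1, p.2.1), p.2.2).
have oOW : open (N `*` W).
  rewrite openE => -[x y] [/= Ox Wy]; exact: nbhs_setX.
have detc t a : N a -> {for (t, a), continuous det}.
  by move=> Oa'; apply: (detour_continuous (x := a1) (N := N)).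
have cphi t z : (N `*` W) z -> {for (t, z), continuous phi}.
  case: z => x y [/= Ox Wy]; apply: (@continuous_mkpair (R * (X * Y))%type).
    apply: (@continuous_comp _ _ _ (fun p : R * (X * Y) => (p.1, p.2.1)) det); last exact: detc.
    apply: (@continuous_mkpair (R * (X * Y))%type); first exact: cvg_fst.
    by apply: (@continuous_comp _ _ _ snd fst); [exact: cvg_snd | exact: cvg_fst].
  by apply: (@continuous_comp _ _ _ snd snd); exact: cvg_snd.
have [|||w' [Hw' Hw0']] := @line_transport A R _ _ _ (N `*` W) good phi (fun z => w0 z.2) oOW L.
- by move=> t [x y] [].
- by move=> t z; exact: cphi.
- move=> [x y] [/= Ox Wy].
  have cs : {for (x, y), continuous (snd : X * Y -> Y)} by exact: cvg_snd.
  have := pull_good_comp cs (Hw0 y Wy).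
  by congr (pull_good _ _ _ _); apply/funext => z; rewrite /phi /det detour0 g0.
have g2 : good (fun z => w' (1, z)) (a1, y1).
  have OW1 : (N `*` W) (a1, y1) by [].
  apply: (@pull_near_id A _ _ good (fun z => phi (1, z)) _ _ L).
    apply: (nbhsS (open_nbhs_nbhs (conj oOW OW1))) => -[x y] [/= Ox Wy].
    by rewrite /phi /det (detour1 _ rhoE).
  have := pull_good_comp (@continuous_pairl _ _ (1 : R) (a1, y1)) (Hw' 1 (a1, y1) OW1).
  by [].
apply: (ls_shift (c := 0) L g2).
apply: (nbhsS (nbhs_setX oO Oa oW Wy1)) => -[a y] [/= Oa' Wy]; rewrite addr0.
have [cg' clg' g0' g1'] := Hgam a; have [Hw Hw00] := Hwa a.
have Ly : lineStr (setT `*` [set y]) good.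
  by apply: lineStr_sub L => -[x y'] [_ /= ->].
have := @path_indep A R X SX Y _ good (gam a) (fun t => det (t, a)) y
  (fun t => wa a (t, y)) (fun t => w' (t, (a, y))) Ly.
apply => //.
- by move=> t; apply: (@continuous_comp _ _ _ (fun t : R => (t, a)) det);
    [exact: continuous_pairr | exact: detc].
- by move=> t; exact: (detour_clamp clg rhoE rhoc).
- by rewrite g0' /det detour0 g0.
- by rewrite g1' /det (detour1 _ rhoE).
- by move=> t _; have := pull_good_comp (@continuous_pairr _ _ t y) (Hw t y Wy).
- by move=> t _; have := pull_good_comp (@continuous_pairr _ _ t (a, y)) (Hw' t (a, y) (conj Oa' Wy)).
- by rewrite Hw00// Hw0'.
Qed.

Lemma chained_sc (X : topologicalType) (x0 : X) :
  simplyConnected R X -> chained A setT x0.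
Proof.
move=> SX d loc x _; have [c [cc _ c0 c1]] := sc_path SX x0 x.
rewrite -c0 -c1; apply/esym.
by apply: (@lconst_seg R A (d \o c)) => // t _; exact: (cc t _ (loc (c t) I)).
Qed.

(** Extension from the single point [x0], with the section shifted to be 0 there and with a dummy
    factor [R] as parameter space. *)
Lemma line_section_sc (X : topologicalType) good :
  simplyConnected R X -> @lineStr A X setT good -> exists u, forall x, good u x.
Proof.
move=> SX L; have [[x0]|nX] := pselect (inhabited X); last first.
  by exists (fun=> 0) => x; case: nX.
have [u gu] := ls_ex L (I : setT x0).
have g0 : good (fun x => u x - u x0) x0 by apply: (ls_shiftW (c := - u x0) L gu).
have L' : lineStr (setT `*` setT) (pull_good (fst : X * R -> X) good).
  by apply: lineStr_pull L => // p _; exact: cvg_fst.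
have [|w [Hw _]] := line_extendable_sc (x0 := x0) SX openT L' (w0 := fun=> 0).
  move=> y _; exists (fun p => u p.1 - u x0).
    exact: (@pull_goodS _ _ _ fst good (fun x => u x - u x0)).
  by apply: nbhsW => y' /=; rewrite subrr.
exists (fun x => w (x, 0)) => x.
have := @pull_good_comp _ _ _ _ fst (fun x => (x, 0)) good w x
  (@continuous_pairr _ _ x (0 : R)) (Hw x 0 I I).
move=> h; apply: (pull_near_id L _ h); exact: nearW.
Qed.

(* The trivialization over [X1 * {x2}] is transported along paths from [x2] in
   [X2], using that a flat torsor on [X1] is trivial; the results are glued over
   [X2] by comparison with the trivialization over [{x1} * X2]. *)
Lemma gerbe_product (X1 X2 : topologicalType) (x1 : X1) (x2 : X2) P C al1 ga1 al2 ga2 :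
  simplyConnected R X1 -> simplyConnected R X2 -> @flatGerbe A (X1 * X2)%type setT P C ->
  solution setT (pull_rel (fun x => (x, x2)) C) al1 ga1 ->
  solution setT (pull_rel (pair x1) C) al2 ga2 ->
  exists a g, solution setT C a g.
Proof.
move=> SX1 SX2 F S1 S2.
have F' : flatGerbe (setT `*` setT) C by apply: flatGerbe_sub F.
have [|a [g S]] := gerbe_glue (line_extendable_sc (x0 := x1) SX1) (@chained_sc X1 x1 SX1) openT I
  openT F' S2; last by exists a, g; apply: solution_sub S.
move=> y1 _.
have [c [cc clc c0 c1]] := sc_path SX2 x2 y1.
have [N [rho [oO Oy rhoE rhoc crho]]] := sc_radial SX2 y1.
pose det := detour c rho.
have detc t a : N a -> {for (t, a), continuous det}.
  by move=> Oa'; apply: (detour_continuous (x := y1) (N := N)).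
(* A homotopy from the retraction onto X1 * {x2}, at time 0, to the inclusion of X1 * N, at time
   1. *)
pose phi (p : R * (X1 * X2)) := (p.2.1, det (p.1, p.2.2)).
have cphi t z : (setT `*` N) z -> {for (t, z), continuous phi}.
  case: z => x y [/= _ Oy']; apply: (@continuous_mkpair (R * (X1 * X2))%type).
    by apply: (@continuous_comp _ _ _ snd fst); [exact: cvg_snd | exact: cvg_fst].
  apply: (@continuous_comp _ _ _ (fun p : R * (X1 * X2) => (p.1, p.2.2)) det); last exact: detc.
  apply: (@continuous_mkpair (R * (X1 * X2))%type); first exact: cvg_fst.
  by apply: (@continuous_comp _ _ _ snd snd); exact: cvg_snd.
have oO' : open (setT `*` N : set (X1 * X2)).
  by rewrite openE => -[x y] [/= _ Oy']; apply: nbhs_setX => //; exact: openT.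
have Fphi : flatGerbe (setT `*` (setT `*` N)) (pull_rel phi C).
  by apply: flatGerbe_pull F => // -[t z] [_ Oz]; exact: cphi.
have cfst (z : X1 * X2) : {for z, continuous (fst : X1 * X2 -> X1)} by exact: cvg_fst.
have S1' : solution (setT `*` N) (@pull_rel A (R * (X1 * X2))%type (X1 * X2)%type
    (pair (0 : R)) P (pull_rel phi C)) (al1 \o fst)
    (fun p q => ga1 p.1 q.1).
  move=> z _; have := @solution_pull A X1 (X1 * X2)%type setT setT fst _ _ al1 ga1
    (fun _ _ => I) (fun z _ => cfst z) S1 z I.
  move=> h; apply: (nbhsS h) => z' h'.
  apply/pull_pull; first exact: continuous_pairl.
  have {h'} := proj1 (pull_pull _ _ _ (cfst z')) h'.
  by rewrite (pull_goodP (g := phi \o pair 0))// => p; rewrite /phi /det /= detour0 c0.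
have [a [g S]] := gerbe_transport oO' Fphi S1'.
exists N, a, g; split => // z Oz.
apply: (nbhsS (nbhs_and (S z Oz) (open_nbhs_nbhs (conj oO' Oz)))) => z' [h Oz'].
(* The isomorphisms from [a z] to [a z'] near [z'] form a torsor over this point, which makes
   [pull_near_id] applicable: at time 1 the homotopy is the identity near [z']. *)
have L : lineStr [set z'] (C (a z) (a z')).
  have [f Cf _] : pull_rel (phi \o pair 1) C (a z) (a z') (fun p => g z p - g z' p) z'.
    by apply/pull_pull; first exact: continuous_pairl.
  have phi1 : (phi \o pair 1) z' = z'.
    by case: (z') Oz' => x y [_ Oy']; rewrite /phi /det /= (detour1 _ rhoE).
  rewrite phi1 in Cf; split.
  - by move=> u x _; exact: (fg_near F).
  - by move=> x ->; exists f.
  - by move=> u v x _; exact: (fg_sub F).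
  - by move=> u v x c'; exact: (fg_shift F).
apply: (@pull_near_id A _ _ _ (phi \o pair 1) _ _ L).
  apply: (nbhsS (open_nbhs_nbhs (conj oO' Oz'))) => -[x y] [/= _ Oy'].
  by rewrite /phi /det /= (detour1 _ rhoE).
by apply/pull_pull; first exact: continuous_pairl.
Qed.

End Extend2.

(** * Calculus on open subsets of R^m *)

Section Line.
Variables (R : realType) (V : normedModType R) (W : normedModType R).

Lemma is_derive_line (f : V -> W) (x h : V) (s : R) :
  derivable f (x + s *: h) h ->
  is_derive s 1 (fun r : R => f (x + r *: h)) ('D_h f (x + s *: h)).
Proof.
move=> df.
have E : (fun r : R => r^-1 *: ((fun r : R => f (x + r *: h)) (r *: 1 + s) - f (x + s *: h))) =
         (fun r => r^-1 *: (f (r *: h + (x + s *: h)) - f (x + s *: h))).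
  apply/funext => r /=; congr (_ *: (f _ - _)).
  by rewrite scalerDl [r *: 1]mulr1 addrCA.
split; first by rewrite /derivable E.
by rewrite /derive E.
Qed.

Let lineE (f : V -> W) (x h : V) :
  (fun r : R => r^-1 *: ((fun r : R => f (x + r *: h)) (r *: 1 + 0) - f (x + 0 *: h))) =
  (fun r => r^-1 *: (f (r *: h + x) - f x)).
Proof.
by apply/funext => r /=; rewrite scale0r !addr0 [r *: 1]mulr1 (addrC x).
Qed.

Lemma derivable_of_line (f : V -> W) (x h : V) :
  derivable (fun r : R => f (x + r *: h)) 0 1 -> derivable f x h.
Proof. by rewrite /derivable lineE. Qed.

Lemma derive_line (f : V -> W) (x h : V) :
  'D_h f x = 'D_1 (fun r : R => f (x + r *: h)) 0.
Proof. by rewrite /derive lineE. Qed.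

End Line.

Section MeanValue.
Variables (R : realType) (V : normedModType R).

Lemma mean_value (f : V -> R) (x h : V) :
  (forall s : R, 0 <= s <= 1 -> derivable f (x + s *: h) h) ->
  exists2 s : R, 0 <= s <= 1 & f (x + h) - f x = 'D_h f (x + s *: h).
Proof.
move=> df; pose g (r : R) := f (x + r *: h).
have dg (s : R) : 0 <= s <= 1 -> is_derive s 1 g ('D_h f (x + s *: h)).
  by move=> s01; apply: is_derive_line; exact: df.
have [||c cI] := @MVT R g (fun s => 'D_h f (x + s *: h)) 0 1 ltr01.
- by move=> s; rewrite in_itv /= => /andP[s0 s1]; apply: dg; rewrite !ltW.
- apply: derivable_within_continuous => s; rewrite in_itv /= => s01.
  by have [] := dg s s01.
rewrite /g scale1r scale0r addr0 subr0 mulr1 => ->; exists c => //.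
by move: cI; rewrite in_itv /= => /andP[? ?]; rewrite !ltW.
Qed.

Lemma derivableZdir (f : V -> R) (x h : V) (c : R) :
  derivable f x h -> derivable f x (c *: h).
Proof.
move=> df; apply: derivable_of_line.
have E : (fun r : R => f (x + r *: (c *: h))) = (fun r => f (x + r *: h)) \o (fun r => c * r).
  by apply/funext => r /=; rewrite scalerA mulrC.
rewrite E.
apply/derivable1_diffP; apply: differentiable_comp.
  apply/derivable1_diffP; apply: derivableM; [exact: derivable_cst|exact: derivable_id].
apply/derivable1_diffP; rewrite mulr0.
by have [] := @is_derive_line R V R f x h 0; rewrite scale0r addr0.
Qed.

Lemma deriveZdir (f : V -> R) (x h : V) (c : R) :
  derivable f x h -> 'D_(c *: h) f x = c * 'D_h f x.
Proof.
move=> df; rewrite derive_line [in RHS]derive_line.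
have E : (fun r : R => f (x + r *: (c *: h))) = (fun r => f (x + r *: h)) \o (fun r => c * r).
  by apply/funext => r /=; rewrite scalerA mulrC.
rewrite E -!derive1E derive1_comp.
- rewrite mulr0 mulrC; congr (_ * _).
  by rewrite derive1Ml ?derive1_id ?mulr1//; exact: derivable_id.
- by apply: derivableM; [exact: derivable_cst|exact: derivable_id].
- rewrite mulr0; by have [] := @is_derive_line R V R f x h 0; rewrite scale0r addr0.
Qed.

Lemma cvg_at0 (f : R -> R) (l : R) :
  (forall e : R, 0 < e -> exists2 d : R, 0 < d & forall s : R, s != 0 -> `|s| < d -> `|f s - l| < e) ->
  f @ 0^' --> l.
Proof.
move=> H; apply/cvgrPdist_lt => e e0; have [d d0 Hd] := H e e0.
exists d => //= s; rewrite /= sub0r normrN => sd s0.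
by rewrite distrC; apply: Hd.
Qed.

Lemma derive_near0 (f : V -> R) (x h : V) (l : R) :
  (forall e : R, 0 < e -> exists2 d : R, 0 < d & forall s : R, s != 0 -> `|s| < d ->
     `|s^-1 * (f (x + s *: h) - f x) - l| < e) -> is_derive x h f l.
Proof.
move=> H.
have h1 : (fun s => s^-1 *: (f (s *: h + x) - f x)) @ 0^' --> l.
  by apply: cvg_at0 => e /H[d d0 Hd]; exists d => // s s0 sd; rewrite (addrC _ x); exact: Hd.
split; first by apply/cvg_ex; exists l.
exact: cvg_lim.
Qed.

(* The segment is small enough for the partial derivative in the direction [v]
   to be close to its value at [x]. *)
Lemma is_deriveDdir (f : V -> R) (x u v : V) :
  (\forall y \near x, derivable f y v) -> derivable f x u ->
  {for x, continuous ('D_v f)} ->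
  is_derive x (u + v) f ('D_u f x + 'D_v f x).
Proof.
move=> nv du cv; apply: derive_near0 => e e0.
have e20 : 0 < e / 2 by rewrite divr_gt0.
have : nbhs x [set y | derivable f y v /\ `|'D_v f x - 'D_v f y| < e / 2].
  exact: filterI nv ((cvgrPdist_lt _ _).1 cv _ e20).
move=> /nbhs_ballP[d1 /= d10 Hd1].
have [d2 d20 Hd2] : exists2 d, 0 < d & forall s, s != 0 -> `|s| < d ->
    `|s^-1 * (f (x + s *: u) - f x) - 'D_u f x| < e / 2.
  have /cvgrPdist_lt/(_ _ e20) : (fun s => s^-1 *: (f (s *: u + x) - f x)) @ 0^' --> 'D_u f x.
    exact: du.
  move=> [d d0 Hd]; exists d => // s s0 sd; rewrite distrC [x + _]addrC.
  by apply: Hd => //=; rewrite sub0r normrN.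
pose M := `|u| + `|v| + 1.
have M0 : 0 < M by rewrite /M; have := normr_ge0 u; have := normr_ge0 v; lra.
exists (Num.min d2 (d1 / M)); first by rewrite lt_min d20 divr_gt0.
move=> s s0; rewrite lt_min => /andP[sd2]; rewrite ltr_pdivlMr// => sd1.
have Hin t : 0 <= t <= 1 -> ball x d1 (x + s *: u + t *: (s *: v)).
  move=> /andP[t0 t1]; rewrite -ball_normE /= -addrA opprD addrA subrr sub0r normrN.
  apply: le_lt_trans (ler_normD _ _) _; rewrite !normrZ (ger0_norm t0).
  apply: le_lt_trans sd1; rewrite /M !mulrDr mulr1 -[X in X <= _]addr0 lerD// lerD2l.
  by rewrite mulrA ler_wpM2r// ler_piMl.
have [t t01] := @mean_value f (x + s *: u) (s *: v) (fun t ht => derivableZdir (c := s) (Hd1 _ (Hin t ht)).1).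
rewrite -addrA -scalerDr deriveZdir; last exact: (Hd1 _ (Hin t t01)).1.
move=> E; have -> : f (x + s *: (u + v)) - f x =
    s * 'D_v f (x + s *: u + t *: (s *: v)) + (f (x + s *: u) - f x).
  by rewrite -E; ring.
rewrite mulrDr mulrA mulVf// mul1r [e]splitr.
set a := 'D_v f _; have -> : a + s^-1 * (f (x + s *: u) - f x) - ('D_u f x + 'D_v f x) =
  (s^-1 * (f (x + s *: u) - f x) - 'D_u f x) - ('D_v f x - a) by ring.
apply: le_lt_trans (ler_normB _ _) _; rewrite ltrD ?Hd2//.
exact: (Hd1 _ (Hin t t01)).2.
Qed.

End MeanValue.

Lemma open_near (X : topologicalType) (U : set X) (x : X) :
  open U -> U x -> \forall y \near x, U y.
Proof. by move=> oU Ux; exact: open_nbhs_nbhs. Qed.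

Lemma near_all (X : topologicalType) (U : set X) (x : X) (P : X -> Prop) :
  open U -> U x -> (forall y, U y -> P y) -> \forall y \near x, P y.
Proof. by move=> oU Ux UP; apply: filterS (open_near oU Ux). Qed.

Lemma cvg_sumR (R : realType) (T I : Type) (F : set_system T) (r : seq I)
    (f : I -> T -> R) (l : I -> R) : Filter F ->
  (forall i, f i x @[x --> F] --> l i) ->
  \sum_(i <- r) f i x @[x --> F] --> \sum_(i <- r) l i.
Proof.
move=> FF H; elim: r => [|i r IH].
  rewrite big_nil (_ : (fun x => _) = cst 0); first exact: cvg_cst.
  by apply/funext => x; rewrite big_nil.
rewrite big_cons (_ : (fun x => _) = (fun x => f i x + \sum_(i <- r) f i x)).
  exact: cvgD.
by apply/funext => x; rewrite big_cons.
Qed.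

Section C1.
Variables (R : realType) (m : nat).
Implicit Types (U : set 'rV[R]_m) (f : 'rV[R]_m -> R).

Definition C1 U f := forall v x, U x -> derivable f x v /\ {for x, continuous ('D_v f)}.

Lemma C1_deriveD U f u v x : open U -> C1 U f -> U x ->
  'D_(u + v) f x = 'D_u f x + 'D_v f x.
Proof.
move=> oU Cf Ux; have [du _] := Cf u x Ux; have [_ cv] := Cf v x Ux.
have nv : \forall y \near x, derivable f y v.
  by apply: near_all oU Ux _ => y Uy; have [] := Cf v y Uy.
by have [_ ->] := is_deriveDdir nv du cv.
Qed.

Lemma C1_deriveZ U f c v x : C1 U f -> U x -> 'D_(c *: v) f x = c * 'D_v f x.
Proof. by move=> Cf Ux; apply: deriveZdir; have [] := Cf v x Ux. Qed.

Lemma C1_derive_sum U f n (c : 'I_n -> R) (v : 'I_n -> 'rV[R]_m) x :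
  open U -> C1 U f -> U x ->
  'D_(\sum_i c i *: v i) f x = \sum_i c i * 'D_(v i) f x.
Proof.
move=> oU Cf Ux; apply: (big_ind2 (fun u r => 'D_u f x = r)).
- exact: derive0.
- by move=> u r u' r' <- <-; exact: C1_deriveD Cf Ux.
- by move=> i _; exact: C1_deriveZ Cf Ux.
Qed.

Lemma C1_deriveE U f v x : open U -> C1 U f -> U x ->
  'D_v f x = \sum_i v 0 i * 'D_(delta_mx 0 i) f x.
Proof.
by move=> oU Cf Ux; rewrite {1}[v]row_sum_delta; exact: C1_derive_sum Cf Ux.
Qed.

Lemma coord_continuous' (i : 'I_m) : continuous (fun x : 'rV[R]_m => x 0 i).
Proof. by move=> x; exact: coord_continuous. Qed.

(** [f] is only assumed derivable in the direction [v]. The increment of [g] along k s is a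
    derivative at an intermediate point, linear in k s; dividing by s, the coordinates of k s tend
    to those of the derivative of [f] and the partial derivatives of [g] converge by continuity. *)
Lemma C1_chain (T : normedModType R) U (g : 'rV[R]_m -> R) (f : T -> 'rV[R]_m) x v :
  open U -> C1 U g -> U (f x) -> derivable f x v ->
  is_derive x v (g \o f) ('D_('D_v f x) g (f x)).
Proof.
move=> oU Cg Ufx df; pose w := 'D_v f x.
pose k (s : R) := f (s *: v + x) - f x.
have hw : (fun s => s^-1 *: k s) @ 0^' --> w by exact: df.
have k0 : k s @[s --> 0^'] --> (0 : 'rV[R]_m).
  have h : (fun s : R => s *: (s^-1 *: k s)) @ 0^' --> (0 : R) *: w.
    apply: cvgZ hw; exact: nbhs_dnbhs.
  rewrite scale0r in h; apply: cvg_trans h; apply: near_eq_cvg.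
  near=> s; rewrite scalerA mulfV ?scale1r//.
  by near: s; exact: nbhs_dnbhs_neq.
have : nbhs (f x) U by apply: open_nbhs_nbhs.
move=> /nbhs_ballP[d /= d0 Hd].
(* [z] is the mean value point on the segment from f x to f x + k s; where the increment is too
   large its value is immaterial. *)
have ex1 (s : R) : exists z, `|k s| < d ->
    g (f x + k s) - g (f x) = \sum_i k s 0 i * 'D_(delta_mx 0 i) g z /\
    `|z - f x| <= `|k s|.
  have [ks|ks] := pselect (`|k s| < d); last by exists 0.
  have seg t : 0 <= t <= 1 -> U (f x + t *: k s).
    move=> /andP[t0 t1]; apply: Hd; rewrite -ball_normE /= opprD addrA subrr sub0r.
    by rewrite normrN normrZ ger0_norm// (le_lt_trans _ ks)// ler_piMl.
  have [t t01 E] := @mean_value R _ g (f x) (k s) (fun t ht => (Cg (k s) _ (seg t ht)).1).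
  exists (f x + t *: k s) => _; split.
    by rewrite E; apply: C1_deriveE (oU) Cg _; exact: seg.
  rewrite addrAC subrr add0r normrZ; case/andP: t01 => t0 t1.
  by rewrite ger0_norm// ler_piMl.
have [z Hz] := choice ex1.
have near_k : \forall s \near 0^', `|k s| < d.
  by have /cvgrPdist_lt/(_ _ d0) := k0; apply: filterS => s; rewrite sub0r normrN.
have zc : z s @[s --> 0^'] --> f x.
  apply/cvgrPdist_lt => e e0; have /cvgrPdist_lt/(_ _ e0) := k0.
  move=> ke; near=> s; have [|_ h] := Hz s; first by near: s.
  rewrite distrC; apply: le_lt_trans h _.
  rewrite -normrN -[- k s]sub0r; near: s; exact: ke.
have lim1 : (fun s => s^-1 *: (g (f x + k s) - g (f x))) @ 0^' -->
    \sum_i w 0 i * 'D_(delta_mx 0 i) g (f x).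
  have h : (fun s => \sum_i (s^-1 *: k s) 0 i * 'D_(delta_mx 0 i) g (z s)) @ 0^' -->
    \sum_i w 0 i * 'D_(delta_mx 0 i) g (f x).
    apply: (@cvg_sumR R R 'I_m (0^') _ (fun i s => (s^-1 *: k s) 0 i * 'D_(delta_mx 0 i) g (z s))
      (fun i => w 0 i * 'D_(delta_mx 0 i) g (f x))).
    move=> i; apply: cvgM.
      by apply: (cvg_comp _ (fun x : 'rV[R]_m => x 0 i) hw); exact: coord_continuous'.
    by apply: (cvg_comp _ ('D_(delta_mx 0 i) g) zc); have [] := Cg (delta_mx 0 i) _ Ufx.
  apply: cvg_trans h; apply: near_eq_cvg; near=> s.
  have [|-> _] := Hz s; first by near: s.
  rewrite /GRing.scale /= mulr_sumr; apply: eq_bigr => i _.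
  by rewrite !mxE mulrA.
rewrite -(C1_deriveE _ oU Cg Ufx) in lim1.
have E : (fun s => s^-1 *: (g (f x + k s) - g (f x))) =
  (fun s => s^-1 *: ((g \o f) (s *: v + x) - (g \o f) x)).
  by apply/funext => s; rewrite /k addrCA subrr addr0.
rewrite E in lim1.
split; first by apply/cvg_ex; eexists; exact: lim1.
exact: cvg_lim lim1.
Unshelve. all: by end_near. Qed.

End C1.

Lemma near_eq_continuous (X Y : topologicalType) (f g : X -> Y) (x : X) :
  (\forall y \near x, f y = g y) -> {for x, continuous f} -> {for x, continuous g}.
Proof.
move=> fg cf; suff : g @ x --> g x by [].
rewrite -(nbhs_singleton fg); apply: cvg_trans cf; exact: near_eq_cvg.
Qed.

(** * Closure properties of functions of class C^k *)

Section CkGen.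
Variables (R : realType) (m : nat) (W : normedModType R).
Implicit Types (U : set 'rV[R]_m) (f g : 'rV[R]_m -> W).

Lemma Ck_continuous k U f x : Ck k U f -> U x -> {for x, continuous f}.
Proof. by case: k => [|k] [cf _]; exact: cf. Qed.

Lemma Ck_derivable k U f v x : Ck k.+1 U f -> U x -> derivable f x v.
Proof. by move=> [_ /(_ v)[df _]]; exact: df. Qed.

Lemma Ck_derive k U f v : Ck k.+1 U f -> Ck k U (fun x => 'D_v f x).
Proof. by move=> [_ /(_ v)[_]]. Qed.

Lemma CkW k U f : Ck k.+1 U f -> Ck k U f.
Proof.
elim: k f => [|k IH] f; first by case.
move=> h; split; first by case: h.
move=> v; split; last exact: IH (Ck_derive v h).
by move=> x; exact: Ck_derivable h.
Qed.

Lemma Ck_sub k U U' f : U' `<=` U -> Ck k U f -> Ck k U' f.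
Proof.
move=> UU; elim: k f => [|k IH] f [cf h]; first by split=> // x /UU /cf.
split=> [x /UU /cf//|v]; have [df Df] := h v.
by split; [move=> x /UU /df | exact: IH].
Qed.

Lemma Ck_ext k U f g : open U -> (forall x, U x -> f x = g x) -> Ck k U f -> Ck k U g.
Proof.
move=> oU; elim: k f g => [|k IH] f g fg [cf h].
  by split=> // x Ux; apply: near_eq_continuous (cf _ Ux); exact: near_all oU Ux _.
split; first by move=> x Ux; apply: near_eq_continuous (cf _ Ux); exact: near_all oU Ux _.
move=> v; have [df Df] := h v; split.
  by move=> x Ux; apply: near_eq_derivable (df _ Ux); exact: near_all oU Ux _.
apply: IH Df => x Ux /=; apply: near_eq_derive; exact: near_all oU Ux _.
Qed.

Lemma Ck_local k U f : (forall x, U x -> exists2 V, V x & Ck k V f) -> Ck k U f.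
Proof.
elim: k f => [|k IH] f loc.
  by split=> // x /loc[V Vx [cf _]]; exact: cf.
split; first by move=> x /loc[V Vx [cf _]]; exact: cf.
move=> v; split; first by move=> x /loc[V Vx h]; exact: Ck_derivable h Vx.
by apply: IH => x /loc[V Vx h]; exists V => //; exact: Ck_derive.
Qed.

Lemma Ck_cst k U (w : W) : Ck k U (fun=> w).
Proof.
elim: k w => [|k IH] w; first by split=> // x _; exact: cst_continuous.
split; first by move=> x _; exact: cst_continuous.
move=> v; split; first by move=> x _; exact: derivable_cst.
have -> : (fun x => 'D_v (fun=> w) x) = fun=> 0; last exact: IH.
by apply/funext => x; exact: derive_cst.
Qed.

Lemma CkD k U f g : open U -> Ck k U f -> Ck k U g -> Ck k U (fun x => f x + g x).
Proof.
move=> oU; elim: k f g => [|k IH] f g hf hg.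
  by split=> // x Ux; exact: continuousD (Ck_continuous hf Ux) (Ck_continuous hg Ux).
split; first by move=> x Ux; exact: continuousD (Ck_continuous hf Ux) (Ck_continuous hg Ux).
move=> v; split.
  by move=> x Ux; apply: derivableD; [exact: Ck_derivable hf Ux | exact: Ck_derivable hg Ux].
apply: Ck_ext (IH _ _ (Ck_derive v hf) (Ck_derive v hg)) => // x Ux.
by rewrite -deriveD//; [exact: Ck_derivable hf Ux | exact: Ck_derivable hg Ux].
Qed.

Lemma CkN k U f : open U -> Ck k U f -> Ck k U (fun x => - f x).
Proof.
move=> oU; elim: k f => [|k IH] f hf.
  by split=> // x Ux; exact: continuousN (Ck_continuous hf Ux).
split; first by move=> x Ux; exact: continuousN (Ck_continuous hf Ux).
move=> v; split; first by move=> x Ux; apply: derivableN; exact: Ck_derivable hf Ux.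
apply: Ck_ext (IH _ (Ck_derive v hf)) => // x Ux.
by rewrite -deriveN//; exact: Ck_derivable hf Ux.
Qed.

Lemma CkB k U f g : open U -> Ck k U f -> Ck k U g -> Ck k U (fun x => f x - g x).
Proof. by move=> oU hf hg; apply: CkD => //; exact: CkN. Qed.

Lemma Ck_sum k U (I : Type) (r : seq I) (f : I -> 'rV[R]_m -> W) : open U ->
  (forall i, Ck k U (f i)) -> Ck k U (fun x => \sum_(i <- r) f i x).
Proof.
move=> oU hf; elim: r => [|i r IH].
  by apply: Ck_ext (Ck_cst k U 0) => // x _; rewrite big_nil.
by apply: Ck_ext (CkD oU (hf i) IH) => // x _; rewrite big_cons.
Qed.

End CkGen.

Section CkReal.
Variables (R : realType) (m : nat).
Implicit Types (U : set 'rV[R]_m) (f g : 'rV[R]_m -> R).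

Lemma Ck1_C1 k U f : Ck k.+1 U f -> C1 U f.
Proof.
move=> h v x Ux; split; first exact: Ck_derivable h Ux.
exact: Ck_continuous (Ck_derive v h) Ux.
Qed.

Lemma CkM k U f g : open U -> Ck k U f -> Ck k U g -> Ck k U (fun x => f x * g x).
Proof.
move=> oU; elim: k f g => [|k IH] f g hf hg.
  by split=> // x Ux; exact: continuousM (Ck_continuous hf Ux) (Ck_continuous hg Ux).
split; first by move=> x Ux; exact: continuousM (Ck_continuous hf Ux) (Ck_continuous hg Ux).
move=> v; split.
  by move=> x Ux; apply: derivableM; [exact: Ck_derivable hf Ux | exact: Ck_derivable hg Ux].
have h1 := IH _ _ (CkW hf) (Ck_derive v hg); have h2 := IH _ _ (CkW hg) (Ck_derive v hf).
apply: Ck_ext (CkD oU h1 h2) => // x Ux.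
by rewrite [RHS]deriveM//; [exact: Ck_derivable hf Ux | exact: Ck_derivable hg Ux].
Qed.

Lemma CkZ k U (c : R) f : open U -> Ck k U f -> Ck k U (fun x => c * f x).
Proof. by move=> oU hf; apply: CkM => //; exact: Ck_cst. Qed.

Lemma is_derive_linear (V W : normedModType R) (f : V -> W) (x v : V) :
  (forall (c : R) u w, f (c *: u + w) = c *: f u + f w) -> is_derive x v f (f v).
Proof.
move=> lf; have h : (fun h : R => h^-1 *: (f (h *: v + x) - f x)) @ 0^' --> f v.
  apply: (cvg_trans _ (@cvg_cst _ (f v) _ (0 : R)^' _)); apply: near_eq_cvg.
  near=> h; rewrite lf addrK scalerA mulVf ?scale1r//.
  by near: h; exact: nbhs_dnbhs_neq.
by split; [apply/cvg_ex; exists (f v) | exact: cvg_lim h].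
Unshelve. all: by end_near. Qed.

Lemma is_derive_coord (i : 'I_m) (x v : 'rV[R]_m) :
  is_derive x v (fun y : 'rV[R]_m => y 0 i) (v 0 i).
Proof. by apply: (is_derive_linear (f := fun y : 'rV[R]_m => y 0 i)) => c u w; rewrite !mxE. Qed.

Lemma Ck_coord k U (i : 'I_m) : Ck k U (fun x : 'rV[R]_m => x 0 i).
Proof.
case: k => [|k]; first by split=> // x _; exact: coord_continuous'.
split; first by move=> x _; exact: coord_continuous'.
move=> v; split; first by move=> x _; have [] := is_derive_coord i x v.
have -> : (fun x => 'D_v (fun y : 'rV[R]_m => y 0 i) x) = fun=> v 0 i.
  by apply/funext => x; have [_ ->] := is_derive_coord i x v.
exact: Ck_cst.
Qed.

Lemma is_derive_comp1 (V : normedModType R) (g : R -> R) (f : V -> R) (x v : V) :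
  derivable f x v -> derivable g (f x) 1 -> is_derive x v (g \o f) ('D_1 g (f x) * 'D_v f x).
Proof.
move=> df dg; pose h (r : R) := f (x + r *: v).
have h0 : h 0 = f x by rewrite /h scale0r addr0.
have dh : derivable h 0 1.
  by have [] := @is_derive_line R V R f x v 0; rewrite scale0r addr0.
have dg' : derivable g (h 0) 1 by rewrite h0.
have dgh : derivable (g \o h) 0 1.
  by apply/derivable1_diffP; apply: differentiable_comp; apply/derivable1_diffP.
split; first exact: derivable_of_line dgh.
apply: (etrans (derive_line (g \o f) x v)); apply: (etrans (esym (derive1E (g \o h) 0))).
apply: (etrans (derive1_comp dh dg')).
by rewrite h0 !derive1E; congr (_ * _); rewrite [RHS]derive_line.
Qed.

Lemma Ck_cos_sin k U f : open U -> Ck k U f ->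
  Ck k U (fun x => cos (f x)) /\ Ck k U (fun x => sin (f x)).
Proof.
move=> oU; elim: k f => [|k IH] f hf.
  split; split=> // x Ux; apply: (continuous_comp (Ck_continuous hf Ux)).
    exact: continuous_cos.
  exact: continuous_sin.
have [Cc Cs] := IH _ (CkW hf).
have cosf v x : U x -> is_derive x v (fun x => cos (f x)) (- sin (f x) * 'D_v f x).
  move=> Ux; have /= := @is_derive_comp1 _ (@cos R) f x v (Ck_derivable hf Ux).
  by have [? ->] := is_derive_cos (f x); apply.
have sinf v x : U x -> is_derive x v (fun x => sin (f x)) (cos (f x) * 'D_v f x).
  move=> Ux; have /= := @is_derive_comp1 _ (@sin R) f x v (Ck_derivable hf Ux).
  by have [? ->] := is_derive_sin (f x); apply.
split; split.
- move=> x Ux; apply: (continuous_comp (Ck_continuous hf Ux)); exact: continuous_cos.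
- move=> v; split; first by move=> x Ux; have [] := cosf v x Ux.
  apply: Ck_ext (CkM oU (CkN oU Cs) (Ck_derive v hf)) => // x Ux.
  by have [_ ->] := cosf v x Ux.
- move=> x Ux; apply: (continuous_comp (Ck_continuous hf Ux)); exact: continuous_sin.
- move=> v; split; first by move=> x Ux; have [] := sinf v x Ux.
  apply: Ck_ext (CkM oU Cc (Ck_derive v hf)) => // x Ux.
  by have [_ ->] := sinf v x Ux.
Qed.

End CkReal.

Section CkVector.
Variables (R : realType) (m n : nat).
Implicit Types (U : set 'rV[R]_m) (f g : 'rV[R]_m -> R).
Implicit Types F : 'rV[R]_m -> 'rV[R]_n.

Lemma continuous_coordP (T : topologicalType) (F : T -> 'rV[R]_n) (x : T) :
  (forall i, {for x, continuous (fun y => F y 0 i)}) -> {for x, continuous F}.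
Proof.
move=> cF; apply/cvgrPdist_lt => e e0.
have h i : \forall y \near x, `|F x 0 i - F y 0 i| < e.
  by have /cvgrPdist_lt/(_ _ e0) := cF i.
have hh : \forall y \near x, forall i, `|F x 0 i - F y 0 i| < e.
  by apply: filter_forall.
apply: filterS hh => y Hy.
rewrite [X in X < _]/Num.Def.normr /= mx_normrE; apply: bigmax_lt => // -[i j] _.
by rewrite ord1 !mxE; exact: Hy.
Qed.

Lemma continuous_coord (T : topologicalType) (F : T -> 'rV[R]_n) (x : T) i :
  {for x, continuous F} -> {for x, continuous (fun y => F y 0 i)}.
Proof.
move=> cF; apply: (@continuous_comp _ _ _ F (fun z : 'rV[R]_n => z 0 i) x cF).
exact: coord_continuous'.
Qed.

Lemma derivable_coord (V : normedModType R) (F : V -> 'rV[R]_n) x v i :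
  derivable F x v -> derivable (fun y => F y 0 i) x v.
Proof. by move=> /derivable_mxP/(_ 0 i). Qed.

Lemma derivable_coordP (V : normedModType R) (F : V -> 'rV[R]_n) x v :
  (forall i, derivable (fun y => F y 0 i) x v) -> derivable F x v.
Proof. by move=> dF; apply/derivable_mxP => i j; rewrite ord1. Qed.

Lemma derive_coord (V : normedModType R) (F : V -> 'rV[R]_n) x v i :
  derivable F x v -> ('D_v F x) 0 i = 'D_v (fun y => F y 0 i) x.
Proof. by move=> dF; rewrite derive_mx// mxE. Qed.

Lemma Ck_coords k U F : open U -> Ck k U F <-> forall i, Ck k U (fun x => F x 0 i).
Proof.
move=> oU; elim: k F => [|k IH] F.
  split=> [[cF _] i|h]; split=> // x Ux; first exact/continuous_coord/cF.
  by apply: continuous_coordP => i; have [] := h i => + _; exact.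
split=> [h i|h].
  split; first by move=> x Ux; exact/continuous_coord/(Ck_continuous h Ux).
  move=> v; split; first by move=> x Ux; exact/derivable_coord/(Ck_derivable h Ux).
  apply: Ck_ext ((IH _).1 (Ck_derive v h) i) => // x Ux.
  by rewrite derive_coord//; exact: Ck_derivable h Ux.
have dF v x : U x -> derivable F x v.
  by move=> Ux; apply: derivable_coordP => i; exact: Ck_derivable (h i) Ux.
split; first by move=> x Ux; apply: continuous_coordP => i; exact: Ck_continuous (h i) Ux.
move=> v; split; first by move=> x; exact: dF.
apply/IH => i; apply: Ck_ext (Ck_derive v (h i)) => // x Ux.
by rewrite derive_coord//; exact: dF.
Qed.

(** A directional derivative of the composite is a sum of products of coordinates of the derivative
    of [F] with partial derivatives of [g] at [F x]; the induction hypothesis covers both factors at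
    the lower order. *)
Lemma Ck_comp k U (V : set 'rV[R]_n) (g : 'rV[R]_n -> R) F : open U -> open V ->
  (forall x, U x -> V (F x)) -> Ck k V g -> Ck k U F -> Ck k U (fun x => g (F x)).
Proof.
move=> oU oV UV; elim: k g => [|k IH] g hg hF.
  split=> // x Ux; apply: (continuous_comp (Ck_continuous hF Ux)).
  exact: Ck_continuous hg (UV _ Ux).
have dgF v x : U x -> is_derive x v (g \o F) ('D_('D_v F x) g (F x)).
  move=> Ux.
  exact: (@C1_chain R n 'rV[R]_m V g F x v oV (Ck1_C1 hg) (UV _ Ux) (Ck_derivable hF Ux)).
split.
  move=> x Ux; apply: (continuous_comp (Ck_continuous hF Ux)).
  exact: Ck_continuous hg (UV _ Ux).
move=> v; split; first by move=> x Ux; have [] := dgF v x Ux.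
have h : Ck k U (fun x => \sum_i 'D_v F x 0 i * 'D_(delta_mx 0 i) g (F x)).
  apply: Ck_sum => // i; apply: CkM => //.
    exact: ((Ck_coords k _ oU).1 (Ck_derive v hF)).
  exact: (IH _ (Ck_derive _ hg) (CkW hF)).
apply: Ck_ext h => // x Ux; have [_ ->] := dgF v x Ux.
by rewrite (C1_deriveE _ oV (Ck1_C1 hg) (UV _ Ux)).
Qed.

End CkVector.

(** * Symmetry of second derivatives *)

Section Schwarz.
Variables (R : realType) (m : nat) (U : set 'rV[R]_m) (f : 'rV[R]_m -> R).
Hypotheses (oU : open U) (Cf : Ck 2 U f).

Lemma derivable_translate (g : 'rV[R]_m -> R) (w y h : 'rV[R]_m) :
  derivable g (y + w) h -> is_derive y h (fun z => g (z + w)) ('D_h g (y + w)).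
Proof.
have E : (fun r : R => r^-1 *: ((fun z => g (z + w)) (r *: h + y) - g (y + w))) =
  (fun r : R => r^-1 *: (g (r *: h + (y + w)) - g (y + w))).
  by apply/funext => r; rewrite addrA.
by move=> dg; split; [rewrite /derivable E | rewrite /derive E].
Qed.

(** The mean value theorem is used twice: along s v for y |-> f (y + s u) - f y, then along s u for
    the derivative of [f] in the direction [v]. The intermediate point tends to [x] with s, and the
    iterated derivative is continuous. *)
Lemma second_difference (x u v : 'rV[R]_m) (e : R) : U x -> 0 < e ->
  exists2 d : R, 0 < d & forall s : R, 0 < s -> s < d ->
    `|f (x + s *: u + s *: v) - f (x + s *: u) - f (x + s *: v) + f x
      - s ^+ 2 * 'D_u ('D_v f) x| <= e * s ^+ 2.
Proof.
move=> Ux e0.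
have Cv := Ck_derive v Cf; have Cuv := Ck_derive u Cv.
have nb : nbhs x [set y | U y /\ `|'D_u ('D_v f) x - 'D_u ('D_v f) y| < e].
  exact: filterI (open_near oU Ux) ((cvgrPdist_lt _ _).1 (Ck_continuous Cuv Ux) _ e0).
move: nb => /nbhs_ballP[d1 /= d10 Hd1].
pose M := `|u| + `|v| + 1.
have M0 : 0 < M by rewrite /M; have := normr_ge0 u; have := normr_ge0 v; lra.
exists (d1 / M); first by rewrite divr_gt0.
move=> s s0; rewrite ltr_pdivlMr// => sd.
have Hin a b : 0 <= a <= 1 -> 0 <= b <= 1 -> ball x d1 (x + b *: (s *: v) + a *: (s *: u)).
  move=> /andP[a0 a1] /andP[b0 b1].
  rewrite -ball_normE /= -addrA opprD addrA subrr sub0r normrN.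
  apply: le_lt_trans (ler_normD _ _) _; rewrite !normrZ !ger0_norm ?(ltW s0)//.
  apply: le_lt_trans sd; rewrite /M.
  have h1 : b * (s * `|v|) <= s * `|v| by rewrite ler_piMl// mulr_ge0// ltW.
  have h2 : a * (s * `|u|) <= s * `|u| by rewrite ler_piMl// mulr_ge0// ltW.
  lra.
have i01 : 0 <= (1 : R) <= 1 by rewrite ler01 lexx.
have i00 : 0 <= (0 : R) <= 1 by rewrite ler01 lexx.
pose g y := f (y + s *: u) - f y.
have dg t : 0 <= t <= 1 -> is_derive (x + t *: (s *: v)) (s *: v) g
   ('D_(s *: v) f (x + t *: (s *: v) + s *: u) - 'D_(s *: v) f (x + t *: (s *: v))).
  move=> t01; apply: is_deriveB.
    apply: derivable_translate; apply: (derivableZdir (c := s)).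
    apply: Ck_derivable Cf _; have := Hin 1 t i01 t01; rewrite scale1r.
    by move=> /Hd1[].
  apply: DeriveDef => //; apply: (derivableZdir (c := s)); apply: Ck_derivable Cf _.
  by have := Hin 0 t i00 t01; rewrite scale0r addr0 => /Hd1[].
have dg1 (t : R) : 0 <= t <= 1 -> derivable g (x + t *: (s *: v)) (s *: v).
  by move=> /dg[].
have [t t01] := mean_value dg1.
have [_ ->] := dg t t01.
rewrite deriveZdir; last first.
  apply: Ck_derivable Cf _; have := Hin 1 t i01 t01; rewrite scale1r.
  by move=> /Hd1[].
rewrite deriveZdir; last first.
  apply: Ck_derivable Cf _.
  by have := Hin 0 t i00 t01; rewrite scale0r addr0 => /Hd1[].
rewrite -mulrBr.
have dv r : 0 <= r <= 1 -> derivable ('D_v f) (x + t *: (s *: v) + r *: (s *: u)) (s *: u).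
  move=> r01; apply: (derivableZdir (c := s)); apply: Ck_derivable Cv _.
  by have /Hd1[] := Hin r t r01 t01.
have [r r01 ->] := mean_value dv.
rewrite deriveZdir; last first.
  by apply: Ck_derivable Cv _; have /Hd1[] := Hin r t r01 t01.
have [_ close] := Hd1 _ (Hin r t r01 t01).
set D := 'D_u _ _ in close *; set D' := 'D_u _ _ in close *; clearbody D D'.
rewrite /g => E.
have -> : f (x + s *: u + s *: v) - f (x + s *: u) - f (x + s *: v) + f x =
  f (x + s *: v + s *: u) - f (x + s *: v) - (f (x + s *: u) - f x).
  by rewrite (addrAC x); ring.
rewrite E mulrA -expr2 -mulrBr normrM ger0_norm ?exprn_ge0 ?(ltW s0)// mulrC.
by apply: ler_wpM2r; [exact/exprn_ge0/ltW | rewrite distrC ltW].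
Qed.

(** The second difference is symmetric in [u] and [v], so both iterated derivatives are its limit
    after division by s^2. *)
Lemma schwarz (x u v : 'rV[R]_m) : U x -> 'D_u ('D_v f) x = 'D_v ('D_u f) x.
Proof.
move=> Ux; apply/eqP; rewrite -subr_eq0 -normr_eq0 eq_le normr_ge0 andbT.
apply/ler_addgt0Pr => e e0; rewrite add0r.
have e20 : 0 < e / 2 by rewrite divr_gt0.
have [d1 d10 H1] := @second_difference x u v _ Ux e20.
have [d2 d20 H2] := @second_difference x v u _ Ux e20.
pose s := Num.min d1 d2 / 2.
have m0 : 0 < Num.min d1 d2 by rewrite lt_min d10.
have s0 : 0 < s by rewrite divr_gt0.
have sm : s < Num.min d1 d2 by rewrite /s; lra.
move: (sm); rewrite lt_min => /andP[sd1 sd2].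
have s2 : 0 < s ^+ 2 by rewrite exprn_gt0.
have := H1 s s0 sd1; have := H2 s s0 sd2.
set A := 'D_v _ _; set B := 'D_u _ _; rewrite (addrAC x (s *: v)).
set a := f _; set b := f _; set c := f _; set z := f _ => h2 h1.
suff : `|(B - A) * s ^+ 2| <= e * s ^+ 2.
  by rewrite normrM (ger0_norm (ltW s2)) ler_pM2r.
have -> : (B - A) * s ^+ 2 = (a - b - c + z - s ^+ 2 * A) - (a - c - b + z - s ^+ 2 * B) by ring.
apply: le_trans (ler_normB _ _) _.
by apply: le_trans (lerD h2 h1) _; rewrite -mulrDl -splitr.
Qed.

End Schwarz.

(** * Poincare lemmas *)

Section UnitIntegral.
Variable R : realType.
Implicit Types f g F : R -> R.

Definition int01 f : R := (\int[@lebesgue_measure R]_(t in `[0%R, 1%R]) f t)%R.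

Definition cont01 f := forall t : R, 0 <= t <= 1 -> {for t, continuous f}.

Lemma cont01_integrable f : cont01 f ->
  (@lebesgue_measure R).-integrable `[0, 1] (EFin \o f).
Proof.
move=> cf; apply: continuous_compact_integrable; first exact: segment_compact.
apply: continuous_in_subspaceT => t /set_mem /=; rewrite in_itv /=; exact: cf.
Qed.

Lemma cont01D f g : cont01 f -> cont01 g -> cont01 (fun t => f t + g t).
Proof. by move=> cf cg t t01; exact: continuousD (cf t t01) (cg t t01). Qed.

Lemma cont01N f : cont01 f -> cont01 (fun t => - f t).
Proof. by move=> cf t t01; exact: continuousN (cf t t01). Qed.

Lemma cont01M f g : cont01 f -> cont01 g -> cont01 (fun t => f t * g t).
Proof. by move=> cf cg t t01; exact: continuousM (cf t t01) (cg t t01). Qed.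

Lemma cont01_cst (c : R) : cont01 (fun=> c).
Proof. by move=> t _; exact: cst_continuous. Qed.

Lemma cont01_exp k : cont01 (fun t => t ^+ k).
Proof. by move=> t _; exact: exprn_continuous. Qed.

Lemma int01_eq f g : (forall t, 0 <= t <= 1 -> f t = g t) -> int01 f = int01 g.
Proof. by move=> fg; apply: eq_Rintegral => t /set_mem /=; rewrite in_itv /=; exact: fg. Qed.

Lemma int01D f g : cont01 f -> cont01 g -> int01 (fun t => f t + g t) = int01 f + int01 g.
Proof. by move=> cf cg; apply: RintegralD => //; exact: cont01_integrable. Qed.

Lemma int01Z (c : R) f : cont01 f -> int01 (fun t => c * f t) = c * int01 f.
Proof. by move=> cf; apply: RintegralZl => //; exact: cont01_integrable. Qed.

Lemma int01B f g : cont01 f -> cont01 g -> int01 (fun t => f t - g t) = int01 f - int01 g.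
Proof. by move=> cf cg; apply: RintegralB => //; exact: cont01_integrable. Qed.

Lemma int01_sum n (f : 'I_n -> R -> R) : (forall i, cont01 (f i)) ->
  int01 (fun t => \sum_i f i t) = \sum_i int01 (f i).
Proof.
move=> cf; suff : cont01 (fun t => \sum_i f i t) /\
  int01 (fun t => \sum_i f i t) = \sum_i int01 (f i) by case.
elim: (index_enum _) => [|i r [IH1 IH2]].
  rewrite (_ : (fun t => _) = fun=> 0); last by apply/funext => t; rewrite big_nil.
  split; first exact: cont01_cst.
  rewrite big_nil -[X in _ = X](mul0r (int01 (fun=> 1))) -int01Z; last exact: cont01_cst.
  by apply: int01_eq => t _; rewrite mul0r.
rewrite (_ : (fun t => _) = fun t => f i t + \sum_(j <- r) f j t); last first.
  by apply/funext => t; rewrite big_cons.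
by rewrite big_cons -IH2 -int01D//; split => //; exact: cont01D.
Qed.

Lemma int01_cst (c : R) : int01 (fun=> c) = c.
Proof.
have m1 : (@lebesgue_measure R) `[0%R, 1%R]%classic = 1%E.
  by rewrite lebesgue_measure_itv /= lte_fin ltr01 oppr0 adde0.
by rewrite /int01 Rintegral_cst//= [X in fine X]m1 /= mulr1.
Qed.

Lemma int01_le_norm (c : R) f : cont01 f ->
  (forall t, 0 <= t <= 1 -> `|f t| <= c) -> `|int01 f| <= c.
Proof.
move=> cf fc; apply: le_trans (le_normr_Rintegral _ _) _ => //.
  exact: cont01_integrable.
rewrite -[leRHS]int01_cst; apply: le_Rintegral => //.
- apply: (@cont01_integrable (fun t => `|f t|)) => t t01.
  by apply: (@continuous_comp _ _ _ f (@Num.norm _ R^o)); [exact: cf | exact: norm_continuous].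
- by apply: (@cont01_integrable (fun=> c)); exact: cont01_cst.
Qed.

Lemma int01_FTC f F : cont01 f ->
  (forall t : R, 0 <= t <= 1 -> is_derive t 1 F (f t)) -> int01 f = F 1 - F 0.
Proof.
move=> cf dF; rewrite /int01 /Rintegral.
have cF (t : R) : 0 <= t <= 1 -> {for t, continuous F}.
  move=> /dF[dFt _]; apply: differentiable_continuous.
  exact/derivable1_diffP.
rewrite (@continuous_FTC2 R f F 0 1 ltr01)//.
- apply: continuous_in_subspaceT => t /set_mem /=; rewrite in_itv /=; exact: cf.
- split.
  + by move=> t; rewrite in_itv /= => /andP[t0 t1]; have [|dt _] := dF t; rewrite ?ltW.
  + by apply: cvg_at_right_filter; apply: cF; rewrite lexx ler01.
  + by apply: cvg_at_left_filter; apply: cF; rewrite lexx ler01.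
- move=> t; rewrite in_itv /= => /andP[t0 t1]; rewrite derive1E.
  by have [|_ ->] := dF t; rewrite ?ltW.
Qed.

End UnitIntegral.

Section RadialIntegral.
Variables (R : realType) (m : nat) (U : set 'rV[R]_m) (x0 : 'rV[R]_m).
Hypotheses (oU : open U)
  (starU : forall x (t : R), U x -> 0 <= t <= 1 -> U (x0 + t *: (x - x0))).
Implicit Types h g : 'rV[R]_m -> R.

Let gam (t : R) (x : 'rV[R]_m) := x0 + t *: (x - x0).

(** The kernel of the homotopy operator on a star-shaped set. Each derivative in [x] contributes a
    factor t, so the exponent has to be a parameter; coefficients of 1-forms start at 0 and those of
    2-forms at 1. *)
Definition radial k h (x : 'rV[R]_m) : R := int01 (fun t => t ^+ k * h (gam t x)).

Lemma gam_continuous x : continuous (fun t : R => gam t x).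
Proof.
move=> t; rewrite /gam; apply: cvgD; first exact: cvg_cst.
by apply: cvgZ; [exact: cvg_id | exact: cvg_cst].
Qed.

Lemma radial_cont01 k h x : Ck 0 U h -> U x -> cont01 (fun t => t ^+ k * h (gam t x)).
Proof.
move=> ch Ux; apply: cont01M; first exact: cont01_exp.
move=> t t01; apply: (@continuous_comp _ _ _ (fun t : R => gam t x) h).
  exact: gam_continuous.
apply: Ck_continuous ch _; exact: starU.
Qed.

(** Uniform continuity along the ray from [x0] to [x], by [cousin] for the existence of a radius
    that serves a whole interval of times. *)
Lemma radial_unif g x (e : R) : Ck 0 U g -> U x -> 0 < e ->
  exists2 d : R, 0 < d & forall (t : R) x', 0 <= t <= 1 -> `|x' - x| < d ->
    U x' /\ `|g (gam t x') - g (gam t x)| < e.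
Proof.
move=> Cg Ux e0.
pose P (s s' : R) := exists2 d : R, 0 < d & forall (t : R) x', s <= t <= s' ->
  0 <= t <= 1 -> `|x' - x| < d -> U x' /\ `|g (gam t x') - g (gam t x)| < e.
suff : P 0 1.
  by move=> [d d0 Hd]; exists d => // t x' t01 xx'; exact: Hd.
apply: (@cousin R P 0 1 ler01); last first.
  move=> a b c ab bc [d1 d10 H1] [d2 d20 H2]; exists (Num.min d1 d2).
    by rewrite lt_min d10.
  move=> t x' /andP[at_ tc] t01; rewrite lt_min => /andP[xd1 xd2].
  have [tb|/ltW bt] := leP t b; [apply: H1 | apply: H2] => //; lra.
move=> t t01.
have e20 : 0 < e / 2 by rewrite divr_gt0.
have cg := Ck_continuous Cg (starU Ux t01).
have : nbhs (gam t x) [set y | `|g (gam t x) - g y| < e / 2].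
  exact: (cvgrPdist_lt _ _).1 cg _ e20.
move=> /nbhs_ballP[d1 /= d10 H1].
have : nbhs x U by exact: open_near oU Ux.
move=> /nbhs_ballP[d2 /= d20 H2].
pose M := `|x - x0| + 1.
have M0 : 0 < M by rewrite /M; have := normr_ge0 (x - x0); lra.
exists (d1 / 2 / M); first by rewrite !divr_gt0.
move=> a b ha ab hb; exists (Num.min (d1 / 2) d2); first by rewrite lt_min d20 divr_gt0.
move=> s x' /andP[as_ sb] /andP[s0 s1]; rewrite lt_min => /andP[xd1 xd2].
have Ux' : U x' by apply: H2; rewrite -ball_normE /= distrC.
split => //.
have st : `|s - t| * M < d1 / 2.
  by rewrite -ltr_pdivlMr// ltr_norml; apply/andP; split; lra.
have dist y : `|y - x| < d1 / 2 -> `|gam t x - gam s y| < d1.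
  move=> yx; have -> : gam t x - gam s y = (t - s) *: (x - x0) - s *: (y - x).
    by apply/rowP => i; rewrite !mxE; ring.
  apply: le_lt_trans (ler_normB _ _) _; rewrite !normrZ (ger0_norm s0) distrC.
  have h1 : `|s - t| * `|x - x0| <= `|s - t| * M by rewrite ler_wpM2l// /M lerDl.
  have h2 : s * `|y - x| <= `|y - x| by rewrite ler_piMl.
  lra.
have c1 : `|g (gam t x) - g (gam s x')| < e / 2.
  by apply: H1; rewrite -ball_normE /=; exact: dist.
have c2 : `|g (gam t x) - g (gam s x)| < e / 2.
  apply: H1; rewrite -ball_normE /=; apply: dist.
  by rewrite subrr normr0 divr_gt0.
rewrite [e]splitr (_ : _ - _ = (g (gam t x) - g (gam s x)) - (g (gam t x) - g (gam s x'))).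
  by apply: le_lt_trans (ler_normB _ _) _; exact: ltrD.
by rewrite opprB [RHS]addrC subrKA.
Qed.

Lemma exp01_le1 (t : R) k : 0 <= t <= 1 -> 0 <= t ^+ k <= 1.
Proof. by move=> /andP[t0 t1]; rewrite exprn_ge0//= exprn_ile1. Qed.

Lemma radial_continuous k h x : Ck 0 U h -> U x -> {for x, continuous (radial k h)}.
Proof.
move=> Ch Ux; apply/(cvgrPdist_le (FF := nbhs_filter (x : 'rV[R]_m))) => e e0.
have [d d0 Hd] := radial_unif Ch Ux e0.
apply/nbhs_ballP; exists d => //= x'; rewrite -ball_normE /= distrC => xx'.
have Ux' : U x' by have [] := Hd 0 x' _ xx'; rewrite ?lexx ?ler01.
rewrite /radial -int01B; try exact: radial_cont01.
apply: int01_le_norm.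
  by apply: cont01D; [|apply: cont01N]; exact: radial_cont01.
move=> t t01; have [_ /ltW gt] := Hd t x' t01 xx'.
rewrite -mulrBr normrM distrC; have /andP[h1 h2] := exp01_le1 k t01.
by rewrite (ger0_norm h1) (le_trans _ gt)// ler_piMl.
Qed.

(** Differentiation under the integral sign: the difference quotient at time t equals t times a
    derivative of [h] at an intermediate point, and [radial_unif] makes its convergence uniform in
    t. *)
Lemma is_derive_radial k h x v : Ck 1 U h -> U x ->
  is_derive x v (radial k h) (radial k.+1 ('D_v h) x).
Proof.
move=> Ch Ux; have Cv := Ck_derive v Ch; have C0 := CkW Ch.
apply: derive_near0 => e e0; have e20 : 0 < e / 2 by rewrite divr_gt0.
have [d d0 Hd] := radial_unif Cv Ux e20.
pose M := `|v| + 1.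
have M0 : 0 < M by rewrite /M; have := normr_ge0 v; lra.
exists (d / M); first by rewrite divr_gt0.
move=> s s0; rewrite ltr_pdivlMr// => sd.
have Hr (r : R) : 0 <= r <= 1 -> `|x + r *: (s *: v) - x| < d.
  move=> /andP[r0 r1]; rewrite addrAC subrr add0r !normrZ (ger0_norm r0).
  apply: le_lt_trans sd; rewrite /M mulrDr mulr1.
  have h1 : r * (`|s| * `|v|) <= `|s| * `|v| by rewrite ler_piMl// mulr_ge0.
  by have := normr_ge0 s; lra.
have Hr1 : `|x + s *: v - x| < d by have := Hr 1; rewrite scale1r; apply; rewrite ler01 lexx.
have Uxs : U (x + s *: v) by have [] := Hd 0 _ _ Hr1; rewrite ?lexx ?ler01.
have c1 := radial_cont01 (k := k) C0 Ux; have c2 := radial_cont01 (k := k) C0 Uxs.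
have c3 := radial_cont01 (k := k.+1) Cv Ux.
rewrite /radial -int01B// -int01Z; last exact/cont01D/cont01N.
have c4 : cont01 (fun t => s^-1 * (t ^+ k * h (gam t (x + s *: v)) - t ^+ k * h (gam t x))).
  by apply: cont01M; [exact: cont01_cst | exact/cont01D/cont01N].
rewrite -int01B//; apply: (@le_lt_trans _ _ (e / 2)); last by lra.
apply: int01_le_norm; first exact/cont01D/cont01N.
move=> t t01.
have gE (r : R) : gam t x + r *: (t *: (s *: v)) = gam t (x + r *: (s *: v)).
  by apply/rowP => i; rewrite !mxE; ring.
have dh (r : R) : 0 <= r <= 1 -> derivable h (gam t x + r *: (t *: (s *: v))) (t *: (s *: v)).
  move=> r01; rewrite scalerA; apply: derivableZdir; rewrite -scalerA.
  apply: Ck_derivable Ch _; rewrite gE; apply: starU => //.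
  by have [] := Hd 0 _ _ (Hr r r01); rewrite ?lexx ?ler01.
have [r r01] := mean_value dh.
have -> : gam t x + t *: (s *: v) = gam t (x + s *: v).
  by have := gE 1; rewrite !scale1r.
have Ur : U (gam t (x + r *: (s *: v))).
  by apply: starU => //; have [] := Hd 0 _ _ (Hr r r01); rewrite ?lexx ?ler01.
rewrite gE [t *: _]scalerA deriveZdir; last exact: Ck_derivable Ch Ur.
have [_ close] := Hd t _ t01 (Hr r r01).
move=> E; rewrite -mulrBr E.
have -> : s^-1 * (t ^+ k * (t * s * 'D_v h (gam t (x + r *: (s *: v))))) -
   t ^+ k.+1 * 'D_v h (gam t x) =
   t ^+ k.+1 * ('D_v h (gam t (x + r *: (s *: v))) - 'D_v h (gam t x)).
  by rewrite exprSr; field.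
rewrite normrM; have /andP[h1 h2] := exp01_le1 k.+1 t01.
by rewrite (ger0_norm h1) (le_trans _ (ltW close))// ler_piMl.
Qed.

Lemma Ck_radial n k h : Ck n U h -> Ck n U (radial k h).
Proof.
elim: n k h => [|n IH] k h Ch.
  by split=> // x Ux; exact: radial_continuous.
have C0 : Ck 0 U h by elim: (n) Ch => [|n' IHn] /CkW.
have C1 : Ck 1 U h by elim: (n) Ch => [//|n' IHn] /CkW.
split; first by move=> x Ux; exact: radial_continuous.
move=> v; split; first by move=> x Ux; have [] := is_derive_radial k v C1 Ux.
apply: Ck_ext (IH k.+1 _ (Ck_derive v Ch)) => // x Ux.
by have [_ ->] := is_derive_radial k v C1 Ux.
Qed.

Lemma radialD k h g x : Ck 0 U h -> Ck 0 U g -> U x ->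
  radial k (fun y => h y + g y) x = radial k h x + radial k g x.
Proof.
move=> Ch Cg Ux; rewrite /radial -int01D; try exact: radial_cont01.
by apply: int01_eq => t _; rewrite mulrDr.
Qed.

Lemma radialZ k (c : R) h x : Ck 0 U h -> U x ->
  radial k (fun y => c * h y) x = c * radial k h x.
Proof.
move=> Ch Ux; rewrite /radial -int01Z; last exact: radial_cont01.
by apply: int01_eq => t _; rewrite mulrCA.
Qed.

Lemma radial_sum k n (h : 'I_n -> 'rV[R]_m -> R) x : (forall i, Ck 0 U (h i)) -> U x ->
  radial k (fun y => \sum_i h i y) x = \sum_i radial k (h i) x.
Proof.
move=> Ch Ux; rewrite /radial -int01_sum; last by move=> i; exact: radial_cont01.
by apply: int01_eq => t _; rewrite mulr_sumr.
Qed.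

(* Integration of the derivative of [t ^ k.+1 * h (gam t x)] over [0, 1]. *)
Lemma radial_euler k h x : Ck 1 U h -> U x ->
  k.+1%:R * radial k h x + \sum_i (x - x0) 0 i * radial k.+1 ('D_(delta_mx 0 i) h) x = h x.
Proof.
move=> Ch Ux; have C0 := CkW Ch; set w := x - x0.
have cD i : cont01 (fun t => t ^+ k.+1 * 'D_(delta_mx 0 i) h (gam t x)).
  exact: (@radial_cont01 k.+1 ('D_(delta_mx 0 i) h) x (Ck_derive _ Ch) Ux).
have E : \sum_i w 0 i * radial k.+1 ('D_(delta_mx 0 i) h) x =
    int01 (fun t => t ^+ k.+1 * 'D_w h (gam t x)).
  rewrite (eq_bigr (fun i => int01 (fun t => w 0 i * (t ^+ k.+1 * 'D_(delta_mx 0 i) h (gam t x))))).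
    rewrite -int01_sum; last by move=> i; apply: cont01M => //; exact: cont01_cst.
    apply: int01_eq => t t01.
    rewrite (C1_deriveE _ oU (Ck1_C1 Ch) (starU Ux t01)) mulr_sumr.
    by apply: eq_bigr => i _; rewrite mulrCA.
  by move=> i _; rewrite int01Z.
have c1 : cont01 (fun t => k.+1%:R * (t ^+ k * h (gam t x))).
  by apply: cont01M; [exact: cont01_cst | exact: radial_cont01].
have c2 : cont01 (fun t => t ^+ k.+1 * 'D_w h (gam t x)).
  exact: (@radial_cont01 k.+1 ('D_w h) x (Ck_derive _ Ch) Ux).
rewrite E /radial -int01Z; last exact: radial_cont01.
rewrite -int01D//.
have dF (t : R) : 0 <= t <= 1 -> is_derive t 1 (fun t => t ^+ k.+1 * h (gam t x))
    (k.+1%:R * (t ^+ k * h (gam t x)) + t ^+ k.+1 * 'D_w h (gam t x)).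
  move=> t01.
  have dh : is_derive t 1 (fun t => h (gam t x)) ('D_w h (gam t x)).
    by apply: is_derive_line; apply: Ck_derivable Ch _; exact: starU.
  have -> : k.+1%:R * (t ^+ k * h (gam t x)) + t ^+ k.+1 * 'D_w h (gam t x) =
    t ^+ k.+1 *: 'D_w h (gam t x) + h (gam t x) *: (k.+1%:R * t ^+ k).
    rewrite /GRing.scale /=; ring.
  have dt : is_derive t 1 (fun t : R => t ^+ k.+1) (k.+1%:R * t ^+ k).
    apply: DeriveDef; first exact: exprn_derivable.
    by rewrite exp_derive /GRing.scale /= mulr1.
  exact: is_deriveM.
rewrite (int01_FTC (cont01D c1 c2) dF).
by rewrite expr1n expr0n /= mul0r subr0 mul1r /gam scale1r addrC subrK.
Qed.

End RadialIntegral.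

Section Poincare.
Variables (R : realType) (m : nat) (U : set 'rV[R]_m) (x0 : 'rV[R]_m).
Hypotheses (oU : open U)
  (starU : forall x (t : R), U x -> 0 <= t <= 1 -> U (x0 + t *: (x - x0))).

Local Notation "''D[' i ] f" := (derive f ^~ (delta_mx 0 i : 'rV[R]_m)) (at level 10, f at level 9).

Lemma radial_ext k (h g : 'rV[R]_m -> R) x : (forall y, U y -> h y = g y) -> U x ->
  radial x0 k h x = radial x0 k g x.
Proof. by move=> hg Ux; apply: int01_eq => t t01; rewrite hg//; exact: starU. Qed.

Opaque radial.

Lemma is_derive_radial_sum k (a : 'I_m -> 'rV[R]_m -> R) x v :
  (forall i, Ck 1 U (a i)) -> U x ->
  is_derive x v (fun y => \sum_i (y - x0) 0 i * radial x0 k (a i) y)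
    (\sum_i (v 0 i * radial x0 k (a i) x + (x - x0) 0 i * radial x0 k.+1 ('D_v (a i)) x)).
Proof.
move=> Ca Ux.
rewrite (_ : (fun y => _) = \sum_i (fun y => (y - x0) 0 i * radial x0 k (a i) y)); last first.
  by apply/funext => y; rewrite fct_sumE.
apply: is_derive_sum => i.
have d1 : is_derive x v (fun y : 'rV[R]_m => (y - x0) 0 i) (v 0 i).
  rewrite (_ : (fun y => _) = (fun y : 'rV[R]_m => y 0 i) - cst (x0 0 i)); last first.
    by apply/funext => y; rewrite !mxE.
  rewrite -[X in is_derive _ _ _ X]subr0; apply: is_deriveB; exact: is_derive_coord.
have d2 := is_derive_radial oU starU k v (Ca i) Ux.
have -> : v 0 i * radial x0 k (a i) x + (x - x0) 0 i * radial x0 k.+1 ('D_v (a i)) x =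
   (x - x0) 0 i *: radial x0 k.+1 ('D_v (a i)) x + radial x0 k (a i) x *: v 0 i.
  by rewrite /GRing.scale /=; ring.
exact: is_deriveM.
Qed.

Lemma Ck_radial_sum n k (a : 'I_m -> 'rV[R]_m -> R) : (forall i, Ck n U (a i)) ->
  Ck n U (fun y => \sum_i (y - x0) 0 i * radial x0 k (a i) y).
Proof.
move=> Ca; apply: Ck_sum => // i; apply: CkM => //; last exact: (Ck_radial oU starU).
apply: (Ck_ext oU (f := fun y : 'rV[R]_m => y 0 i - x0 0 i)).
  by move=> y _; rewrite !mxE.
by apply: CkB => //; [exact: Ck_coord | exact: Ck_cst].
Qed.

Theorem poincare1 (a : 'I_m -> 'rV[R]_m -> R) :
  (forall i, smooth_on U (a i)) ->
  (forall i j x, U x -> 'D[i] (a j) x = 'D[j] (a i) x) ->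
  exists2 phi : 'rV[R]_m -> R, smooth_on U phi &
    forall x v, U x -> 'D_v phi x = \sum_i v 0 i * a i x.
Proof.
(* The potential is the integral of the form along the ray from [x0] to [y]. *)
move=> Sa cl; exists (fun y => \sum_i (y - x0) 0 i * radial x0 0 (a i) y).
  by move=> n; apply: Ck_radial_sum => i; exact: Sa.
move=> x v Ux; have Ca i := Sa i 1%N.
have [_ ->] := is_derive_radial_sum 0 v Ca Ux.
have C0 i j : Ck 0 U ('D[i] (a j)) by exact: Ck_derive (Ca j).
(* Closedness exchanges the two indices in the derivatives of the coefficients, so that the sum over
   [i] becomes the Euler term of [radial_euler] for each coefficient [a j]. *)
rewrite big_split /=; under [X in _ + X]eq_bigr => i _.
  rewrite (@radial_ext _ _ (fun y => \sum_j v 0 j * 'D[i] (a j) y)) //; last first.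
    move=> y Uy; rewrite (C1_deriveE _ oU (Ck1_C1 (Ca i)) Uy).
    by apply: eq_bigr => j _; rewrite cl.
  rewrite (radial_sum starU)//; last by move=> j; apply: CkM => //; exact: Ck_cst.
  under eq_bigr => j _ do rewrite (radialZ starU)//.
  rewrite mulr_sumr.
  over.
rewrite exchange_big /= -big_split /=; apply: eq_bigr => j _.
rewrite -(radial_euler oU starU 0 (Ca j) Ux) mul1r mulrDr mulr_sumr; congr (_ + _).
by apply: eq_bigr => i _; rewrite mulrCA.
Qed.

Lemma derive_radial_sum_delta k (a : 'I_m -> 'rV[R]_m -> R) x l :
  (forall i, Ck 1 U (a i)) -> U x ->
  'D[l] (fun y => \sum_i (y - x0) 0 i * radial x0 k (a i) y) x =
    radial x0 k (a l) x + \sum_i (x - x0) 0 i * radial x0 k.+1 ('D[l] (a i)) x.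
Proof.
move=> Ca Ux; have [_ ->] := is_derive_radial_sum k (delta_mx 0 l) Ca Ux.
rewrite big_split /=; congr (_ + _); rewrite (bigD1 l)//= mxE !eqxx mul1r big1 ?addr0// => i ik.
by rewrite mxE eqxx (negbTE ik) mul0r.
Qed.

Theorem poincare2 (f : 'I_m -> 'I_m -> 'rV[R]_m -> R) :
  (forall i j, smooth_on U (f i j)) ->
  (forall i j x, U x -> f i j x = - f j i x) ->
  (forall i j k x, U x -> 'D[i] (f j k) x - 'D[j] (f i k) x + 'D[k] (f i j) x = 0) ->
  exists2 a : 'I_m -> 'rV[R]_m -> R, (forall i, smooth_on U (a i)) &
    forall i j x, U x -> 'D[i] (a j) x - 'D[j] (a i) x = f i j x.
Proof.
move=> Sf anti cl.
(* The 2-form is contracted with the ray. The weight t gives the factor 2 in [radial_euler], which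
   matches the two equal contributions of the antisymmetric pair [f l j], [f j l]. *)
exists (fun j y => \sum_i (y - x0) 0 i * radial x0 1 (f i j) y).
  by move=> j n; apply: Ck_radial_sum => i; exact: Sf.
move=> l j x Ux; have Cf p q := Sf p q 1%N.
have C0 p q r : Ck 0 U ('D[p] (f q r)) by exact: Ck_derive (Cf q r).
rewrite (derive_radial_sum_delta 1 l (fun i => Cf i j) Ux).
rewrite (derive_radial_sum_delta 1 j (fun i => Cf i l) Ux).
have -> : radial x0 1 (f j l) x = - radial x0 1 (f l j) x.
  rewrite -mulN1r -(radialZ starU)//; last exact: CkW.
  by apply: radial_ext => // y Uy; rewrite mulN1r anti.
rewrite -(radial_euler oU starU 1 (Cf l j) Ux).
have aux (r S1 S2 S3 : R) : S3 = S1 - S2 -> r + S1 - (- r + S2) = 2%:R * r + S3.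
  by move=> ->; ring.
apply: aux.
rewrite -sumrB; apply: eq_bigr => i _; rewrite -mulrBr; congr (_ * _).
rewrite (@radial_ext _ _ (fun y => 'D[l] (f i j) y + -1 * 'D[j] (f i l) y)) //; last first.
  move=> y Uy; have h1 := cl i l j y Uy.
  by rewrite mulN1r; apply/eqP; rewrite -subr_eq0 opprB addrA addrAC -h1; apply/eqP; ring.
rewrite (radialD starU)//; last by apply: CkM => //; exact: Ck_cst.
by rewrite (radialZ starU)// mulN1r.
Qed.

End Poincare.

(** * Manifolds *)

Section SmoothMaps.
Variable R : realType.

Lemma open_preim (X Y : topologicalType) (U : set X) (V : set Y) (p : X -> Y) :
  open U -> (forall x, U x -> {for x, continuous p}) -> open V ->
  open (U `&` p @^-1` V).
Proof.
move=> oU cp oV; rewrite openE => x [Ux Vpx].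
have h : nbhs x (p @^-1` V) by apply: cp => //; exact: open_nbhs_nbhs.
exact: filterI (open_near oU Ux) h.
Qed.

Lemma smooth_sub m (W : normedModType R) (U U' : set 'rV[R]_m) (f : 'rV[R]_m -> W) :
  U' `<=` U -> smooth_on U f -> smooth_on U' f.
Proof. by move=> UU Sf k; apply: Ck_sub UU (Sf k). Qed.

Lemma smooth_ext m (W : normedModType R) (U : set 'rV[R]_m) (f g : 'rV[R]_m -> W) :
  open U -> (forall x, U x -> f x = g x) -> smooth_on U f -> smooth_on U g.
Proof. by move=> oU fg Sf k; apply: Ck_ext oU fg (Sf k). Qed.

Lemma smooth_coords m n (U : set 'rV[R]_m) (F : 'rV[R]_m -> 'rV[R]_n) : open U ->
  smooth_on U F <-> forall i, smooth_on U (fun x => F x 0 i).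
Proof.
move=> oU; split=> [SF i k|SF k]; first exact: ((Ck_coords k F oU).1 (SF k)).
by apply/Ck_coords => // i; exact: SF.
Qed.

Lemma smooth_comp m n (U : set 'rV[R]_m) (V : set 'rV[R]_n) (g : 'rV[R]_n -> R) F :
  open U -> open V -> (forall x, U x -> V (F x)) -> smooth_on V g -> smooth_on U F ->
  smooth_on U (fun x => g (F x)).
Proof. by move=> oU oV UV Sg SF k; apply: Ck_comp oU oV UV (Sg k) (SF k). Qed.

Lemma smooth_compV m n l (U : set 'rV[R]_m) (V : set 'rV[R]_n) (g : 'rV[R]_n -> 'rV[R]_l) F :
  open U -> open V -> (forall x, U x -> V (F x)) -> smooth_on V g -> smooth_on U F ->
  smooth_on U (fun x => g (F x)).
Proof.
move=> oU oV UV Sg SF; apply/smooth_coords => // i.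
exact: (smooth_comp oU oV UV ((smooth_coords g oV).1 Sg i) SF).
Qed.

Lemma smooth_id m (U : set 'rV[R]_m) : open U -> smooth_on U (id : 'rV[R]_m -> 'rV[R]_m).
Proof. by move=> oU; apply/smooth_coords => // i k; exact: Ck_coord. Qed.

Lemma smooth_lsubmx m n (U : set 'rV[R]_(m + n)) : open U -> smooth_on U (@lsubmx R 1 m n).
Proof.
move=> oU; apply/smooth_coords => // i k.
by apply: Ck_ext oU _ (Ck_coord k U (lshift n i)) => x _; rewrite mxE.
Qed.

Lemma smooth_rsubmx m n (U : set 'rV[R]_(m + n)) : open U -> smooth_on U (@rsubmx R 1 m n).
Proof.
move=> oU; apply/smooth_coords => // i k.
by apply: Ck_ext oU _ (Ck_coord k U (rshift m i)) => x _; rewrite mxE.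
Qed.

Lemma smooth_row_mx l m n (U : set 'rV[R]_l) (f : 'rV[R]_l -> 'rV[R]_m) (g : 'rV[R]_l -> 'rV[R]_n) :
  open U -> smooth_on U f -> smooth_on U g -> smooth_on U (fun x => row_mx (f x) (g x)).
Proof.
move=> oU Sf Sg; apply/smooth_coords => // i; case: (split_ordP i) => j ->.
  apply: (smooth_ext oU (f := fun x => f x 0 j)); first by move=> x _; rewrite row_mxEl.
  exact: (smooth_coords f oU).1.
apply: (smooth_ext oU (f := fun x => g x 0 j)); first by move=> x _; rewrite row_mxEr.
exact: (smooth_coords g oU).1.
Qed.

Lemma lsubmx_continuous m n : continuous (@lsubmx R 1 m n).
Proof.
move=> x; apply: continuous_coordP => i.
rewrite (_ : (fun y => _) = (fun y : 'rV[R]_(m + n) => y 0 (lshift n i))); last first.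
  by apply/funext => y; rewrite mxE.
exact: coord_continuous'.
Qed.

Lemma rsubmx_continuous m n : continuous (@rsubmx R 1 m n).
Proof.
move=> x; apply: continuous_coordP => i.
rewrite (_ : (fun y => _) = (fun y : 'rV[R]_(m + n) => y 0 (rshift m i))); last first.
  by apply/funext => y; rewrite mxE.
exact: coord_continuous'.
Qed.

Lemma row_mx_continuous (X : topologicalType) m n (f : X -> 'rV[R]_m) (g : X -> 'rV[R]_n) x :
  {for x, continuous f} -> {for x, continuous g} ->
  {for x, continuous (fun y => row_mx (f y) (g y))}.
Proof.
move=> cf cg; apply: continuous_coordP => i; case: (split_ordP i) => j ->.
  rewrite (_ : (fun y => _) = (fun y => f y 0 j)); first exact: continuous_coord.
  by apply/funext => y; rewrite row_mxEl.
rewrite (_ : (fun y => _) = (fun y => g y 0 j)); first exact: continuous_coord.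
by apply/funext => y; rewrite row_mxEr.
Qed.

(** [r] is the chart and [p] its inverse. Through [lc_smooth] every plot into [D] factors as [p]
    after a smooth map, hence a smooth form on [D] is determined by its values on the single plot
    [p]. *)
Record local_chart (M : smoothSpace R) (N : nat) (U : set 'rV[R]_N) (p : 'rV[R]_N -> M)
    (r : M -> 'rV[R]_N) (D : set M) : Prop := LocalChart {
  lc_open : open D;
  lc_plot : plot M U p;
  lc_pD : forall y, U y -> D (p y);
  lc_rp : forall y, U y -> r (p y) = y;
  lc_rU : forall z, D z -> U (r z);
  lc_pr : forall z, D z -> p (r z) = z;
  lc_cont : forall z, D z -> {for z, continuous r};
  lc_smooth : forall l (U' : set 'rV[R]_l) q, plot M U' q -> (forall y, U' y -> D (q y)) ->
     smooth_on U' (fun y => r (q y)) }.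

(** A [smoothSpace] is raw data, a topology and a family of plots. This is the interface through
    which all later arguments use a manifold; Lie groups satisfy it and it passes to products. *)
Record manifold (M : smoothSpace R) : Prop := Manifold {
  mf_open : forall m (U : set 'rV[R]_m) p, plot M U p -> open U;
  mf_cont : forall m (U : set 'rV[R]_m) p, plot M U p ->
    forall x, U x -> {for x, continuous p};
  mf_comp : forall m l (U : set 'rV[R]_m) (U' : set 'rV[R]_l) p f, plot M U p ->
    open U' -> smooth_on U' f -> (forall y, U' y -> U (f y)) -> plot M U' (p \o f);
  mf_ext : forall m (U : set 'rV[R]_m) p q, plot M U p -> (forall x, U x -> p x = q x) ->
    plot M U q;
  mf_chart : forall x, exists N (U : set 'rV[R]_N) p r D, @local_chart M N U p r D /\ D x }.

Lemma mf_sub (M : smoothSpace R) m (U U' : set 'rV[R]_m) p :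
  manifold M -> plot M U p -> open U' -> U' `<=` U -> plot M U' p.
Proof.
move=> mM Pp oU' UU; have := mf_comp mM Pp oU' (smooth_id oU') UU.
by apply.
Qed.

(** Chart images are shrunk to balls because these are star-shaped around the image of [x], as the
    Poincare lemmas and the radial contraction require. *)
Lemma mf_ball (M : smoothSpace R) (x : M) (V : set M) : manifold M -> open V -> V x ->
  exists N (x0 : 'rV[R]_N) (e : R) p r D,
    [/\ 0 < e, @local_chart M N (ball x0 e) p r D, D x, r x = x0 & D `<=` V].
Proof.
move=> mM oV Vx; have [N [U [p [r [D [C Dx]]]]]] := mf_chart mM x.
have Urx := lc_rU C Dx.
have oUV : open (U `&` p @^-1` V).
  by apply: open_preim oV; [exact: (mf_open mM (lc_plot C)) | exact: (mf_cont mM (lc_plot C))].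
have : nbhs (r x) (U `&` p @^-1` V).
  by apply: open_nbhs_nbhs; split=> //; split=> //=; rewrite (lc_pr C).
move=> /nbhs_ballP[e /= e0 He].
have ob : open (ball (r x) e) by exact: ball_open.
exists N, (r x), e, p, r, (D `&` r @^-1` (ball (r x) e)); split => //; first last.
- move=> z [Dz /= bz]; have := He _ bz; case=> _ /=; by rewrite (lc_pr C).
- by split => //=; exact: ballxx.
split.
- by apply: open_preim ob; [exact: (lc_open C) | exact: (lc_cont C)].
- by apply: (mf_sub mM (lc_plot C) ob) => y /He [].
- by move=> y by_; have [Uy _] := He _ by_; split; [exact: (lc_pD C) | rewrite /= (lc_rp C)].
- by move=> y /He[Uy _]; exact: (lc_rp C).
- by move=> z [_].
- by move=> z [Dz _]; exact: (lc_pr C).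
- by move=> z [Dz _]; exact: (lc_cont C).
- by move=> l U' q Pq qD; apply: (lc_smooth C Pq) => y /qD[].
Qed.

Definition smooth_map (M N : smoothSpace R) (f : M -> N) : Prop :=
  forall m (U : set 'rV[R]_m) p, plot M U p -> plot N U (f \o p).

(** Near [x] the map is the plot [f \o p] after the continuous chart [r]. *)
Lemma smooth_map_continuous (M N : smoothSpace R) (f : M -> N) :
  manifold M -> manifold N -> smooth_map f -> continuous f.
Proof.
move=> mM mN Sf x; have [n [U [p [r [D [C Dx]]]]]] := mf_chart mM x.
have cpr : {for x, continuous (fun z => f (p (r z)))}.
  apply: (@continuous_comp _ _ _ r (f \o p)); first exact: (lc_cont C Dx).
  exact: (mf_cont mN (Sf _ _ _ (lc_plot C)) (lc_rU C Dx)).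
apply: near_eq_continuous cpr; apply: near_all (lc_open C) Dx _ => z Dz.
by rewrite (lc_pr C).
Qed.

Lemma manifold_lie (G : lieGroup R) : manifold (lie_space G).
Proof.
pose A := lie_atlas G.
split.
- by move=> m U p [].
- by move=> m U p [_ [cp _]].
- move=> m l U U' p f [oU [cp Sp]] oU' Sf UU; split => //; split.
    move=> y U'y; apply: continuous_comp; last by apply: cp; exact: UU.
    exact: Ck_continuous (Sf 0%N) U'y.
  move=> a; have oUa : open (U `&` p @^-1` chart_dom A a).
    exact: open_preim oU cp (@chart_dom_open _ _ _ A a).
  have cpf y : U' y -> {for y, continuous (p \o f)}.
    move=> U'y; apply: continuous_comp; last by apply: cp; exact: UU.
    exact: Ck_continuous (Sf 0%N) U'y.
  have oU'a : open (U' `&` (p \o f) @^-1` chart_dom A a).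
    exact: open_preim oU' cpf (@chart_dom_open _ _ _ A a).
  apply: (smooth_compV oU'a oUa _ (Sp a)).
    by move=> y [U'y /= day]; split => //; exact: UU.
  by apply: smooth_sub Sf => y [].
- move=> m U p q [oU [cp Sp]] pq; split => //; split.
    by move=> x Ux; apply: near_eq_continuous (cp _ Ux); exact: near_all oU Ux _.
  move=> a; have Eset : U `&` q @^-1` chart_dom A a = U `&` p @^-1` chart_dom A a.
    by apply/seteqP; split => y [Uy /=]; [rewrite -pq | rewrite pq].
  rewrite Eset; apply: smooth_ext (Sp a).
    exact: open_preim oU cp (@chart_dom_open _ _ _ A a).
  by move=> x [Ux _] /=; rewrite pq.
- move=> x; have [a ax] := @chart_cover _ _ _ A x.
  exists (lie_dim G), (chart_map A a @` chart_dom A a), (chart_inv A a), (chart_map A a),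
    (chart_dom A a); split => //; split.
  + exact: chart_dom_open.
  + split; first exact: chart_img_open.
    split; first by move=> y; exact: chart_inv_continuous.
    move=> b; apply: smooth_sub (@chart_smooth _ _ _ A a b) => y [[z az <-]] /=.
    by rewrite chart_mapK// => bz; exists z.
  + by move=> _ [z az <-]; rewrite chart_mapK.
  + by move=> _ [z az <-]; rewrite chart_mapK.
  + by move=> z az; exists z.
  + by move=> z az; rewrite chart_mapK.
  + by move=> z; exact: chart_map_continuous.
  + move=> l U' q [oU' [cq Sq]] qD; apply: smooth_sub (Sq a) => y U'y.
    by split => //=; exact: qD.
Qed.

Lemma manifold_prod (M N : smoothSpace R) : manifold M -> manifold N ->
  manifold (prod_space M N).
Proof.
move=> mM mN; split.
- by move=> m U p [/(mf_open mM)].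
- move=> m U p [Pp Pq] x Ux.
  rewrite (_ : p = fun z => ((fst \o p) z, (snd \o p) z)).
    exact: continuous_mkpair (mf_cont mM Pp Ux) (mf_cont mN Pq Ux).
  by apply/funext => y /=; case: (p y).
- move=> m l U U' p f [Pp Pq] oU' Sf UU; split.
    exact: (mf_comp mM Pp oU' Sf UU).
  exact: (mf_comp mN Pq oU' Sf UU).
- move=> m U p q [Pp Pq] pq; split.
    by apply: (mf_ext mM Pp) => x Ux /=; rewrite pq.
  by apply: (mf_ext mN Pq) => x Ux /=; rewrite pq.
- move=> [x y]; have [n1 [U1 [p1 [r1 [D1 [C1 Dx]]]]]] := mf_chart mM x.
  have [n2 [U2 [p2 [r2 [D2 [C2 Dy]]]]]] := mf_chart mN y.
  pose U : set 'rV[R]_(n1 + n2) := @lsubmx R 1 n1 n2 @^-1` U1 `&` @rsubmx R 1 n1 n2 @^-1` U2.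
  have oU : open U.
    apply: openI; apply: open_comp => //.
    + by move=> z _; exact: lsubmx_continuous.
    + exact: (mf_open mM (lc_plot C1)).
    + by move=> z _; exact: rsubmx_continuous.
    + exact: (mf_open mN (lc_plot C2)).
  exists (n1 + n2)%N, U, (fun z => (p1 (lsubmx z), p2 (rsubmx z))),
    (fun z => row_mx (r1 z.1) (r2 z.2)), (D1 `*` D2); split => //; split.
  + rewrite openE => -[a b] [/= Da Db]; apply: nbhs_setX => //.
      exact: (lc_open C1). exact: (lc_open C2).
  + split; [apply: (mf_comp mM (lc_plot C1) oU) | apply: (mf_comp mN (lc_plot C2) oU)].
    * exact: smooth_lsubmx.
    * by move=> z [].
    * exact: smooth_rsubmx.
    * by move=> z [].
  + by move=> z [/= ? ?]; split; [exact: (lc_pD C1) | exact: (lc_pD C2)].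
  + by move=> z [/= ? ?]; rewrite (lc_rp C1)// (lc_rp C2)// hsubmxK.
  + move=> [a b] [/= Da Db]; split=> /=.
      by rewrite row_mxKl; exact: (lc_rU C1).
    by rewrite row_mxKr; exact: (lc_rU C2).
  + by move=> [a b] [/= Da Db]; rewrite row_mxKl row_mxKr (lc_pr C1)// (lc_pr C2).
  + move=> [a b] [/= Da Db].
    apply: (@row_mx_continuous (M * N)%type _ _ (r1 \o fst) (r2 \o snd)).
      by apply: continuous_comp; [exact: cvg_fst | exact: (lc_cont C1)].
    by apply: continuous_comp; [exact: cvg_snd | exact: (lc_cont C2)].
  + move=> l U' q [Pq1 Pq2] qD.
    apply: smooth_row_mx; first exact: (mf_open mM Pq1).
      by apply: (lc_smooth C1 Pq1) => z /qD[].
    by apply: (lc_smooth C2 Pq2) => z /qD[].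
Qed.

End SmoothMaps.

(** * Simple connectedness of manifolds and products *)

Section SimplyConnected.
Variable R : realType.

Definition locally_radial (X : topologicalType) := forall x : X, exists O, exists rho : R * X -> X,
  [/\ open O, O x, forall y, O y -> rho (0, y) = x /\ rho (1, y) = y,
    forall t y, rho (t, y) = rho (clamp t, y) &
    forall t y, O y -> {for (t, y), continuous rho}].

Lemma within_clamp (Y X : topologicalType) (S : set Y) (k : Y -> Y) (c : Y -> X) :
  {within S, continuous c} -> continuous k -> (forall y, S (k y)) -> continuous (c \o k).
Proof.
move=> /subspace_continuousP cc ck Sk y Q nQ.
have /= h := cc _ (Sk y) _ nQ.
have h' : nbhs (k y) [set z | S z -> Q (c z)] by exact: h.
by apply: (nbhsS (ck _ _ h')) => z /= Hz; exact: Hz.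
Qed.

(** Paths and homotopies given on [0, 1] and on the square are extended to all real times by
    composition with [clamp]. *)
Lemma simplyConnected_of_radial (X : topologicalType) :
  simply_connected R X -> locally_radial X -> simplyConnected R X.
Proof.
move=> [path loop] rad; split => //.
- move=> x y; have [c [cc c0 c1]] := path x y; exists (c \o @clamp R); split.
  + apply: (within_clamp cc); first exact: clamp_continuous.
    by move=> t; rewrite set_itvE; exact: clamp_itv.
  + by move=> t /=; rewrite clampK.
  + by rewrite /= clamp0.
  + by rewrite /= clamp1.
- move=> c cc clc c01.
  have [|//|H [cH Hs Ht]] := loop c; first exact: continuous_subspaceT.
  exists (fun p => H (clamp p.1, clamp p.2)); split.
  + apply: (@within_clamp (R * R)%type _ _ (fun p => (clamp p.1, clamp p.2)) _ cH).
      move=> p; apply: (@continuous_mkpair (R * R)%type).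
        by apply: (@continuous_comp _ _ _ fst); [exact: cvg_fst | exact: clamp_continuous].
      by apply: (@continuous_comp _ _ _ snd); [exact: cvg_snd | exact: clamp_continuous].
    by move=> p; split; exact: clamp_itv.
  + by move=> s; rewrite /= clamp0 clc; exact: (Hs _ (clamp_itv s)).1.
  + by move=> s; rewrite /= clamp1; exact: (Hs _ (clamp_itv s)).2.
  + by move=> t; rewrite /= clamp0; exact: (Ht _ (clamp_itv t)).1.
  + by move=> t; rewrite /= clamp1; exact: (Ht _ (clamp_itv t)).2.
Qed.

(** The contraction runs along straight segments in a chart whose image is a ball centred at the
    image of [x]. *)
Lemma manifold_radial (M : smoothSpace R) : manifold M -> locally_radial M.
Proof.
move=> mM x; have [N [x0 [e [p [r [D [e0 C Dx rx _]]]]]]] := mf_ball mM openT (I : setT x).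
exists D, (fun ty => p ((1 - clamp ty.1) *: x0 + clamp ty.1 *: r ty.2)); split => //.
- exact: (lc_open C).
- move=> y Dy /=; rewrite clamp0 clamp1 subr0 subrr !scale0r !scale1r addr0 add0r.
  by rewrite -{1}rx (lc_pr C)// (lc_pr C).
- by move=> t y /=; rewrite clampK.
- move=> t y Dy; apply: (@continuous_comp (R * M)%type _ _
    (fun ty : R * M => (1 - clamp ty.1) *: x0 + clamp ty.1 *: r ty.2) p); last first.
    apply: (mf_cont mM (lc_plot C)) => /=.
    have := lc_rU C Dy; rewrite -!ball_normE /= => hb.
    rewrite (_ : x0 - _ = clamp t *: (x0 - r y)); last first.
      by apply/rowP => i; rewrite !mxE; ring.
    have /andP[t0 t1] := clamp_itv t.
    by rewrite normrZ ger0_norm// (le_lt_trans _ hb)// ler_piMl.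
  have cc : {for (t, y), continuous (fun ty : R * M => clamp ty.1)}.
    by apply: (@continuous_comp _ _ _ fst); [exact: cvg_fst | exact: clamp_continuous].
  have cr : {for (t, y), continuous (fun ty : R * M => r ty.2)}.
    by apply: (@continuous_comp _ _ _ snd); [exact: cvg_snd | exact: (lc_cont C)].
  apply: cvgD; apply: cvgZ => //; last exact: cvg_cst.
  by apply: cvgB => //; exact: cvg_cst.
Qed.

Lemma simplyConnected_prod (X Y : topologicalType) :
  simplyConnected R X -> simplyConnected R Y -> simplyConnected R (X * Y)%type.
Proof.
move=> SX SY; split.
- move=> [x y] [x' y']; have [c [cc clc c0 c1]] := sc_path SX x x'.
  have [d [cd cld d0 d1]] := sc_path SY y y'.
  exists (fun t => (c t, d t)); split; rewrite ?c0 ?d0 ?c1 ?d1//.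
    by move=> t; exact: continuous_mkpair (cc t) (cd t).
  by move=> t; rewrite clc cld.
- move=> c cc clc c01.
  have c1 : continuous (fst \o c).
    by move=> t; apply: continuous_comp; [exact: cc | exact: cvg_fst].
  have c2 : continuous (snd \o c).
    by move=> t; apply: continuous_comp; [exact: cc | exact: cvg_snd].
  have [|//=|H [cH h1 h2 h3 h4]] := sc_loop SX c1; [by move=> t /=; rewrite clc | by rewrite c01 | ].
  have [|//=|K [cK k1 k2 k3 k4]] := sc_loop SY c2; [by move=> t /=; rewrite clc | by rewrite c01 | ].
  exists (fun p => (H p, K p)); split.
  + by move=> p; exact: (@continuous_mkpair (R * R)%type) (cH p) (cK p).
  + by move=> s; rewrite h1 k1 /=; case: (c s).
  + by move=> s; rewrite h2 k2 /=; case: (c 0).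
  + by move=> s; rewrite h3 k3 /=; case: (c 0).
  + by move=> s; rewrite h4 k4 /=; case: (c 0).
- move=> [x y]; have [N1 [rho1 [oN1 Ox e1 cl1 c1]]] := sc_radial SX x.
  have [N2 [rho2 [oN2 Oy e2 cl2 c2]]] := sc_radial SY y.
  exists (N1 `*` N2), (fun p => (rho1 (p.1, p.2.1), rho2 (p.1, p.2.2))); split => //.
  + by rewrite openE => -[a b] [/= Oa Ob]; apply: nbhs_setX.
  + move=> [a b] [/= Oa Ob]; by rewrite /= !(e1 _ Oa).1 !(e1 _ Oa).2 (e2 _ Ob).1 (e2 _ Ob).2.
  + by move=> t [a b] /=; rewrite cl1 cl2.
  + move=> t [a b] [/= Oa Ob]; apply: (@continuous_mkpair (R * (X * Y))%type).
      apply: (@continuous_comp _ _ _ (fun p : R * (X * Y) => (p.1, p.2.1)) rho1); last exact: c1.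
      apply: (@continuous_mkpair (R * (X * Y))%type); first exact: cvg_fst.
      by apply: (@continuous_comp _ _ _ snd fst); [exact: cvg_snd | exact: cvg_fst].
    apply: (@continuous_comp _ _ _ (fun p : R * (X * Y) => (p.1, p.2.2)) rho2); last exact: c2.
    apply: (@continuous_mkpair (R * (X * Y))%type); first exact: cvg_fst.
    by apply: (@continuous_comp _ _ _ snd snd); exact: cvg_snd.
Qed.

End SimplyConnected.

(** * Calculus of vector-valued and bilinear expressions *)

Section VecCalc.
Variable R : realType.

Lemma is_derive_coordP (T : normedModType R) n (F : T -> 'rV[R]_n) x v (d : 'rV[R]_n) :
  (forall i, is_derive x v (fun y => F y 0 i) (d 0 i)) -> is_derive x v F d.
Proof.
move=> dF; have dfF : derivable F x v by apply: derivable_coordP => i; have [] := dF i.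
apply: DeriveDef => //; apply/rowP => i; rewrite derive_coord//.
by have [_ ->] := dF i.
Qed.

Lemma is_derive_coordE (T : normedModType R) n (F : T -> 'rV[R]_n) x v d i :
  is_derive x v F d -> is_derive x v (fun y => F y 0 i) (d 0 i).
Proof.
move=> [dF <-]; apply: DeriveDef; first exact: derivable_coord.
by rewrite derive_coord.
Qed.

Lemma chainV (T : normedModType R) m l (U : set 'rV[R]_m) (g : 'rV[R]_m -> 'rV[R]_l)
    (f : T -> 'rV[R]_m) x v d :
  open U -> Ck 1 U g -> U (f x) -> is_derive x v f d ->
  is_derive x v (fun y => g (f y)) ('D_d g (f x)).
Proof.
move=> oU Cg Ufx [df <-]; apply: is_derive_coordP => i.
have Ci := (Ck_coords 1 g oU).1 Cg i.
rewrite derive_coord; last exact: Ck_derivable Cg Ufx.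
exact: (@C1_chain R m T U (fun z => g z 0 i) f x v oU (Ck1_C1 Ci) Ufx df).
Qed.

Lemma Ck1_is_derive m (W : normedModType R) (U : set 'rV[R]_m) (g : 'rV[R]_m -> W) x v :
  Ck 1 U g -> U x -> is_derive x v g ('D_v g x).
Proof. by move=> Cg Ux; apply: DeriveDef => //; exact: Ck_derivable Cg Ux. Qed.

Lemma deriveV_lin m l (U : set 'rV[R]_m) (g : 'rV[R]_m -> 'rV[R]_l) x (c : R) u v :
  open U -> Ck 1 U g -> U x -> 'D_(c *: u + v) g x = c *: 'D_u g x + 'D_v g x.
Proof.
move=> oU Cg Ux; apply/rowP => i; rewrite !mxE.
rewrite !derive_coord; try exact: Ck_derivable Cg Ux.
have Ci := Ck1_C1 ((Ck_coords 1 g oU).1 Cg i).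
by rewrite (C1_deriveD _ _ oU Ci Ux) (C1_deriveZ _ _ Ci Ux).
Qed.

Lemma deriveV_sum m l (U : set 'rV[R]_m) (g : 'rV[R]_m -> 'rV[R]_l) x n (c : 'I_n -> R)
    (v : 'I_n -> 'rV[R]_m) :
  open U -> Ck 1 U g -> U x ->
  'D_(\sum_i c i *: v i) g x = \sum_i c i *: 'D_(v i) g x.
Proof.
move=> oU Cg Ux; apply: (big_ind2 (fun u r => 'D_u g x = r)).
- exact: derive0.
- by move=> u r u' r' <- <-; rewrite -{1}[u]scale1r (deriveV_lin _ _ _ oU Cg Ux) scale1r.
- by move=> i _; rewrite -[c i *: v i]addr0 (deriveV_lin _ _ _ oU Cg Ux) derive0 addr0.
Qed.

Lemma schwarzV m l (U : set 'rV[R]_m) (g : 'rV[R]_m -> 'rV[R]_l) x u v :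
  open U -> Ck 2 U g -> U x -> 'D_u ('D_v g) x = 'D_v ('D_u g) x.
Proof.
move=> oU Cg Ux; apply/rowP => i.
have E w w' : ('D_w ('D_w' g) x) 0 i = 'D_w ('D_w' (fun y => g y 0 i)) x.
  rewrite derive_coord; last by apply: Ck_derivable (Ck_derive w' Cg) Ux.
  apply: near_eq_derive; apply: near_all oU Ux _ => y Uy.
  by rewrite derive_coord//; exact: Ck_derivable (CkW Cg) Uy.
apply: (etrans (E u v)); apply: (etrans _ (esym (E v u))).
exact: (@schwarz R m U (fun y => g y 0 i) oU ((Ck_coords 2 g oU).1 Cg i) x u v Ux).
Qed.

Lemma is_derive_sumR (T : normedModType R) n (f : 'I_n -> T -> R) (d : 'I_n -> R) x v :
  (forall i, is_derive x v (f i) (d i)) ->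
  is_derive x v (fun y => \sum_i f i y) (\sum_i d i).
Proof.
move=> df; rewrite (_ : (fun y => _) = \sum_i f i); first exact: is_derive_sum.
by apply/funext => y; rewrite fct_sumE.
Qed.

Lemma is_derive_mulR (T : normedModType R) (f g : T -> R) (df dg : R) x v :
  is_derive x v f df -> is_derive x v g dg ->
  is_derive x v (fun y => f y * g y) (df * g x + f x * dg).
Proof.
move=> hf hg; have -> : df * g x + f x * dg = f x *: dg + g x *: df.
  by rewrite /GRing.scale /=; ring.
exact: is_deriveM.
Qed.

Section Bilinear.
Variables (m n : nat) (b : 'rV[R]_m -> 'rV[R]_n -> R).
Hypotheses (blin : forall c u v w, b (c *: u + v) w = c * b u w + b v w)
  (brin : forall c u v w, b w (c *: u + v) = c * b w u + b w v).

Lemma bilin0l w : b 0 w = 0.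
Proof. by have := blin (-1) 0 0 w; rewrite scaler0 addr0 mulN1r addNr. Qed.

Lemma bilin0r w : b w 0 = 0.
Proof. by have := brin (-1) 0 0 w; rewrite scaler0 addr0 mulN1r addNr. Qed.

Lemma bilin_suml k (c : 'I_k -> R) (u : 'I_k -> 'rV[R]_m) w :
  b (\sum_i c i *: u i) w = \sum_i c i * b (u i) w.
Proof.
apply: (big_ind2 (fun u r => b u w = r)) => [|u1 r1 u2 r2 <- <-|i _].
- exact: bilin0l.
- by rewrite -{1}[u1]scale1r blin mul1r.
- by rewrite -[X in b X]addr0 blin bilin0l addr0.
Qed.

Lemma bilin_sumr k (c : 'I_k -> R) (u : 'I_k -> 'rV[R]_n) w :
  b w (\sum_i c i *: u i) = \sum_i c i * b w (u i).
Proof.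
apply: (big_ind2 (fun u r => b w u = r)) => [|u1 r1 u2 r2 <- <-|i _].
- exact: bilin0r.
- by rewrite -{1}[u1]scale1r brin mul1r.
- by rewrite -[X in b _ X]addr0 brin bilin0r addr0.
Qed.

(** Bilinear maps such as the inner product are given by algebraic laws alone; the expansion in
    coordinates yields their smoothness and product rule. *)
Lemma bilinE u w : b u w = \sum_i \sum_j u 0 i * w 0 j * b (delta_mx 0 i) (delta_mx 0 j).
Proof.
rewrite {1}[u]row_sum_delta bilin_suml; apply: eq_bigr => i _.
rewrite {1}[w]row_sum_delta bilin_sumr mulr_sumr; apply: eq_bigr => j _.
by rewrite mulrA.
Qed.

Lemma is_derive_bilin (T : normedModType R) (F : T -> 'rV[R]_m) (H : T -> 'rV[R]_n) x v dF dH :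
  is_derive x v F dF -> is_derive x v H dH ->
  is_derive x v (fun y => b (F y) (H y)) (b dF (H x) + b (F x) dH).
Proof.
move=> hF hH.
rewrite (_ : (fun y => _) = (fun y => \sum_i \sum_j
   F y 0 i * H y 0 j * b (delta_mx 0 i) (delta_mx 0 j))); last first.
  by apply/funext => y; exact: bilinE.
rewrite (bilinE dF) (bilinE _ dH) -big_split /=; apply: is_derive_sumR => i.
rewrite -big_split /=; apply: is_derive_sumR => j.
have := is_derive_mulR (is_derive_mulR (is_derive_coordE i hF) (is_derive_coordE j hH))
  (is_derive_cst (b (delta_mx 0 i) (delta_mx 0 j)) x v).
by rewrite mulr0 addr0 mulrDl.
Qed.

Lemma smooth_bilin l (U : set 'rV[R]_l) F H : open U -> smooth_on U F -> smooth_on U H ->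
  smooth_on U (fun y => b (F y) (H y)).
Proof.
move=> oU SF SH k.
apply: (Ck_ext oU (f := fun y => \sum_i \sum_j
   F y 0 i * H y 0 j * b (delta_mx 0 i) (delta_mx 0 j))).
  by move=> y _; rewrite [RHS]bilinE.
apply: Ck_sum => // i; apply: Ck_sum => // j; apply: CkM => //; last exact: Ck_cst.
by apply: CkM => //; [exact: (Ck_coords k F oU).1 | exact: (Ck_coords k H oU).1].
Qed.

End Bilinear.

Lemma is_derive_lin_comp (T : normedModType R) m n (L : 'rV[R]_m -> 'rV[R]_n)
    (F : T -> 'rV[R]_m) x v dF :
  (forall (c : R) u w, L (c *: u + w) = c *: L u + L w) -> is_derive x v F dF ->
  is_derive x v (fun y => L (F y)) (L dF).
Proof.
move=> lin hF; have L0 : L 0 = 0.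
  by have := lin (-1) 0 0; rewrite scaler0 addr0 scaleN1r addNr.
have LE u : L u = \sum_i u 0 i *: L (delta_mx 0 i).
  rewrite {1}[u]row_sum_delta; apply: (big_ind2 (fun u r => L u = r)) => [//|u1 r1 u2 r2 <- <-|i _].
    by rewrite -{1}[u1]scale1r lin scale1r.
  by rewrite -[X in L X]addr0 lin L0 addr0.
apply: is_derive_coordP => j.
rewrite (_ : (fun y => _) = (fun y => \sum_i F y 0 i * L (delta_mx 0 i) 0 j)); last first.
  by apply/funext => y; rewrite LE summxE; apply: eq_bigr => i _; rewrite mxE.
rewrite LE summxE; apply: is_derive_sumR => i; rewrite mxE.
have := is_derive_mulR (is_derive_coordE i hF) (is_derive_cst (L (delta_mx 0 i) 0 j) x v).
by rewrite mulr0 addr0.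
Qed.

Lemma is_derive_row_mx (T : normedModType R) m n (f : T -> 'rV[R]_m) (g : T -> 'rV[R]_n)
    x v df dg : is_derive x v f df -> is_derive x v g dg ->
  is_derive x v (fun y => row_mx (f y) (g y)) (row_mx df dg).
Proof.
move=> hf hg; apply: is_derive_coordP => i; case: (split_ordP i) => j ->.
  rewrite row_mxEl (_ : (fun y => _) = (fun y => f y 0 j)); first exact: is_derive_coordE.
  by apply/funext => y; rewrite row_mxEl.
rewrite row_mxEr (_ : (fun y => _) = (fun y => g y 0 j)); first exact: is_derive_coordE.
by apply/funext => y; rewrite row_mxEr.
Qed.

Lemma partial2 m1 m2 l (U : set 'rV[R]_(m1 + m2)) (phi : 'rV[R]_(m1 + m2) -> 'rV[R]_l) x y v :
  open U -> Ck 1 U phi -> U (row_mx x y) ->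
  is_derive y v (fun y => phi (row_mx x y)) ('D_(row_mx 0 v) phi (row_mx x y)).
Proof.
move=> oU Cp Uxy.
exact: (chainV (f := fun y => row_mx x y) oU Cp Uxy
  (is_derive_row_mx (is_derive_cst x y v) (is_derive_id y v))).
Qed.

Lemma partial1 m1 m2 l (U : set 'rV[R]_(m1 + m2)) (phi : 'rV[R]_(m1 + m2) -> 'rV[R]_l) x y v :
  open U -> Ck 1 U phi -> U (row_mx x y) ->
  is_derive x v (fun x => phi (row_mx x y)) ('D_(row_mx v 0) phi (row_mx x y)).
Proof.
move=> oU Cp Uxy.
exact: (chainV (f := fun x => row_mx x y) oU Cp Uxy
  (is_derive_row_mx (is_derive_id x v) (is_derive_cst y x v))).
Qed.

End VecCalc.

(** * Maurer-Cartan forms *)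

Section LieCalculus.
Variables (R : realType) (G : lieGroup R).
Let n := lie_dim G.
Local Notation A := (lie_atlas G).
Local Notation c := (@lie_chart R G).
Local Notation ci := (@lie_chart_inv R G).
Local Notation e := (c 1%g).
Local Notation D := (chart_dom A (chart_at_1 G)).
Local Notation W := (chart_map A (chart_at_1 G) @` chart_dom A (chart_at_1 G)).
Local Notation P := (@plot R (lie_space G) _).

Lemma D1 : D 1%g.
Proof. by rewrite /chart_at_1; exact: (projT2 (cid (chart_cover A 1%g))). Qed.

Lemma oD : open D. Proof. exact: chart_dom_open. Qed.
Lemma oW : open W. Proof. exact: chart_img_open. Qed.
Lemma W1 : W e. Proof. by exists 1%g => //; exact: D1. Qed.
Lemma cK g : D g -> ci (c g) = g. Proof. exact: chart_mapK. Qed.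
Lemma ciD s : W s -> D (ci s). Proof. by move=> [g Dg <-]; rewrite [ci _]cK. Qed.
Lemma ciK s : W s -> c (ci s) = s. Proof. by move=> [g Dg <-]; rewrite [ci _]cK. Qed.
Lemma Wc g : D g -> W (c g). Proof. by exists g. Qed.
Lemma ci1 : ci e = 1%g. Proof. exact/cK/D1. Qed.

Lemma plot_open m (U : set 'rV[R]_m) p : P U p -> open U.
Proof. by case. Qed.

Lemma plot_continuous m (U : set 'rV[R]_m) p x : P U p -> U x -> {for x, continuous p}.
Proof. by move=> [_ [cp _]]; exact: cp. Qed.

Lemma plot_ci : P W ci.
Proof.
split; first exact: oW.
split; first by move=> s; exact: chart_inv_continuous.
move=> b; apply: smooth_sub (@chart_smooth _ _ _ A (chart_at_1 G) b) => y [[z az <-]] /=.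
by rewrite [lie_chart_inv _]cK// => bz; exists z.
Qed.

Lemma plot_cst m (U : set 'rV[R]_m) (g : G) : open U -> P U (fun=> g).
Proof.
move=> oU; split => //; split; first by move=> x _; exact: cst_continuous.
by move=> a k; exact: Ck_cst.
Qed.

Lemma plotM m (U : set 'rV[R]_m) p q : P U p -> P U q -> P U (fun x => p x * q x)%g.
Proof. by move=> [oU Sp] [_ Sq]; split=> //; exact: lie_mul_smooth. Qed.

Lemma plotV m (U : set 'rV[R]_m) p : P U p -> P U (fun x => (p x)^-1)%g.
Proof. by move=> [oU Sp]; split=> //; exact: lie_inv_smooth. Qed.

Lemma plot_comp m l (U : set 'rV[R]_m) (V : set 'rV[R]_l) p f : P U p -> open V ->
  smooth_on V f -> (forall y, V y -> U (f y)) -> P V (fun y => p (f y)).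
Proof. exact: (mf_comp (manifold_lie G)). Qed.

Lemma plot_openD m (U : set 'rV[R]_m) p : P U p -> open (U `&` p @^-1` D).
Proof. by move=> Pp; apply: open_preim oD; [exact: plot_open Pp | move=> x; exact: plot_continuous]. Qed.

Lemma plot_smooth m (U : set 'rV[R]_m) p : P U p ->
  smooth_on (U `&` p @^-1` D) (fun y => c (p y)).
Proof. by move=> [_ [_ Sp]]; exact: (Sp (chart_at_1 G)). Qed.

Lemma plot_is_derive m (U : set 'rV[R]_m) p x v : P U p -> U x -> D (p x) ->
  is_derive x v (fun y => c (p y)) ('D_v (fun y => c (p y)) x).
Proof.
move=> Pp Ux Dx; apply: (Ck1_is_derive v (plot_smooth Pp 1%N)).
by split.
Qed.

Lemma plot_chain m l (U : set 'rV[R]_m) p (Om : set 'rV[R]_n) (H : 'rV[R]_n -> 'rV[R]_l) x v :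
  P U p -> U x -> D (p x) -> open Om -> Ck 1 Om H -> Om (c (p x)) ->
  is_derive x v (fun y => H (c (p y))) ('D_('D_v (fun y => c (p y)) x) H (c (p x))).
Proof.
move=> Pp Ux Dx oO CH Ox.
exact: (chainV (f := fun y => c (p y)) oO CH Ox (plot_is_derive v Pp Ux Dx)).
Qed.

Lemma plot_nearD m (U : set 'rV[R]_m) p x : P U p -> U x -> D (p x) ->
  \forall y \near x, U y /\ D (p y).
Proof. by move=> Pp Ux Dx; exact: (open_near (plot_openD Pp) (conj Ux Dx)). Qed.

Lemma derive_c_lin m (U : set 'rV[R]_m) p x (a : R) u v : P U p -> U x -> D (p x) ->
  'D_(a *: u + v) (fun y => c (p y)) x =
  a *: 'D_u (fun y => c (p y)) x + 'D_v (fun y => c (p y)) x.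
Proof.
by move=> Pp Ux Dx; exact: (deriveV_lin a u v (plot_openD Pp) (plot_smooth Pp 1%N) (conj Ux Dx)).
Qed.

(* A plot is read near [x] through its left translate to the identity. *)
Lemma plot_left m (U : set 'rV[R]_m) p (g : G) : P U p -> P U (fun y => g * p y)%g.
Proof. by move=> Pp; apply: plotM => //; apply: plot_cst; exact: plot_open Pp. Qed.

Lemma plot_right m (U : set 'rV[R]_m) p (g : G) : P U p -> P U (fun y => p y * g)%g.
Proof. by move=> Pp; apply: plotM => //; apply: plot_cst; exact: plot_open Pp. Qed.

Lemma D1E g : g = 1%g -> D g. Proof. by move=> ->; exact: D1. Qed.

Lemma thetaL_lin m (U : set 'rV[R]_m) p x (a : R) (u w : 'rV[R]_m) : P U p -> U x ->
  thetaL p x (fun=> a *: u + w) = a *: thetaL p x (fun=> u) + thetaL p x (fun=> w).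
Proof.
move=> Pp Ux; apply: derive_c_lin (plot_left _ Pp) Ux _; apply: D1E; exact: mulVg.
Qed.

Lemma thetaR_lin m (U : set 'rV[R]_m) p x (a : R) (u w : 'rV[R]_m) : P U p -> U x ->
  thetaR p x (fun=> a *: u + w) = a *: thetaR p x (fun=> u) + thetaR p x (fun=> w).
Proof.
move=> Pp Ux; apply: derive_c_lin (plot_right _ Pp) Ux _; apply: D1E; exact: mulgV.
Qed.

Lemma thetaL_comp m l (U : set 'rV[R]_m) (V : set 'rV[R]_l) p q f y (v : 'I_1 -> 'rV[R]_l) :
  P U p -> open V -> Ck 1 V f -> V y -> U (f y) -> (forall y, V y -> q y = p (f y)) ->
  thetaL q y v = thetaL p (f y) (fun i => 'D_(v i) f y).
Proof.
move=> Pp oV Sf Vy Ufy qpf; rewrite /thetaL.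
rewrite (near_eq_derive (g := fun z => c ((p (f y))^-1 * p (f z))%g)); last first.
  by apply: (near_all oV Vy) => z Vz; rewrite (qpf y Vy) (qpf z Vz).
have Dy : D ((p (f y))^-1 * p (f y))%g by apply: D1E; exact: mulVg.
have Pl := plot_left (p (f y))^-1%g Pp.
have [_ ->//] := chainV (f := f) (plot_openD Pl) (plot_smooth Pl 1%N) (conj Ufy Dy)
  (Ck1_is_derive (v ord0) Sf Vy).
Qed.

Lemma thetaR_comp m l (U : set 'rV[R]_m) (V : set 'rV[R]_l) p q f y (v : 'I_1 -> 'rV[R]_l) :
  P U p -> open V -> Ck 1 V f -> V y -> U (f y) -> (forall y, V y -> q y = p (f y)) ->
  thetaR q y v = thetaR p (f y) (fun i => 'D_(v i) f y).
Proof.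
move=> Pp oV Sf Vy Ufy qpf; rewrite /thetaR.
rewrite (near_eq_derive (g := fun z => c (p (f z) * (p (f y))^-1)%g)); last first.
  by apply: (near_all oV Vy) => z Vz; rewrite (qpf y Vy) (qpf z Vz).
have Dy : D (p (f y) * (p (f y))^-1)%g by apply: D1E; exact: mulgV.
have Pl := plot_right (p (f y))^-1%g Pp.
have [_ ->//] := chainV (f := f) (plot_openD Pl) (plot_smooth Pl 1%N) (conj Ufy Dy)
  (Ck1_is_derive (v ord0) Sf Vy).
Qed.

(* [theta x v] is the derivative on the diagonal of [(x, y) |-> p x ^-1 * p y]
   in the second variable. *)
Lemma smooth_diag m (U : set 'rV[R]_m) (q : 'rV[R]_(m + m) -> G) (v : 'rV[R]_m) :
  open U -> P [set z | U (lsubmx z) /\ U (rsubmx z)] q ->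
  (forall x, U x -> q (row_mx x x) = 1%g) ->
  smooth_on U (fun x => 'D_v (fun y => c (q (row_mx x y))) x).
Proof.
move=> oU Pq q1; set V := [set z | _] in Pq.
pose Om := V `&` q @^-1` D; have oO : open Om by exact: plot_openD Pq.
have Sq : smooth_on Om (fun z => c (q z)) by exact: plot_smooth Pq.
have Od x : U x -> Om (row_mx x x).
  by move=> Ux; split; [rewrite /V /= row_mxKl row_mxKr | apply: D1E; exact: q1].
have Sd : smooth_on Om ('D_(row_mx 0 v) (fun z => c (q z))).
  by move=> k; exact: Ck_derive (Sq k.+1).
have Srow : smooth_on U (fun x : 'rV[R]_m => row_mx x x).
  by apply: smooth_row_mx => //; exact: smooth_id.
apply: smooth_ext (smooth_compV oU oO Od Sd Srow) => // x Ux.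
by have [_ ->] := partial2 v oO (Sq 1%N) (Od x Ux).
Qed.

Lemma smooth_thetaL m (U : set 'rV[R]_m) p (v : 'I_1 -> 'rV[R]_m) : P U p ->
  smooth_on U (fun x => thetaL p x v).
Proof.
move=> Pp; have oU := plot_open Pp.
have oV : open [set z : 'rV[R]_(m + m) | U (lsubmx z) /\ U (rsubmx z)].
  apply: openI; apply: open_comp => //.
    by move=> z _; exact: lsubmx_continuous.
  by move=> z _; exact: rsubmx_continuous.
have h := @smooth_diag m U (fun z => (p (lsubmx z))^-1 * p (rsubmx z))%g (v ord0) oU.
apply: smooth_ext oU _ (h _ _) => [x Ux||x Ux].
- apply: (congr1 (fun F => derive F x (v ord0))); apply/funext => y.
  by rewrite row_mxKl row_mxKr.
- apply: plotM; [apply: plotV|]; apply: (plot_comp Pp oV).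
  + exact: smooth_lsubmx.
  + by move=> z [].
  + exact: smooth_rsubmx.
  + by move=> z [].
- by rewrite row_mxKl row_mxKr mulVg.
Qed.

Definition conj_chart (g : G) (s : 'rV[R]_n) : 'rV[R]_n := c (g * ci s * g^-1)%g.

Lemma plot_conj m (U : set 'rV[R]_m) p (g : G) : P U p -> P U (fun y => g * p y * g^-1)%g.
Proof. by move=> Pp; apply: plot_right; exact: plot_left. Qed.

Lemma conjg1E (g : G) : (g * 1 * g^-1)%g = 1%g. Proof. by rewrite mulg1 mulgV. Qed.

Lemma conj_chart_e g : conj_chart g e = e.
Proof. by rewrite /conj_chart ci1 conjg1E. Qed.

Definition conj_dom (g : G) : set 'rV[R]_n := W `&` (fun s => g * ci s * g^-1)%g @^-1` D.

Lemma conj_dom_open g : open (conj_dom g).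
Proof. exact: plot_openD (plot_conj g plot_ci). Qed.

Lemma conj_dom_e g : conj_dom g e.
Proof. by split; [exact: W1 | rewrite /= ci1 conjg1E; exact: D1]. Qed.

Lemma conj_chart_smooth g : smooth_on (conj_dom g) (conj_chart g).
Proof. exact: plot_smooth (plot_conj g plot_ci). Qed.

Lemma AdE (g : G) (X : 'rV[R]_n) : @Ad R G g X = 'D_X (conj_chart g) e. Proof. by []. Qed.

Lemma Ad_lin (g : G) (a : R) (X Y : 'rV[R]_n) : Ad g (a *: X + Y) = a *: Ad g X + Ad g Y.
Proof. exact: (deriveV_lin a X Y (@conj_dom_open g) (@conj_chart_smooth g 1%N) (@conj_dom_e g)). Qed.

Lemma derive_conj m (U : set 'rV[R]_m) p x v (g : G) : P U p -> U x -> p x = 1%g ->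
  'D_v (fun y => c (g * p y * g^-1)%g) x = Ad g ('D_v (fun y => c (p y)) x).
Proof.
move=> Pp Ux px; have Dx := D1E px.
have Ox : conj_dom g (c (p x)) by rewrite px; exact: conj_dom_e.
have [_ E] := plot_chain v Pp Ux Dx (@conj_dom_open g) (@conj_chart_smooth g 1%N) Ox.
rewrite px in E; rewrite [RHS]AdE -E; apply: near_eq_derive.
have := plot_nearD Pp Ux Dx; apply: filterS => y [_ Dy].
by rewrite /conj_chart cK.
Qed.

Lemma AdM (g h : G) (X : 'rV[R]_n) : Ad (g * h)%g X = Ad g (Ad h X).
Proof.
have := @derive_conj _ _ _ e X g (plot_conj h plot_ci) W1.
rewrite ci1 conjg1E => /(_ erefl) <-; 
apply: (congr1 (fun F => derive F e X)); apply/funext => y.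
by rewrite invgM !mulgA.
Qed.

Lemma Ad1 (X : 'rV[R]_n) : @Ad R G 1%g X = X.
Proof.
rewrite /Ad (near_eq_derive (g := id)); first by rewrite derive_id.
apply: near_all oW W1 _ => y Wy.
by rewrite mul1g invg1 mulg1 [LHS]ciK.
Qed.

(** From p y (p x)^-1 = p x ((p x)^-1 p y) (p x)^-1, a conjugate of the curve whose derivative is
    [thetaL]. *)
Lemma thetaR_Ad m (U : set 'rV[R]_m) p x v : P U p -> U x ->
  thetaR p x v = Ad (p x) (thetaL p x v).
Proof.
move=> Pp Ux; rewrite -(derive_conj _ _ (plot_left _ Pp) Ux); last exact: mulVg.
apply: (congr1 (fun F => derive F x (v ord0))); apply/funext => y.
by rewrite mulgA mulgV mul1g.
Qed.

Definition mul_chart (z : 'rV[R]_(n + n)) : 'rV[R]_n :=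
  c (ci (lsubmx z) * ci (rsubmx z))%g.

Definition mul_dom : set 'rV[R]_(n + n) :=
  [set z | W (lsubmx z) /\ W (rsubmx z)] `&`
  (fun z => ci (lsubmx z) * ci (rsubmx z))%g @^-1` D.

Lemma oWW : open [set z : 'rV[R]_(n + n) | W (lsubmx z) /\ W (rsubmx z)].
Proof.
apply: openI; apply: open_comp; try exact: oW.
  by move=> z _; exact: lsubmx_continuous.
by move=> z _; exact: rsubmx_continuous.
Qed.

Lemma plot_cil : P [set z : 'rV[R]_(n + n) | W (lsubmx z) /\ W (rsubmx z)]
  (fun z => ci (lsubmx z)).
Proof. by apply: (plot_comp plot_ci oWW (smooth_lsubmx oWW)) => z []. Qed.

Lemma plot_cir : P [set z : 'rV[R]_(n + n) | W (lsubmx z) /\ W (rsubmx z)]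
  (fun z => ci (rsubmx z)).
Proof. by apply: (plot_comp plot_ci oWW (smooth_rsubmx oWW)) => z []. Qed.

Lemma mul_dom_open : open mul_dom.
Proof. exact: plot_openD (plotM plot_cil plot_cir). Qed.

Lemma mul_chart_smooth : smooth_on mul_dom mul_chart.
Proof. exact: plot_smooth (plotM plot_cil plot_cir). Qed.

Lemma mul_chartE s t : mul_chart (row_mx s t) = c (ci s * ci t)%g.
Proof. by rewrite /mul_chart row_mxKl row_mxKr. Qed.

Lemma mul_domE s t : W s -> W t -> D (ci s * ci t)%g -> mul_dom (row_mx s t).
Proof. by move=> Ws Wt Dst; split; rewrite /= row_mxKl row_mxKr. Qed.

Lemma mul_chart_sr s : W s -> mul_chart (row_mx s e) = s.
Proof. by move=> Ws; rewrite mul_chartE ci1 mulg1 [LHS]ciK. Qed.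

Lemma mul_chart_sl s : W s -> mul_chart (row_mx e s) = s.
Proof. by move=> Ws; rewrite mul_chartE ci1 mul1g [LHS]ciK. Qed.

Lemma mul_dom_sr s : W s -> mul_dom (row_mx s e).
Proof.
move=> Ws; apply: mul_domE => //; first exact: W1.
by rewrite ci1 mulg1; exact: ciD.
Qed.

Lemma mul_dom_sl s : W s -> mul_dom (row_mx e s).
Proof.
move=> Ws; apply: mul_domE => //; first exact: W1.
by rewrite ci1 mul1g; exact: ciD.
Qed.

Lemma derive_id_near (F : 'rV[R]_n -> 'rV[R]_n) (X : 'rV[R]_n) (s : 'rV[R]_n) :
  W s -> (forall t, W t -> F t = t) -> 'D_X F s = X.
Proof.
move=> Ws FE; rewrite (near_eq_derive (g := id)); first by rewrite derive_id.
by apply: (near_all oW Ws) => t Wt; exact: FE.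
Qed.

Lemma mul_partial1 (X : 'rV[R]_n) : 'D_(row_mx X 0) mul_chart (row_mx e e) = X.
Proof.
have [_ <-] := partial1 X mul_dom_open (@mul_chart_smooth 1%N) (mul_dom_sr W1).
by apply: derive_id_near; [exact: W1 | exact: mul_chart_sr].
Qed.

Lemma mul_partial2 (X : 'rV[R]_n) : 'D_(row_mx 0 X) mul_chart (row_mx e e) = X.
Proof.
have [_ <-] := partial2 X mul_dom_open (@mul_chart_smooth 1%N) (mul_dom_sr W1).
by apply: derive_id_near; [exact: W1 | exact: mul_chart_sl].
Qed.

Lemma row_mx_split (a b : 'rV[R]_n) : row_mx a b = 1 *: row_mx a 0 + row_mx 0 b.
Proof. by rewrite scale1r add_row_mx addr0 add0r. Qed.

(** Multiplication by 1 on either side is the identity, so both partial derivatives of the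
    multiplication at (1, 1) are the identity. *)
Lemma derive_mul m (U : set 'rV[R]_m) p q x v : P U p -> P U q -> U x ->
  p x = 1%g -> q x = 1%g ->
  'D_v (fun y => c (p y * q y)%g) x =
  'D_v (fun y => c (p y)) x + 'D_v (fun y => c (q y)) x.
Proof.
move=> Pp Pq Ux px qx; have Dp := D1E px; have Dq := D1E qx.
have hp := plot_is_derive v Pp Ux Dp; have hq := plot_is_derive v Pq Ux Dq.
have Ox : mul_dom (row_mx (c (p x)) (c (q x))).
  by rewrite px qx; apply: mul_dom_sr; exact: W1.
have [_ E] := chainV (f := fun y => row_mx (c (p y)) (c (q y))) mul_dom_open
  (@mul_chart_smooth 1%N) Ox (is_derive_row_mx hp hq).
rewrite px qx (row_mx_split ('D_v (fun y => c (p y)) x)) in E.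
rewrite (deriveV_lin _ _ _ mul_dom_open (@mul_chart_smooth 1%N) (mul_dom_sr W1)) in E.
rewrite scale1r mul_partial1 mul_partial2 in E; rewrite -E; apply: near_eq_derive.
have h : nbhs x [set y | (U y /\ D (p y)) /\ (U y /\ D (q y))].
  exact: filterI (plot_nearD Pp Ux Dp) (plot_nearD Pq Ux Dq).
by apply: filterS h => y [[_ Dpy] [_ Dqy]]; rewrite mul_chartE !cK.
Qed.

(** With a = (p x)^-1 p y and b = (q x)^-1 q y, the left translate of p y q y is ((q x)^-1 a q x) b,
    a product of two curves through 1. *)
Lemma thetaL_mul m (U : set 'rV[R]_m) p q x v : P U p -> P U q -> U x ->
  thetaL (fun y => p y * q y)%g x v = Ad (q x)^-1%g (thetaL p x v) + thetaL q x v.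
Proof.
move=> Pp Pq Ux.
have Pl := plot_left (p x)^-1%g Pp; have Ql := plot_left (q x)^-1%g Pq.
rewrite -(derive_conj _ _ Pl Ux); last exact: mulVg.
rewrite -(derive_mul _ (plot_conj _ Pl) Ql Ux).
- apply: (congr1 (fun F => derive F x (v ord0))); apply/funext => y.
  by rewrite invgM invgK !mulgA mulgK.
- by rewrite mulVg mulg1 mulgV.
- exact: mulVg.
Qed.

Lemma derive_c_cst m (U : set 'rV[R]_m) (q : 'rV[R]_m -> G) x v :
  open U -> U x -> (forall y, q y = 1%g) -> 'D_v (fun y => c (q y)) x = 0.
Proof.
move=> oU Ux q1; rewrite (_ : (fun y => c (q y)) = cst e) ?derive_cst//.
by apply/funext => y; rewrite q1.
Qed.

(** The curves p y (p x)^-1 and p x (p y)^-1 pass through 1 and have constant product 1, so their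
    derivatives add up to 0. *)
Lemma thetaL_inv m (U : set 'rV[R]_m) p x v : P U p -> U x ->
  thetaL (fun y => (p y)^-1)%g x v = - thetaR p x v.
Proof.
move=> Pp Ux; apply/eqP; rewrite -addr_eq0 addrC; apply/eqP.
have Pr := plot_right (p x)^-1%g Pp.
have Pl := plot_left (p x) (plotV Pp).
have := derive_mul (v ord0) Pr Pl Ux (mulgV _) (mulgV _).
rewrite (derive_c_cst _ (plot_open Pp) Ux); last first.
  by move=> y; rewrite -mulgA mulKg mulgV.
move=> E; rewrite [RHS]E; congr (_ + _); rewrite /thetaL; apply: (congr1 (fun F => derive F x (v ord0))).
by apply/funext => y; rewrite invgK.
Qed.

Lemma thetaR_inv m (U : set 'rV[R]_m) p x v : P U p -> U x ->
  thetaR (fun y => (p y)^-1)%g x v = - thetaL p x v.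
Proof.
move=> Pp Ux; apply/eqP; rewrite -addr_eq0 addrC; apply/eqP.
have Pl := plot_left (p x)^-1%g Pp.
have Pr := plot_right (p x) (plotV Pp).
have := derive_mul (v ord0) Pl Pr Ux (mulVg _) (mulVg _).
rewrite (derive_c_cst _ (plot_open Pp) Ux); last first.
  by move=> y; rewrite -mulgA (mulgA (p y)) mulgV mul1g mulVg.
move=> E; rewrite [RHS]E; congr (_ + _); rewrite /thetaR; apply: (congr1 (fun F => derive F x (v ord0))).
by apply/funext => y; rewrite invgK.
Qed.

End LieCalculus.

Local Opaque derive.

(** * The Lie bracket and the Maurer-Cartan equations *)

Section LieBracket.
Variables (R : realType) (G : lieGroup R).
Let n := lie_dim G.
Local Notation A := (lie_atlas G).
Local Notation c := (@lie_chart R G).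
Local Notation ci := (@lie_chart_inv R G).
Local Notation e := (c 1%g).
Local Notation D := (chart_dom A (chart_at_1 G)).
Local Notation W := (chart_map A (chart_at_1 G) @` chart_dom A (chart_at_1 G)).
Local Notation P := (@plot R (lie_space G) _).
Local Notation mu := (@mul_chart R G).
Local Notation WW := [set z : 'rV[R]_(n + n) | W (lsubmx z) /\ W (rsubmx z)].
Implicit Types X Y Z : 'rV[R]_n.

Definition Ad_chart X (s : 'rV[R]_n) : 'rV[R]_n := Ad (ci s) X.

Let kq (z : 'rV[R]_(n + n)) : G := (ci (lsubmx z) * ci (rsubmx z) * (ci (lsubmx z))^-1)%g.

Let Pkq : P WW kq.
Proof. exact: plotM (plotM (@plot_cil R G) (@plot_cir R G)) (plotV (@plot_cil R G)). Qed.

Let kdom : set 'rV[R]_(n + n) := WW `&` kq @^-1` D.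
Let okdom : open kdom. Proof. exact: plot_openD Pkq. Qed.
Let Skq : smooth_on kdom (fun z => c (kq z)). Proof. exact: plot_smooth Pkq. Qed.

Let kdom_e s : W s -> kdom (row_mx s e).
Proof.
move=> Ws; split.
  by rewrite /= row_mxKl row_mxKr; split => //; exact: W1.
by rewrite /kq /= row_mxKl row_mxKr ci1 conjg1E; exact: D1.
Qed.

Let Ad_chartE X s : W s -> Ad_chart X s = 'D_(row_mx 0 X) (fun z => c (kq z)) (row_mx s e).
Proof.
move=> Ws; have [_ <-] := partial2 X okdom (Skq 1%N) (kdom_e Ws).
rewrite /Ad_chart /Ad; apply: (congr1 (fun F => derive F e X)); apply/funext => y.
by rewrite /kq row_mxKl row_mxKr.
Qed.

(** [Ad] is the partial derivative at the identity in z of the smooth function s z s^-1 of two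
    variables; therefore it depends smoothly on s. *)
Lemma Ad_chart_smooth X : smooth_on W (Ad_chart X).
Proof.
have Sd : smooth_on kdom ('D_(row_mx 0 X) (fun z => c (kq z))).
  by move=> k; exact: Ck_derive (Skq k.+1).
have Srow : smooth_on W (fun s : 'rV[R]_n => row_mx s e).
  apply: smooth_row_mx; [exact: oW | exact/smooth_id/oW | by move=> k; exact: Ck_cst].
apply: smooth_ext (smooth_compV (@oW R G) okdom kdom_e Sd Srow); first exact: oW.
by move=> s Ws; rewrite Ad_chartE.
Qed.

Lemma bracketE X Y : lie_bracket X Y = 'D_X (Ad_chart Y) e.
Proof. by []. Qed.

Lemma Ad_chart_e X : Ad_chart X e = X.
Proof. by rewrite /Ad_chart ci1; exact: Ad1. Qed.

Lemma bracket_linl (a : R) X Y Z :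
  lie_bracket (a *: X + Y) Z = a *: lie_bracket X Z + lie_bracket Y Z.
Proof. exact: (deriveV_lin a X Y (@oW R G) (@Ad_chart_smooth Z 1%N) (@W1 R G)). Qed.

Lemma bracket_linr (a : R) X Y Z :
  lie_bracket Z (a *: X + Y) = a *: lie_bracket Z X + lie_bracket Z Y.
Proof.
have h1 := Ck1_is_derive Z (@Ad_chart_smooth X 1%N) (@W1 R G).
have h2 := Ck1_is_derive Z (@Ad_chart_smooth Y 1%N) (@W1 R G).
have [_ <-] := is_deriveD (is_deriveZ a h1) h2.
rewrite bracketE; apply: (congr1 (fun F => derive F e Z)); apply/funext => s.
exact: Ad_lin.
Qed.

(** The bilinear second-order term of the multiplication at (1, 1) in the chart. It depends on the
    chart; its antisymmetrization is the bracket. *)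
Definition mul2 X Y : 'rV[R]_n :=
  'D_(row_mx X 0) ('D_(row_mx 0 Y) mu) (row_mx e e).

Let mee : @mul_dom R G (row_mx e e). Proof. by apply: mul_dom_sr; exact: W1. Qed.

Lemma is_derive_mulpart1 X Z :
  is_derive e Z (fun s => 'D_(row_mx X 0) mu (row_mx e s)) (mul2 X Z).
Proof.
have Sm : Ck 1 (@mul_dom R G) ('D_(row_mx X 0) mu).
  exact: Ck_derive (@mul_chart_smooth R G 2%N).
rewrite /mul2 (schwarzV _ _ (@mul_dom_open R G) (@mul_chart_smooth R G 2%N) mee).
exact: (partial2 Z (@mul_dom_open R G) Sm mee).
Qed.

Lemma is_derive_mulpart2 Y Z :
  is_derive e Z (fun s => 'D_(row_mx 0 Y) mu (row_mx s e)) (mul2 Z Y).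
Proof.
have Sm : Ck 1 (@mul_dom R G) ('D_(row_mx 0 Y) mu).
  exact: Ck_derive (@mul_chart_smooth R G 2%N).
exact: (partial1 Z (@mul_dom_open R G) Sm mee).
Qed.

Lemma row_mx0_sum X : row_mx X (0 : 'rV[R]_n) = \sum_i X 0 i *: row_mx (delta_mx 0 i) 0.
Proof.
rewrite {1}[X]row_sum_delta; apply: (big_ind2 (fun u r => row_mx u (0 : 'rV[R]_n) = r)).
- by rewrite row_mx0.
- by move=> u1 r1 u2 r2 <- <-; rewrite add_row_mx addr0.
- by move=> i _; rewrite scale_row_mx scaler0.
Qed.

Lemma row_0mx_sum X : row_mx (0 : 'rV[R]_n) X = \sum_i X 0 i *: row_mx 0 (delta_mx 0 i).
Proof.
rewrite {1}[X]row_sum_delta; apply: (big_ind2 (fun u r => row_mx (0 : 'rV[R]_n) u = r)).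
- by rewrite row_mx0.
- by move=> u1 r1 u2 r2 <- <-; rewrite add_row_mx addr0.
- by move=> i _; rewrite scale_row_mx scaler0.
Qed.

Lemma mul2_sumr X Z : mul2 Z X = \sum_i X 0 i *: mul2 Z (delta_mx 0 i).
Proof.
have [_ <-] := is_derive_mulpart2 X Z.
have E : is_derive e Z (\sum_i (fun s => X 0 i *: 'D_(row_mx 0 (delta_mx 0 i)) mu (row_mx s e)))
   (\sum_i X 0 i *: mul2 Z (delta_mx 0 i)).
  by apply: is_derive_sum => i; apply: is_deriveZ; exact: is_derive_mulpart2.
have [_ <-] := E; apply: near_eq_derive; apply: (near_all (@oW R G) (@W1 R G)) => s Ws.
rewrite fct_sumE row_0mx_sum.
exact: (deriveV_sum _ _ (@mul_dom_open R G) (@mul_chart_smooth R G 1%N) (mul_dom_sr Ws)).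
Qed.

Lemma mul2_suml X Z : mul2 X Z = \sum_i X 0 i *: mul2 (delta_mx 0 i) Z.
Proof.
have Sm : Ck 1 (@mul_dom R G) ('D_(row_mx 0 Z) mu).
  exact: Ck_derive (@mul_chart_smooth R G 2%N).
rewrite /mul2 row_mx0_sum.
exact: (deriveV_sum _ _ (@mul_dom_open R G) Sm mee).
Qed.

Lemma is_derive_scale (T : normedModType R) m (f : T -> R) (F : T -> 'rV[R]_m) x v df dF :
  is_derive x v f df -> is_derive x v F dF ->
  is_derive x v (fun y => f y *: F y) (df *: F x + f x *: dF).
Proof.
move=> hf hF; apply: is_derive_coordP => i.
rewrite (_ : (fun y => _) = (fun y => f y * F y 0 i)); last first.
  by apply/funext => y; rewrite mxE.
rewrite !mxE; exact: is_derive_mulR hf (is_derive_coordE i hF).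
Qed.

(* Differentiate [(s z s^-1) s = s z] in [z], then in [s]. *)
Lemma bracket_mul2 X Y : lie_bracket X Y = mul2 X Y - mul2 Y X.
Proof.
apply/eqP; rewrite eq_sym subr_eq eq_sym; apply/eqP.
have [_ <-] := is_derive_mulpart2 Y X.
have h : is_derive e X (\sum_i (fun s =>
    Ad_chart Y s 0 i *: 'D_(row_mx (delta_mx 0 i) 0) mu (row_mx e s)))
    (\sum_i (lie_bracket X Y 0 i *: (delta_mx 0 i : 'rV[R]_n) + Y 0 i *: mul2 (delta_mx 0 i) X)).
  apply: is_derive_sum => i.
  have h1 : is_derive e X (fun s => Ad_chart Y s 0 i) (lie_bracket X Y 0 i).
    by apply: is_derive_coordE; exact: Ck1_is_derive (@Ad_chart_smooth Y 1%N) (@W1 R G).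
  have := is_derive_scale h1 (is_derive_mulpart1 (delta_mx 0 i) X).
  by rewrite Ad_chart_e mul_partial1.
transitivity (\sum_i (lie_bracket X Y 0 i *: (delta_mx 0 i : 'rV[R]_n) + Y 0 i *: mul2 (delta_mx 0 i) X)).
  by rewrite big_split /= -mul2_suml -row_sum_delta.
have [_ <-] := h; apply: near_eq_derive; apply: (near_all (@oW R G) (@W1 R G)) => s Ws.
rewrite fct_sumE.
rewrite -(deriveV_sum _ _ (@mul_dom_open R G) (@mul_chart_smooth R G 1%N) (mul_dom_sl Ws)).
rewrite -row_mx0_sum.
have [_ <-] := partial2 Y (@mul_dom_open R G) (@mul_chart_smooth R G 1%N) (mul_dom_sr Ws).
have hk := partial2 Y okdom (Skq 1%N) (kdom_e Ws).
rewrite -(Ad_chartE Y Ws) in hk.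
have hrow := is_derive_row_mx hk (is_derive_cst s e Y).
have kE : c (kq (row_mx s e)) = e by rewrite /kq row_mxKl row_mxKr ci1 conjg1E.
have Om : @mul_dom R G (row_mx (c (kq (row_mx s e))) s) by rewrite kE; exact: mul_dom_sl.
have E := chainV (f := fun y => row_mx (c (kq (row_mx s y))) s)
  (@mul_dom_open R G) (@mul_chart_smooth R G 1%N) Om hrow.
rewrite kE in E; have [_ <-] := E; apply: near_eq_derive.
have De : D (ci s * ci e * (ci s)^-1)%g by rewrite ci1 conjg1E; exact: D1.
apply: filterS (plot_nearD (plot_conj (ci s) (@plot_ci R G)) (@W1 R G) De) => y [_ Dy].
rewrite !mul_chartE /kq row_mxKl row_mxKr [ci (c (_ * _ * _)%g)]cK//.
by rewrite mulgVK.
Qed.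

(* Maurer-Cartan: with [f = c (p x ^-1 * p)], the derivative of [f] is the left
   translation of [theta], and second derivatives of [f] commute. *)
Lemma maurer_cartanL m (U : set 'rV[R]_m) p x (u v : 'rV[R]_m) : P U p -> U x ->
  'D_u (fun y => thetaL p y (fun=> v)) x - 'D_v (fun y => thetaL p y (fun=> u)) x =
  - lie_bracket (thetaL p x (fun=> u)) (thetaL p x (fun=> v)) :> 'rV[R]_n.
Proof.
move=> Pp Ux; have oU := plot_open Pp.
pose a y := ((p x)^-1 * p y)%g; have Pa : P U a by exact: plot_left.
have Da : D (a x) by apply: D1E; exact: mulVg.
pose f y := c (a y); pose U' := U `&` a @^-1` D.
have oU' : open U' by exact: plot_openD Pa.
have Sf : smooth_on U' f by exact: plot_smooth Pa.
have U'x : U' x by [].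
have fx : f x = e by rewrite /f /a mulVg.
(* For z near y, a z = a y ((p y)^-1 p z). Differentiation at z = y presents the derivative of [f]
   as the left translate of [thetaL] by [f y]. *)
have th w y : U' y -> 'D_w f y =
    \sum_i thetaL p y (fun=> w) 0 i *: 'D_(row_mx 0 (delta_mx 0 i)) mu (row_mx (f y) e).
  move=> [Uy Day].
  have Pl := plot_left (p y)^-1%g Pp.
  have D1y : D ((p y)^-1 * p y)%g by apply: D1E; exact: mulVg.
  have hy := plot_is_derive w Pl Uy D1y.
  have Wf : W (f y) by exact: Wc.
  have Om : @mul_dom R G (row_mx (f y) (c ((p y)^-1 * p y)%g)).
    by rewrite mulVg; exact: mul_dom_sr.
  have E := chainV (f := fun z => row_mx (f y) (c ((p y)^-1 * p z)%g))
    (@mul_dom_open R G) (@mul_chart_smooth R G 1%N) Om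
    (is_derive_row_mx (is_derive_cst (f y) y w) hy).
  rewrite mulVg in E.
  rewrite -(deriveV_sum _ _ (@mul_dom_open R G) (@mul_chart_smooth R G 1%N) (mul_dom_sr Wf)).
  rewrite -row_0mx_sum /thetaL; have [_ <-] := E; apply: near_eq_derive.
  apply: filterS (plot_nearD Pl Uy D1y) => z [_ Dz].
  by rewrite mul_chartE /f !cK// /a -!mulgA mulVKg.
(* The product rule for [th] at [x], where [f x] is the identity: one term differentiates [thetaL],
   the other moves the base point of the translation and gives [mul2]. *)
have key u' w' : is_derive x u' ('D_w' f)
    ('D_u' (fun y => thetaL p y (fun=> w')) x +
     mul2 (thetaL p x (fun=> u')) (thetaL p x (fun=> w'))).
  have St : smooth_on U (fun y => thetaL p y (fun=> w')) by exact: smooth_thetaL.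
  have dth := Ck1_is_derive u' (St 1%N) Ux.
  have df : is_derive x u' f (thetaL p x (fun=> u')) by exact: plot_is_derive u' Pa Ux Da.
  have h : is_derive x u' (\sum_i (fun y => thetaL p y (fun=> w') 0 i *:
       'D_(row_mx 0 (delta_mx 0 i)) mu (row_mx (f y) e)))
     (\sum_i (('D_u' (fun y => thetaL p y (fun=> w')) x) 0 i *: (delta_mx 0 i : 'rV[R]_n) +
        thetaL p x (fun=> w') 0 i *: mul2 (thetaL p x (fun=> u')) (delta_mx 0 i))).
    apply: is_derive_sum => i.
    have Sm : Ck 1 (@mul_dom R G) ('D_(row_mx 0 (delta_mx 0 i)) mu).
      exact: Ck_derive (@mul_chart_smooth R G 2%N).
    have Om : @mul_dom R G (row_mx (f x) e) by rewrite fx; apply: mul_dom_sr; exact: W1.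
    have h1 := chainV (f := fun z => row_mx (f z) e) (@mul_dom_open R G) Sm Om
      (is_derive_row_mx df (is_derive_cst e x u')).
    have := is_derive_scale (is_derive_coordE i dth) h1.
    by rewrite fx mul_partial2.
  rewrite big_split /= -mul2_sumr -row_sum_delta in h.
  apply: near_eq_is_derive h; apply: (near_all oU' U'x) => y U'y.
  by rewrite fct_sumE [RHS]th.
have [_ E1] := key u v; have [_ E2] := key v u.
have S := etrans (esym E1) (etrans (schwarzV u v oU' (Sf 2%N) U'x) E2).
have aux (a1 b1 x1 y1 : 'rV[R]_n) : a1 + x1 = b1 + y1 -> a1 - b1 = - (x1 - y1).
  move=> /(canRL (addrK _)) ->; apply/rowP => i; rewrite !mxE; ring.
by rewrite bracket_mul2; exact: aux S.
Qed.

Lemma thetaR_thetaL_inv m (U : set 'rV[R]_m) p x v : P U p -> U x ->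
  thetaR p x v = - thetaL (fun y => (p y)^-1)%g x v.
Proof. by move=> Pp Ux; rewrite (thetaL_inv _ Pp Ux) opprK. Qed.

Lemma smooth_thetaR m (U : set 'rV[R]_m) p (v : 'I_1 -> 'rV[R]_m) : P U p ->
  smooth_on U (fun x => thetaR p x v : 'rV[R]_n).
Proof.
move=> Pp; have oU := plot_open Pp.
have St : smooth_on U (fun x => thetaL (fun y => (p y)^-1)%g x v : 'rV[R]_n).
  exact: smooth_thetaL (plotV Pp).
move=> k; apply: (Ck_ext oU _ (CkN oU (St k))) => x Ux.
by rewrite -(thetaR_thetaL_inv v Pp Ux).
Qed.

Lemma lin_opp k l (L : 'rV[R]_k -> 'rV[R]_l) (X : 'rV[R]_k) :
  (forall (a : R) u w, L (a *: u + w) = a *: L u + L w) -> L (- X) = - L X.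
Proof.
move=> lin; have L0 : L 0 = 0.
  by have := lin (-1) 0 0; rewrite scaler0 addr0 scaleN1r addNr.
by have := lin (-1) X 0; rewrite !addr0 !scaleN1r L0 addr0.
Qed.

Lemma bracketN0 X Y : lie_bracket (- X) Y = - lie_bracket X Y :> 'rV[R]_n.
Proof.
apply: (lin_opp (L := fun X => lie_bracket X Y : 'rV[R]_n)) => a u w.
exact: bracket_linl.
Qed.

Lemma bracketC X Y : lie_bracket X Y = - lie_bracket Y X :> 'rV[R]_n.
Proof. by rewrite !bracket_mul2 opprB. Qed.

(** [thetaR] of p is minus [thetaL] of the inverse of p. The left side is linear and the bracket
    quadratic in the form, so the sign of the equation changes. *)
Lemma maurer_cartanR m (U : set 'rV[R]_m) p x (u v : 'rV[R]_m) : P U p -> U x ->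
  'D_u (fun y => thetaR p y (fun=> v)) x - 'D_v (fun y => thetaR p y (fun=> u)) x =
  lie_bracket (thetaR p x (fun=> u)) (thetaR p x (fun=> v)) :> 'rV[R]_n.
Proof.
move=> Pp Ux; have oU := plot_open Pp; have PV := plotV Pp.
have E w w' : 'D_w (fun y => thetaR p y (fun=> w')) x =
    - 'D_w (fun y => thetaL (fun y => (p y)^-1)%g y (fun=> w')) x :> 'rV[R]_n.
  have St : smooth_on U (fun y => thetaL (fun y => (p y)^-1)%g y (fun=> w') : 'rV[R]_n).
    exact: smooth_thetaL PV.
  have [_ <-] := is_deriveN (Ck1_is_derive w (St 1%N) Ux).
  apply: near_eq_derive; apply: (near_all oU Ux) => y Uy.
  by rewrite (thetaR_thetaL_inv _ Pp Uy).
rewrite (E u v) (E v u) opprK addrC.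
rewrite (maurer_cartanL _ _ PV Ux) !(thetaR_thetaL_inv _ Pp Ux).
by rewrite bracketN0 [in RHS]bracketC bracketN0 opprK -bracketC.
Qed.

(** Differentiate Ad g (Ad s Y) = Ad (g s g^-1) (Ad g Y) in s at the identity. *)
Lemma Ad_bracket (g : G) X Y :
  Ad g (lie_bracket X Y) = lie_bracket (Ad g X) (Ad g Y) :> 'rV[R]_n.
Proof.
have h := Ck1_is_derive X (@Ad_chart_smooth Y 1%N) (@W1 R G).
have hg := is_derive_lin_comp (@Ad_lin R G g) h.
have hc := Ck1_is_derive X (@conj_chart_smooth R G g 1%N) (@conj_dom_e R G g).
have We : W (conj_chart g e) by rewrite conj_chart_e; exact: W1.
have h2 := chainV (f := conj_chart g) (@oW R G) (@Ad_chart_smooth (Ad g Y) 1%N) We hc.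
rewrite conj_chart_e in h2.
have E1 : 'D_X (fun s => Ad g (Ad_chart Y s) : 'rV[R]_n) e = Ad g (lie_bracket X Y).
  by case: hg.
have E2 : 'D_X (fun s => Ad_chart (Ad g Y) (conj_chart g s)) e =
    lie_bracket (Ad g X) (Ad g Y).
  by case: h2.
apply: (etrans (esym E1)); apply: (etrans _ E2); apply: near_eq_derive.
apply: (near_all (@conj_dom_open R G g) (@conj_dom_e R G g)) => s [Ws Ds].
have ck : ci (conj_chart g s) = (g * ci s * g^-1)%g by exact: cK.
by rewrite /Ad_chart ck -[RHS]AdM mulgVK -AdM.
Qed.

Section Invariant.
Variable B : lie_algebra G -> lie_algebra G -> R.
Hypothesis Binv : invariant_inner_product B.

Lemma inv_linl (a : R) X Y Z : B (a *: X + Y) Z = a * B X Z + B Y Z.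
Proof. by case: Binv => h _ _ _; exact: h. Qed.

Lemma inv_sym X Y : B X Y = B Y X.
Proof. by case: Binv => _ h _ _; exact: h. Qed.

Lemma inv_linr (a : R) X Y Z : B Z (a *: X + Y) = a * B Z X + B Z Y.
Proof. by rewrite inv_sym inv_linl inv_sym (inv_sym Y). Qed.

Lemma inv_Ad (g : G) X Y : B (Ad g X) (Ad g Y) = B X Y.
Proof. by case: Binv => _ _ _ h; exact: h. Qed.

(** The derivative in s, at the identity, of the constant function B (Ad s Y) (Ad s Z). *)
Lemma inv_bracket X Y Z : B (lie_bracket X Y) Z + B Y (lie_bracket X Z) = 0.
Proof.
have hY := Ck1_is_derive X (@Ad_chart_smooth Y 1%N) (@W1 R G).
have hZ := Ck1_is_derive X (@Ad_chart_smooth Z 1%N) (@W1 R G).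
have [_] := is_derive_bilin inv_linl inv_linr hY hZ.
rewrite !Ad_chart_e => <-.
rewrite (_ : (fun y => _) = cst (B Y Z)) ?derive_cst//.
by apply/funext => s; exact: inv_Ad.
Qed.

End Invariant.

End LieBracket.

(** * The Cartan 3-form and quasi-Hamiltonian spaces *)

Lemma wedge2E (R : realType) (M : smoothSpace R) (W1 W2 : Type) (W : lmodType R)
    (op : W1 -> W2 -> W) (alpha : diff_form W1 M 1) (beta : diff_form W2 M 1) m p x (v : 'I_2 -> 'rV[R]_m) :
  wedge_form op alpha beta p x v =
  op (alpha m p x (fun=> v ord0)) (beta m p x (fun=> v ord_max)) -
  op (alpha m p x (fun=> v ord_max)) (beta m p x (fun=> v ord0)).
Proof.
rewrite /wedge_form !big_ord_recl big_ord0 addr0 /= expr0 expr1 scale1r scaleN1r.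
have E (i j : 'I_2) : (forall k : 'I_1, lift i k = j) -> (fun k : 'I_1 => v (lift i k)) = fun=> v j.
  by move=> h; apply/funext => k; rewrite h.
rewrite (E ord0 ord_max); last by move=> k; apply/val_inj; rewrite (ord1 k).
rewrite (E (lift ord0 ord0) ord0); last by move=> k; apply/val_inj; rewrite (ord1 k).
have -> : lift ord0 ord0 = ord_max :> 'I_2 by apply/val_inj.
by [].
Qed.

Definition o0 : 'I_3 := ord0.
Definition o1 : 'I_3 := lift ord0 ord0.
Definition o2 : 'I_3 := ord_max.

Definition pair_of (T : Type) (a b : T) : 'I_2 -> T := fun j => if j == ord0 then a else b.

Lemma pair_of0 T (a b : T) : pair_of a b ord0 = a. Proof. by []. Qed.
Lemma pair_of1 T (a b : T) : pair_of a b ord_max = b. Proof. by []. Qed.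

Lemma face0 T (v : 'I_3 -> T) : (fun j : 'I_2 => v (lift o0 j)) = pair_of (v o1) (v o2).
Proof.
apply/funext => j; rewrite /pair_of; case: eqP => [->|/eqP j0]; congr v; apply/val_inj => //.
by case: j j0 => -[|[|?]].
Qed.

Lemma face1 T (v : 'I_3 -> T) : (fun j : 'I_2 => v (lift o1 j)) = pair_of (v o0) (v o2).
Proof.
apply/funext => j; rewrite /pair_of; case: eqP => [->|/eqP j0]; congr v; apply/val_inj => //.
by case: j j0 => -[|[|?]].
Qed.

Lemma face2 T (v : 'I_3 -> T) : (fun j : 'I_2 => v (lift o2 j)) = pair_of (v o0) (v o1).
Proof.
apply/funext => j; rewrite /pair_of; case: eqP => [->|/eqP j0]; congr v; apply/val_inj => //.
by case: j j0 => -[|[|?]].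
Qed.

Lemma sum_ord3 (V : nmodType) (F : 'I_3 -> V) : \sum_i F i = F o0 + F o1 + F o2.
Proof.
rewrite !big_ord_recl big_ord0 addr0 addrA; congr (_ + _ + F _); exact/val_inj.
Qed.

Lemma ext_d3E (R : realType) (M : smoothSpace R) (tau : diff_form R M 2) m p x
    (v : 'I_3 -> 'rV[R]_m) :
  ext_d (W := R) tau p x v =
  'D_(v o0) (fun y => tau m p y (pair_of (v o1) (v o2))) x -
  'D_(v o1) (fun y => tau m p y (pair_of (v o0) (v o2))) x +
  'D_(v o2) (fun y => tau m p y (pair_of (v o0) (v o1))) x.
Proof.
rewrite /ext_d sum_ord3 face0 face1 face2 /= expr0 expr1 sqrrN expr1n.
by rewrite !scale1r scaleN1r.
Qed.

Lemma sum6 (R : realType) (t : R) :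
  12^-1 * (1 * (2 * t) + -1 * (2 * - t) + 1 * (2 * t)) = 2^-1 * t.
Proof. by lra. Qed.

(** The letters of [aaa], ..., [bbb] tell which slots of [triple] are filled from [thetaL p] (a) and
    from [thetaR q] (b). With k the third index, [xij] stands for B (da i j) (b k) and [yij] for B
    (a k) (db i j). The first six hypotheses are Maurer-Cartan equations, the other four the
    symmetries of [triple]. *)
Lemma cartan_mul_alg (R : realType) (aaa aab aba baa abb bab bba bbb : R)
    (x01 x10 x02 x20 x12 x21 y01 y10 y02 y20 y12 y21 t2 t1 s2 s1 : R) :
  x01 - x10 = - t2 -> x02 - x20 = - t1 -> x12 - x21 = - baa ->
  y01 - y10 = s2 -> y02 - y20 = s1 -> y12 - y21 = abb ->
  t2 = aab -> aba = - t1 -> s2 = bba -> bab = - s1 ->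
  2^-1 * (aaa + aab + aba + baa + abb + bab + bba + bbb) =
  2^-1 * aaa + 2^-1 * bbb - 2^-1 *
   ((x01 + y02 - (x02 + y01)) - (x10 + y12 - (x12 + y10)) + (x20 + y21 - (x21 + y20))).
Proof. move=> *; lra. Qed.

Lemma subst6 (R : realType) (k c0 c1 c2 d0 d1 d2 c0' c1' c2' d0' d1' d2' : R) :
  c0 = c0' -> c1 = c1' -> c2 = c2' -> d0 = d0' -> d1 = d1' -> d2 = d2' ->
  c0' = c1' + c2' - k * (d0' - d1' + d2') -> c0 = c1 + c2 - k * (d0 - d1 + d2).
Proof. by move=> -> -> -> -> -> ->. Qed.

Section CartanForm.
Variables (R : realType) (G : lieGroup R) (B : lie_algebra G -> lie_algebra G -> R).
Hypothesis Binv : invariant_inner_product B.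
Let n := lie_dim G.
Implicit Types X Y Z : 'rV[R]_n.

Definition triple X Y Z : R := B X (lie_bracket Y Z).

Lemma B_opp X Y : B (- X) Y = - B X Y.
Proof.
have := inv_linl Binv (-1) X 0 Y; rewrite addr0 scaleN1r => ->.
by rewrite (bilin0l (inv_linl Binv)) addr0 mulN1r.
Qed.

Lemma B_oppr X Y : B X (- Y) = - B X Y.
Proof. by rewrite inv_sym// B_opp inv_sym. Qed.

Lemma BrE X Y Z : B X (Y + Z) = B X Y + B X Z.
Proof. by have := inv_linr Binv 1 Y Z X; rewrite scale1r mul1r. Qed.

Lemma BlE X Y Z : B (Y + Z) X = B Y X + B Z X.
Proof. by have := inv_linl Binv 1 Y Z X; rewrite scale1r mul1r. Qed.

Lemma brD X Y Z : lie_bracket X (Y + Z) = lie_bracket X Y + lie_bracket X Z :> 'rV[R]_n.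
Proof.
have h : lie_bracket X (1 *: Y + Z) = 1 *: lie_bracket X Y + lie_bracket X Z :> 'rV[R]_n.
  exact: bracket_linr.
by rewrite !scale1r in h.
Qed.

Lemma brDl X Y Z : lie_bracket (Y + Z) X = lie_bracket Y X + lie_bracket Z X :> 'rV[R]_n.
Proof.
have h : lie_bracket (1 *: Y + Z) X = 1 *: lie_bracket Y X + lie_bracket Z X :> 'rV[R]_n.
  exact: bracket_linl.
by rewrite !scale1r in h.
Qed.

Lemma triple_flip X Y Z : triple X Y Z = - triple X Z Y.
Proof. by rewrite /triple bracketC inv_sym// B_opp inv_sym. Qed.

Lemma triple_cyc X Y Z : triple X Y Z = triple Z X Y.
Proof.
have := inv_bracket Binv Y X Z; rewrite bracketC B_opp addrC => /eqP.
by rewrite subr_eq0 => /eqP; rewrite /triple => ->; rewrite inv_sym.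
Qed.

(** Together with the two preceding symmetries this makes [triple] totally antisymmetric: one of
    them comes from the bracket, the other from invariance of [B]. *)
Lemma triple_swap X Y Z : triple X Y Z = - triple Y X Z.
Proof. by rewrite triple_flip triple_cyc. Qed.

Lemma tripleDl X X' Y Z : triple (X + X') Y Z = triple X Y Z + triple X' Y Z.
Proof. exact: BlE. Qed.

Lemma tripleDm X X' Y Z : triple Y (X + X') Z = triple Y X Z + triple Y X' Z.
Proof. by rewrite /triple brDl BrE. Qed.

Lemma tripleDr X X' Y Z : triple Y Z (X + X') = triple Y Z X + triple Y Z X'.
Proof. by rewrite /triple brD BrE. Qed.

Lemma triple_expand X X' Y Y' Z Z' :
  triple (X + X') (Y + Y') (Z + Z') =
  triple X Y Z + triple X Y Z' + triple X Y' Z + triple X' Y Z +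
  triple X Y' Z' + triple X' Y Z' + triple X' Y' Z + triple X' Y' Z'.
Proof.
rewrite tripleDl (tripleDm Y Y') (tripleDm Y Y') !(tripleDr Z Z').
move: (triple X Y Z) (triple X Y Z') (triple X Y' Z) (triple X' Y Z)
  (triple X Y' Z') (triple X' Y Z') (triple X' Y' Z) (triple X' Y' Z').
by move=> *; rewrite !addrA; ring.
Qed.

Lemma tripleAd (g : G) X Y Z : triple (Ad g X) (Ad g Y) (Ad g Z) = triple X Y Z.
Proof. by rewrite /triple -Ad_bracket (inv_Ad Binv). Qed.

Lemma tripleN X Y Z : triple (- X) (- Y) (- Z) = - triple X Y Z.
Proof.
have bN Y' Z' : lie_bracket (- Y') (- Z') = lie_bracket Y' Z' :> 'rV[R]_n.
  by rewrite bracketN0 [in LHS]bracketC bracketN0 opprK -bracketC.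
by rewrite /triple bN B_opp.
Qed.

Lemma wedge_bracketE m (p : 'rV[R]_m -> lie_space G) x (a b : 'rV[R]_m) :
  wedge_form (W := 'rV[R]_n) (@lie_bracket R G : _ -> _ -> 'rV[R]_n) (@thetaL R G) (@thetaL R G)
    p x (pair_of a b) =
  2 *: (lie_bracket (thetaL p x (fun=> a)) (thetaL p x (fun=> b)) : 'rV[R]_n).
Proof.
apply: (etrans (@wedge2E R (lie_space G) 'rV[R]_n 'rV[R]_n 'rV[R]_n
  (@lie_bracket R G) (@thetaL R G) (@thetaL R G) m p x (pair_of a b))).
rewrite pair_of0 pair_of1.
have aux (a1 b1 : 'rV[R]_n) : a1 = - b1 -> a1 - b1 = 2 *: a1.
  by move=> ->; rewrite scaler_nat mulr2n.
apply: aux; exact: bracketC.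
Qed.

Lemma cartan_sum X Y Z :
  12^-1 * (1 *: B X (2 *: (lie_bracket Y Z : 'rV[R]_n)) +
    -1 *: B Y (2 *: (lie_bracket X Z : 'rV[R]_n)) +
    1 *: B Z (2 *: (lie_bracket X Y : 'rV[R]_n))) = 2^-1 * triple X Y Z.
Proof.
have BZ X' Y' Z' : B X' (2 *: (lie_bracket Y' Z' : 'rV[R]_n)) = 2 * triple X' Y' Z'.
  rewrite -[2 *: _]addr0 (inv_linr Binv) (bilin0r (inv_linr Binv)).
  by rewrite addr0.
have h1 := triple_cyc X Y Z; have h2 := triple_flip Y X Z; have h3 := triple_cyc Y Z X.
rewrite (BZ X Y Z) (BZ Y X Z) (BZ Z X Y) h2 h3 -h1.
exact: sum6.
Qed.

(** The three terms of the outer wedge agree by the symmetries of [triple], and the inner wedge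
    contributes a factor 2 to each; 6/12 = 1/2. *)
Lemma cartan_formE m (p : 'rV[R]_m -> lie_space G) x (v : 'I_3 -> 'rV[R]_m) :
  cartan_form B p x v = 2^-1 * triple (thetaL p x (fun=> v o0))
    (thetaL p x (fun=> v o1)) (thetaL p x (fun=> v o2)).
Proof.
have E : cartan_form B p x v = 12^-1 * \sum_(i < 3) (-1) ^+ i *:
   B (thetaL p x (fun=> v i)) (wedge_form (W := 'rV[R]_n)
     (@lie_bracket R G : _ -> _ -> 'rV[R]_n) (@thetaL R G) (@thetaL R G)
      p x (fun j => v (lift i j))) by [].
rewrite E sum_ord3 face0 face1 face2 !wedge_bracketE -cartan_sum.
have h0 : (-1) ^+ o0 = 1 :> R by rewrite expr0.
have h1 : (-1) ^+ o1 = -1 :> R by rewrite expr1.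
have h2 : (-1) ^+ o2 = 1 :> R by rewrite sqrrN expr1n.
by rewrite h0 h1 h2.
Qed.

(* Both [thetaL p] and [thetaR q] solve a Maurer-Cartan equation, with opposite
   signs, and [thetaL (p * q)] is [thetaL p + thetaR q] up to the adjoint action. *)
Lemma cartan_mul m (U : set 'rV[R]_m) p q x (v : 'I_3 -> 'rV[R]_m) :
  plot (lie_space G) U p -> plot (lie_space G) U q -> U x ->
  let tau y a b := B (thetaL p y (fun=> a)) (thetaR q y (fun=> b)) -
                   B (thetaL p y (fun=> b)) (thetaR q y (fun=> a)) in
  cartan_form B (fun y => p y * q y)%g x v = cartan_form B p x v + cartan_form B q x v -
    2^-1 * ('D_(v o0) (fun y => tau y (v o1) (v o2)) x
          - 'D_(v o1) (fun y => tau y (v o0) (v o2)) x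
          + 'D_(v o2) (fun y => tau y (v o0) (v o1)) x).
Proof.
move=> Pp Pq Ux tau; have oU := plot_open Pp.
pose a i : 'rV[R]_n := thetaL p x (fun=> v i); pose b i : 'rV[R]_n := thetaR q x (fun=> v i).
pose da i j : 'rV[R]_n := 'D_(v i) (fun y => thetaL p y (fun=> v j)) x.
pose db i j : 'rV[R]_n := 'D_(v i) (fun y => thetaR q y (fun=> v j)) x.
have Da i j : is_derive x (v i) (fun y => thetaL p y (fun=> v j) : 'rV[R]_n) (da i j).
  exact: Ck1_is_derive (smooth_thetaL (fun=> v j) Pp 1%N) Ux.
have Db i j : is_derive x (v i) (fun y => thetaR q y (fun=> v j) : 'rV[R]_n) (db i j).
  exact: Ck1_is_derive (smooth_thetaR (fun=> v j) Pq 1%N) Ux.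
have dtau i j k : 'D_(v i) (fun y => tau y (v j) (v k)) x =
   B (da i j) (b k) + B (a j) (db i k) - (B (da i k) (b j) + B (a k) (db i j)).
  have h1 := is_derive_bilin (inv_linl Binv) (inv_linr Binv) (Da i j) (Db i k).
  have h2 := is_derive_bilin (inv_linl Binv) (inv_linr Binv) (Da i k) (Db i j).
  by have [_ E] := is_deriveB h1 h2; exact: E.
have mc i j k : B (da i j) (b k) - B (da j i) (b k) = - triple (b k) (a i) (a j).
  have h := BlE (b k) (da i j) (- da j i).
  by rewrite B_opp in h; rewrite -h (maurer_cartanL _ _ Pp Ux) B_opp (inv_sym Binv).
have mcr i j k : B (a k) (db i j) - B (a k) (db j i) = triple (a k) (b i) (b j).
  have h := BrE (a k) (db i j) (- db j i).
  rewrite B_oppr in h.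
  by rewrite -h (maurer_cartanR _ _ Pq Ux).
have thq i : thetaL (fun y => p y * q y)%g x (fun=> v i) = Ad (q x)^-1%g (a i + b i) :> 'rV[R]_n.
  rewrite (thetaL_mul _ Pp Pq Ux) /b (thetaR_Ad _ Pq Ux).
  have AdD (g : G) (X Y : 'rV[R]_n) : Ad g (X + Y) = Ad g X + Ad g Y :> 'rV[R]_n.
    by have := Ad_lin g 1 X Y; rewrite !scale1r.
  by rewrite AdD -AdM mulVg Ad1.
have thR i : b i = Ad (q x) (thetaL q x (fun=> v i)) by exact: thetaR_Ad Pq Ux.
have E : triple (thetaL q x (fun=> v o0)) (thetaL q x (fun=> v o1)) (thetaL q x (fun=> v o2)) =
  triple (b o0) (b o1) (b o2) by rewrite !thR tripleAd.
apply: (subst6 (cartan_formE _ x v) (cartan_formE p x v) (etrans (cartan_formE q x v)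
  (congr1 (fun t => 2^-1 * t) E)) (dtau o0 o1 o2) (dtau o1 o0 o2) (dtau o2 o0 o1)).
rewrite (thq o0) (thq o1) (thq o2) tripleAd triple_expand -/(a o0) -/(a o1) -/(a o2).
apply: cartan_mul_alg (mc o0 o1 o2) (mc o0 o2 o1) (mc o1 o2 o0) (mcr o0 o1 o2) (mcr o0 o2 o1)
  (mcr o1 o2 o0) _ _ _ _.
- exact: esym (triple_cyc (a o0) (a o1) (b o2)).
- exact: triple_swap (a o0) (b o1) (a o2).
- exact: esym (triple_cyc (b o0) (b o1) (a o2)).
- exact: triple_swap (b o0) (a o1) (b o2).
Qed.

End CartanForm.

(** * Operations on smooth forms *)

Section SmoothForms.
Variable R : realType.
Implicit Types M N : smoothSpace R.

Lemma plot_inT M m (U : set 'rV[R]_m) (p : 'rV[R]_m -> M) : plot M U p -> plot_in setT U p.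
Proof. by []. Qed.

Lemma smooth_form_sub M k (V V' : set M) (alpha : diff_form R M k) : V' `<=` V ->
  smooth_form V alpha -> smooth_form V' alpha.
Proof.
move=> VV [h1 h2 h3 h4].
have pin m (U : set 'rV[R]_m) p : plot_in V' U p -> plot_in V U p.
  by move=> [Pp UV]; split => // x /UV /VV.
split.
- by move=> m U p x /pin; exact: h1.
- by move=> m U p x /pin; exact: h2.
- by move=> m U p /pin; exact: h3.
- by move=> m l U U' p q f /pin Pp /pin Pq; exact: h4.
Qed.

Lemma smooth_form_pull M N k (f : M -> N) (V : set N) (alpha : diff_form R N k) :
  smooth_map f -> smooth_form V alpha -> smooth_form (f @^-1` V) (form_pull f alpha).
Proof.
move=> Sf [h1 h2 h3 h4].
have pin m (U : set 'rV[R]_m) p : plot_in (f @^-1` V) U p -> plot_in V U (f \o p).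
  by move=> [Pp UV]; split => //; exact: Sf.
split.
- by move=> m U p x /pin; exact: h1.
- by move=> m U p x /pin; exact: h2.
- by move=> m U p /pin; exact: h3.
- move=> m l U U' p q g /pin Pp /pin Pq Sg UU; apply: h4 Pp Pq Sg _ => y /UU[Uy qy].
  by split => //=; rewrite qy.
Qed.

Lemma smooth_form_add M k (V : set M) (alpha beta : diff_form R M k) : manifold M ->
  smooth_form V alpha -> smooth_form V beta -> smooth_form V (form_add alpha beta).
Proof.
move=> mM [h1 h2 h3 h4] [g1 g2 g3 g4]; split.
- move=> m U p x Pp Ux i v c u w /=.
  have /= := h1 m U p x Pp Ux i v c u w; have /= := g1 m U p x Pp Ux i v c u w.
  by rewrite /form_add => -> ->; ring.
- move=> m U p x Pp Ux i j v ij vij.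
  by rewrite /form_add (h2 m U p x Pp Ux i j)// (g2 m U p x Pp Ux i j)// addr0.
- move=> m U p Pp v n; apply: CkD (h3 m U p Pp v n) (g3 m U p Pp v n).
  exact: (mf_open mM (proj1 Pp)).
- move=> m l U U' p q f Pp Pq Sf UU y v U'y; rewrite /form_add.
  by rewrite (h4 _ _ _ _ _ _ _ Pp Pq Sf UU)// (g4 _ _ _ _ _ _ _ Pp Pq Sf UU).
Qed.

Lemma smooth_form_scale M k (V : set M) (c : R) (alpha : diff_form R M k) : manifold M ->
  smooth_form V alpha -> smooth_form V (form_scale c alpha).
Proof.
move=> mM [h1 h2 h3 h4]; split.
- move=> m U p x Pp Ux i v a u w /=.
  by have /= := h1 m U p x Pp Ux i v a u w; rewrite /form_scale => ->; ring.
- move=> m U p x Pp Ux i j v ij vij.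
  by rewrite /form_scale (h2 m U p x Pp Ux i j)// mulr0.
- move=> m U p Pp v n; apply: CkZ (h3 m U p Pp v n).
  exact: (mf_open mM (proj1 Pp)).
- move=> m l U U' p q f Pp Pq Sf UU y v U'y; rewrite /form_scale.
  by rewrite (h4 _ _ _ _ _ _ _ Pp Pq Sf UU).
Qed.

Lemma form_subE M k (alpha beta : diff_form R M k) :
  form_sub alpha beta = form_add alpha (form_scale (-1) beta).
Proof.
do 4!(apply/functional_extensionality_dep => ?).
by rewrite /form_sub /form_add /form_scale mulN1r.
Qed.

Lemma smooth_form_subf M k (V : set M) (alpha beta : diff_form R M k) : manifold M ->
  smooth_form V alpha -> smooth_form V beta -> smooth_form V (form_sub alpha beta).
Proof.
move=> mM Sa Sb; rewrite form_subE; apply: smooth_form_add => //.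
exact: smooth_form_scale.
Qed.

Lemma form_is_derive M k (V : set M) (alpha : diff_form R M k) m (U : set 'rV[R]_m) p x u v :
  smooth_form V alpha -> plot_in V U p -> U x ->
  is_derive x u (fun y => alpha m p y v) ('D_u (fun y => alpha m p y v) x).
Proof. by move=> [_ _ h3 _] Pp Ux; exact: Ck1_is_derive (h3 m U p Pp v 1%N) Ux. Qed.

Lemma ext_d_add M k (V : set M) (alpha beta : diff_form R M k) m (U : set 'rV[R]_m) p x v :
  smooth_form V alpha -> smooth_form V beta -> plot_in V U p -> U x ->
  ext_d (W := R) (form_add alpha beta) p x v =
  ext_d (W := R) alpha p x v + ext_d (W := R) beta p x v.
Proof.
move=> Sa Sb Pp Ux; rewrite /ext_d -big_split /=; apply: eq_bigr => i _.
rewrite -scalerDr; congr (_ *: _).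
have h1 := form_is_derive (v i) (fun j => v (lift i j)) Sa Pp Ux.
have h2 := form_is_derive (v i) (fun j => v (lift i j)) Sb Pp Ux.
by case: (is_deriveD h1 h2).
Qed.

Lemma ext_d_scale M k (V : set M) (c : R) (alpha : diff_form R M k) m (U : set 'rV[R]_m) p x v :
  smooth_form V alpha -> plot_in V U p -> U x ->
  ext_d (W := R) (form_scale c alpha) p x v = c * ext_d (W := R) alpha p x v.
Proof.
move=> Sa Pp Ux; rewrite /ext_d mulr_sumr; apply: eq_bigr => i _.
have h1 := form_is_derive (v i) (fun j => v (lift i j)) Sa Pp Ux.
have E : 'D_(v i) (fun y => form_scale c alpha p y (fun j => v (lift i j))) x =
  c * 'D_(v i) (fun y => alpha m p y (fun j => v (lift i j))) x.
  by case: (is_deriveZ c h1).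
by rewrite [X in _ *: X]E /GRing.scale /= mulrCA.
Qed.

Lemma ext_d_sub M k (V : set M) (alpha beta : diff_form R M k) m (U : set 'rV[R]_m) p x v :
  manifold M ->
  smooth_form V alpha -> smooth_form V beta -> plot_in V U p -> U x ->
  ext_d (W := R) (form_sub alpha beta) p x v =
  ext_d (W := R) alpha p x v - ext_d (W := R) beta p x v.
Proof.
move=> mM Sa Sb Pp Ux; rewrite form_subE (ext_d_add v Sa (smooth_form_scale (-1) mM Sb) Pp Ux).
by rewrite (ext_d_scale (-1) v Sb Pp Ux) mulN1r.
Qed.

Lemma ext_d_near M k (alpha beta : diff_form R M k) m (U : set 'rV[R]_m) p x
    (v : 'I_k.+1 -> 'rV[R]_m) :
  open U -> U x -> (forall y w, U y -> alpha m p y w = beta m p y w) ->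
  ext_d (W := R) alpha p x v = ext_d (W := R) beta p x v.
Proof.
move=> oU Ux ab; rewrite /ext_d; apply: eq_bigr => i _; congr (_ *: _).
by apply: near_eq_derive; apply: (near_all oU Ux) => y Uy; exact: ab.
Qed.

(** [smooth_form] concerns real-valued forms; this is its counterpart for 1-forms with values in the
    Lie algebra, made for the Maurer-Cartan forms and their pullbacks. *)
Record vform (M : smoothSpace R) (n : nat) (alpha : diff_form 'rV[R]_n M 1) : Prop := VForm {
  vf_lin : forall m (U : set 'rV[R]_m) p x, plot M U p -> U x ->
    forall (c : R) (u w : 'rV[R]_m), alpha m p x (fun=> c *: u + w) =
      c *: alpha m p x (fun=> u) + alpha m p x (fun=> w);
  vf_smooth : forall m (U : set 'rV[R]_m) p, plot M U p ->
    forall v, smooth_on U (fun x => alpha m p x v);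
  vf_nat : forall m l (U : set 'rV[R]_m) (U' : set 'rV[R]_l) p q f,
    plot M U p -> plot M U' q -> smooth_on U' f ->
    (forall y, U' y -> U (f y) /\ q y = p (f y)) ->
    forall y v, U' y -> alpha l q y v = alpha m p (f y) (fun i => 'D_(v i) f y) }.

Lemma vform_pull M N n (f : M -> N) (alpha : diff_form 'rV[R]_n N 1) : smooth_map f ->
  vform alpha -> vform (form_pull f alpha).
Proof.
move=> Sf [h1 h2 h3]; split.
- by move=> m U p x Pp; exact: h1 (Sf _ _ _ Pp).
- by move=> m U p Pp; exact: h2 (Sf _ _ _ Pp).
- move=> m l U U' p q g Pp Pq Sg UU; apply: h3 (Sf _ _ _ Pp) (Sf _ _ _ Pq) Sg _.
  by move=> y /UU[Uy qy]; split => //=; rewrite qy.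
Qed.

Lemma vform_thetaL (G : lieGroup R) : vform (@thetaL R G : diff_form 'rV[R]_(lie_dim G) _ 1).
Proof.
split.
- by move=> m U p x Pp Ux c u w; exact: thetaL_lin Pp Ux.
- by move=> m U p Pp v; exact: smooth_thetaL.
- move=> m l U U' p q f Pp Pq Sf UU y v U'y.
  have [Ufy _] := UU y U'y.
  by apply: (thetaL_comp v Pp (plot_open Pq) (Sf 1%N) U'y Ufy) => z /UU[].
Qed.

Lemma vform_thetaR (G : lieGroup R) : vform (@thetaR R G : diff_form 'rV[R]_(lie_dim G) _ 1).
Proof.
split.
- by move=> m U p x Pp Ux c u w; exact: thetaR_lin Pp Ux.
- by move=> m U p Pp v; exact: smooth_thetaR.
- move=> m l U U' p q f Pp Pq Sf UU y v U'y.
  have [Ufy _] := UU y U'y.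
  by apply: (thetaR_comp v Pp (plot_open Pq) (Sf 1%N) U'y Ufy) => z /UU[].
Qed.

Lemma ord2P (i : 'I_2) : i = ord0 \/ i = ord_max.
Proof. by case: i => -[|[|//]] ?; [left|right]; apply/val_inj. Qed.

Lemma smooth_form_wedge M n (b : 'rV[R]_n -> 'rV[R]_n -> R)
    (alpha beta : diff_form 'rV[R]_n M 1) : manifold M ->
  (forall c u v w, b (c *: u + v) w = c * b u w + b v w) ->
  (forall c u v w, b w (c *: u + v) = c * b w u + b w v) ->
  vform alpha -> vform beta -> smooth_form setT (wedge_form (W := R) b alpha beta).
Proof.
move=> mM bl br [a1 a2 a3] [b1 b2 b3]; split.
- move=> m U p x [Pp _] Ux i v c u w /=; rewrite !wedge2E.
  have al := a1 m U p x Pp Ux c u w; have be := b1 m U p x Pp Ux c u w.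
  by case: (ord2P i) => -> /=; rewrite al be bl br; ring.
- move=> m U p x Pp Ux i j v ij vij; rewrite wedge2E.
  have -> : v ord0 = v ord_max; last exact: subrr.
  by case: (ord2P i) ij vij => ->; case: (ord2P j) => -> //.
- move=> m U p [Pp _] v; have oU := mf_open mM Pp.
  have E x : wedge_form (W := R) b alpha beta p x v =
    b (alpha m p x (fun=> v ord0)) (beta m p x (fun=> v ord_max)) -
    b (alpha m p x (fun=> v ord_max)) (beta m p x (fun=> v ord0)) by rewrite wedge2E.
  have S i j := smooth_bilin bl br oU (a2 m U p Pp (fun=> v i)) (b2 m U p Pp (fun=> v j)).
  by move=> k; apply: Ck_ext oU _ (CkB oU (S ord0 ord_max k) (S ord_max ord0 k)) => x _.
- move=> m l U U' p q f [Pp _] [Pq _] Sf UU y v U'y; rewrite !wedge2E.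
  have al := a3 _ _ _ _ _ _ _ Pp Pq Sf UU y; have be := b3 _ _ _ _ _ _ _ Pp Pq Sf UU y.
  by rewrite !(al _ U'y) !(be _ U'y).
Qed.

End SmoothForms.

Local Opaque thetaL thetaR Ad lie_bracket.

(** * The relation d omega = Psi^* eta for G^2 and for fusion products *)

Section QHam.
Variables (R : realType) (G : lieGroup R) (B : lie_algebra G -> lie_algebra G -> R).
Hypothesis Binv : invariant_inner_product B.
Let n := lie_dim G.
Let LG := lie_space G.

Lemma smooth_mapM (M : smoothSpace R) (f g : M -> LG) : smooth_map f -> smooth_map g ->
  smooth_map (fun x => f x * g x : LG)%g.
Proof. by move=> Sf Sg m U p Pp; exact: plotM (Sf _ _ _ Pp) (Sg _ _ _ Pp). Qed.

Lemma smooth_mapV (M : smoothSpace R) (f : M -> LG) : smooth_map f ->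
  smooth_map (fun x => (f x)^-1 : LG)%g.
Proof. by move=> Sf m U p Pp; exact: plotV (Sf _ _ _ Pp). Qed.

Lemma triple_congr (b : lie_algebra G -> lie_algebra G -> R) (X Y Z X' Y' Z' : 'rV[R]_n) :
  X = X' -> Y = Y' -> Z = Z' -> triple b X Y Z = triple b X' Y' Z'.
Proof. by move=> -> -> ->. Qed.

Definition mwedge (M : smoothSpace R) (f g : M -> LG) : diff_form R M 2 :=
  wedge_form (W := R) B (form_pull f (@thetaL R G)) (form_pull g (@thetaR R G)).

Lemma smooth_mwedge (M : smoothSpace R) (f g : M -> LG) : manifold M ->
  smooth_map f -> smooth_map g -> smooth_form setT (mwedge f g).
Proof.
move=> mM Sf Sg.
apply: (@smooth_form_wedge R M n B (form_pull f (@thetaL R G)) (form_pull g (@thetaR R G)) mM).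
- exact: inv_linl Binv.
- exact: inv_linr Binv.
- exact: vform_pull Sf (vform_thetaL G).
- exact: vform_pull Sg (vform_thetaR G).
Qed.

Lemma cartan_mul_ext (M : smoothSpace R) (f g : M -> LG) m (U : set 'rV[R]_m) p x v :
  smooth_map f -> smooth_map g -> plot M U p -> U x ->
  cartan_form B (fun y => f (p y) * g (p y))%g x v =
  cartan_form B (f \o p) x v + cartan_form B (g \o p) x v -
  2^-1 * ext_d (W := R) (mwedge f g) p x v.
Proof.
move=> Sf Sg Pp Ux.
apply: (etrans (cartan_mul Binv v (Sf _ _ _ Pp) (Sg _ _ _ Pp) Ux)).
congr (_ - _ * _); rewrite ext_d3E.
have E a b : (fun y => mwedge f g p y (pair_of a b)) = (fun y =>
    B (thetaL (f \o p) y (fun=> a)) (thetaR (g \o p) y (fun=> b)) -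
    B (thetaL (f \o p) y (fun=> b)) (thetaR (g \o p) y (fun=> a))).
  by apply/funext => y; exact: wedge2E.
by congr (_ - _ + _); apply: (congr1 (fun F => derive F x _)); exact: esym (E _ _).
Qed.

(** [thetaL] of the inverse is -Ad p (thetaL p), and [triple] is odd under a common sign and
    invariant under [Ad]. *)
Lemma cartan_inv m (U : set 'rV[R]_m) (p : 'rV[R]_m -> LG) x v : plot LG U p -> U x ->
  cartan_form B (fun y => (p y)^-1 : LG)%g x v = - cartan_form B p x v.
Proof.
move=> Pp Ux; apply: (etrans (cartan_formE Binv _ x v)).
apply: (etrans _ (congr1 -%R (esym (cartan_formE Binv p x v)))).
rewrite -mulrN; congr (_ * _).
have E i : thetaL (fun y => (p y)^-1 : LG)%g x (fun=> v i) =
    - Ad (p x) (thetaL p x (fun=> v i)) :> 'rV[R]_n.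
  apply: (etrans (thetaL_inv (fun=> v i) Pp Ux)); congr (- _).
  exact: (thetaR_Ad (fun=> v i) Pp Ux).
apply: (etrans (triple_congr B (E o0) (E o1) (E o2))).
exact: (etrans (tripleN Binv _ _ _) (congr1 -%R (tripleAd Binv (p x) _ _ _))).
Qed.

Record good_qham (M : qHamSpace G) : Prop := GoodQham {
  gq_manifold : manifold M;
  gq_moment : smooth_map (qham_moment M);
  gq_form : smooth_form setT (qham_form M);
  gq_d : forall m (U : set 'rV[R]_m) p x v, plot M U p -> U x ->
    ext_d (W := R) (qham_form M) p x v = cartan_form B (qham_moment M \o p) x v }.

(** The defect of eta under multiplication of the two moment maps is exactly the differential of the
    term that fusion adds to the sum of the 2-forms. *)
Lemma good_fusion (M1 M2 : qHamSpace G) :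
  good_qham M1 -> good_qham M2 -> good_qham (fusion B M1 M2).
Proof.
move=> [mM1 S1 F1 d1] [mM2 S2 F2 d2].
set M := prod_space M1 M2.
have mM : manifold M by exact: manifold_prod.
have Sfst : @smooth_map R M M1 fst by move=> m U p [].
have Ssnd : @smooth_map R M M2 snd by move=> m U p [].
have SP1 : @smooth_map R M LG (qham_moment M1 \o fst).
  by move=> m U p Pp; exact: (S1 _ _ _ (Sfst _ _ _ Pp)).
have SP2 : @smooth_map R M LG (qham_moment M2 \o snd).
  by move=> m U p Pp; exact: (S2 _ _ _ (Ssnd _ _ _ Pp)).
have SF1 : smooth_form setT (form_pull (M := M) fst (qham_form M1)).
  exact: smooth_form_pull Sfst F1.
have SF2 : smooth_form setT (form_pull (M := M) snd (qham_form M2)).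
  exact: smooth_form_pull Ssnd F2.
have Sw : smooth_form setT (mwedge (M := M) (qham_moment M1 \o fst) (qham_moment M2 \o snd)).
  exact: smooth_mwedge.
have SA := smooth_form_add mM SF1 SF2.
have SW := smooth_form_scale 2^-1 mM Sw.
split.
- exact: mM.
- exact: (smooth_mapM SP1 SP2).
- exact: (smooth_form_subf mM SA SW).
- move=> m U p x v Pp Ux.
  have Pp' : plot_in (setT : set M) U p by [].
  apply: (etrans (ext_d_sub v mM SA SW Pp' Ux)).
  rewrite (ext_d_add v SF1 SF2 Pp' Ux) (ext_d_scale 2^-1 v Sw Pp' Ux).
  apply: (etrans _ (esym (cartan_mul_ext v SP1 SP2 Pp Ux))).
  congr (_ + _ - _).
    exact: (d1 _ _ _ _ _ (Sfst _ _ _ Pp) Ux).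
  exact: (d2 _ _ _ _ _ (Ssnd _ _ _ Pp) Ux).
Qed.

Lemma double_alg (k a b w1 w2 w3 X Y T : R) :
  X = a + b - k * w1 -> Y = - a + - b - k * w2 -> T = X + Y - k * w3 ->
  - k * (w1 + w2) - k * w3 = T.
Proof. move=> -> -> ->; ring. Qed.

(** The multiplication formula is applied to a b, to a^-1 b^-1 and to the product of these two. The
    pullbacks of eta by a and b cancel those by a^-1 and b^-1, and the three defects are the three
    terms of omega. *)
Lemma good_double : good_qham (qham_double B).
Proof.
set M := prod_space LG LG.
have mG : manifold LG by exact: manifold_lie.
have mM : manifold M by exact: manifold_prod.
have Sa : @smooth_map R M LG fst by move=> m U p [].
have Sb : @smooth_map R M LG snd by move=> m U p [].
have Sab := smooth_mapM Sa Sb.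
have SaV := smooth_mapV Sa; have SbV := smooth_mapV Sb.
have SabV := smooth_mapM SaV SbV.
pose w1 := mwedge (M := M) fst snd.
pose w2 : diff_form R M 2 := wedge_form (W := R) B (form_pull (M := M) fst (@thetaR R G)) (form_pull (M := M) snd (@thetaL R G)).
pose w3 := mwedge (M := M) (fun x => x.1 * x.2 : LG)%g (fun x => x.1^-1 * x.2^-1 : LG)%g.
have S1 : smooth_form setT w1 by exact: smooth_mwedge.
have S3 : smooth_form setT w3 by exact: smooth_mwedge.
have S2 : smooth_form setT w2.
  apply: (@smooth_form_wedge R M n B (form_pull (M := M) fst (@thetaR R G)) (form_pull (M := M) snd (@thetaL R G)) mM).
  - exact: inv_linl Binv.
  - exact: inv_linr Binv.
  - exact: vform_pull Sa (vform_thetaR G).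
  - exact: vform_pull Sb (vform_thetaL G).
have S12 := smooth_form_scale (- 2^-1) mM (smooth_form_add mM S1 S2).
have S3' := smooth_form_scale 2^-1 mM S3.
have Eform : qham_form (qham_double B) = form_sub (form_scale (- 2^-1) (form_add w1 w2))
  (form_scale 2^-1 w3) by [].
split.
- exact: mM.
- have S := smooth_mapM (smooth_mapM Sab SaV) SbV.
  by exact: S.
- rewrite Eform; exact: (smooth_form_subf mM S12 S3').
- move=> m U p x v Pp Ux; rewrite Eform.
  have Pp' : plot_in (setT : set M) U p by [].
  have oU := mf_open mM Pp.
  apply: (etrans (ext_d_sub v mM S12 S3' Pp' Ux)).
  rewrite (ext_d_scale (- 2^-1) v (smooth_form_add mM S1 S2) Pp' Ux).
  rewrite (ext_d_add v S1 S2 Pp' Ux) (ext_d_scale 2^-1 v S3 Pp' Ux).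
  have Pa := Sa _ _ _ Pp; have Pb := Sb _ _ _ Pp.
  have E1 := cartan_mul_ext v Sa Sb Pp Ux.
  have E2 := cartan_mul_ext v SaV SbV Pp Ux.
  have E3 := cartan_mul_ext v Sab SabV Pp Ux.
  (* Inversion exchanges [thetaL] and [thetaR] up to a sign, and the two signs cancel in [B]: the
     defect for (a^-1, b^-1) is the second term of omega. *)
  have w2E : ext_d (W := R) (mwedge (fun x : M => (x.1)^-1 : LG)%g (fun x : M => (x.2)^-1 : LG)%g) p x v
      = ext_d (W := R) w2 p x v.
    apply: (ext_d_near _ oU Ux) => y w Uy.
    apply: (etrans (wedge2E _ _ _ _ _ _)); apply: (etrans _ (esym (wedge2E _ _ _ _ _ _))).
    have ta u : form_pull (fun x : M => (x.1)^-1 : LG)%g (@thetaL R G) p y u =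
        - form_pull (M := M) fst (@thetaR R G) p y u := thetaL_inv u Pa Uy.
    have tb u : form_pull (fun x : M => (x.2)^-1 : LG)%g (@thetaR R G) p y u =
        - form_pull (M := M) snd (@thetaL R G) p y u := thetaR_inv u Pb Uy.
    have BN (X Y : 'rV[R]_n) : B (- X) (- Y) = B X Y.
      by rewrite (B_opp Binv) (B_oppr Binv) opprK.
    have BNN i j : B (form_pull (fun x : M => (x.1)^-1 : LG)%g (@thetaL R G) p y (fun=> w i))
       (form_pull (fun x : M => (x.2)^-1 : LG)%g (@thetaR R G) p y (fun=> w j)) =
       B (form_pull (M := M) fst (@thetaR R G) p y (fun=> w i))
         (form_pull (M := M) snd (@thetaL R G) p y (fun=> w j)).
      exact: (etrans (congr2 B (ta (fun=> w i)) (tb (fun=> w j))) (BN _ _)).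
    by congr (_ - _); exact: BNN.
  have Em : qham_moment (qham_double B) \o p =
     (fun y => ((p y).1 * (p y).2) * ((p y).1^-1 * (p y).2^-1) : LG)%g.
    by apply/funext => y /=; rewrite !mulgA.
  rewrite w2E in E2.
  have Ia := cartan_inv v Pa Ux; have Ib := cartan_inv v Pb Ux.
  have E2' : cartan_form B ((fun x : M => x.1^-1 * x.2^-1 : LG)%g \o p) x v =
    - cartan_form B (fst \o p) x v + - cartan_form B (snd \o p) x v -
    2^-1 * ext_d (W := R) w2 p x v.
    apply: (etrans E2); congr (_ + _ - _); [exact: Ia | exact: Ib].
  have E1' : cartan_form B ((fun x : M => x.1 * x.2 : LG)%g \o p) x v =
    cartan_form B (fst \o p) x v + cartan_form B (snd \o p) x v -
    2^-1 * ext_d (W := R) w1 p x v by exact: E1.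
  apply: (etrans _ (esym (congr1 (fun f => cartan_form B f x v) Em))).
  exact: (double_alg E1' E2' E3).
Qed.

Lemma good_multi_double k : good_qham (multi_double B k).
Proof.
elim: k => [|k IH] /=; first exact: good_double.
exact: good_fusion IH good_double.
Qed.

End QHam.

(** * U(1)-valued functions and local primitives *)

Section Circle.
Variable R : realType.

(* The group U(1), written additively. *)
Record circle := Circle { circle_val :> R[i]; circle_norm : `|circle_val| == 1 }.

HB.instance Definition _ := [isSub for circle_val].
HB.instance Definition _ := [Choice of circle by <:].

Lemma circle0_norm : `|1 : R[i]| == 1. Proof. by rewrite normr1. Qed.
Lemma circleD_norm (x y : circle) : `|(x : R[i]) * (y : R[i])| == 1.
Proof. by rewrite normrM (eqP (circle_norm x)) (eqP (circle_norm y)) mulr1. Qed.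
Lemma circleN_norm (x : circle) : `|(x : R[i])^-1| == 1.
Proof. by rewrite normfV (eqP (circle_norm x)) invr1. Qed.

Lemma circle_neq0 (x : circle) : (x : R[i]) != 0.
Proof. by rewrite -normr_eq0 (eqP (circle_norm x)) oner_neq0. Qed.

Definition circle_zero := Circle circle0_norm.
Definition circle_add x y := Circle (circleD_norm x y).
Definition circle_opp x := Circle (circleN_norm x).

Lemma circle_addA : associative circle_add.
Proof. by move=> x y z; apply/val_inj; rewrite /= mulrA. Qed.
Lemma circle_addC : commutative circle_add.
Proof. by move=> x y; apply/val_inj; rewrite /= mulrC. Qed.
Lemma circle_add0 : left_id circle_zero circle_add.
Proof. by move=> x; apply/val_inj; rewrite /= mul1r. Qed.
Lemma circle_addN : left_inverse circle_zero circle_opp circle_add.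
Proof. by move=> x; apply/val_inj; rewrite /= mulVf// circle_neq0. Qed.

HB.instance Definition _ :=
  GRing.isZmodule.Build circle circle_addA circle_addC circle_add0 circle_addN.

Lemma circle_valD (x y : circle) : (x + y : circle) = (x : R[i]) * (y : R[i]) :> R[i]. Proof. by []. Qed.
Lemma circle_valN (x : circle) : (- x : circle) = (x : R[i])^-1 :> R[i]. Proof. by []. Qed.
Lemma circle_valB (x y : circle) : (x - y : circle) = (x : R[i]) / (y : R[i]) :> R[i]. Proof. by []. Qed.

(* Outside the unit circle the value is the junk value 1. *)
Definition to_circle (z : R[i]) : circle := insubd circle_zero z.

Lemma to_circleK z : `|z| = 1 -> to_circle z = z :> R[i].
Proof. by move=> z1; rewrite /to_circle insubdK// unfold_in z1. Qed.

Lemma to_circle_val (x : circle) : to_circle x = x.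
Proof. by apply/val_inj; rewrite /= to_circleK//; exact/eqP/circle_norm. Qed.

Lemma to_circle_div x y : `|x| = 1 -> `|y| = 1 -> to_circle (x / y) = to_circle x - to_circle y.
Proof.
by move=> x1 y1; apply/val_inj; rewrite /= !to_circleK// normf_div x1 y1 divr1.
Qed.

Lemma to_circle_mul x y : `|x| = 1 -> `|y| = 1 -> to_circle (x * y) = to_circle x + to_circle y.
Proof.
by move=> x1 y1; apply/val_inj; rewrite /= !to_circleK// normrM x1 y1 mulr1.
Qed.

Lemma to_circle_inv x : `|x| = 1 -> to_circle x^-1 = - to_circle x.
Proof. by move=> x1; apply/val_inj; rewrite /= !to_circleK// normfV x1 invr1. Qed.

Lemma to_circle_cocycle x y z t : `|x| = 1 -> `|y| = 1 -> `|z| = 1 -> `|t| = 1 ->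
  to_circle (x / y * z / t) = to_circle x - to_circle y + to_circle z - to_circle t.
Proof.
move=> x1 y1 z1 t1; have xy1 : `|x / y| = 1 by rewrite normf_div x1 y1 divr1.
rewrite to_circle_div//; last by rewrite normrM xy1 z1 mulr1.
by rewrite to_circle_mul// to_circle_div.
Qed.

Lemma to_circle1 : to_circle 1 = 0.
Proof. by apply/val_inj; rewrite /= to_circleK// normr1. Qed.

Definition cosC (x : circle) : R := complex.Re x.
Definition sinC (x : circle) : R := complex.Im x.

Lemma cosC_sinC x : cosC x ^+ 2 + sinC x ^+ 2 = 1.
Proof.
have /eqP := circle_norm x; rewrite /cosC /sinC; case: (circle_val x) => a b /=.
rewrite normc_def /= => -[h].
have h0 : 0 <= a ^+ 2 + b ^+ 2 by rewrite addr_ge0// sqr_ge0.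
by rewrite -(sqr_sqrtr h0) h expr1n.
Qed.

Lemma circle_eqP (x y : circle) : cosC x = cosC y -> sinC x = sinC y -> x = y.
Proof.
move=> c s; apply/val_inj => /=; move: c s; rewrite /cosC /sinC.
by case: (circle_val x) (circle_val y) => [a b] [a' b'] /= -> ->.
Qed.

Lemma cosCD x y : cosC (x + y) = cosC x * cosC y - sinC x * sinC y.
Proof. by rewrite /cosC /sinC circle_valD; case: (circle_val x) (circle_val y) => [a b] []. Qed.

Lemma sinCD x y : sinC (x + y) = cosC x * sinC y + sinC x * cosC y.
Proof. by rewrite /cosC /sinC circle_valD; case: (circle_val x) (circle_val y) => [a b] []. Qed.

Lemma cosCN x : cosC (- x) = cosC x.
Proof.
have := cosC_sinC x; rewrite /cosC /sinC circle_valN; case: (circle_val x) => [a b] /= h.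
by rewrite /GRing.inv /= h divr1.
Qed.

Lemma sinCN x : sinC (- x) = - sinC x.
Proof.
have := cosC_sinC x; rewrite /cosC /sinC circle_valN; case: (circle_val x) => [a b] /= h.
by rewrite /GRing.inv /= h divr1.
Qed.

Lemma angle_norm (t : R) : `|(cos t +i* sin t)%C| == 1.
Proof. by rewrite normc_def /= cos2Dsin2 sqrtr1. Qed.

Definition angle (t : R) : circle := Circle (angle_norm t).

Lemma cosC_angle t : cosC (angle t) = cos t. Proof. by []. Qed.
Lemma sinC_angle t : sinC (angle t) = sin t. Proof. by []. Qed.

End Circle.

Local Opaque cosC sinC.

(** * Logarithmic derivatives of U(1)-valued functions *)

Section LogDerivative.
Variables (R : realType) (M : smoothSpace R).
Hypothesis mM : manifold M.
Implicit Types (V O : set M) (g h : M -> circle R) (A : diff_form R M 1).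

(* d g = 2 pi i A g on [O], for the U(1)-valued function [g]. *)
Definition logd O g A : Prop := forall m (U : set 'rV[R]_m) p, plot_in O U p ->
  [/\ smooth_on U (fun x => cosC (g (p x))), smooth_on U (fun x => sinC (g (p x))) &
    forall x v, U x ->
      'D_(v ord0) (fun y => cosC (g (p y))) x = - (2 * pi * A m p x v * sinC (g (p x))) /\
      'D_(v ord0) (fun y => sinC (g (p y))) x = 2 * pi * A m p x v * cosC (g (p x))].

Lemma plot_in_sub V O m (U : set 'rV[R]_m) p : O `<=` V -> plot_in O U p -> plot_in V U p.
Proof. by move=> OV [Pp UO]; split => // x /UO /OV. Qed.

Lemma logd_sub V O g A : O `<=` V -> logd V g A -> logd O g A.
Proof. by move=> OV L m U p /(plot_in_sub OV) /L. Qed.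

Lemma logd_ext O g h A A' : (forall x, O x -> g x = h x) -> form_eq O A A' ->
  logd O g A -> logd O h A'.
Proof.
move=> gh AA L m U p Pp; have [Sc Ss D] := L m U p Pp.
have oU := mf_open mM Pp.1.
have E x : U x -> g (p x) = h (p x) by move=> Ux; apply: gh; exact: Pp.2.
split.
- by apply: smooth_ext oU _ Sc => x Ux; rewrite E.
- by apply: smooth_ext oU _ Ss => x Ux; rewrite E.
- move=> x v Ux; have [D1 D2] := D x v Ux.
  have Ec : 'D_(v ord0) (fun y => cosC (h (p y))) x = 'D_(v ord0) (fun y => cosC (g (p y))) x.
    by apply: near_eq_derive; apply: (near_all oU Ux) => y Uy; rewrite E.
  have Es : 'D_(v ord0) (fun y => sinC (h (p y))) x = 'D_(v ord0) (fun y => sinC (g (p y))) x.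
    by apply: near_eq_derive; apply: (near_all oU Ux) => y Uy; rewrite E.
  by rewrite -(AA m U p x v Pp Ux) -(E _ Ux); split; [exact: etrans Ec D1 | exact: etrans Es D2].
Qed.

Lemma logd_local O g A :
  (forall x, O x -> exists V, [/\ open V, V x & logd (V `&` O) g A]) -> logd O g A.
Proof.
move=> loc m U p Pp; have oU := mf_open mM Pp.1.
have h x : U x -> exists U', [/\ U' x, U' `<=` U & plot_in setT U' p /\
   [/\ smooth_on U' (fun x => cosC (g (p x))), smooth_on U' (fun x => sinC (g (p x))) &
    forall x v, U' x ->
      'D_(v ord0) (fun y => cosC (g (p y))) x = - (2 * pi * A m p x v * sinC (g (p x))) /\
      'D_(v ord0) (fun y => sinC (g (p y))) x = 2 * pi * A m p x v * cosC (g (p x))]].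
  move=> Ux; have [V [oV Vpx L]] := loc _ (Pp.2 _ Ux).
  have oUV : open (U `&` p @^-1` V) by apply: open_preim oV => //; exact: (mf_cont mM Pp.1).
  have UU : U `&` p @^-1` V `<=` U by move=> y [].
  have P' : plot M (U `&` p @^-1` V) p := mf_sub mM Pp.1 oUV UU.
  exists (U `&` p @^-1` V); split => //; split => //.
  by apply: L; split => // y [/Pp.2 Oy Vy].
split.
- by move=> k; apply: Ck_local => x /h[U' [U'x _ [_ [S _ _]]]]; exists U'.
- by move=> k; apply: Ck_local => x /h[U' [U'x _ [_ [_ S _]]]]; exists U'.
- by move=> x v /h[U' [U'x _ [_ [_ _ D]]]]; exact: D.
Qed.

Lemma mulCD_alg (k a a' c s c' s' : R) :
  - (k * a * s) * c' + c * - (k * a' * s') - (k * a * c * s' + s * (k * a' * c')) =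
  - (k * (a + a') * (c * s' + s * c')).
Proof. ring. Qed.

Lemma mulSD_alg (k a a' c s c' s' : R) :
  - (k * a * s) * s' + c * (k * a' * c') + (k * a * c * c' + s * - (k * a' * s')) =
  k * (a + a') * (c * c' - s * s').
Proof. ring. Qed.

Lemma logdD O g h A A' : logd O g A -> logd O h A' -> logd O (fun x => g x + h x) (form_add A A').
Proof.
move=> L L' m U p Pp; have [Sc Ss D] := L m U p Pp; have [Sc' Ss' D'] := L' m U p Pp.
have oU := mf_open mM Pp.1.
have Ec : (fun y => cosC (g (p y) + h (p y))) = fun y =>
  cosC (g (p y)) * cosC (h (p y)) - sinC (g (p y)) * sinC (h (p y)).
  by apply/funext => y; rewrite cosCD.
have Es : (fun y => sinC (g (p y) + h (p y))) = fun y =>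
  cosC (g (p y)) * sinC (h (p y)) + sinC (g (p y)) * cosC (h (p y)).
  by apply/funext => y; rewrite sinCD.
rewrite Ec Es; split.
- by move=> k; apply: (CkB oU); apply: (CkM oU).
- by move=> k; apply: (CkD oU); apply: (CkM oU).
- move=> x v Ux; have [D1 D2] := D x v Ux; have [D3 D4] := D' x v Ux.
  have dc := Ck1_is_derive (v ord0) (Sc 1%N) Ux; have ds := Ck1_is_derive (v ord0) (Ss 1%N) Ux.
  have dc' := Ck1_is_derive (v ord0) (Sc' 1%N) Ux; have ds' := Ck1_is_derive (v ord0) (Ss' 1%N) Ux.
  rewrite D1 in dc; rewrite D2 in ds; rewrite D3 in dc'; rewrite D4 in ds'.
  rewrite cosCD sinCD /form_add; split.
  + have [_ E] := is_deriveB (is_derive_mulR dc dc') (is_derive_mulR ds ds').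
    by apply: (etrans E); exact: mulCD_alg.
  + have [_ E] := is_deriveD (is_derive_mulR dc ds') (is_derive_mulR ds dc').
    by apply: (etrans E); exact: mulSD_alg.
Qed.

Lemma logdN O g A : logd O g A -> logd O (fun x => - g x) (form_scale (-1) A).
Proof.
move=> L m U p Pp; have [Sc Ss D] := L m U p Pp.
have oU := mf_open mM Pp.1.
have Ec : (fun y => cosC (- g (p y))) = fun y => cosC (g (p y)).
  by apply/funext => y; rewrite cosCN.
have Es : (fun y => sinC (- g (p y))) = fun y => - sinC (g (p y)).
  by apply/funext => y; rewrite sinCN.
rewrite Ec Es; split => //.
- by move=> k; apply: (CkN oU).
- move=> x v Ux; have [D1 D2] := D x v Ux.
  have ds := Ck1_is_derive (v ord0) (Ss 1%N) Ux.
  rewrite D2 in ds; rewrite cosCN sinCN /form_scale; split.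
  + by apply: (etrans D1); ring.
  + by have [_ E] := is_deriveN ds; apply: (etrans E); ring.
Qed.

Lemma logd_cst O (c : circle R) (A : diff_form R M 1) :
  form_eq O A (fun _ _ _ _ => 0) -> logd O (fun=> c) A.
Proof.
move=> A0 m U p Pp; split=> [k|k|x v Ux]; [exact: Ck_cst | exact: Ck_cst |].
by rewrite (A0 m U p x v Pp Ux) !derive_cst mulr0 !mul0r oppr0.
Qed.

Lemma form_eq_sym k O (A A' : diff_form R M k) : form_eq O A A' -> form_eq O A' A.
Proof. by move=> h m U p x v Pp Ux; rewrite (h m U p x v Pp Ux). Qed.

Lemma logd_add_cst O g A (c : circle R) : logd O g A -> logd O (fun x => g x + c) A.
Proof.
move=> L; have L0 := logd_cst (O := O) c (A := fun _ _ _ _ => 0) (fun _ _ _ _ _ _ _ => erefl).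
apply: logd_ext (logdD L L0) => // m U p x v Pp Ux.
by rewrite /form_add addr0.
Qed.

Lemma logdB O g h A A' : logd O g A -> logd O h A' ->
  logd O (fun x => g x - h x) (form_sub A A').
Proof.
move=> L L'; apply: logd_ext (logdD L (logdN L')) => // m U p x v Pp Ux.
by rewrite /form_add /form_scale /form_sub mulN1r.
Qed.

(** On a chart ball around [x] all derivatives of the real and imaginary parts vanish, so by the
    mean value theorem they are constant along each radius. *)
Lemma logd0_lconst O g A x : open O -> O x -> logd O g A ->
  form_eq O A (fun _ _ _ _ => 0) -> \forall y \near x, g y = g x.
Proof.
move=> oO Ox L A0; have [N [x0 [e [p [r [D [e0 C Dx rx DO]]]]]]] := mf_ball mM oO Ox.
have Pp : plot_in O (ball x0 e) p.
  by split; [exact: (lc_plot C) | move=> y by_; apply: DO; exact: (lc_pD C)].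
have [Sc Ss H] := L _ _ _ Pp.
have cst (f : 'rV[R]_N -> R) : smooth_on (ball x0 e) f ->
    (forall y v, ball x0 e y -> 'D_v f y = 0) -> forall y, ball x0 e y -> f y = f x0.
  move=> Sf D0 y by_; pose u := y - x0.
  have bt (t : R) : 0 <= t <= 1 -> ball x0 e (x0 + t *: u).
    move=> /andP[t0 t1]; move: by_; rewrite -!ball_normE /= => hb.
    rewrite opprD addNKr normrN normrZ ger0_norm// (le_lt_trans _ hb)//.
    by rewrite -(normrN u) opprB ler_piMl.
  have [s s01] := @mean_value R _ f x0 u (fun s hs => Ck_derivable (Sf 1%N) (bt s hs)).
  by have Eu : x0 + u = y := subrKC _ _; rewrite Eu D0; [move=> /eqP; rewrite subr_eq0 => /eqP | exact: bt].
have cE y : D y -> cosC (g y) = cosC (g x) /\ sinC (g y) = sinC (g x).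
  move=> Dy; have px : p x0 = x by rewrite -rx (lc_pr C).
  have D0 (f : circle R -> R) := cst (fun y => f (g (p y))).
  have by_ := lc_rU C Dy.
  have := D0 (@cosC R) Sc _ _ by_; have := D0 (@sinC R) Ss _ _ by_.
  rewrite (lc_pr C)// px => hs hc; split; [apply: hc | apply: hs] => z v bz.
    have [-> _] := H z (fun=> v) bz; rewrite (A0 _ _ _ _ (fun=> v) Pp bz).
    by rewrite mulr0 mul0r oppr0.
  have [_ ->] := H z (fun=> v) bz; rewrite (A0 _ _ _ _ (fun=> v) Pp bz).
  by rewrite mulr0 mul0r.
apply: (near_all (lc_open C) Dx) => y /cE[hc hs]; exact: circle_eqP.
Qed.

(** The passage between complex functions, in which line bundles are stated, and [logd], which
    speaks of real and imaginary parts and turns products and quotients of unitary functions into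
    sums and differences. *)
Lemma logdP V (z : M -> R[i]) A : unitary_on V z ->
  logd V (fun x => to_circle (z x)) A <->
  smooth_fun V z /\ form_eq V (d_fun z) (two_pi_i_form A z).
Proof.
Transparent cosC sinC.
move=> Vz.
have EC m (U : set 'rV[R]_m) p : plot_in V U p -> forall x, U x ->
  cosC (to_circle (z (p x))) = complex.Re (z (p x)) /\
  sinC (to_circle (z (p x))) = complex.Im (z (p x)).
  by move=> [_ UV] x /UV /Vz z1; rewrite /cosC /sinC to_circleK.
have ED m (U : set 'rV[R]_m) p : plot_in V U p -> forall x v, U x ->
  'D_v (fun y => cosC (to_circle (z (p y)))) x = 'D_v (fun y => complex.Re (z (p y))) x /\
  'D_v (fun y => sinC (to_circle (z (p y)))) x = 'D_v (fun y => complex.Im (z (p y))) x.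
  move=> Pp x v Ux; have oU := mf_open mM Pp.1.
  by split; apply: near_eq_derive; apply: (near_all oU Ux) => y Uy; have [] := EC _ _ _ Pp y Uy.
Local Opaque cosC sinC.
have prodE (a : R) (w : R[i]) : (0 +i* a)%C * w =
  (- (a * complex.Im w) +i* (a * complex.Re w))%C.
  by case: w => c s; apply/eqP; rewrite eq_complex /=; apply/andP; split; apply/eqP; ring.
split=> [L|[Sz Dz] m U p Pp].
  split=> [m U p Pp|m U p x v Pp Ux].
    have [Sc Ss _] := L m U p Pp; have oU := mf_open mM Pp.1.
    by split; [apply: smooth_ext oU _ Sc | apply: smooth_ext oU _ Ss] => x /(EC _ _ _ Pp)[].
  have [_ _ /(_ x v Ux)[D1 D2]] := L m U p Pp.
  have [E1 E2] := ED _ _ _ Pp x (v ord0) Ux; have [F1 F2] := EC _ _ _ Pp x Ux.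
  rewrite /two_pi_i_form prodE /d_fun -F1 -F2.
  by apply: (congr2 (@Complex R)); [exact: etrans (esym E1) D1 | exact: etrans (esym E2) D2].
have [Sc Ss] := Sz m U p Pp; have oU := mf_open mM Pp.1.
split.
- by apply: smooth_ext oU _ Sc => x /(EC _ _ _ Pp)[].
- by apply: smooth_ext oU _ Ss => x /(EC _ _ _ Pp)[].
- move=> x v Ux; have := Dz m U p x v Pp Ux.
  have [E1 E2] := ED _ _ _ Pp x (v ord0) Ux; have [F1 F2] := EC _ _ _ Pp x Ux.
  rewrite /two_pi_i_form prodE /d_fun -F1 -F2 => -[D1 D2].
  by split; [exact: etrans E1 D1 | exact: etrans E2 D2].
Qed.

End LogDerivative.
Arguments logd_add_cst {R M} mM {O g A} c.

Lemma ball_star (R : realType) N (x0 : 'rV[R]_N) (e : R) x (t : R) : ball x0 e x ->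
  0 <= t <= 1 -> ball x0 e (x0 + t *: (x - x0)).
Proof.
rewrite -!ball_normE /= => hb /andP[t0 t1].
rewrite opprD addNKr normrN normrZ ger0_norm// (le_lt_trans _ hb)//.
by rewrite -(normrN (x - x0)) opprB ler_piMl.
Qed.

(** * Forms in a chart *)

Section ChartForms.
Variables (R : realType) (M : smoothSpace R).
Hypothesis mM : manifold M.
Variables (N : nat) (U : set 'rV[R]_N) (p : 'rV[R]_N -> M) (r : M -> 'rV[R]_N) (D : set M).
Hypothesis C : local_chart U p r D.

Let oU : open U := mf_open mM (lc_plot C).
Let Pp : plot_in D U p := conj (lc_plot C) (lc_pD C).

Notation dl i := (delta_mx 0 i : 'rV[R]_N).

Lemma form1_sum (A : diff_form R M 1) y (v : 'rV[R]_N) : smooth_form D A -> U y ->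
  A N p y (fun=> v) = \sum_i v 0 i * A N p y (fun=> dl i).
Proof.
move=> [lin _ _ _] Uy.
have L c u w : A N p y (fun=> c *: u + w) = c * A N p y (fun=> u) + A N p y (fun=> w).
  have := lin N U p y Pp Uy ord0 (fun=> 0) c u w.
  have E t : (fun j : 'I_1 => if j == ord0 then t else 0 : 'rV[R]_N) = (fun=> t).
    by apply/funext => j; rewrite ord1.
  by rewrite /= !E.
have L0 : A N p y (fun=> 0) = 0.
  have := L (-1) 0 0; rewrite scaler0 addr0 mulN1r addNr; exact.
rewrite {1}[v]row_sum_delta.
apply: (big_ind2 (fun u s => A N p y (fun=> u) = s)) => //.
- by move=> u1 s1 u2 s2 <- <-; have := L 1 u1 u2; rewrite scale1r mul1r.
- by move=> i _; have := L (v 0 i) (dl i) 0; rewrite L0 !addr0.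
Qed.

Lemma pair_ofE (T : Type) (v : 'I_2 -> T) : v = pair_of (v ord0) (v ord_max).
Proof. by apply/funext => j; case: (ord2P j) => ->. Qed.

Lemma form2_sum (F : diff_form R M 2) y (u v : 'rV[R]_N) : smooth_form D F -> U y ->
  F N p y (pair_of u v) =
  \sum_i \sum_j u 0 i * v 0 j * F N p y (pair_of (dl i) (dl j)).
Proof.
move=> [lin _ _ _] Uy.
have Ll c a b w : F N p y (pair_of (c *: a + b) w) = c * F N p y (pair_of a w) + F N p y (pair_of b w).
  have := lin N U p y Pp Uy ord0 (pair_of 0 w) c a b.
  have E t : (fun j : 'I_2 => if j == ord0 then t else pair_of 0 w j : 'rV[R]_N) = pair_of t w.
    by apply/funext => j; case: (ord2P j) => ->.
  by rewrite /= !E.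
have Lr c a b w : F N p y (pair_of w (c *: a + b)) = c * F N p y (pair_of w a) + F N p y (pair_of w b).
  have := lin N U p y Pp Uy ord_max (pair_of w 0) c a b.
  have E t : (fun j : 'I_2 => if j == ord_max then t else pair_of w 0 j : 'rV[R]_N) = pair_of w t.
    by apply/funext => j; case: (ord2P j) => ->.
  by rewrite /= !E.
exact: (@bilinE R N N (fun a b => F N p y (pair_of a b)) Ll Lr).
Qed.

Variable a : 'I_N -> 'rV[R]_N -> R.
Hypothesis Sa : forall i, smooth_on U (a i).

(** The pullback by the chart [r] of the 1-form with coefficients [a i], evaluated on arbitrary
    plots. *)
Definition chart_form : diff_form R M 1 := fun m q x v =>
  \sum_i ('D_(v ord0) (fun y => r (q y)) x) 0 i * a i (r (q x)).

Lemma chart_rq m (U' : set 'rV[R]_m) q : plot_in D U' q -> smooth_on U' (fun y => r (q y)).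
Proof. by move=> Pq; exact: (lc_smooth C Pq.1 Pq.2). Qed.

Lemma chart_qU m (U' : set 'rV[R]_m) q y : plot_in D U' q -> U' y -> U (r (q y)).
Proof. by move=> Pq U'y; exact: (lc_rU C (Pq.2 _ U'y)). Qed.

Lemma smooth_a_rq m (U' : set 'rV[R]_m) q i : plot_in D U' q ->
  smooth_on U' (fun y => a i (r (q y))).
Proof.
move=> Pq; apply: (smooth_comp (mf_open mM Pq.1) oU _ (Sa i) (chart_rq Pq)) => y.
exact: chart_qU.
Qed.

Lemma smooth_drq m (U' : set 'rV[R]_m) q v i : plot_in D U' q ->
  smooth_on U' (fun x => ('D_v (fun y => r (q y)) x) 0 i).
Proof.
move=> Pq k; exact: ((Ck_coords k _ (mf_open mM Pq.1)).1 (Ck_derive v (chart_rq Pq k.+1)) i).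
Qed.

Lemma chart_rq_comp m l (U' : set 'rV[R]_m) (V' : set 'rV[R]_l) q q'
    (f : 'rV[R]_l -> 'rV[R]_m) y v :
  plot_in D U' q -> plot_in D V' q' -> smooth_on V' f ->
  (forall y, V' y -> U' (f y) /\ q' y = q (f y)) -> V' y ->
  'D_v (fun y => r (q' y)) y = 'D_('D_v f y) (fun y => r (q y)) (f y).
Proof.
move=> Pq Pq' Sf UU V'y.
have [_ E] := chainV (mf_open mM Pq.1) (chart_rq Pq 1%N) (UU y V'y).1
  (Ck1_is_derive v (Sf 1%N) V'y).
apply: (etrans _ E); apply: near_eq_derive.
by apply: (near_all (mf_open mM Pq'.1) V'y) => z /UU[_ ->].
Qed.

Lemma smooth_chart_form : smooth_form D chart_form.
Proof.
split.
- move=> m U' q x Pq U'x i v c u w /=; rewrite /chart_form (_ : (ord0 == i) = true) ?ord1//=.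
  rewrite mulr_sumr -big_split; apply: eq_bigr => j _ /=.
  have E := deriveV_lin c u w (mf_open mM Pq.1) (chart_rq Pq 1%N) U'x.
  have /(congr1 (fun s : 'rV[R]_N => s 0 j)) E' := E.
  rewrite !mxE in E'.
  apply: (etrans (congr1 (fun s => s * a j (r (q x))) E')).
  by rewrite mulrDl mulrA.
- by move=> m U' q x Pq U'x i j; rewrite !ord1 eqxx.
- move=> m U' q Pq v k; have oU' := mf_open mM Pq.1.
  by apply: (Ck_sum _ oU') => i; apply: (CkM oU'); [exact: smooth_drq | exact: smooth_a_rq].
- move=> m l U' V' q q' f Pq Pq' Sf UU y v V'y; rewrite /chart_form.
  apply: eq_bigr => i _; rewrite (UU y V'y).2.
  by rewrite (chart_rq_comp _ Pq Pq' Sf UU V'y).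
Qed.

Lemma form_chartE k (F : diff_form R M k) m (U' : set 'rV[R]_m) q x v :
  smooth_form D F -> plot_in D U' q -> U' x ->
  F m q x v = F N p (r (q x)) (fun i => 'D_(v i) (fun y => r (q y)) x).
Proof.
move=> [_ _ _ nat] Pq U'x; apply: (nat _ _ U U' p q (fun y => r (q y)) Pp Pq) => //.
  exact: chart_rq.
by move=> y U'y; split; [exact: chart_qU Pq U'y | rewrite (lc_pr C (Pq.2 _ U'y))].
Qed.

Lemma is_derive_a_rq m (U' : set 'rV[R]_m) q x v i : plot_in D U' q -> U' x ->
  is_derive x v (fun y => a i (r (q y)))
    (\sum_j ('D_v (fun y => r (q y)) x) 0 j * 'D_(dl j) (a i) (r (q x))).
Proof.
move=> Pq U'x; have Urq := chart_qU Pq U'x.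
have Cr := chart_rq Pq 1%N.
have h := C1_chain oU (Ck1_C1 (Sa i 1%N)) Urq (Ck_derivable (v := v) Cr U'x).
by rewrite -(C1_deriveE _ oU (Ck1_C1 (Sa i 1%N)) Urq).
Qed.

(** In its use [DD] holds second derivatives of the chart along a plot. They are the same in both
    sums by symmetry and cancel; exchanging the summation indices leaves the antisymmetrized
    derivatives of the coefficients. *)
Lemma swap_alg n (A B : 'I_n -> R) (DD : 'I_n -> R) (al : 'I_n -> R) (da f : 'I_n -> 'I_n -> R) :
  (forall i j, da i j - da j i = f i j) ->
  (\sum_i (DD i * al i + B i * \sum_j A j * da j i)) -
  (\sum_i (DD i * al i + A i * \sum_j B j * da j i)) =
  \sum_i \sum_j A i * B j * f i j.
Proof.
move=> fE; rewrite !big_split /= opprD addrACA subrr add0r.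
under eq_bigr do rewrite mulr_sumr.
rewrite exchange_big /= -sumrB; apply: eq_bigr => i _.
rewrite mulr_sumr -sumrB; apply: eq_bigr => j _; rewrite -fE; ring.
Qed.

Lemma ext_d2E (A : diff_form R M 1) m (q : 'rV[R]_m -> M) x v :
  ext_d (W := R) A q x v = 'D_(v ord0) (fun y => A m q y (fun=> v ord_max)) x -
    'D_(v ord_max) (fun y => A m q y (fun=> v ord0)) x.
Proof.
rewrite /ext_d big_ord_recl big_ord1 /= expr0 expr1 scale1r scaleN1r.
have E0 : (fun j : 'I_1 => v (lift ord0 j)) = fun=> v ord_max.
  by apply/funext => -[[|//] lt]; congr (v _); apply: ord_inj.
have E1 : (fun j : 'I_1 => v (lift (lift ord0 ord0) j)) = fun=> v ord0.
  by apply/funext => -[[|//] lt]; congr (v _); apply: ord_inj.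
have E2 : lift ord0 ord0 = ord_max :> 'I_2 by apply: ord_inj.
by rewrite E0 E1 E2.
Qed.

(** Exterior differentiation commutes with the pullback by [r], so it is enough to know the
    antisymmetrized derivatives of the coefficients in the chart. *)
Lemma ext_d_chart_form (F : diff_form R M 2) : smooth_form D F ->
  (forall i j y, U y -> 'D_(dl i) (a j) y - 'D_(dl j) (a i) y = F N p y (pair_of (dl i) (dl j))) ->
  form_eq D (ext_d (W := R) chart_form) F.
Proof.
move=> SF HF m U' q x v Pq U'x; have oU' := mf_open mM Pq.1.
rewrite ext_d2E (form_chartE v SF Pq U'x).
have h u w : 'D_u (fun y => chart_form q y (fun=> w)) x =
  \sum_i (('D_u ('D_w (fun y => r (q y))) x) 0 i * a i (r (q x)) +
     ('D_w (fun y => r (q y)) x) 0 i *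
       \sum_j ('D_u (fun y => r (q y)) x) 0 j * 'D_(dl j) (a i) (r (q x))).
  have d i : is_derive x u (fun y => ('D_w (fun y => r (q y)) y) 0 i * a i (r (q y)))
    (('D_u ('D_w (fun y => r (q y))) x) 0 i * a i (r (q x)) +
     ('D_w (fun y => r (q y)) x) 0 i *
       \sum_j ('D_u (fun y => r (q y)) x) 0 j * 'D_(dl j) (a i) (r (q x))).
    apply: is_derive_mulR; last exact: (is_derive_a_rq u i Pq U'x).
    apply: is_derive_coordE; apply: Ck1_is_derive U'x.
    exact: (Ck_derive w (chart_rq Pq 2%N)).
  by have [_ E] := is_derive_sumR d.
apply: (etrans (congr2 (fun s t => s - t) (h _ _) (h _ _))).
rewrite (schwarzV (v ord_max) (v ord0) oU' (chart_rq Pq 2%N) U'x).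
apply: (etrans (swap_alg _ _ _ _ (fun i j => HF i j _ (chart_qU Pq U'x)))).
apply: (etrans (esym (form2_sum _ _ SF (chart_qU Pq U'x)))).
by congr (F _ _ _ _); apply/esym; exact: (pair_ofE (fun i => 'D_(v i) (fun y => r (q y)) x)).
Qed.

End ChartForms.

Section LocalPrimitives.
Variables (R : realType) (M : smoothSpace R).
Hypothesis mM : manifold M.

Lemma derive_cos_sin m (U : set 'rV[R]_m) (f : 'rV[R]_m -> R) x v : smooth_on U f -> U x ->
  'D_v (fun y => cos (f y)) x = - ('D_v f x * sin (f x)) /\
  'D_v (fun y => sin (f y)) x = 'D_v f x * cos (f x).
Proof.
move=> Sf Ux; have df : derivable f x v := Ck_derivable (Sf 1%N) Ux.
have [dc Ec] := is_derive_cos (f x); have [ds Es] := is_derive_sin (f x).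
have [_ E1] := is_derive_comp1 df dc; have [_ E2] := is_derive_comp1 df ds.
split; first by apply: (etrans E1); rewrite Ec mulNr mulrC.
by apply: (etrans E2); rewrite Es mulrC.
Qed.

Lemma logd_exists (O : set M) (A : diff_form R M 1) x : open O -> O x -> smooth_form O A ->
  form_eq O (ext_d (W := R) A) (fun _ _ _ _ => 0) ->
  exists V g, [/\ open V, V x, V `<=` O & logd V g A].
Proof.
move=> oO Ox SA dA; have [N [x0 [e [p [r [D [e0 C Dx rx DO]]]]]]] := mf_ball mM oO Ox.
have ob : open (ball x0 e) by exact: ball_open.
have SD := smooth_form_sub DO SA.
have Pp : plot_in D (ball x0 e) p := conj (lc_plot C) (lc_pD C).
pose a i y := A N p y (fun=> delta_mx 0 i).
have Sa i : smooth_on (ball x0 e) (a i) by case: SD => _ _ S _; exact: S.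
have [|phi Sphi Dphi] := poincare1 ob (@ball_star R N x0 e) Sa.
  move=> i j y by_; have := dA N _ p y (pair_of (delta_mx 0 i) (delta_mx 0 j))
    (plot_in_sub DO Pp) by_.
  by rewrite ext_d2E => /eqP; rewrite subr_eq0 => /eqP.
(* This is exp (2 pi i phi) for a potential phi of [A] in the chart; the factor is the normalization
   of [logd]. *)
exists D, (fun z => angle (2 * pi * phi (r z))); split => //; first exact: (lc_open C).
move=> m U q Pq; have oU := mf_open mM Pq.1.
have Sphiq : smooth_on U (fun y => phi (r (q y))).
  apply: (smooth_comp oU ob _ Sphi (chart_rq C Pq)) => y Uy; exact: (chart_qU C Pq Uy).
have Sf : smooth_on U (fun y => 2 * pi * phi (r (q y))) by move=> k; apply: (CkZ _ oU).
split=> [k|k|y v Uy].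
- exact: (Ck_cos_sin oU (Sf k)).1.
- exact: (Ck_cos_sin oU (Sf k)).2.
- have [E1 E2] := derive_cos_sin (v ord0) Sf Uy.
  have Urq := chart_qU C Pq Uy.
  have EA : A m q y v = 'D_('D_(v ord0) (fun z => r (q z)) y) phi (r (q y)).
    rewrite Dphi// (form_chartE C v SD Pq Uy).
    have Ev : (fun i => 'D_(v i) (fun z => r (q z)) y) = fun=> 'D_(v ord0) (fun z => r (q z)) y.
      by apply/funext => i; rewrite ord1.
    by rewrite Ev; exact: (form1_sum C _ SD Urq).
  have Ed : 'D_(v ord0) (fun z => 2 * pi * phi (r (q z))) y = 2 * pi * A m q y v.
    have h1 := C1_chain ob (Ck1_C1 (Sphi 1%N)) Urq (Ck_derivable (v := v ord0) (chart_rq C Pq 1%N) Uy).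
    by have [_ E] := is_deriveZ (2 * pi) h1; rewrite EA; exact: E.
  rewrite cosC_angle sinC_angle; split.
    by apply: (etrans E1); rewrite Ed.
  by apply: (etrans E2); rewrite Ed.
Qed.

Lemma primitive_exists (O : set M) (F : diff_form R M 2) x : open O -> O x -> smooth_form O F ->
  form_eq O (ext_d (W := R) F) (fun _ _ _ _ => 0) ->
  exists V A, [/\ open V, V x, V `<=` O, smooth_form V A & form_eq V (ext_d (W := R) A) F].
Proof.
move=> oO Ox SF dF; have [N [x0 [e [p [r [D [e0 C Dx rx DO]]]]]]] := mf_ball mM oO Ox.
have ob : open (ball x0 e) by exact: ball_open.
have SD := smooth_form_sub DO SF.
have Pp : plot_in D (ball x0 e) p := conj (lc_plot C) (lc_pD C).
pose dl i : 'rV[R]_N := delta_mx 0 i.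
pose f i j y := F N p y (pair_of (dl i) (dl j)).
have Sf i j : smooth_on (ball x0 e) (f i j) by case: SD => _ _ S _; exact: S.
have fC i j y : ball x0 e y -> f i j y = - f j i y.
  move=> by_; have [_ alt _ _] := SD.
  (* Forms are alternating by definition; the antisymmetry asked by [poincare2] follows by
     polarization at dl i + dl j. *)
  have alt' u : F N p y (pair_of u u) = 0 by exact: (alt _ _ _ _ Pp by_ ord0 ord_max).
  have [lin _ _ _] := SD.
  have L u u' w : F N p y (pair_of (u + u') w) = F N p y (pair_of u w) + F N p y (pair_of u' w).
    have := lin N _ p y Pp by_ ord0 (pair_of 0 w) 1 u u'; rewrite /= scale1r mul1r.
    have E t : (fun j : 'I_2 => if j == ord0 then t else pair_of 0 w j : 'rV[R]_N) = pair_of t w.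
      by apply/funext => k; case: (ord2P k) => ->.
    by rewrite !E.
  have L' u u' w : F N p y (pair_of w (u + u')) = F N p y (pair_of w u) + F N p y (pair_of w u').
    have := lin N _ p y Pp by_ ord_max (pair_of w 0) 1 u u'; rewrite /= scale1r mul1r.
    have E t : (fun j : 'I_2 => if j == ord_max then t else pair_of w 0 j : 'rV[R]_N) = pair_of w t.
      by apply/funext => k; case: (ord2P k) => ->.
    by rewrite !E.
  have := alt' (dl i + dl j); rewrite L !L' !alt' add0r addr0 => /eqP.
  by rewrite addr_eq0 => /eqP.
have [i j k y by_|a Sa Ha] := poincare2 ob (@ball_star R N x0 e) Sf fC.
  pose v (t : 'I_3) := if t == o0 then dl i else if t == o1 then dl j else dl k.
  have := dF N _ p y v (plot_in_sub DO Pp) by_.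
  by rewrite ext_d3E.
exists D, (chart_form r a); split => //; first exact: (lc_open C).
  exact: (smooth_chart_form mM C Sa).
exact: (ext_d_chart_form mM C Sa SD).
Qed.

End LocalPrimitives.

(** * Gerbes and pre-quantizations *)

Section LineBundleCalculus.
Variables (R : realType) (M : smoothSpace R).
Hypothesis mM : manifold M.
Implicit Types (L : lineBundle M) (V : set M).

Definition cframe L (a : frame_index L) (x : M) : circle R := to_circle (frame L a x).

Definition unitary_frames L := forall a, unitary_on (frame_dom L a) (frame L a).

Lemma unitary_tensor L1 L2 : unitary_frames L1 -> unitary_frames L2 ->
  unitary_frames (lb_tensor L1 L2).
Proof. by move=> u1 u2 [a b] x [/= /u1 ha /u2 hb]; rewrite normrM ha hb mulr1. Qed.

Lemma unitary_dual L : unitary_frames L -> unitary_frames (lb_dual L).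
Proof. by move=> u a x /u /= ha; rewrite normfV ha invr1. Qed.

Lemma cframe_tensor L1 L2 a x : unitary_frames L1 -> unitary_frames L2 ->
  frame_dom (lb_tensor L1 L2) a x ->
  cframe (L := lb_tensor L1 L2) a x = cframe (L := L1) a.1 x + cframe (L := L2) a.2 x.
Proof. by move=> u1 u2 [d1 d2]; apply: to_circle_mul; [exact: u1 | exact: u2]. Qed.

Lemma cframe_dual L a x : unitary_frames L -> frame_dom (lb_dual L) a x ->
  cframe (L := lb_dual L) a x = - cframe (L := L) a x.
Proof. by move=> u d; apply: to_circle_inv; exact: u. Qed.

Lemma complex_move (x y : R[i]) (s t : R) :
  x + (0 +i* (2 * pi * s))%C * y = (0 +i* (2 * pi * t))%C * y <->
  x = (0 +i* (2 * pi * (t - s)))%C * y.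
Proof.
have E : (0 +i* (2 * pi * (t - s)))%C * y =
  (0 +i* (2 * pi * t))%C * y - (0 +i* (2 * pi * s))%C * y.
  by rewrite -mulrBl; congr (_ * _); apply/eqP; rewrite eq_complex /=; apply/andP; split;
    apply/eqP; ring.
rewrite E; split=> [<-|->]; first by rewrite addrK.
by rewrite subrK.
Qed.

(** The connection form moves to the other side: the covariant derivative of z is 2 pi i A z exactly
    when z has logarithmic derivative A minus the connection form. *)
Lemma covariantP L a V (z : M -> R[i]) (A : diff_form R M 1) :
  form_eq V (covariant (L := L) a z) (two_pi_i_form A z) <->
  form_eq V (d_fun z) (two_pi_i_form (form_sub A (conn_form L a)) z).
Proof.
have E m (p : 'rV[R]_m -> M) x v :=
  complex_move (d_fun z p x v) (z (p x)) (conn_form L a m p x v) (A m p x v).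
by split=> h m U p x v Pp Ux; [apply: (E m p x v).1 | apply: (E m p x v).2]; exact: h Pp Ux.
Qed.

Lemma lb_transition V L a b : is_line_bundle V L ->
  logd (frame_dom L a `&` frame_dom L b) (fun x => cframe b x - cframe a x)
    (form_sub (conn_form L b) (conn_form L a)).
Proof.
move=> [_ u _ h]; have [Sg /covariantP Eg] := h a b.
have U : unitary_on (frame_dom L a `&` frame_dom L b) (fun x => frame L b x / frame L a x).
  by move=> x [/u ha /u hb]; rewrite normf_div ha hb divr1.
apply: (logd_ext mM _ _ ((logdP mM _ U).2 (conj Sg Eg))) => // x [da db].
by apply: to_circle_div; exact: u.
Qed.

Lemma lb_transitionE V L : (forall a, open (frame_dom L a)) -> V = \bigcup_a frame_dom L a ->
  unitary_frames L -> (forall a, smooth_form (frame_dom L a) (conn_form L a)) ->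
  (forall a b, logd (frame_dom L a `&` frame_dom L b) (fun x => cframe b x - cframe a x)
    (form_sub (conn_form L b) (conn_form L a))) -> is_line_bundle V L.
Proof.
move=> oL VE u S T; split => // a b /=.
have U : unitary_on (frame_dom L a `&` frame_dom L b) (fun x => frame L b x / frame L a x).
  by move=> x [/u ha /u hb]; rewrite normf_div ha hb divr1.
have [|Sg Eg] := (logdP mM (form_sub (conn_form L b) (conn_form L a)) U).1.
  apply: (logd_ext mM _ _ (T a b)) => // x [da db].
  by apply/esym/to_circle_div; exact: u.
by split => //; apply/covariantP.
Qed.

(** A unitary section is parallel when its quotient by each frame has minus the connection form as
    logarithmic derivative. From here on parallel sections are handled through this criterion. *)
Lemma section_logd V L (s : M -> R[i]) : unitary_frames L ->
  parallel_unitary_section V L s <->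
  unitary_on V s /\ forall a, logd (V `&` frame_dom L a) (fun x => to_circle (s x) - cframe a x)
    (form_scale (-1) (conn_form L a)).
Proof.
move=> u.
have U a : unitary_on V s -> unitary_on (V `&` frame_dom L a) (fun x => s x / frame L a x).
  by move=> us x [/us ha /u hb]; rewrite normf_div ha hb divr1.
have Z (z : M -> R[i]) : (fun m (p : 'rV[R]_m -> M) x (v : 'I_1 -> 'rV[R]_m) => 0) =
   two_pi_i_form (fun _ _ _ _ => 0) z.
  apply/functional_extensionality_dep => m; do 3!(apply/functional_extensionality_dep => ?).
  by rewrite /two_pi_i_form mulr0 mul0r.
have N a : form_sub (fun _ _ _ _ => 0) (conn_form L a) = form_scale (-1) (conn_form L a).
  apply/functional_extensionality_dep => m; do 3!(apply/functional_extensionality_dep => ?).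
  by rewrite /form_sub /form_scale sub0r mulN1r.
split=> -[us h]; split=> // a.
- have [Sg] := h a; rewrite (Z (fun x => s x / frame L a x)) => /covariantP Eg.
  rewrite N in Eg.
  apply: (logd_ext mM _ _ ((logdP mM _ (U a us)).2 (conj Sg Eg))) => // x [da db].
  by apply: to_circle_div; [exact: us | exact: u].
- have [|Sg Eg] := (logdP mM (form_scale (-1) (conn_form L a)) (U a us)).1.
    apply: (logd_ext mM _ _ (h a)) => // x [da db].
    by apply/esym/to_circle_div; [exact: us | exact: u].
  split => //; rewrite (Z (fun x => s x / frame L a x)); apply/covariantP.
  by rewrite N.
Qed.

End LineBundleCalculus.

(** * Pullback of line bundles and gerbes *)

Section Pull.
Variables (R : realType) (M N : smoothSpace R) (f : M -> N).
Hypotheses (mM : manifold M) (mN : manifold N) (Sf : smooth_map f).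

Let cf : continuous f := smooth_map_continuous mM mN Sf.

Lemma plot_in_pull V m (U : set 'rV[R]_m) p : plot_in (f @^-1` V) U p -> plot_in V U (f \o p).
Proof. by move=> [Pp UV]; split => //; exact: Sf. Qed.

Lemma smooth_fun_pull V g : smooth_fun V g -> smooth_fun (f @^-1` V) (g \o f).
Proof. by move=> Sg m U p /plot_in_pull; exact: Sg. Qed.

Lemma is_line_bundle_pull V L : is_line_bundle V L -> is_line_bundle (f @^-1` V) (lb_pull f L).
Proof.
move=> [[oL VE] u S T]; split.
- split; first by move=> a; apply: open_comp => // x _; exact: cf.
  by rewrite VE; apply/seteqP; split=> x [a _ da]; exists a.
- by move=> a x; exact: u.
- by move=> a; exact: smooth_form_pull.
- move=> a b; have [Sg Eg] := T a b; split; first exact: smooth_fun_pull Sg.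
  move=> m U p x v Pp; apply: Eg.
  exact: (@plot_in_pull (frame_dom L a `&` frame_dom L b)) Pp.
Qed.

Lemma parallel_unitary_section_pull V L s : parallel_unitary_section V L s ->
  parallel_unitary_section (f @^-1` V) (lb_pull f L) (s \o f).
Proof.
move=> [us h]; split=> [x|a]; first exact: us.
have [Sg Eg] := h a; split; first exact: smooth_fun_pull Sg.
move=> m U p x v Pp; apply: Eg.
exact: (@plot_in_pull (V `&` frame_dom L a)) Pp.
Qed.

Lemma is_gerbe_pull (Gr : gerbe N) : is_gerbe Gr -> is_gerbe (gerbe_pull f Gr).
Proof.
move=> [[oU UE] [LL Ls] th coc [Sw Cw]]; split.
- split; first by move=> i; apply: open_comp => // x _; exact: cf.
  apply/seteqP; split=> x // _.
  by have : (\bigcup_i gerbe_dom Gr i) (f x) by rewrite UE.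
- split=> i j; first exact: is_line_bundle_pull (LL i j).
  by have [s Hs] := Ls i j; exists (s \o f); exact: (parallel_unitary_section_pull Hs).
- by move=> i j k; exact: (parallel_unitary_section_pull (th i j k)).
- by move=> i j k l x; exact: coc.
- split; first by move=> i; exact: smooth_form_pull Sf (Sw i).
  move=> i j a m U p x v Pp; apply: Cw.
  exact: (@plot_in_pull (frame_dom (gerbe_line Gr i j) a)) Pp.
Qed.

End Pull.

Ltac form_ring :=
  let m := fresh in let U := fresh in let p := fresh in let x := fresh in let v := fresh in
  move=> m U p x v _ _; rewrite /= /form_add /form_sub /form_scale /=; ring.

(** * Frames of a gerbe without the cocycle theta *)

Section GerbeStructure.
Variables (R : realType) (M : smoothSpace R).
Hypothesis mM : manifold M.
Variable Gr : gerbe M.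
Hypothesis HG : is_gerbe Gr.

Local Notation I := (gerbe_index Gr).
Local Notation Ud := (gerbe_dom Gr).
Local Notation L := (gerbe_line Gr).
Local Notation Fr i j := (frame_index (L i j)).
Local Notation dm c := (frame_dom _ c).
Local Notation cn c := (conn_form _ c).
Local Notation varpi := (gerbe_form Gr).

Lemma gerbe_dom_open i : open (Ud i). Proof. by have [[]] := HG. Qed.

Lemma gerbe_domP x : exists i, Ud i x.
Proof.
have [[_ UE] _ _ _ _] := HG.
have [i _ Ui] : (\bigcup_i Ud i) x by rewrite UE.
by exists i.
Qed.

Definition base_index (x : M) : I := projT1 (cid (gerbe_domP x)).

Lemma base_indexP x : Ud (base_index x) x.
Proof. exact: projT2 (cid (gerbe_domP x)). Qed.

Lemma gl_line i j : is_line_bundle (Ud i `&` Ud j) (L i j).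
Proof. by have [_ [h _] _ _ _] := HG. Qed.

Lemma gl_unitary i j : unitary_frames (L i j).
Proof. by have [_ ? _ _] := gl_line i j. Qed.

Lemma gl_open i j (c : Fr i j) : open (dm c).
Proof. by have [[? _] _ _ _] := gl_line i j. Qed.

Lemma gl_dom i j (c : Fr i j) x : dm c x -> Ud i x /\ Ud j x.
Proof.
have [[_ E] _ _ _] := gl_line i j => dx.
have : (Ud i `&` Ud j) x by rewrite E; exists c.
by [].
Qed.

Lemma gl_frame i j x : Ud i x -> Ud j x -> exists c : Fr i j, dm c x.
Proof.
have [[_ E] _ _ _] := gl_line i j => Ui Uj.
have : (Ud i `&` Ud j) x by [].
by rewrite E => -[c _ dx]; exists c.
Qed.

Lemma gl_smooth i j (c : Fr i j) : smooth_form (dm c) (cn c).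
Proof. by have [_ _ ? _] := gl_line i j. Qed.

Lemma gl_curv i j (c : Fr i j) :
  form_eq (dm c) (ext_d (W := R) (cn c)) (form_sub (varpi j) (varpi i)).
Proof. by have [_ _ _ _ [_ h]] := HG; exact: form_eq_sym (h i j c). Qed.

Definition ctheta i j k x : circle R := to_circle (gerbe_theta Gr i j k x).
Definition theta0 i j x : circle R := ctheta (base_index x) i j x.

Lemma theta_unit i j k x : Ud i x -> Ud j x -> Ud k x -> `|gerbe_theta Gr i j k x| = 1.
Proof. by have [_ _ th _ _] := HG; have [u _] := th i j k => Ui Uj Uk; apply: u. Qed.

(** The cocycle condition of [theta] at [x] for the base index of [x] followed by i, j, k. *)
Lemma theta_cocycle i j k x : Ud i x -> Ud j x -> Ud k x ->
  ctheta i j k x = theta0 j k x - theta0 i k x + theta0 i j x.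
Proof.
move=> Ui Uj Uk; have Ub := base_indexP x.
have [_ _ _ coc _] := HG.
have := coc (base_index x) i j k x (conj (conj (conj Ub Ui) Uj) Uk).
move=> /(congr1 (@to_circle R)).
have u1 := theta_unit Ui Uj Uk; have u2 := theta_unit Ub Uj Uk.
have u3 := theta_unit Ub Ui Uk; have u4 := theta_unit Ub Ui Uj.
rewrite to_circle_cocycle//.
rewrite -/(ctheta i j k x) -/(ctheta (base_index x) j k x) -/(ctheta (base_index x) i k x)
  -/(ctheta (base_index x) i j x) -/(theta0 j k x) -/(theta0 i k x) -/(theta0 i j x).
rewrite to_circle1.
move=> /(congr1 (fun t => t + theta0 j k x - theta0 i k x + theta0 i j x)).
rewrite add0r => <-; zmod.
Qed.

(* At each [x], the cochain [theta0] trivializes the cocycle [theta] (without any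
   continuity in [x]); in this trivialization the frames multiply without [theta]. *)
Definition lframe i j (c : Fr i j) x : circle R := cframe c x - theta0 i j x.

Lemma lframe_trans i j (a b : Fr i j) : logd (dm a `&` dm b)
  (fun x => lframe b x - lframe a x) (form_sub (cn b) (cn a)).
Proof.
apply: (logd_ext mM _ _ (@lb_transition R M mM _ _ a b (gl_line i j))) => // x _.
rewrite /lframe; zmod.
Qed.

(** Parallelism of [theta i j k] in the frames [a], [b], [c], rewritten by [theta_cocycle]. All
    compatibilities between the lines of the gerbe are used below in this form. *)
Lemma lframe_triangle i j k (a : Fr j k) (b : Fr i k) (c : Fr i j) :
  logd (dm a `&` dm b `&` dm c) (fun x => lframe b x - lframe a x - lframe c x)
    (form_sub (form_sub (cn b) (cn a)) (cn c)).
Proof.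
have [_ _ th _ _] := HG.
have U1 : unitary_frames (lb_dual (L i k)) by apply: unitary_dual; exact: gl_unitary.
have U2 : unitary_frames (lb_tensor (L j k) (lb_dual (L i k))).
  by apply: unitary_tensor => //; exact: gl_unitary.
have U : unitary_frames (lb_tensor (lb_tensor (L j k) (lb_dual (L i k))) (L i j)).
  by apply: unitary_tensor => //; exact: gl_unitary.
have [_ /(_ ((a, b), c)) h] := (section_logd mM _ _ U).1 (th i j k).
have Usub : dm a `&` dm b `&` dm c `<=` Ud i `&` Ud j `&` Ud k `&` (dm a `&` dm b `&` dm c).
  by move=> x [[da db] dc]; split => //; split; [split|]; [have [] := gl_dom dc |
    have [] := gl_dom dc | have [] := gl_dom da].
apply: (logd_ext mM _ _ (logd_sub Usub h)).
  move=> x [[da db] dc].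
  have E : cframe (L := lb_tensor (lb_tensor (L j k) (lb_dual (L i k))) (L i j)) ((a, b), c) x =
      cframe a x - cframe b x + cframe c x.
    rewrite (cframe_tensor U2 (@gl_unitary i j)); last by split => //; split.
    rewrite (cframe_tensor (@gl_unitary j k) U1); last by split.
    by rewrite (cframe_dual (@gl_unitary i k)).
  rewrite E -/(ctheta i j k x) theta_cocycle //; first last.
  - by have [] := gl_dom da.
  - by have [] := gl_dom dc.
  - by have [] := gl_dom dc.
  rewrite /lframe; zmod.
form_ring.
Qed.

End GerbeStructure.
Arguments lframe_triangle {R M} mM {Gr} HG {i j k} a b c.
Arguments lframe_trans {R M} mM {Gr} HG {i j} a b.

(** * The flat gerbe of local pre-quantizations *)

Section Patches.
Variables (R : realType) (M : smoothSpace R).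
Hypothesis mM : manifold M.
Variable Gr : gerbe M.
Hypothesis HG : is_gerbe Gr.
Variable omega : diff_form R M 2.
Hypothesis Sw : smooth_form setT omega.
Hypothesis dw : forall i, form_eq (gerbe_dom Gr i) (ext_d (W := R) (gerbe_form Gr i)) (ext_d (W := R) omega).

Local Notation I := (gerbe_index Gr).
Local Notation Ud := (gerbe_dom Gr).
Local Notation L := (gerbe_line Gr).
Local Notation Fr i j := (frame_index (L i j)).
Local Notation dm c := (frame_dom _ c).
Local Notation cn c := (conn_form _ c).
Local Notation varpi := (gerbe_form Gr).
Local Notation lf := (lframe HG).

(* A local pre-quantization over [pt_dom]: the lines [L_ji] for [j] = [pt_idx],
   with the connection 1-form [pt_form] added, so that their curvature is
   [varpi_i - omega] when [d pt_form = varpi_j - omega]. *)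
Record patch := Patch { pt_dom : set M; pt_idx : I; pt_form : diff_form R M 1 }.

Implicit Types al be : patch.

Record good_patch al : Prop := GoodPatch {
  pt_open : open (pt_dom al);
  pt_sub : pt_dom al `<=` Ud (pt_idx al);
  pt_smooth : smooth_form (pt_dom al) (pt_form al);
  pt_ext_d : form_eq (pt_dom al) (ext_d (W := R) (pt_form al)) (form_sub (varpi (pt_idx al)) omega) }.

Lemma gerbe_form_smooth i : smooth_form (Ud i) (varpi i).
Proof. by have [_ _ _ _ [h _]] := HG; exact: h. Qed.

(** By [dw] the 2-form varpi_j - omega is closed, so it has a primitive near [x]. *)
Lemma patch_exists j x : Ud j x -> exists al, [/\ good_patch al, pt_idx al = j & pt_dom al x].
Proof.
move=> Ujx; have Sw' := smooth_form_sub (@subsetT _ (Ud j)) Sw.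
have SF := smooth_form_subf mM (gerbe_form_smooth j) Sw'.
have dF : form_eq (Ud j) (ext_d (W := R) (form_sub (varpi j) omega)) (fun _ _ _ _ => 0).
  move=> m U p x' v Pp Ux.
  rewrite (ext_d_sub v mM (gerbe_form_smooth j) Sw' Pp Ux) (dw v Pp Ux).
  exact: subrr.
have [V [A [oV Vx VU SA dA]]] := primitive_exists mM (gerbe_dom_open HG j) Ujx SF dF.
by exists (Patch V j A).
Qed.

(* Two patches differ by a line bundle of curvature 0, of which [f] is a section. *)
Definition compat al be (f : M -> circle R) (x : M) : Prop :=
  [/\ good_patch al, good_patch be & exists O, [/\ open O, O x, O `<=` pt_dom al, O `<=` pt_dom be &
    forall c : Fr (pt_idx al) (pt_idx be), logd (O `&` dm c) (fun y => f y + lf c y)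
      (form_add (form_sub (pt_form al) (pt_form be)) (cn c))]].

(** The triangle with three equal indices and three equal frames: in the pointwise trivialization
    the line [L j j] has the parallel section 1. *)
Lemma lframe_diag j (c : Fr j j) : logd (dm c) (lf c) (cn c).
Proof.
have T := lframe_triangle mM HG c c c.
have h : dm c `<=` dm c `&` dm c `&` dm c by move=> x.
apply: (logd_ext mM _ _ (logdN mM (logd_sub h T))) => [x _ /=|]; first by zmod.
form_ring.
Qed.

Arguments lframe_diag {j} c.

Lemma compat_refl al x : good_patch al -> pt_dom al x -> compat al al (fun=> 0) x.
Proof.
move=> ga ax; split => //; exists (pt_dom al); split => //; first exact: pt_open.
move=> c; have h : pt_dom al `&` dm c `<=` dm c by move=> y [].
apply: (logd_ext mM _ _ (logd_sub h (lframe_diag c))) => [y _|]; first by zmod.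
form_ring.
Qed.

(** Near each point, frames [c1] and [c2] of the two intermediate lines are available, and
    [lframe_triangle] converts them into the frame [c] of the line between the outer patches. *)
Lemma compat_comp al be ga f g x : compat al be f x -> compat be ga g x ->
  compat al ga (fun y => f y + g y) x.
Proof.
move=> [ha hb [V [oV Vx Va Vb HV]]] [_ hc [W [oW Wx Wb Wc HW]]].
split => //; exists (V `&` W); split => //.
- exact: openI.
- by move=> y [/Va].
- by move=> y [_ /Wc].
- move=> c; apply: (logd_local mM) => y [[Vy Wy] cy].
  have [c1 d1] := gl_frame HG (pt_sub ha (Va _ Vy)) (pt_sub hb (Vb _ Vy)).
  have [c2 d2] := gl_frame HG (pt_sub hb (Vb _ Vy)) (pt_sub hc (Wc _ Wy)).
  exists (dm c1 `&` dm c2); split => //.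
    by apply: openI; exact: (gl_open HG).
  have T := lframe_triangle mM HG c2 c c1.
  set S := (X in logd X).
  have s1 : S `<=` V `&` dm c1 by move=> z [[? ?] [[? ?] ?]].
  have s2 : S `<=` W `&` dm c2 by move=> z [[? ?] [[? ?] ?]].
  have s3 : S `<=` dm c2 `&` dm c `&` dm c1 by move=> z [[? ?] [[? ?] ?]].
  have h := logdD mM (logdD mM (logd_sub s1 (HV c1)) (logd_sub s2 (HW c2))) (logd_sub s3 T).
  apply: (logd_ext mM _ _ h) => [z _ /=|]; first by zmod.
  form_ring.
Qed.

Lemma compat_inv al be f x : compat al be f x -> compat be al (fun y => - f y) x.
Proof.
move=> [ha hb [V [oV Vx Va Vb HV]]]; split => //; exists V; split => // c.
apply: (logd_local mM) => y [Vy cy].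
have [c1 d1] := gl_frame HG (pt_sub ha (Va _ Vy)) (pt_sub hb (Vb _ Vy)).
have [c2 d2] := gl_frame HG (pt_sub ha (Va _ Vy)) (pt_sub ha (Va _ Vy)).
exists (dm c1 `&` dm c2); split => //; first by apply: openI; exact: (gl_open HG).
have T := lframe_triangle mM HG c c2 c1.
set S := (X in logd X).
have s1 : S `<=` V `&` dm c1 by move=> z [[? ?] [? ?]].
have s2 : S `<=` dm c2 by move=> z [[? ?] [? ?]].
have s3 : S `<=` dm c `&` dm c2 `&` dm c1 by move=> z [[? ?] [? ?]].
have h := logdB mM (logdB mM (logd_sub s2 (lframe_diag c2)) (logd_sub s3 T))
  (logd_sub s1 (HV c1)).
apply: (logd_ext mM _ _ h) => [z _ /=|]; first by zmod.
form_ring.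
Qed.

Lemma compat_dom al be f x : compat al be f x ->
  [/\ good_patch al, good_patch be, pt_dom al x & pt_dom be x].
Proof. by move=> [ha hb [V [oV Vx Va Vb _]]]; split => //; [exact: Va | exact: Vb]. Qed.

(** The line by which two patches differ is flat: (varpi_a - omega) - (varpi_b - omega) + (varpi_b -
    varpi_a) = 0, so [logd_exists] gives a local parallel section. *)
Lemma compat_ex al be x : good_patch al -> good_patch be -> pt_dom al x -> pt_dom be x ->
  exists f, compat al be f x.
Proof.
move=> ha hb ax bx; have [c cx] := gl_frame HG (pt_sub ha ax) (pt_sub hb bx).
pose V := pt_dom al `&` pt_dom be `&` dm c.
have oV : open V.
  by apply: openI; [apply: openI; exact: pt_open | exact: (gl_open HG)].
have va : V `<=` pt_dom al by move=> y [[]].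
have vb : V `<=` pt_dom be by move=> y [[]].
have vc : V `<=` dm c by move=> y [].
have Sa := smooth_form_sub va (pt_smooth ha); have Sb := smooth_form_sub vb (pt_smooth hb).
have Sc := smooth_form_sub vc (gl_smooth HG c).
have Sab := smooth_form_subf mM Sa Sb.
have S := smooth_form_add mM Sab Sc.
have dS : form_eq V (ext_d (W := R) (form_add (form_sub (pt_form al) (pt_form be)) (cn c)))
    (fun _ _ _ _ => 0).
  move=> m U p y v Pp Uy.
  rewrite (ext_d_add v Sab Sc Pp Uy) (ext_d_sub v mM Sa Sb Pp Uy).
  rewrite (pt_ext_d ha v (plot_in_sub va Pp) Uy) (pt_ext_d hb v (plot_in_sub vb Pp) Uy).
  rewrite (gl_curv HG v (plot_in_sub vc Pp) Uy) /form_sub; ring.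
have [W [h [oW Wx WV Lh]]] := logd_exists mM oV (conj (conj ax bx) cx : V x) S dS.
exists (fun y => h y - lf c y); split => //; exists W; split => //.
- by move=> y /WV /va.
- by move=> y /WV /vb.
- move=> c'; have T := lframe_trans mM HG c c'.
  have s1 : W `&` dm c' `<=` W by move=> y [].
  have s2 : W `&` dm c' `<=` dm c `&` dm c' by move=> y [/WV /vc].
  apply: (logd_ext mM _ _ (logdD mM (logd_sub s1 Lh) (logd_sub s2 T))) => [z _ /=|]; first by zmod.
  form_ring.
Qed.

Lemma compat_near al be f x : compat al be f x -> \forall y \near x, compat al be f y.
Proof.
move=> [ha hb [V [oV Vx Va Vb HV]]]; apply: (near_all oV Vx) => y Vy.
by split => //; exists V.
Qed.

(** The difference of the two sections has logarithmic derivative 0; the frame [c] and the patch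
    forms cancel. *)
Lemma compat_sub al be f g x : compat al be f x -> compat al be g x ->
  exists c, \forall y \near x, g y = f y + c.
Proof.
move=> [ha hb [V [oV Vx Va Vb HV]]] [_ _ [W [oW Wx Wa Wb HW]]].
have [c cx] := gl_frame HG (pt_sub ha (Va _ Vx)) (pt_sub hb (Vb _ Vx)).
pose S := V `&` W `&` dm c.
have oS : open S by apply: openI; [exact: openI | exact: (gl_open HG)].
have s1 : S `<=` V `&` dm c by move=> y [[]].
have s2 : S `<=` W `&` dm c by move=> y [[]].
have h := logdB mM (logd_sub s2 (HW c)) (logd_sub s1 (HV c)).
exists (g x - f x).
have := logd0_lconst mM oS (conj (conj Vx Wx) cx : S x) h _.
have Z : form_eq S (form_sub (form_add (form_sub (pt_form al) (pt_form be)) (cn c))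
   (form_add (form_sub (pt_form al) (pt_form be)) (cn c))) (fun _ _ _ _ => 0).
  by move=> m U p y v _ _; rewrite /form_sub subrr.
move=> /(_ Z); apply: filterS => y /(congr1 (fun t => t + f y)) E.
transitivity (g y + lf c y - (f y + lf c y) + f y); first by zmod.
rewrite E; zmod.
Qed.

Lemma compat_shift al be f g x c : compat al be f x ->
  (\forall y \near x, g y = f y + c) -> compat al be g x.
Proof.
move=> [ha hb [V [oV Vx Va Vb HV]]] /near_open[W [oW Wx HW]].
split => //; exists (V `&` W); split => //.
- exact: openI.
- by move=> y [/Va].
- by move=> y [/Vb].
- move=> c'; have s1 : V `&` W `&` dm c' `<=` V `&` dm c' by move=> y [[]].
  apply: (logd_ext mM _ _ (logd_add_cst mM c (logd_sub s1 (HV c')))) => [y [[Vy Wy] _]|//].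
  rewrite /= HW//; zmod.
Qed.

(** This is the pullback gerbe corrected by omega. All patches serve as indices, since [compat]
    includes their goodness. *)
Theorem compat_flatGerbe : flatGerbe setT compat.
Proof.
split.
- by move=> a b f x _; exact: compat_near.
- by move=> a b c f g x; exact: compat_comp.
- by move=> a b f x; exact: compat_inv.
- move=> x _; have [j Uj] := gerbe_domP HG x; have [al [ga _ ax]] := patch_exists Uj.
  by exists al; exact: compat_refl.
- move=> a b x _ /compat_dom[ga _ ax _] /compat_dom[gb _ bx _].
  exact: compat_ex.
- by move=> a b f g x _; exact: compat_sub.
- by move=> a b f g x c; exact: compat_shift.
Qed.

End Patches.
Arguments lframe_diag {R M} mM {Gr} HG {j} c.

(** * From a solution to a pre-quantization *)

Section Build.
Variables (R : realType) (M : smoothSpace R).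
Hypothesis mM : manifold M.
Variable Gr : gerbe M.
Hypothesis HG : is_gerbe Gr.
Variable omega : diff_form R M 2.

Local Notation I := (gerbe_index Gr).
Local Notation Ud := (gerbe_dom Gr).
Local Notation L := (gerbe_line Gr).
Local Notation Fr i j := (frame_index (L i j)).
Local Notation dm c := (frame_dom _ c).
Local Notation cn c := (conn_form _ c).
Local Notation varpi := (gerbe_form Gr).
Local Notation lf := (lframe HG).
Local Notation CC := (compat HG omega).

Variables (al : M -> patch Gr) (g : M -> M -> circle R).
Hypothesis S : solution setT CC al g.

Let Wex x : exists V, [/\ open V, V x & forall y, V y -> CC (al x) (al y) (fun z => g x z - g y z) y].
Proof. have [V [oV Vx HV]] := near_open (@S x Logic.I); by exists V; split. Qed.

Definition sol_dom x : set M := projT1 (cid (Wex x)).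
Lemma sol_open x : open (sol_dom x). Proof. by have [] := projT2 (cid (Wex x)). Qed.
Lemma sol_in x : sol_dom x x. Proof. by have [] := projT2 (cid (Wex x)). Qed.
Lemma sol_compat x y : sol_dom x y -> CC (al x) (al y) (fun z => g x z - g y z) y.
Proof. by have [_ _ h] := projT2 (cid (Wex x)); exact: h. Qed.

Lemma sol_good x : good_patch omega (al x).
Proof. by have [] := compat_dom (sol_compat (sol_in x)). Qed.

Lemma sol_sub x y : sol_dom x y -> pt_dom (al x) y.
Proof. by move=> /sol_compat /compat_dom[]. Qed.

Lemma sol_compat2 x x' y : sol_dom x y -> sol_dom x' y ->
  CC (al x) (al x') (fun z => g x z - g x' z) y.
Proof.
move=> /sol_compat h /sol_compat /(compat_inv mM) h'.
have := compat_comp mM h h'.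
by congr (CC _ _ _ _); apply/funext => z; zmod.
Qed.

(** Near [x] the line E_i is the line of the gerbe from the index of the patch [al x] to [i], with
    the patch form added to its connection. A frame is a point [x] together with a frame of that
    line, corrected by the cochain [g x] so that the pieces glue. *)
Definition sol_line i : lineBundle M := @LineBundle R M {x : M & Fr (pt_idx (al x)) i}
  (fun s => sol_dom (tag s) `&` dm (tagged s))
  (fun s y => circle_val (g (tag s) y + lf (tagged s) y))
  (fun s => form_add (pt_form (al (tag s))) (cn (tagged s))).

(** In the pointwise trivialization in which [lframe] multiplies without [theta], the isomorphisms
    psi are 1; back in the original fibres they are [theta0]. *)
Definition sol_quasi : quasiLineBundle Gr :=
  @QuasiLineBundle R M Gr sol_line (fun i k x => circle_val (theta0 HG i k x)).

Lemma cframe_sol i (s : frame_index (sol_line i)) y :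
  cframe s y = g (tag s) y + lf (tagged s) y.
Proof. exact: to_circle_val. Qed.

Lemma unitary_sol i : unitary_frames (sol_line i).
Proof. by move=> s x _; exact/eqP/circle_norm. Qed.

(** The cochain g relates the patches of the two frames by an isomorphism of the flat gerbe, and the
    triangle through a frame between the two patch indices relates the lines. *)
Lemma sol_transition i (s t : frame_index (sol_line i)) :
  logd (dm s `&` dm t) (fun x => cframe t x - cframe s x) (form_sub (cn t) (cn s)).
Proof.
apply: (logd_local mM) => y [[Ws ds] [Wt dt]].
have [_ _ [V [oV Vy Va Vb HV]]] := sol_compat2 Ws Wt.
have [c cy] := gl_frame HG (pt_sub (sol_good _) (Va _ Vy)) (pt_sub (sol_good _) (Vb _ Vy)).
exists (V `&` dm c); split => //; first by apply: openI => //; exact: (gl_open HG).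
have T := lframe_triangle mM HG (tagged t) (tagged s) c.
set O := (X in logd X).
have s1 : O `<=` V `&` dm c by move=> z [].
have s2 : O `<=` dm (tagged t) `&` dm (tagged s) `&` dm c by move=> z [[? ?] [[? ?] [? ?]]].
have h := logdB mM (logdN mM (logd_sub s1 (HV c))) (logd_sub s2 T).
apply: (logd_ext mM _ _ h) => [z _ /=|]; first by rewrite !cframe_sol; zmod.
form_ring.
Qed.

Arguments sol_transition {i} s t.

Lemma sol_frame i x : Ud i x -> exists b : Fr (pt_idx (al x)) i, dm b x.
Proof.
by move=> Ui; apply: (gl_frame HG _ Ui); apply: (pt_sub (sol_good x)); exact: sol_sub (sol_in x).
Qed.

Lemma sol_line_bundle i : is_line_bundle (Ud i) (sol_line i).
Proof.
apply: lb_transitionE => //.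
- by move=> s; apply: openI; [exact: sol_open | exact: (gl_open HG)].
- apply/seteqP; split=> x.
    move=> Ui; have [b bx] := sol_frame Ui.
    by exists (Tagged (fun x => Fr (pt_idx (al x)) i) b) => //; split => //; exact: sol_in.
  by move=> [s _ [_ ds]]; have [] := gl_dom HG ds.
- exact: unitary_sol.
- move=> s; apply: smooth_form_add => //.
    by apply: smooth_form_sub (pt_smooth (sol_good _)) => y [/sol_sub].
  by apply: smooth_form_sub (gl_smooth HG (tagged s)) => y [].
- exact: sol_transition.
Qed.

Lemma sol_psi i k : parallel_unitary_section (Ud i `&` Ud k)
  (lb_tensor (lb_tensor (lb_dual (sol_line k)) (sol_line i)) (L i k)) (quasi_psi sol_quasi i k).
Proof.
have U1 : unitary_frames (lb_dual (sol_line k)) by apply: unitary_dual; exact: unitary_sol.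
have U2 : unitary_frames (lb_tensor (lb_dual (sol_line k)) (sol_line i)).
  by apply: unitary_tensor => //; exact: unitary_sol.
have U : unitary_frames (lb_tensor (lb_tensor (lb_dual (sol_line k)) (sol_line i)) (L i k)).
  by apply: unitary_tensor => //; exact: (gl_unitary HG).
apply/(section_logd mM _ _ U); split; first by move=> x _; exact/eqP/circle_norm.
move=> [[a b] c]; apply: (logd_local mM) => y [[Ui Uk] [[da db] dc]].
(* The frames [a] and [b] may sit over different patches. An auxiliary frame [b0] of E_i over the
   patch of [a] allows one triangle with [c]; the change from [b0] to [b] is a transition of E_i. *)
have Way := da.1.
have [b0 by0] : exists b0 : Fr (pt_idx (al (tag a))) i, dm b0 y.
  by apply: (gl_frame HG _ Ui); apply: (pt_sub (sol_good (tag a))); exact: sol_sub.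
pose b' : frame_index (sol_line i) := Tagged (fun x => Fr (pt_idx (al x)) i) b0.
exists (dm b0); split => //; first exact: (gl_open HG).
have T := lframe_triangle mM HG c (tagged a) b0.
have T' := sol_transition b' b.
set O := (X in logd X).
have s1 : O `<=` dm c `&` dm (tagged a) `&` dm b0 by move=> z [? [? [[[? ?] [? ?]] ?]]].
have s2 : O `<=` dm b' `&` dm b by move=> z [? [? [[[? ?] [? ?]] ?]]].
have h := logdB mM (logd_sub s1 T) (logd_sub s2 T').
apply: (logd_ext mM _ _ h); last by form_ring.
move=> z [? [? [[da' db'] dc']]].
have E : cframe (L := lb_tensor (lb_tensor (lb_dual (sol_line k)) (sol_line i)) (L i k)) ((a, b), c) z =
    - cframe (L := sol_line k) a z + cframe b z + cframe c z.
  rewrite (cframe_tensor U2 (@gl_unitary _ _ _ HG i k)); last by split => //; split.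
  rewrite (cframe_tensor U1 (@unitary_sol i)); last by split.
  by rewrite (cframe_dual (@unitary_sol k) da').
rewrite E to_circle_val !cframe_sol  /= [lf c z]/lframe; zmod.
Qed.

Lemma sol_is_quasi : is_quasi_line_bundle sol_quasi.
Proof.
split; [exact: sol_line_bundle | exact: sol_psi |].
move=> i j k x [[Ui Uj] Uk] /=.
rewrite -circle_valB -circle_valD -(theta_cocycle HG Ui Uj Uk).
by apply: to_circleK; exact: theta_unit.
Qed.

(** With a the patch index, the curvature is (varpi_a - omega) + (varpi_i - varpi_a) = varpi_i -
    omega. *)
Lemma sol_error : error_form sol_quasi omega.
Proof.
move=> i s; have sa : dm s `<=` pt_dom (al (tag s)) by move=> y [/sol_sub].
have sc : dm s `<=` dm (tagged s) by move=> y [].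
move=> m U p x v Pp Ux; have gd := sol_good (tag s).
have Sa := smooth_form_sub sa (pt_smooth gd).
have Sc := smooth_form_sub sc (gl_smooth HG (tagged s)).
apply: (etrans _ (esym (ext_d_add v Sa Sc Pp Ux))).
rewrite (pt_ext_d gd v (plot_in_sub sa Pp) Ux) (gl_curv HG v (plot_in_sub sc Pp) Ux).
rewrite /form_sub; ring.
Qed.

End Build.

(** * Uniqueness of the pre-quantization *)

Section Uniqueness.
Variables (R : realType) (M : smoothSpace R).
Hypothesis mM : manifold M.
Variable Gr : gerbe M.
Hypothesis HG : is_gerbe Gr.
Variable omega : diff_form R M 2.

Local Notation I := (gerbe_index Gr).
Local Notation Ud := (gerbe_dom Gr).
Local Notation L := (gerbe_line Gr).
Local Notation dm c := (frame_dom _ c).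
Local Notation cn c := (conn_form _ c).
Local Notation varpi := (gerbe_form Gr).

Section OneQuasi.
Variable Q : quasiLineBundle Gr.
Hypothesis HQ : is_quasi_line_bundle Q.
Local Notation E := (quasi_line Q).

Definition cpsi i k x : circle R := to_circle (quasi_psi Q i k x).

Lemma ql_line i : is_line_bundle (Ud i) (E i). Proof. by have [] := HQ. Qed.

Lemma ql_unitary i : unitary_frames (E i). Proof. by have [] := ql_line i. Qed.

Lemma ql_open i (a : frame_index (E i)) : open (dm a).
Proof. by have [[? _] _ _ _] := ql_line i. Qed.

Lemma ql_dom i (a : frame_index (E i)) x : dm a x -> Ud i x.
Proof. by have [[_ ->] _ _ _] := ql_line i; exists a. Qed.

Lemma ql_frame i x : Ud i x -> exists a : frame_index (E i), dm a x.
Proof. by have [[_ ->] _ _ _] := ql_line i; case=> a _ ax; exists a. Qed.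

Lemma ql_smooth i (a : frame_index (E i)) : smooth_form (dm a) (cn a).
Proof. by have [_ _ ? _] := ql_line i. Qed.

Lemma psi_unit i k x : Ud i x -> Ud k x -> `|quasi_psi Q i k x| = 1.
Proof. by have [_ h _] := HQ; have [u _] := h i k => Ui Uk; apply: u. Qed.

Lemma cpsi_cocycle i j k x : Ud i x -> Ud j x -> Ud k x ->
  cpsi j k x - cpsi i k x + cpsi i j x = ctheta i j k x.
Proof.
move=> Ui Uj Uk; have [_ _ h] := HQ.
have u1 := psi_unit Uj Uk; have u2 := psi_unit Ui Uk; have u3 := psi_unit Ui Uj.
rewrite /ctheta -(h i j k x (conj (conj Ui Uj) Uk)) to_circle_mul// ?to_circle_div//.
by rewrite normf_div u1 u2 divr1.
Qed.

Lemma cpsi_logd i k (a : frame_index (E k)) (b : frame_index (E i)) (c : frame_index (L i k)) :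
  logd (dm a `&` dm b `&` dm c)
    (fun x => cpsi i k x - (- cframe a x + cframe b x + cframe c x))
    (form_scale (-1) (form_add (form_add (form_scale (-1) (cn a)) (cn b)) (cn c))).
Proof.
have [_ /(_ i k) h _] := HQ.
have U1 : unitary_frames (lb_dual (E k)) by apply: unitary_dual; exact: ql_unitary.
have U2 : unitary_frames (lb_tensor (lb_dual (E k)) (E i)).
  by apply: unitary_tensor => //; exact: ql_unitary.
have U : unitary_frames (lb_tensor (lb_tensor (lb_dual (E k)) (E i)) (L i k)).
  by apply: unitary_tensor => //; exact: (gl_unitary HG).
have [_ /(_ ((a, b), c)) hl] := (section_logd mM _ _ U).1 h.
have s1 : dm a `&` dm b `&` dm c `<=` Ud i `&` Ud k `&` (dm a `&` dm b `&` dm c).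
  by move=> x [[da db] dc]; split => //; split; [exact: ql_dom db | exact: ql_dom da].
apply: (logd_ext mM _ _ (logd_sub s1 hl)) => // x [[da db] dc].
have -> : cframe (L := lb_tensor (lb_tensor (lb_dual (E k)) (E i)) (L i k)) ((a, b), c) x =
    - cframe a x + cframe b x + cframe c x.
  rewrite (cframe_tensor U2 (@gl_unitary _ _ _ HG i k)); last by split => //; split.
  rewrite (cframe_tensor U1 (@ql_unitary i)); last by split.
  by rewrite (cframe_dual (@ql_unitary k) da).
by [].
Qed.

End OneQuasi.

Arguments cpsi_logd {Q} HQ {i k} a b c.

Variables Q Q' : quasiLineBundle Gr.
Hypotheses (HQ : is_quasi_line_bundle Q) (HQ' : is_quasi_line_bundle Q').
Hypotheses (EQ : error_form Q omega) (EQ' : error_form Q' omega).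
Local Notation E := (quasi_line Q).
Local Notation E' := (quasi_line Q').

(* Its coboundary is [psi / psi'], so that the [s i] of an isomorphism are a common
   function times [psi_ratio i]. *)
Definition psi_ratio i x : circle R :=
  cpsi Q (base_index HG x) i x - cpsi Q' (base_index HG x) i x.

(** Both psi and psi' have coboundary [theta], so their quotient is a cocycle; its values at the
    base index of [x] split it. *)
Lemma psi_ratioE i k x : Ud i x -> Ud k x ->
  cpsi Q i k x - cpsi Q' i k x = psi_ratio k x - psi_ratio i x.
Proof.
move=> Ui Uk; have Ub := base_indexP HG x.
have h1 := cpsi_cocycle HQ Ub Ui Uk; have h2 := cpsi_cocycle HQ' Ub Ui Uk.
have := congr2 (fun s t => s - t) h1 h2; rewrite subrr.
move=> /(congr1 (fun t => t + psi_ratio k x - psi_ratio i x)); rewrite add0r => <-.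
rewrite /psi_ratio; zmod.
Qed.

(** Chosen so that u + dframe is the quotient of the candidate section u + psi_ratio i by the frame
    of E'_i E_i^-1; [dconn] is minus the connection form of that frame. *)
Definition dframe i (s : frame_index (E' i) * frame_index (E i)) x : circle R :=
  psi_ratio i x - cframe s.1 x + cframe s.2 x.
Definition ddom i (s : frame_index (E' i) * frame_index (E i)) := dm s.1 `&` dm s.2.
Definition dconn i (s : frame_index (E' i) * frame_index (E i)) := form_sub (cn s.2) (cn s.1).

Lemma ddom_open i s : open (@ddom i s).
Proof. by apply: openI; [exact: (ql_open HQ') | exact: (ql_open HQ)]. Qed.

Lemma ddom_dom i s x : @ddom i s x -> Ud i x.
Proof. by move=> [ds _]; exact: (ql_dom HQ' ds). Qed.

(** The indices [i] and [k] may differ: parallelism of psi and of psi' over one frame [c] of L i k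
    relates them, and [c] cancels. So the function u of a parallel section is independent of the
    index. *)
Lemma dframe_transition i k s t : logd (@ddom i s `&` @ddom k t)
  (fun x => dframe t x - dframe s x) (form_sub (dconn t) (dconn s)).
Proof.
apply: (logd_local mM) => y [dsy dty].
have [c cy] := gl_frame HG (ddom_dom dsy) (ddom_dom dty).
exists (dm c); split => //; first exact: (gl_open HG).
have h := cpsi_logd HQ t.2 s.2 c; have h' := cpsi_logd HQ' t.1 s.1 c.
set O := (X in logd X).
have s1 : O `<=` dm t.2 `&` dm s.2 `&` dm c by move=> z [? [[? ?] [? ?]]].
have s2 : O `<=` dm t.1 `&` dm s.1 `&` dm c by move=> z [? [[? ?] [? ?]]].
apply: (logd_ext mM _ _ (logdB mM (logd_sub s1 h) (logd_sub s2 h'))); last first.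
  by rewrite /dconn; form_ring.
move=> z [cz [dsz dtz]].
have := psi_ratioE (ddom_dom dsz) (ddom_dom dtz).
rewrite /dframe => /(congr1 (fun u => u + cframe t.2 z - cframe s.2 z - cframe t.1 z + cframe s.1 z)) e.
transitivity (psi_ratio k z - psi_ratio i z + cframe t.2 z - cframe s.2 z - cframe t.1 z + cframe s.1 z);
  last by zmod.
rewrite -e; zmod.
Qed.

Arguments dframe_transition {i k} s t.

Definition iso_section (u : M -> circle R) (x : M) : Prop :=
  exists O, [/\ open O, O x & forall i (s : frame_index (E' i) * frame_index (E i)),
    logd (O `&` ddom s) (fun y => u y + dframe s y) (dconn s)].

Lemma dframe_exists x : exists i (s : frame_index (E' i) * frame_index (E i)), ddom s x.
Proof.
have [i Ui] := gerbe_domP HG x; have [a ax] := ql_frame HQ Ui.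
by have [a' a'x] := ql_frame HQ' Ui; exists i, (a', a).
Qed.

(** E_i and E'_i have the same curvature because the error forms agree, so the difference bundle is
    flat and has local parallel sections. *)
Lemma iso_lineStr : lineStr setT iso_section.
Proof.
split.
- move=> u x _ [V [oV Vx HV]]; apply: (near_all oV Vx) => y Vy.
  by exists V.
- move=> x _; have [i [[a' a] [dx' dx]]] := dframe_exists x.
  pose V := dm a' `&` dm a.
  have oV : open V by exact: (ddom_open (i := i) (a', a)).
  have v1 : V `<=` dm a' by move=> y [].
  have v2 : V `<=` dm a by move=> y [].
  have S1 := smooth_form_sub v1 (ql_smooth HQ' a').
  have S2 := smooth_form_sub v2 (ql_smooth HQ a).
  have dS : form_eq V (ext_d (W := R) (form_sub (cn a) (cn a'))) (fun _ _ _ _ => 0).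
    move=> m U p y v Pp Uy; apply: (etrans (ext_d_sub v mM S2 S1 Pp Uy)).
    rewrite -(@EQ i a m U p y v (plot_in_sub v2 Pp) Uy) -(@EQ' i a' m U p y v (plot_in_sub v1 Pp) Uy).
    exact: subrr.
  have [W [h [oW Wx WV Lh]]] := logd_exists mM oV (conj dx' dx : V x) (smooth_form_subf mM S2 S1) dS.
  exists (fun y => h y - dframe (a', a) y); exists W; split => // k t.
  have T := dframe_transition (i := i) (a', a) t.
  have s1 : W `&` ddom t `<=` W by move=> y [].
  have s2 : W `&` ddom t `<=` ddom (a', a) `&` ddom t by move=> y [/WV Wy ?].
  apply: (logd_ext mM _ _ (logdD mM (logd_sub s1 Lh) (logd_sub s2 T))) => [z _ /=|]; first by zmod.
  by rewrite /dconn; form_ring.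
- move=> u v x _ [V [oV Vx HV]] [W [oW Wx HW]].
  have [i [s sx]] := dframe_exists x.
  pose S := V `&` W `&` ddom s.
  have oS : open S by apply: openI; [exact: openI | exact: ddom_open].
  have s1 : S `<=` V `&` ddom s by move=> y [[]].
  have s2 : S `<=` W `&` ddom s by move=> y [[]].
  have h := logdB mM (logd_sub s2 (HW i s)) (logd_sub s1 (HV i s)).
  exists (v x - u x).
  have := logd0_lconst mM oS (conj (conj Vx Wx) sx : S x) h _.
  have Z : form_eq S (form_sub (dconn s) (dconn s)) (fun _ _ _ _ => 0).
    by move=> m U p y w _ _; rewrite /form_sub subrr.
  move=> /(_ Z); apply: filterS => y /(congr1 (fun t => t + u y)) e.
  transitivity (v y + dframe s y - (u y + dframe s y) + u y); first by zmod.
  rewrite e; zmod.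
- move=> u v x c [V [oV Vx HV]] /near_open[W [oW Wx HW]].
  exists (V `&` W); split => //; first exact: openI.
  move=> i s; have s1 : V `&` W `&` ddom s `<=` V `&` ddom s by move=> y [[]].
  apply: (logd_ext mM _ _ (logd_add_cst mM c (logd_sub s1 (HV i s)))) => [y [[Vy Wy] _]|//].
  rewrite /= HW//; zmod.
Qed.

Theorem quasi_unique : simplyConnected R M -> quasi_isomorphic Q Q'.
Proof.
move=> SM; have [u Hu] := line_section_sc SM iso_lineStr.
exists (fun i x => circle_val (u x + psi_ratio i x)); split.
- move=> i.
  have U1 : unitary_frames (lb_dual (E i)) by apply: unitary_dual; exact: (@ql_unitary _ HQ i).
  have U : unitary_frames (lb_tensor (E' i) (lb_dual (E i))).
    by apply: unitary_tensor => //; exact: (@ql_unitary _ HQ' i).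
  apply/(section_logd mM _ _ U); split; first by move=> x _; exact/eqP/circle_norm.
  move=> [a' a]; apply: (logd_local mM) => y [Ui [da' da]].
  have [V [oV Vy HV]] := Hu y; exists V; split => //.
  have s1 : V `&` (Ud i `&` (dm a' `&` dm a)) `<=` V `&` ddom (a', a) by move=> z [? []].
  apply: (logd_ext mM _ _ (logd_sub s1 (HV i (a', a)))); last by rewrite /dconn; form_ring.
  move=> z [_ [_ [da'z daz]]]; rewrite to_circle_val.
  rewrite (cframe_tensor (@ql_unitary _ HQ' i) U1); last by split.
  rewrite (cframe_dual (@ql_unitary _ HQ i) daz) /dframe /=; zmod.
- move=> i j x [Ui Uj].
  have := psi_ratioE Ui Uj.
  have u1 := psi_unit HQ Ui Uj; have u2 := psi_unit HQ' Ui Uj.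
  rewrite -(to_circleK u1) -(to_circleK u2) -!circle_valB -circle_valD -/(cpsi Q i j x) -/(cpsi Q' i j x).
  move=> /(congr1 (fun t => t + cpsi Q' i j x - cpsi Q i j x)) e.
  have -> : u x + psi_ratio j x - (u x + psi_ratio i x) + (cpsi Q' i j x - cpsi Q i j x) =
     psi_ratio j x - psi_ratio i x + cpsi Q' i j x - cpsi Q i j x by zmod.
  rewrite -e.
  by have -> : cpsi Q i j x - cpsi Q' i j x + cpsi Q' i j x - cpsi Q i j x = 0 by zmod.
Qed.

End Uniqueness.

(** * Slices of G^(2h) *)

Local Opaque thetaL thetaR.

Section Slice.
Variables (R : realType) (N M : smoothSpace R) (s : N -> M).
Hypotheses (mN : manifold N) (mM : manifold M) (Ss : smooth_map s).
Variable Gr : gerbe M.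
Hypothesis HG : is_gerbe Gr.
Variable omega : diff_form R M 2.
Hypothesis Sw : smooth_form setT omega.
Hypothesis dw : forall i, form_eq (gerbe_dom Gr i) (ext_d (W := R) (gerbe_form Gr i)) (ext_d (W := R) omega).

Lemma logd_pull V (g : M -> circle R) A : logd V g A -> logd (s @^-1` V) (g \o s) (form_pull s A).
Proof. by move=> Lg m U p Pp; exact: (Lg m U (s \o p) (plot_in_pull Ss Pp)). Qed.

(* Over a slice on which both 2-forms vanish the forms of patches become closed. *)
Lemma slice_solution j : (forall y, gerbe_dom Gr j (s y)) ->
  form_eq setT (form_pull s (gerbe_form Gr j)) (fun _ _ _ _ => 0) ->
  form_eq setT (form_pull s omega) (fun _ _ _ _ => 0) ->
  exists al g, solution setT (pull_rel s (compat HG omega)) al g.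
Proof.
move=> Uj w0 o0.
have cs := smooth_map_continuous mN mM Ss.
have ex y : exists t : (set M * diff_form R M 1) * (set N * (N -> circle R)),
    [/\ good_patch omega (Patch t.1.1 j t.1.2), t.1.1 (s y), open t.2.1, t.2.1 y &
      t.2.1 `<=` s @^-1` t.1.1 /\ logd t.2.1 t.2.2 (form_pull s t.1.2)].
  have [[V i A] [gp /= ij Vsy]] := patch_exists mM HG Sw dw (Uj y).
  subst i.
  have oV : open (s @^-1` V).
    by apply: open_comp; [move=> z _; exact: cs | exact: (pt_open gp)].
  have dA : form_eq (s @^-1` V) (ext_d (W := R) (form_pull s A)) (fun _ _ _ _ => 0).
    move=> m U p x v Pp Ux.
    have E := pt_ext_d gp v (plot_in_pull Ss Pp) Ux.
    apply: (etrans E); rewrite /form_sub /=.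
    have P' : plot_in setT U p by split => //; exact: Pp.1.
    have e1 := w0 m U p x v P' Ux; have e2 := o0 m U p x v P' Ux.
    by rewrite -[RHS](subrr 0); apply: (congr2 (fun a b => a - b)); [exact: e1 | exact: e2].
  have [W [h [oW Wy WV Lh]]] := logd_exists mN oV (Vsy : (s @^-1` V) y)
    (smooth_form_pull Ss (pt_smooth gp)) dA.
  by exists ((V, A), (W, h)).
have [t Ht] := choice ex.
(* All patches have index [j]; the cochain at [y] is a function on the slice with the restricted
   patch form as logarithmic derivative. *)
exists (fun y => Patch (t y).1.1 j (t y).1.2), (fun y => (t y).2.2) => y _.
have [gy _ oWy Wy [WV Ly]] := Ht y.
apply: (near_all oWy Wy) => y' Wy'.
have [gy' Vy' oW' W'y' [WV' Ly']] := Ht y'.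
have [u Cu] := compat_ex mM HG gy gy' (WV _ Wy' : pt_dom (Patch (t y).1.1 j (t y).1.2) (s y')) Vy'.
have [_ _ [V [oV Vs Va Vb /= HV]]] := Cu.
have [c cs'] := gl_frame HG (Uj y') (Uj y').
pose S := (t y).2.1 `&` (t y').2.1 `&` (s @^-1` (V `&` frame_dom _ c)).
have oS : open S.
  apply: openI; first exact: openI.
  apply: open_comp; first by move=> z _; exact: cs.
  by apply: openI => //; exact: (gl_open HG).
have s1 : S `<=` (t y).2.1 by move=> z [[]].
have s2 : S `<=` (t y').2.1 by move=> z [[]].
have s3 : S `<=` s @^-1` (V `&` frame_dom _ c) by move=> z [].
have s4 : S `<=` s @^-1` (frame_dom _ c) by move=> z [_ []].
have h1 := logdB mN (logd_sub s1 Ly) (logd_sub s2 Ly').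
(* [c] frames the diagonal line [L j j], where [lframe] has the connection form as logarithmic
   derivative, so it drops out and the condition on [u] alone remains. *)
have h2 := logdB mN (logd_sub s3 (logd_pull (HV c)))
  (logd_sub s4 (logd_pull (lframe_diag mM HG c))).
have h := logdB mN h1 h2.
have Z : form_eq S (form_sub (form_sub (form_pull s (t y).1.2) (form_pull s (t y').1.2))
    (form_sub (form_pull s (form_add (form_sub (t y).1.2 (t y').1.2) (conn_form _ c)))
       (form_pull s (conn_form _ c)))) (fun _ _ _ _ => 0).
  by move=> m U p x v _ _; rewrite /form_pull /form_sub /form_add; ring.
have Sy' : S y' by [].
(* [u] lives on M, while the required transition lives on the slice only. Both have the same
   logarithmic derivative there, so a constant shift of [u] induces the transition near y'. *)
pose F z := (t y).2.2 z - (t y').2.2 z - (u (s z) + lframe HG c (s z) - lframe HG c (s z)).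
have Hk : \forall z \near y', F z = F y' := logd0_lconst mN oS Sy' h Z.
exists (fun z => u z + F y'); first by apply: (compat_shift mM Cu); exact: nearW.
apply: filterS Hk => z /(congr1 (fun a => u (s z) + a)) <-; rewrite /F; zmod.
Qed.

End Slice.

(** * The slices of G^(2h) *)

Section Slices.
Variables (R : realType) (G : lieGroup R) (B : lie_algebra G -> lie_algebra G -> R).
Hypothesis Binv : invariant_inner_product B.
Let n := lie_dim G.
Let LG := lie_space G.

(** The index counts from 0 as in [multi_double], so this is G^(k+1), the factor of the a's or of
    the b's. *)
Fixpoint powG (k : nat) : smoothSpace R := if k is k'.+1 then prod_space (powG k') LG else LG.

Lemma powG_manifold k : manifold (powG k).
Proof.
elim: k => [|k IH] /=; first exact: manifold_lie.
by apply: manifold_prod => //; exact: manifold_lie.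
Qed.

Lemma powG_sc k : simply_connected R G -> simplyConnected R (powG k).
Proof.
move=> SG; have S0 : simplyConnected R LG.
  by apply: simplyConnected_of_radial SG _; exact: (manifold_radial (manifold_lie G)).
by elim: k => [|k IH] //=; exact: simplyConnected_prod.
Qed.

Lemma multi_double_sc k : simply_connected R G -> simplyConnected R (multi_double B k).
Proof.
move=> SG; have S0 : simplyConnected R LG by exact: (powG_sc 0 SG).
have S1 : simplyConnected R (qham_double B) by exact: (simplyConnected_prod S0 S0).
by elim: k => [|k IH] //; exact: (simplyConnected_prod IH S1).
Qed.

Fixpoint unitG (k : nat) : powG k :=
  if k is k'.+1 then (unitG k', 1%g) else 1%g.

(** Regroups all a's and all b's into the pairs of the fusion product, the shape needed to view M as
    a product of two simply connected spaces. *)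
Fixpoint join_double (k : nat) : powG k * powG k -> multi_double B k :=
  if k is k'.+1 return powG k * powG k -> multi_double B k
  then fun x => (join_double (x.1.1, x.2.1), (x.1.2, x.2.2)) else id.

Fixpoint split_double (k : nat) : multi_double B k -> powG k * powG k :=
  if k is k'.+1 return multi_double B k -> powG k * powG k
  then fun x => (((split_double x.1).1, x.2.1), ((split_double x.1).2, x.2.2)) else id.

Lemma split_doubleK k : cancel (@split_double k) (@join_double k).
Proof.
elim: k => [|k IH] // -[x [a b]] /=.
by rewrite -surjective_pairing IH.
Qed.

Lemma join_double_smooth k : @smooth_map R (prod_space (powG k) (powG k)) (multi_double B k) (@join_double k).
Proof.
elim: k => [|k IH] //= m U p [[P1 P2] [P3 P4]]; split; last by split.
by apply: (IH m U (fun x => ((p x).1.1, (p x).2.1))); split.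
Qed.

Lemma split_double_smooth k : @smooth_map R (multi_double B k) (prod_space (powG k) (powG k)) (@split_double k).
Proof.
elim: k => [|k IH] //= m U p [P1 [P2 P3]].
by have [Q1 Q2] := IH m U (fst \o p) P1; split; split.
Qed.

Lemma thetaL_cst m (g : G) (x : 'rV[R]_m) v : thetaL (fun=> g : LG) x v = 0 :> 'rV[R]_n.
Proof. Transparent thetaL. by rewrite /thetaL derive_cst. Qed.

Lemma thetaR_cst m (g : G) (x : 'rV[R]_m) v : thetaR (fun=> g : LG) x v = 0 :> 'rV[R]_n.
Proof. Transparent thetaR. by rewrite /thetaR derive_cst. Qed.

Local Opaque thetaL thetaR.

Lemma wedge_0l (M : smoothSpace R) (alpha beta : diff_form 'rV[R]_n M 1) m (p : 'rV[R]_m -> M) x v :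
  (forall u, alpha m p x u = 0) -> wedge_form (W := R) B alpha beta p x v = 0.
Proof. by move=> a0; rewrite wedge2E !a0 !(bilin0l (inv_linl Binv)) subr0. Qed.

Lemma wedge_0r (M : smoothSpace R) (alpha beta : diff_form 'rV[R]_n M 1) m (p : 'rV[R]_m -> M) x v :
  (forall u, beta m p x u = 0) -> wedge_form (W := R) B alpha beta p x v = 0.
Proof. by move=> b0; rewrite wedge2E !b0 !(bilin0r (inv_linr Binv)) subr0. Qed.

Lemma wedge_opp (M : smoothSpace R) (alpha beta : diff_form 'rV[R]_n M 1) m (p : 'rV[R]_m -> M) x v :
  (forall u, beta m p x u = - alpha m p x u) -> wedge_form (W := R) B alpha beta p x v = 0.
Proof.
move=> ba; rewrite wedge2E !ba !(B_oppr Binv) (inv_sym Binv (alpha m p x (fun=> v ord_max))).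
exact: subrr.
Qed.

Lemma double_slice_alg (k w1 w2 w3 : R) : w1 = 0 -> w2 = 0 -> w3 = 0 ->
  - k * (w1 + w2) - k * w3 = 0.
Proof. by move=> -> -> ->; ring. Qed.

Lemma fusion_slice_alg (k w1 w2 w3 : R) : w1 = 0 -> w2 = 0 -> w3 = 0 ->
  w1 + w2 - k * w3 = 0.
Proof. by move=> -> -> ->; ring. Qed.

(** Where b = 1 its Maurer-Cartan forms vanish, which kills the first two terms. The last term pairs
    [thetaL] of a with [thetaR] of a^-1, that is with -thetaL of a, and vanishes by symmetry of
    [B]. *)
Lemma double_slice1 m (U : set 'rV[R]_m) (p : 'rV[R]_m -> LG) x v : plot LG U p -> U x ->
  qham_form (qham_double B) m (fun y => (p y, 1%g)) x v = 0.
Proof.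
move=> Pp Ux; apply: double_slice_alg.
- by apply: wedge_0r => u; exact: (@thetaR_cst m 1%g x u).
- by apply: wedge_0r => u; exact: (@thetaL_cst m 1%g x u).
- apply: wedge_opp => u.
  have E1 : (fun y => p y * 1 : LG)%g = p by apply/funext => y; rewrite mulg1.
  have E2 : (fun y => (p y)^-1 * 1^-1 : LG)%g = fun y => (p y)^-1%g.
    by apply/funext => y; rewrite invg1 mulg1.
  apply: (etrans (congr1 (fun q => thetaR q x u) E2)).
  apply: (etrans (thetaR_inv u Pp Ux)).
  exact: (congr1 (fun q => - thetaL q x u) (esym E1)).
Qed.

Lemma double_slice2 m (U : set 'rV[R]_m) (p : 'rV[R]_m -> LG) x v : plot LG U p -> U x ->
  qham_form (qham_double B) m (fun y => (1%g, p y)) x v = 0.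
Proof.
move=> Pp Ux; apply: double_slice_alg.
- by apply: wedge_0l => u; exact: (@thetaL_cst m 1%g x u).
- by apply: wedge_0l => u; exact: (@thetaR_cst m 1%g x u).
- apply: wedge_opp => u.
  have E1 : (fun y => 1 * p y : LG)%g = p by apply/funext => y; rewrite mul1g.
  have E2 : (fun y => 1^-1 * (p y)^-1 : LG)%g = fun y => (p y)^-1%g.
    by apply/funext => y; rewrite invg1 mul1g.
  apply: (etrans (congr1 (fun q => thetaR q x u) E2)).
  apply: (etrans (thetaR_inv u Pp Ux)).
  exact: (congr1 (fun q => - thetaL q x u) (esym E1)).
Qed.

Definition slice1 k (a : powG k) : multi_double B k := join_double (a, unitG k).
Definition slice2 k (b : powG k) : multi_double B k := join_double (unitG k, b).

Lemma moment_slice1 k (a : powG k) : qham_moment (multi_double B k) (slice1 a) = 1%g.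
Proof.
elim: k a => [|k IH] /= a; first by rewrite /= mulg1 mulgV mul1g invg1.
by rewrite (IH a.1) /= mul1g mulg1 mulgV mul1g invg1.
Qed.

Lemma moment_slice2 k (b : powG k) : qham_moment (multi_double B k) (slice2 b) = 1%g.
Proof.
elim: k b => [|k IH] /= b; first by rewrite /= mul1g invg1 mulg1 mulgV.
by rewrite (IH b.1) /= !mul1g invg1 mulg1 mulgV.
Qed.

(** In the fusion product the two summands vanish by induction and by [double_slice1], and the mixed
    term because the first moment map is constant on the slice. *)
Lemma form_slice1 k : form_eq setT (form_pull (@slice1 k) (qham_form (multi_double B k)))
  (fun _ _ _ _ => 0).
Proof.
elim: k => [|k IH] m U p x v [Pp _] Ux; first exact: (@double_slice1 m U p x v Pp Ux).
move: Pp => [P1 P2]; apply: fusion_slice_alg.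
- exact: (IH m U (fst \o p) x v (plot_inT P1) Ux).
- exact: (@double_slice1 m U (snd \o p) x v P2 Ux).
- apply: wedge_0l => u.
  have E : (fun y => qham_moment (multi_double B k) (slice1 (p y).1)) = fun=> 1%g.
    by apply/funext => y; exact: moment_slice1.
  apply: (etrans (congr1 (fun q => thetaL (q : _ -> LG) x u) E)).
  exact: (@thetaL_cst m 1%g x u).
Qed.

Lemma form_slice2 k : form_eq setT (form_pull (@slice2 k) (qham_form (multi_double B k)))
  (fun _ _ _ _ => 0).
Proof.
elim: k => [|k IH] m U p x v [Pp _] Ux; first exact: (@double_slice2 m U p x v Pp Ux).
move: Pp => [P1 P2]; apply: fusion_slice_alg.
- exact: (IH m U (fst \o p) x v (plot_inT P1) Ux).
- exact: (@double_slice2 m U (snd \o p) x v P2 Ux).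
- apply: wedge_0l => u.
  have E : (fun y => qham_moment (multi_double B k) (slice2 (p y).1)) = fun=> 1%g.
    by apply/funext => y; exact: moment_slice2.
  apply: (etrans (congr1 (fun q => thetaL (q : _ -> LG) x u) E)).
  exact: (@thetaL_cst m 1%g x u).
Qed.

Lemma plot_cst_powG k (z : powG k) m (U : set 'rV[R]_m) : open U -> plot (powG k) U (fun=> z).
Proof.
move=> oU; elim: k z => [|k IH] z /=; first exact: plot_cst.
by split; [exact: (IH z.1) | exact: plot_cst].
Qed.

Lemma slice1_smooth k : smooth_map (@slice1 k).
Proof.
move=> m U p Pp; apply: (@join_double_smooth k m U (fun y => (p y, unitG k))); split => //.
by apply: plot_cst_powG; exact: (mf_open (powG_manifold k) Pp).
Qed.

Lemma slice2_smooth k : smooth_map (@slice2 k).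
Proof.
move=> m U p Pp; apply: (@join_double_smooth k m U (fun y => (unitG k, p y))); split => //.
by apply: plot_cst_powG; exact: (mf_open (powG_manifold k) Pp).
Qed.

End Slices.

(** * Existence of a solution on G^(2h) *)

Section Existence.
Variables (R : realType) (G : lieGroup R) (B : lie_algebra G -> lie_algebra G -> R).
Hypotheses (G_sc : simply_connected R G) (Binv : invariant_inner_product B).
Variables (Gr : gerbe (lie_space G)) (k : nat).
Hypotheses (HGr : is_gerbe Gr) (Gr_curv : gerbe_curvature Gr (cartan_form B)).

Let M := multi_double B k.
Let Psi : M -> lie_space G := qham_moment M.
Let gM : good_qham B M := good_multi_double Binv k.
Let mM : manifold M := gq_manifold gM.
Let mG : manifold (lie_space G) := manifold_lie G.
Let GrM := gerbe_pull Psi Gr.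
Let HG : is_gerbe GrM := is_gerbe_pull mM mG (gq_moment gM) HGr.
Let Sw : smooth_form setT (qham_form M) := gq_form gM.

Lemma pull_curvature i : form_eq (gerbe_dom GrM i) (ext_d (W := R) (gerbe_form GrM i))
  (ext_d (W := R) (qham_form M)).
Proof.
move=> m U p x v Pp Ux; apply: (etrans _ (esym (gq_d gM v Pp.1 Ux))).
exact: (@Gr_curv i m U (Psi \o p) x v (plot_in_pull (gq_moment gM) Pp) Ux).
Qed.

Let CC := compat HG (qham_form M).
Let P := @powG R G k.
Let mP : manifold P := @powG_manifold R G k.

(* A 2-form pulled back along a constant map vanishes. *)
Lemma slice_gerbe_form (s : P -> M) j : smooth_map s -> (forall y, Psi (s y) = 1%g) ->
  gerbe_dom Gr j 1%g -> form_eq setT (form_pull s (gerbe_form GrM j)) (fun _ _ _ _ => 0).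
Proof.
move=> Ss s1 j1 m U p x v [Pp _] Ux.
have [_ _ _ _ [Sj _]] := HGr; have [lin _ _ nat] := Sj j.
have oU := mf_open mP Pp.
have E : Psi \o (s \o p) = fun=> 1%g by apply/funext => y /=; exact: s1.
change (gerbe_form Gr j m (Psi \o (s \o p)) x v = 0); rewrite E.
have Pc : plot_in (gerbe_dom Gr j) U (fun=> 1%g : lie_space G).
  by split; [exact: plot_cst | move=> y _].
have S0 : smooth_on U (fun=> x) by move=> d; exact: Ck_cst.
(* A constant map equals its composite with the constant map [x], whose derivatives are 0;
   naturality evaluates the form on zero vectors. *)
apply: (etrans (nat m m U U _ _ (fun=> x) Pc Pc S0 _ x v Ux)); first by move=> y _; split.
have E0 : (fun i : 'I_2 => 'D_(v i) (fun=> x) x) = fun=> 0.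
  by apply/funext => i; exact: derive_cst.
rewrite E0.
have := lin m U _ x Pc Ux ord0 (fun=> 0) (-1) 0 0.
have E1 : (fun j0 : 'I_2 => if j0 == ord0 then 0 else 0 : 'rV[R]_m) = fun=> 0.
  by apply/funext => j0; case: ifP.
by rewrite /= scaler0 addr0 E1 mulN1r addNr.
Qed.

Lemma global_solution : exists al g, solution setT CC al g.
Proof.
have SP : simplyConnected R P by exact: powG_sc.
have [j Uj] := gerbe_domP HGr (1%g : lie_space G).
pose e : P := @unitG R G k.
have cjoin : continuous (@join_double R G B k : P * P -> M).
  exact: (smooth_map_continuous (manifold_prod mP mP) mM (@join_double_smooth _ _ B k)).
have csplit : continuous (@split_double R G B k : M -> P * P).
  exact: (smooth_map_continuous mM (manifold_prod mP mP) (@split_double_smooth _ _ B k)).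
have F := compat_flatGerbe mM HG Sw pull_curvature.
have F' : flatGerbe setT (pull_rel (@join_double R G B k : P * P -> M) CC).
  by apply: flatGerbe_pull F => // y _; exact: cjoin.
have [al1 [g1 S1]] : exists al g, solution setT (pull_rel (@slice1 R G B k : P -> M) CC) al g.
  apply: (@slice_solution R P M _ mP mM (@slice1_smooth R G B k) GrM HG (qham_form M) Sw pull_curvature j).
  - by move=> y; move: Uj; rewrite -(@moment_slice1 R G B k y).
  - by apply: slice_gerbe_form => //; [exact: slice1_smooth | exact: moment_slice1].
  - exact: form_slice1.
have [al2 [g2 S2]] : exists al g, solution setT (pull_rel (@slice2 R G B k : P -> M) CC) al g.
  apply: (@slice_solution R P M _ mP mM (@slice2_smooth R G B k) GrM HG (qham_form M) Sw pull_curvature j).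
  - by move=> y; move: Uj; rewrite -(@moment_slice2 R G B k y).
  - by apply: slice_gerbe_form => //; [exact: slice2_smooth | exact: moment_slice2].
  - exact: form_slice2.
have S1' : solution setT (pull_rel (fun x => (x, e)) (pull_rel (@join_double R G B k : P * P -> M) CC)) al1 g1.
  move=> y _; apply: filterS (@S1 y Logic.I) => z h.
  by apply/pull_pull; first exact: continuous_pairr.
have S2' : solution setT (pull_rel (pair e) (pull_rel (@join_double R G B k : P * P -> M) CC)) al2 g2.
  move=> y _; apply: filterS (@S2 y Logic.I) => z h.
  by apply/pull_pull; first exact: continuous_pairl.
(* Both factors are G^h with base point [e], and the two slice solutions are the data along the
   axes. *)
have [a [g S]] := gerbe_product SP SP F' S1' S2'.
(* The solution on P * P returns to M along the inverse of the regrouping; the two successive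
   pullbacks amount to the identity. *)
have S' := solution_pull (D' := setT) (phi := @split_double R G B k) (fun _ _ => Logic.I) (fun z _ => csplit z) S.
exists (a \o @split_double R G B k), (fun y z => g (@split_double R G B k y) (@split_double R G B k z)) => y _.
apply: filterS (@S' y Logic.I) => z h.
have [u Cu wu] := proj1 (pull_pull _ _ _ (csplit z)) h.
have Ez : @join_double R G B k (@split_double R G B k z) = z := @split_doubleK R G B k z.
rewrite /= Ez in Cu; apply: (fg_near_eq F Cu).
by apply: filterS wu => t; rewrite /= split_doubleK => ->.
Qed.

End Existence.

Theorem mainTheorem9 (R : realType) (G : lieGroup R) (T : set G)
    (B : lie_algebra G -> lie_algebra G -> R) (Gr : gerbe (lie_space G)) (h : nat)
    (G_compact : compact [set: G]) (G_simple : lie_simple G)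
    (G_simply_connected : simply_connected R G) (T_max : maximal_torus T)
    (B_inner : invariant_inner_product B) (B_basic : is_basic T B)
    (Gr_gerbe : is_gerbe Gr) (Gr_curvature : gerbe_curvature Gr (cartan_form B))
    (h_ge1 : (1 <= h)%N) :
  let M := multi_double B h.-1 in
  (exists Q, prequantization (M := M) (Gr := Gr) Q) /\
  (forall Q Q', prequantization (M := M) (Gr := Gr) Q ->
     prequantization (M := M) (Gr := Gr) Q' -> quasi_isomorphic Q Q').
Proof.
move=> M.
have gM := good_multi_double B_inner h.-1.
have mM := gq_manifold gM.
have HG := is_gerbe_pull mM (manifold_lie G) (gq_moment gM) Gr_gerbe.
split.
  have [al [g S]] := @global_solution R G B G_simply_connected B_inner Gr h.-1 Gr_gerbe Gr_curvature.
  by exists (sol_quasi S); split; [exact: sol_is_quasi | exact: sol_error].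
move=> Q Q' [HQ EQ] [HQ' EQ'].
apply: (quasi_unique mM HG HQ HQ' EQ EQ'); exact: multi_double_sc.
Qed.
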